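(* Let $t$ and $m$ be positive integers with $m(t-1)\leq 24$ and put $\mu=\frac{m(t-1)}{24}$. Let $$A:=\max\left\{\frac{t}{\gcd(t,\ell)}: 1\leq \ell\leq t \text{ and } \gcd(t,\ell)>\sqrt{t}\right\},$$ and let $M$ be the maximum of the set $$\left\{\frac{\sqrt{m(t-1)}}{2t}\right\}\cup\left\{\frac{1}{\ell}\sqrt{\frac{m\left(\gcd(t,\ell)^2-t\right)}{t}}: 1\leq \ell<t \text{ and } \gcd(t,\ell)>\sqrt{t}\right\}.$$ Then for every positive integer $n>\mu$, $$c_t^{(m)}(n)=\frac{2\pi\mu^{1/2}}{t}(n-\mu)^{-1/2}\,\alpha_t^{(m)}(n)\,I_{-1}\!\left(\frac{4\pi\sqrt{\mu(n-\mu)}}{t}\right)+E_t^{(m)}(n),$$ where $|E_t^{(m)}(n)|\leq \overline{E}_t^{(m)}(n)$ with $$\overline{E}_t^{(m)}(n):=\frac{\pi^{7/4}}{2^{3/4}}A^{m/2}\mu^{1/4}\exp\left(\frac{\sqrt{6}\,\pi M}{3}\sqrt{n-\mu}\right)+2te^{2+8\pi\mu}+2e^2t^{\frac{m}{2}+1}\exp\left(\pi\mu+m\left(\frac{e^{-\pi}}{(1-e^{-\pi})^2}+\frac{e^{-\pi/t}}{(1-e^{-\pi/t})^2}\right)\right).$$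
   Context: For positive integers $t,m$, the integers $c_t^{(m)}(n)$ are defined by $\sum_{n\ge 0}c_t^{(m)}(n)q^n=\frac{(q;q)_\infty^m}{(q^t;q^t)_\infty^m}$, where $(a;q)_\infty=\prod_{n=0}^\infty(1-aq^n)$, $|q|<1$. For a positive integer $k$ and an integer $h$ with $\gcd(h,k)=1$, the Dedekind sum is $s(h,k)=\sum_{r=1}^{k-1}\frac{r}{k}\left(\frac{hr}{k}-\left\lfloor\frac{hr}{k}\right\rfloor-\frac12\right)$, with $s(h,1)=0$. Define $$\alpha_t^{(m)}(n)=\sum_{0\le h<t,\ \gcd(h,t)=1}\exp\left(-m\pi i\, s(h,t)-\frac{2\pi i n h}{t}\right).$$ $I_s$ is the modified Bessel function of the first kind, $I_s(x)=\sum_{j\ge0}\frac{1}{j!\,\Gamma(j+s+1)}\left(\frac{x}{2}\right)^{2j+s}$ (with $1/\Gamma=0$ at nonpositive integers); for an integer $k$, $I_k(x)=\frac1\pi\int_0^\pi e^{x\cos\theta}\cos(k\theta)\,d\theta$. When $t=1$ the set defining $A$ is empty; put $A=1$ (its value is irrelevant since then $\mu=0$). *)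

(* Defs.v *)
From Stdlib Require Import Reals ZArith List.
From Coquelicot Require Import Coquelicot.
Open Scope R_scope.

(* prod_{k < N} f k *)
Fixpoint Cprod (f : nat -> C) (N : nat) : C :=
  match N with
  | O => RtoC 1
  | S N' => Cmult (Cprod f N') (f N')
  end.

Definition Clim_seq (u : nat -> C) : C :=
  (real (Lim_seq (fun n => Re (u n))), real (Lim_seq (fun n => Im (u n)))).

(* (a;q)_oo; meaningful for |q| < 1, where the partial products converge. *)
Definition qpoch (a q : C) : C :=
  Clim_seq (fun N => Cprod (fun n => (1 - a * q ^ n)%C) N).

(* "c n = c_t^(m)(n) for all n": the expansion holds on the open unit disc,
   which determines the integers c n uniquely. *)
Definition is_ctm (t m : nat) (c : nat -> Z) : Prop :=
  forall q : C, Cmod q < 1 ->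
    is_series (K := C_AbsRing) (V := C_NormedModule)
      (fun n => (RtoC (IZR (c n)) * q ^ n)%C)
      (qpoch q q ^ m / qpoch (q ^ t) (q ^ t) ^ m)%C.

(* Int_part is the floor function.  The sum is empty when k = 1. *)
Definition dedekind_sum (h : Z) (k : nat) : R :=
  sum_n_m
    (fun r : nat =>
       INR r / INR k *
       (IZR h * INR r / INR k - IZR (Int_part (IZR h * INR r / INR k)) - 1 / 2))
    1 (k - 1).

Definition Cexp (z : C) : C :=
  (exp (Re z) * cos (Im z), exp (Re z) * sin (Im z)).

Definition alpha (t m n : nat) : C :=
  sum_n_m (G := C_AbelianMonoid)
    (fun h : nat =>
       if Nat.eqb (Nat.gcd h t) 1 then
         Cexp (- (RtoC (INR m) * RtoC PI * Ci
                  * RtoC (dedekind_sum (Z.of_nat h) t))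
               - 2 * RtoC PI * Ci * RtoC (INR n) * RtoC (INR h)
                 / RtoC (INR t))%C
       else RtoC 0)
    0 (t - 1).

(* 1/Gamma at integer arguments: Gamma(z) = (z-1)! for z >= 1, and 1/Gamma
   vanishes at the nonpositive integers. *)
Definition inv_Gamma_Z (z : Z) : R :=
  if Z.leb z 0 then 0 else / INR (fact (Z.to_nat (z - 1))).

(* I_s(x) for integer order s. *)
Definition BesselI (s : Z) (x : R) : R :=
  Series (fun j : nat =>
    / INR (fact j) * inv_Gamma_Z (Z.of_nat j + s + 1)
    * powerRZ (x / 2) (2 * Z.of_nat j + s)).

Definition mu (t m : nat) : R := INR m * (INR t - 1) / 24.

Definition large_gcd (t l : nat) : bool :=
  if Rlt_dec (sqrt (INR t)) (INR (Nat.gcd t l)) then true else false.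

(* All the members t / gcd(t,l) are >= 1, so the seed 1 only plays a role when
   the set is empty (t = 1).  The natural-number division is exact. *)
Definition maxA (t : nat) : nat :=
  fold_right Nat.max 1%nat
    (map (fun l => Nat.div t (Nat.gcd t l)) (filter (large_gcd t) (seq 1 t))).

Definition maxM (t m : nat) : R :=
  fold_right Rmax (sqrt (INR m * (INR t - 1)) / (2 * INR t))
    (map (fun l =>
            1 / INR l * sqrt (INR m * (INR (Nat.gcd t l) ^ 2 - INR t) / INR t))
         (filter (large_gcd t) (seq 1 (t - 1)))).

(* mu^(1/4) is written with square roots because mu = 0 when t = 1, whereas
   Rpower 0 y = 1.  The bases of the Rpower's below are all positive. *)
Definition Ebar (t m n : nat) : R :=
  Rpower PI (7 / 4) / Rpower 2 (3 / 4)
    * Rpower (INR (maxA t)) (INR m / 2) * sqrt (sqrt (mu t m))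
    * exp (sqrt 6 * PI * maxM t m / 3 * sqrt (INR n - mu t m))
  + 2 * INR t * exp (2 + 8 * PI * mu t m)
  + 2 * exp 2 * Rpower (INR t) (INR m / 2 + 1)
    * exp (PI * mu t m
           + INR m * (exp (- PI) / (1 - exp (- PI)) ^ 2
                      + exp (- PI / INR t) / (1 - exp (- PI / INR t)) ^ 2)).

(* Main.v *)
Require Import Defs.
From Stdlib Require Import Reals ZArith List.
From Coquelicot Require Import Coquelicot.
From Stdlib Require Import Lra Lia Psatz Permutation.
Open Scope R_scope.
Set Bullet Behavior "Strict Subproofs".

(** The coefficient is the integral of [F(q) q^(-n)] over the circle of radius
    [exp (- 2 pi / N^2)], where [F] is the quotient of Euler products and
    [N^2 >= pi (n - mu)].  Near a root of unity [exp (2 pi i h / k)] the transformation law of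
    Euler's product gives ([quotient_local]) [F(q) q^(-n) = P(w) R(w)], with [w] a local
    parameter, [P(w)] a constant times [exp (a w + b / w)], [a = 2 pi (n - mu)], and [R] tending
    to 1 at the cusp.  The sign of [b] is that of [gcd(t,k)^2 - t].  If it is not positive, the
    integrand is bounded near the cusp.  If it is positive, [P] is unbounded, but [mu <= 1] keeps
    its growth below the rate at which [R] approaches 1, and the integrand minus [P] is bounded
    ([quotient_singular]).

    The circle need not be cut into arcs.  Each singular cusp of denominator [k <= N] carries a
    chord of half length [1 / (2 k N)]; distinct chords are disjoint.  By Dirichlet's theorem
    every point of the circle is within [1 / (k N)] of a cusp, where the local analysis applies,
    and [P] is bounded off its chord.  So the integrand minus all the [P], each restricted to its
    chord, is bounded uniformly ([integrand_minus_principal_parts]).  The integral of [P] over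
    its chord is completed to a rectangle around the essential singularity, whose residue is the
    series of [I_1 = I_(-1)] ([rect_bessel]); on the other sides [b / w] has bounded real part.
    The cusps of denominator [t] give the main term.  The other singular denominators have
    smaller Bessel arguments, measured by [maxM], and there are at most [sqrt (pi (n - mu))] of
    them, which gives the first error term; the second and third come from the chords and from
    the bounded parts.  If [n - mu] is so small that [N = t] has to be taken larger than this,
    the third error term absorbs the remaining denominators as well.

    The transformation law ([lamb_transform]) is stated for the logarithm of Euler's product.  It
    follows from the inversion [z -> 1 / z] by Euclid's algorithm, the reciprocity law of the
    Dedekind sums matching one step of it.  The inversion ([lamb_inversion]) is proved by
    differentiation: the derivative is an Eisenstein series of weight two, which the partial
    fractions of [1 / sinh^2] expand into a double sum of the [1 / (r z + i l)^2].  That sum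
    converges only conditionally.  Truncated to a square it is symmetric under inversion, and the
    boundary terms of the truncation form a Riemann sum with limit [pi / 2], independently of
    [z]; they account for the factor [sqrt z]. *)

(** * Complex numbers: exponential, finite sums, limits, derivatives *)

Lemma C_eq : forall a b : C, Re a = Re b -> Im a = Im b -> a = b.
Proof. intros [a1 a2] [b1 b2]; simpl; intros; subst; reflexivity. Qed.

Lemma Re_minus : forall a b : C, Re (a - b)%C = Re a - Re b.
Proof. intros [] []; simpl; ring. Qed.
Lemma Im_minus : forall a b : C, Im (a - b)%C = Im a - Im b.
Proof. intros [] []; simpl; ring. Qed.

Lemma Cmod_sqr : forall z : C, Cmod z ^ 2 = Re z ^ 2 + Im z ^ 2.
Proof. exact Cmod2_alt. Qed.

Lemma im_le_Cmod : forall c : C, Rabs (Im c) <= Cmod c.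
Proof.
  intros c. pose proof (Rmax_Cmod c) as H.
  eapply Rle_trans; [|exact H]. apply Rmax_r.
Qed.

Lemma Cmod_le_of_sqr : forall (z : C) M, 0 <= M -> Re z ^ 2 + Im z ^ 2 <= M ^ 2 -> Cmod z <= M.
Proof.
  intros z M HM H. rewrite <- Cmod_sqr in H.
  apply Rnot_lt_le; intro. assert (M ^ 2 < Cmod z ^ 2) by nra. lra.
Qed.

Lemma Cmod_ge_of_sqr : forall (z : C) M, M ^ 2 <= Re z ^ 2 + Im z ^ 2 -> M <= Cmod z.
Proof.
  intros z M H. rewrite <- Cmod_sqr in H. pose proof (Cmod_ge_0 z).
  apply Rnot_lt_le; intro. nra.
Qed.

Lemma Cmod_minus_sym : forall a b : C, Cmod (a - b)%C = Cmod (b - a)%C.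
Proof. intros. rewrite <- Cmod_opp. f_equal. ring. Qed.

Lemma Cmod_minus_triangle : forall a b : C, Cmod (a - b)%C <= Cmod a + Cmod b.
Proof. intros. unfold Cminus. rewrite <- (Cmod_opp b). apply Cmod_triangle. Qed.

Lemma Cmod_triangle_lower : forall a b : C, Cmod a - Cmod b <= Cmod (a - b)%C.
Proof.
  intros. assert (Cmod a <= Cmod (a - b)%C + Cmod b).
  { replace a with ((a - b) + b)%C at 1 by ring. apply Cmod_triangle. }
  lra.
Qed.

Lemma Cmod_RtoC : forall x, 0 <= x -> Cmod (RtoC x) = x.
Proof. intros. rewrite Cmod_R. apply Rabs_pos_eq; auto. Qed.

Lemma RtoC_neq : forall x : R, x <> 0 -> RtoC x <> (RtoC 0).
Proof. intros x H E. apply H. apply RtoC_inj in E. exact E. Qed.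

Lemma Cneq_Re : forall z : C, Re z <> 0 -> z <> (RtoC 0).
Proof. intros z H E; subst; apply H; reflexivity. Qed.

Lemma Cexp_plus : forall a b, Cexp (a + b)%C = (Cexp a * Cexp b)%C.
Proof.
  intros [a1 a2] [b1 b2]. unfold Cexp; simpl. rewrite exp_plus, cos_plus, sin_plus.
  unfold Cmult; simpl; f_equal; ring.
Qed.

Lemma Cexp_0 : Cexp (RtoC 0) = (RtoC 1).
Proof. unfold Cexp; simpl. rewrite exp_0, cos_0, sin_0. unfold RtoC; f_equal; ring. Qed.

Lemma Cmod_Cexp : forall z, Cmod (Cexp z) = exp (Re z).
Proof.
  intros z. unfold Cmod, Cexp; simpl fst; simpl snd.
  replace ((exp (Re z) * cos (Im z)) ^ 2 + (exp (Re z) * sin (Im z)) ^ 2)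
    with (exp (Re z) ^ 2).
  - replace (exp (Re z) ^ 2) with (Rsqr (exp (Re z))) by (unfold Rsqr; ring).
    apply sqrt_Rsqr. left; apply exp_pos.
  - pose proof (sin2_cos2 (Im z)) as H. unfold Rsqr in H.
    transitivity (exp (Re z) ^ 2 * (sin (Im z) * sin (Im z) + cos (Im z) * cos (Im z))); [rewrite H|]; ring.
Qed.

Lemma Cexp_neq_0 : forall z, Cexp z <> (RtoC 0).
Proof.
  intros z E. pose proof (exp_pos (Re z)). rewrite <- Cmod_Cexp, E, Cmod_0 in H. lra.
Qed.

Lemma Cexp_opp : forall z, Cexp (- z)%C = (/ Cexp z)%C.
Proof.
  intros z. assert (Cexp (- z) * Cexp z = 1)%C.
  { rewrite <- Cexp_plus. replace (- z + z)%C with (RtoC 0) by ring. apply Cexp_0. }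
  pose proof (Cexp_neq_0 z).
  transitivity (Cexp (- z) * Cexp z * / Cexp z)%C. field; auto. rewrite H; ring.
Qed.

Lemma Cexp_minus : forall a b, Cexp (a - b)%C = (Cexp a / Cexp b)%C.
Proof. intros. unfold Cminus. rewrite Cexp_plus, Cexp_opp. reflexivity. Qed.

Lemma Cexp_pow : forall z n, (Cexp z ^ n)%C = Cexp (RtoC (INR n) * z)%C.
Proof.
  intros z n. induction n.
  - simpl Cpow. rewrite Cmult_0_l, Cexp_0. reflexivity.
  - rewrite Cpow_S, IHn, <- Cexp_plus. f_equal. rewrite S_INR, RtoC_plus. ring.
Qed.

Lemma Cexp_RtoC : forall x, Cexp (RtoC x) = RtoC (exp x).
Proof. intros. unfold Cexp; simpl. rewrite cos_0, sin_0. unfold RtoC; f_equal; ring. Qed.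

Lemma Cexp_2PI_nat : forall n, Cexp (RtoC (2 * PI * INR n) * Ci)%C = (RtoC 1).
Proof.
  intros n. unfold Cexp; simpl.
  replace (2 * PI * INR n * 0 - 0 * 1) with 0 by ring.
  replace (2 * PI * INR n * 1 + 0 * 0) with (0 + 2 * INR n * PI) by ring.
  rewrite exp_0, cos_period, sin_period, cos_0, sin_0. unfold RtoC; f_equal; ring.
Qed.

Lemma Cexp_2PI_Z : forall n : Z, Cexp (RtoC (2 * PI * IZR n) * Ci)%C = (RtoC 1).
Proof.
  intros n. destruct (Z_le_gt_dec 0 n).
  - rewrite <- (Z2Nat.id n) by auto. rewrite <- INR_IZR_INZ. apply Cexp_2PI_nat.
  - replace (RtoC (2 * PI * IZR n) * Ci)%C with (- (RtoC (2 * PI * INR (Z.to_nat (- n))) * Ci))%C.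
    + rewrite Cexp_opp, Cexp_2PI_nat. field.
    + rewrite INR_IZR_INZ, Z2Nat.id by lia. rewrite opp_IZR.
      apply C_eq; simpl; ring.
Qed.

Lemma cos_eq_1_small : forall x, -2 * PI < x < 2 * PI -> cos x = 1 -> x = 0.
Proof.
  intros x Hx Hc.
  assert (Hs : sin (x / 2) = 0).
  { replace x with (2 * (x / 2)) in Hc by field. rewrite cos_2a_sin in Hc. nra. }
  destruct (Rtotal_order x 0) as [H|[H|H]]; auto; exfalso.
  - assert (0 < sin (- (x / 2))) by (apply sin_gt_0; lra). rewrite sin_neg in H0. lra.
  - assert (0 < sin (x / 2)) by (apply sin_gt_0; lra). lra.
Qed.

(** ** Finite sums *)

Fixpoint csum (f : nat -> C) (n : nat) : C :=
  match n with O => (RtoC 0) | S n' => (csum f n' + f n')%C end.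

Fixpoint rsum (f : nat -> R) (n : nat) : R :=
  match n with O => 0 | S n' => rsum f n' + f n' end.

Lemma csum_ext : forall f g n, (forall i, (i < n)%nat -> f i = g i) -> csum f n = csum g n.
Proof. induction n; intros; simpl; auto. rewrite IHn, H; auto. Qed.

Lemma rsum_ext : forall f g n, (forall i, (i < n)%nat -> f i = g i) -> rsum f n = rsum g n.
Proof. induction n; intros; simpl; auto. rewrite IHn, H; auto. Qed.

Lemma csum_plus : forall f g n, csum (fun i => f i + g i)%C n = (csum f n + csum g n)%C.
Proof. induction n; simpl. ring. rewrite IHn; ring. Qed.

Lemma csum_minus : forall f g n, csum (fun i => f i - g i)%C n = (csum f n - csum g n)%C.
Proof. induction n; simpl. ring. rewrite IHn; ring. Qed.

Lemma csum_scal : forall k f n, csum (fun i => k * f i)%C n = (k * csum f n)%C.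
Proof. induction n; simpl. ring. rewrite IHn; ring. Qed.

Lemma csum_swap : forall (f : nat -> nat -> C) n m,
  csum (fun i => csum (fun j => f i j) m) n = csum (fun j => csum (fun i => f i j) n) m.
Proof.
  induction n; intros; simpl.
  - induction m; simpl; [|rewrite <- IHm]; ring.
  - rewrite IHn, <- csum_plus. reflexivity.
Qed.

Lemma csum_add : forall f n m, csum f (n + m) = (csum f n + csum (fun i => f (n + i)%nat) m)%C.
Proof.
  induction m; simpl. rewrite Nat.add_0_r; ring.
  rewrite Nat.add_succ_r; simpl. rewrite IHm; ring.
Qed.

Lemma csum_S_l : forall f n, csum f (S n) = (f O + csum (fun i => f (S i)) n)%C.
Proof. intros. change (S n) with (1 + n)%nat. rewrite csum_add. simpl. ring. Qed.

Lemma rsum_telescope : forall (u : nat -> R) n, rsum (fun i => u i - u (S i)) n = u O - u n.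
Proof. induction n; simpl. ring. rewrite IHn; ring. Qed.

Lemma Cmod_csum : forall f n, Cmod (csum f n) <= rsum (fun i => Cmod (f i)) n.
Proof.
  induction n; simpl. rewrite Cmod_0; lra.
  eapply Rle_trans; [apply Cmod_triangle|]. lra.
Qed.

Lemma rsum_le : forall f g n, (forall i, (i < n)%nat -> f i <= g i) -> rsum f n <= rsum g n.
Proof.
  induction n; intros; simpl. lra.
  assert (f n <= g n) by (apply H; lia). assert (rsum f n <= rsum g n) by (apply IHn; auto). lra.
Qed.

Lemma rsum_const : forall k n, rsum (fun _ => k) n = INR n * k.
Proof. induction n; simpl rsum. simpl; ring. rewrite IHn, S_INR. ring. Qed.

Lemma rsum_scal : forall k f n, rsum (fun i => k * f i) n = k * rsum f n.
Proof. induction n; simpl. ring. rewrite IHn; ring. Qed.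

Lemma rsum_plus : forall f g n, rsum (fun i => f i + g i) n = rsum f n + rsum g n.
Proof. induction n; simpl. ring. rewrite IHn; ring. Qed.

Lemma Cmod_csum_le : forall f g n, (forall i, (i < n)%nat -> Cmod (f i) <= g i) -> Cmod (csum f n) <= rsum g n.
Proof. intros. eapply Rle_trans; [apply Cmod_csum|]. apply rsum_le; auto. Qed.

Lemma Re_csum : forall f n, Re (csum f n) = rsum (fun i => Re (f i)) n.
Proof. induction n; cbn [csum rsum]; auto. rewrite re_plus, IHn; auto. Qed.
Lemma Im_csum : forall f n, Im (csum f n) = rsum (fun i => Im (f i)) n.
Proof. induction n; cbn [csum rsum]; auto. rewrite im_plus, IHn; auto. Qed.

Lemma RtoC_rsum : forall f n, RtoC (rsum f n) = csum (fun i => RtoC (f i)) n.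
Proof. induction n; simpl; auto. rewrite RtoC_plus, IHn; auto. Qed.

Lemma rsum_sum_n : forall f n, rsum f (S n) = sum_n f n.
Proof.
  induction n; intros. simpl; rewrite sum_O; ring.
  rewrite sum_Sn, <- IHn. reflexivity.
Qed.

(** ** Limits of complex sequences *)

Definition Clim (u : nat -> C) (l : C) : Prop :=
  is_lim_seq (fun n => Cmod (u n - l)%C) 0.

Lemma Clim_squeeze : forall u l (e : nat -> R),
  (forall n, Cmod (u n - l)%C <= e n) -> is_lim_seq e 0 -> Clim u l.
Proof.
  intros u l e H He. unfold Clim.
  apply (is_lim_seq_le_le (fun _ => 0) _ e); auto.
  - intros n; split; auto. apply Cmod_ge_0.
  - apply is_lim_seq_const.
Qed.

Lemma Clim_ext : forall u v l, (forall n, u n = v n) -> Clim u l -> Clim v l.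
Proof. intros u v l H Hu. unfold Clim. eapply is_lim_seq_ext; [|exact Hu]. intros; simpl. rewrite H; auto. Qed.

Lemma Clim_const : forall l, Clim (fun _ => l) l.
Proof.
  intros l. apply Clim_squeeze with (fun _ => 0). 2: apply is_lim_seq_const.
  intros. replace (l - l)%C with (RtoC 0) by ring. rewrite Cmod_0; lra.
Qed.

Lemma is_lim_seq_plus_0 : forall u v, is_lim_seq u 0 -> is_lim_seq v 0 -> is_lim_seq (fun n => u n + v n) 0.
Proof. intros. replace (Finite 0) with (Finite (0 + 0)) by (f_equal; ring). apply is_lim_seq_plus'; auto. Qed.

Lemma is_lim_seq_scal_0 : forall k u, is_lim_seq u 0 -> is_lim_seq (fun n => k * u n) 0.
Proof.
  intros. replace (Finite 0) with (Rbar_mult (Finite k) (Finite 0)) by (simpl; f_equal; ring).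
  apply is_lim_seq_scal_l; auto.
Qed.

Lemma Clim_plus : forall u v a b, Clim u a -> Clim v b -> Clim (fun n => u n + v n)%C (a + b)%C.
Proof.
  intros u v a b Ha Hb. apply Clim_squeeze with (fun n => Cmod (u n - a)%C + Cmod (v n - b)%C).
  - intros n. replace (u n + v n - (a + b))%C with ((u n - a) + (v n - b))%C by ring. apply Cmod_triangle.
  - apply is_lim_seq_plus_0; auto.
Qed.

Lemma Clim_scal : forall k u a, Clim u a -> Clim (fun n => k * u n)%C (k * a)%C.
Proof.
  intros k u a Ha. apply Clim_squeeze with (fun n => Cmod k * Cmod (u n - a)%C).
  - intros n. replace (k * u n - k * a)%C with (k * (u n - a))%C by ring. rewrite Cmod_mult; lra.
  - apply is_lim_seq_scal_0; auto.
Qed.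

Lemma Clim_opp : forall u a, Clim u a -> Clim (fun n => - u n)%C (- a)%C.
Proof.
  intros. replace (- a)%C with (- (1) * a)%C by ring.
  apply Clim_ext with (fun n => - (1) * u n)%C. intros; ring. apply Clim_scal; auto.
Qed.

Lemma Clim_minus : forall u v a b, Clim u a -> Clim v b -> Clim (fun n => u n - v n)%C (a - b)%C.
Proof. intros. unfold Cminus. apply (Clim_plus u (fun n => - v n)%C); auto. apply Clim_opp; auto. Qed.

Lemma Clim_bound : forall u l (e : nat -> R) (b : R),
  Clim u l -> (forall n, Cmod (u n) <= e n) -> is_lim_seq e b -> Cmod l <= b.
Proof.
  intros u l e b Hu He Hb.
  assert (H : is_lim_seq (fun n => e n + Cmod (u n - l)%C) (b + 0)) by (apply is_lim_seq_plus'; auto).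
  rewrite Rplus_0_r in H.
  apply (is_lim_seq_le (fun _ => Cmod l) (fun n => e n + Cmod (u n - l)%C) (Finite (Cmod l)) (Finite b)); auto.
  - intros n. specialize (He n). pose proof (Cmod_triangle_lower l (u n)). rewrite Cmod_minus_sym in H0. lra.
  - apply is_lim_seq_const.
Qed.

Lemma Clim_unique : forall u a b, Clim u a -> Clim u b -> a = b.
Proof.
  intros u a b Ha Hb. assert (H := Clim_minus _ _ _ _ Ha Hb).
  assert (Cmod (a - b)%C <= 0).
  { apply (Clim_bound _ _ (fun _ => 0) 0 H). 2: apply is_lim_seq_const.
    intros. replace (u n - u n)%C with (RtoC 0) by ring. rewrite Cmod_0; lra. }
  apply Ceq_minus. apply Cmod_eq_0. apply Rle_antisym; auto. apply Cmod_ge_0.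
Qed.

Lemma Clim_mult : forall u v a b, Clim u a -> Clim v b -> Clim (fun n => u n * v n)%C (a * b)%C.
Proof.
  intros u v a b Ha Hb.
  apply Clim_squeeze with (fun n => Cmod (u n - a)%C * Cmod (v n - b)%C + (Cmod b * Cmod (u n - a)%C + Cmod a * Cmod (v n - b)%C)).
  - intros n. replace (u n * v n - a * b)%C with ((u n - a) * (v n - b) + (b * (u n - a) + a * (v n - b)))%C by ring.
    rewrite <- !Cmod_mult. eapply Rle_trans; [apply Cmod_triangle|].
    apply Rplus_le_compat_l. apply Cmod_triangle.
  - apply is_lim_seq_plus_0; [|apply is_lim_seq_plus_0; apply is_lim_seq_scal_0; auto].
    replace (Finite 0) with (Finite (0 * 0)) by (f_equal; ring). apply is_lim_seq_mult'; auto.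
Qed.

Lemma Clim_Re : forall u a, Clim u a -> is_lim_seq (fun n => Re (u n)) (Re a).
Proof.
  intros u a H. apply is_lim_seq_ext with (fun n => Re a + Re (u n - a)%C).
  - intros; rewrite Re_minus; ring.
  - replace (Finite (Re a)) with (Finite (Re a + 0)) by (f_equal; ring). apply is_lim_seq_plus'. apply is_lim_seq_const.
    apply is_lim_seq_abs_0. apply (is_lim_seq_le_le (fun _ => 0) _ (fun n => Cmod (u n - a)%C)); auto.
    + intros; split. apply Rabs_pos. apply re_le_Cmod.
    + apply is_lim_seq_const.
Qed.

Lemma Clim_Im : forall u a, Clim u a -> is_lim_seq (fun n => Im (u n)) (Im a).
Proof.
  intros u a H. apply is_lim_seq_ext with (fun n => Im a + Im (u n - a)%C).
  - intros; rewrite Im_minus; ring.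
  - replace (Finite (Im a)) with (Finite (Im a + 0)) by (f_equal; ring). apply is_lim_seq_plus'. apply is_lim_seq_const.
    apply is_lim_seq_abs_0. apply (is_lim_seq_le_le (fun _ => 0) _ (fun n => Cmod (u n - a)%C)); auto.
    + intros; split. apply Rabs_pos. apply im_le_Cmod.
    + apply is_lim_seq_const.
Qed.

Lemma Clim_of_components : forall u a,
  is_lim_seq (fun n => Re (u n)) (Re a) -> is_lim_seq (fun n => Im (u n)) (Im a) -> Clim u a.
Proof.
  intros u a Hr Hi.
  apply Clim_squeeze with (fun n => Rabs (Re (u n) - Re a) + Rabs (Im (u n) - Im a)).
  - intros n. rewrite <- Re_minus, <- Im_minus. set (z := (u n - a)%C).
    apply Cmod_le_of_sqr. pose proof (Rabs_pos (Re z)); pose proof (Rabs_pos (Im z)); lra.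
    rewrite <- (pow2_abs (Re z)), <- (pow2_abs (Im z)).
    pose proof (Rabs_pos (Re z)); pose proof (Rabs_pos (Im z)). nra.
  - apply is_lim_seq_plus_0; apply (proj1 (is_lim_seq_abs_0 _)).
    + replace (Finite 0) with (Finite (Re a - Re a)) by (f_equal; ring).
      apply is_lim_seq_minus'; auto. apply is_lim_seq_const.
    + replace (Finite 0) with (Finite (Im a - Im a)) by (f_equal; ring).
      apply is_lim_seq_minus'; auto. apply is_lim_seq_const.
Qed.

Lemma Clim_seq_correct : forall u a, Clim u a -> Clim_seq u = a.
Proof.
  intros u a H. unfold Clim_seq.
  rewrite (is_lim_seq_unique _ _ (Clim_Re _ _ H)), (is_lim_seq_unique _ _ (Clim_Im _ _ H)).
  destruct a; reflexivity.
Qed.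

Lemma Clim_incr : forall u a k, Clim u a -> Clim (fun n => u (n + k)%nat) a.
Proof. intros u a k H. unfold Clim in *. apply (is_lim_seq_incr_n (fun n => Cmod (u n - a)%C) k). exact H. Qed.

Lemma Clim_subseq : forall u a phi, (forall n, (n <= phi n)%nat) -> Clim u a -> Clim (fun n => u (phi n)) a.
Proof.
  intros u a phi Hphi H. unfold Clim in *.
  apply is_lim_seq_spec in H. apply is_lim_seq_spec. intros eps. destruct (H eps) as [N HN].
  exists N. intros n Hn. apply HN. specialize (Hphi n). lia.
Qed.

(** ** Absolutely convergent complex series *)

(** Componentwise, so that the series theory of the reals applies; it is used for
    absolutely convergent series only. *)
Definition Cser (a : nat -> C) : C := (Series (fun n => Re (a n)), Series (fun n => Im (a n))).

Lemma is_series_rsum : forall a l, is_series a l -> is_lim_seq (rsum a) l.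
Proof.
  intros a l H. apply is_lim_seq_incr_1.
  eapply is_lim_seq_ext; [|exact H]. intros n; symmetry; apply rsum_sum_n.
Qed.

Lemma Cser_lim : forall a, ex_series (fun n => Cmod (a n)) -> Clim (csum a) (Cser a).
Proof.
  intros a H. apply Clim_of_components.
  - eapply is_lim_seq_ext. intros n; symmetry; apply Re_csum.
    apply is_series_rsum. apply Series_correct.
    apply (ex_series_le (V := R_CompleteNormedModule) _ (fun n => Cmod (a n))); auto.
    intros; apply re_le_Cmod.
  - eapply is_lim_seq_ext. intros n; symmetry; apply Im_csum.
    apply is_series_rsum. apply Series_correct.
    apply (ex_series_le (V := R_CompleteNormedModule) _ (fun n => Cmod (a n))); auto.
    intros; apply im_le_Cmod.
Qed.

Lemma ex_series_Cmod_le : forall (a : nat -> C) g,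
  (forall n, Cmod (a n) <= g n) -> ex_series g -> ex_series (fun n => Cmod (a n)).
Proof.
  intros a g H Hg. apply (ex_series_le (V := R_CompleteNormedModule) _ g); auto.
  intros n. unfold norm; simpl; unfold abs; simpl. rewrite Rabs_pos_eq; auto. apply Cmod_ge_0.
Qed.

Lemma Cser_lim_le : forall a g,
  (forall n, Cmod (a n) <= g n) -> ex_series g -> Clim (csum a) (Cser a).
Proof. intros. apply Cser_lim. eapply ex_series_Cmod_le; eauto. Qed.

Lemma Cser_bound : forall a g (l : R),
  (forall n, Cmod (a n) <= g n) -> is_series g l -> Cmod (Cser a) <= l.
Proof.
  intros a g l H Hl. apply (Clim_bound (csum a) _ (rsum g) l).
  - apply Cser_lim_le with g; auto. exists l; auto.
  - intros; apply Cmod_csum_le; auto.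
  - apply is_series_rsum; auto.
Qed.

(** ** Derivatives of complex functions of a real variable *)

(** Complex analysis is done along curves throughout: every function that occurs is
    differentiated only after composition with a path. *)
Definition cder (f : R -> C) (s : R) (l : C) : Prop :=
  is_derive (fun x => Re (f x)) s (Re l) /\ is_derive (fun x => Im (f x)) s (Im l).

Lemma cder_eq : forall f s l l', cder f s l -> l = l' -> cder f s l'.
Proof. intros; subst; auto. Qed.

Lemma cder_ext : forall f g s l, (forall x, f x = g x) -> cder f s l -> cder g s l.
Proof.
  intros f g s l H [H1 H2]; split; eapply is_derive_ext; eauto; intros; simpl; rewrite H; auto.
Qed.

Lemma cder_const : forall c s, cder (fun _ => c) s (RtoC 0).
Proof. intros; split; simpl; apply (is_derive_const (V := R_NormedModule)). Qed.

Lemma cder_RtoC : forall f s l, is_derive f s l -> cder (fun x => RtoC (f x)) s (RtoC l).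
Proof. intros; split; simpl; auto. apply (is_derive_const (V := R_NormedModule)). Qed.

Lemma cder_plus : forall f g s a b, cder f s a -> cder g s b -> cder (fun x => f x + g x)%C s (a + b)%C.
Proof.
  intros f g s a b [H1 H2] [H3 H4]; split; simpl.
  - apply (is_derive_plus (V := R_NormedModule) (fun x => Re (f x)) (fun x => Re (g x))); auto.
  - apply (is_derive_plus (V := R_NormedModule) (fun x => Im (f x)) (fun x => Im (g x))); auto.
Qed.

Lemma cder_opp : forall f s a, cder f s a -> cder (fun x => - f x)%C s (- a)%C.
Proof.
  intros f s a [H1 H2]; split; simpl.
  - apply (is_derive_opp (V := R_NormedModule) (fun x => Re (f x))); auto.
  - apply (is_derive_opp (V := R_NormedModule) (fun x => Im (f x))); auto.
Qed.

Lemma cder_minus : forall f g s a b, cder f s a -> cder g s b -> cder (fun x => f x - g x)%C s (a - b)%C.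
Proof. intros. apply (cder_plus f (fun x => - g x)%C); auto. apply cder_opp; auto. Qed.

Lemma cder_mult : forall f g s a b, cder f s a -> cder g s b ->
  cder (fun x => f x * g x)%C s (a * g s + f s * b)%C.
Proof.
  intros f g s a b [H1 H2] [H3 H4]; split; simpl.
  - replace (fst a * fst (g s) - snd a * snd (g s) + (fst (f s) * fst b - snd (f s) * snd b))
      with ((fst a * fst (g s) + fst (f s) * fst b) - (snd a * snd (g s) + snd (f s) * snd b)) by ring.
    apply (is_derive_minus (V := R_NormedModule) (fun x => fst (f x) * fst (g x)) (fun x => snd (f x) * snd (g x))).
    + apply (is_derive_mult (fun x => Re (f x)) (fun x => Re (g x))); auto. intros; apply Rmult_comm.
    + apply (is_derive_mult (fun x => Im (f x)) (fun x => Im (g x))); auto. intros; apply Rmult_comm.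
  - replace (fst a * snd (g s) + snd a * fst (g s) + (fst (f s) * snd b + snd (f s) * fst b))
      with ((fst a * snd (g s) + fst (f s) * snd b) + (snd a * fst (g s) + snd (f s) * fst b)) by ring.
    apply (is_derive_plus (V := R_NormedModule) (fun x => fst (f x) * snd (g x)) (fun x => snd (f x) * fst (g x))).
    + apply (is_derive_mult (fun x => Re (f x)) (fun x => Im (g x))); auto. intros; apply Rmult_comm.
    + apply (is_derive_mult (fun x => Im (f x)) (fun x => Re (g x))); auto. intros; apply Rmult_comm.
Qed.

Lemma cder_scal : forall k f s a, cder f s a -> cder (fun x => k * f x)%C s (k * a)%C.
Proof.
  intros. eapply cder_eq. apply cder_mult. apply cder_const. exact H. cbv beta; ring.
Qed.

Lemma cder_affine : forall a v s, cder (fun x => a + RtoC x * v)%C s v.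
Proof.
  intros. eapply cder_eq. apply cder_plus. apply cder_const. apply cder_mult.
  apply (cder_RtoC (fun x => x)). apply (is_derive_id (K := R_AbsRing)). apply cder_const.
  unfold one; cbv beta; simpl. ring.
Qed.

Lemma cder_inv : forall f s a, f s <> (RtoC 0) -> cder f s a -> cder (fun x => / f x)%C s (- a / (f s * f s))%C.
Proof.
  intros f s a Hn [H1 H2].
  assert (Hp : fst (f s) ^ 2 + snd (f s) ^ 2 <> 0).
  { intro E. apply Hn. apply Cmod_eq_0. pose proof (Cmod_sqr (f s)). unfold Re, Im in H. rewrite E in H. nra. }
  set (u := fun x => Re (f x)) in *. set (v := fun x => Im (f x)) in *.
  assert (Hu : Derive u s = Re a) by (apply is_derive_unique; auto).
  assert (Hv : Derive v s = Im a) by (apply is_derive_unique; auto).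
  assert (Eu : ex_derive u s) by (eexists; eauto). assert (Ev : ex_derive v s) by (eexists; eauto).
  assert (Hq : fst (f s) * fst (f s) + snd (f s) * snd (f s) <> 0) by (intro E; apply Hp; lra).
  assert (Hq2 : (fst (f s) * fst (f s) - snd (f s) * snd (f s)) * (fst (f s) * fst (f s) - snd (f s) * snd (f s))
    + (fst (f s) * snd (f s) + snd (f s) * fst (f s)) * (fst (f s) * snd (f s) + snd (f s) * fst (f s)) <> 0).
  { intro E. apply Hq. nra. }
  split; simpl.
  - change (is_derive (fun x => u x / (u x * (u x * 1) + v x * (v x * 1))) s
      (Re (- a / (f s * f s))%C)).
    auto_derive.
    + repeat split; auto; unfold u, v, Re, Im; rewrite !Rmult_1_r; exact Hq.
    + change (fun x => u x) with u. change (fun x => v x) with v. rewrite Hu, Hv. simpl. unfold u, v, Re, Im.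
      rewrite !Rmult_1_r. field. auto.
  - change (is_derive (fun x => - v x / (u x * (u x * 1) + v x * (v x * 1))) s
      (Im (- a / (f s * f s))%C)).
    auto_derive.
    + repeat split; auto; unfold u, v, Re, Im; rewrite !Rmult_1_r; exact Hq.
    + change (fun x => u x) with u. change (fun x => v x) with v. rewrite Hu, Hv. simpl. unfold u, v, Re, Im.
      rewrite !Rmult_1_r. field. auto.
Qed.

Lemma cder_Cexp : forall f s a, cder f s a -> cder (fun x => Cexp (f x)) s (a * Cexp (f s))%C.
Proof.
  intros f s a [H1 H2].
  set (u := fun x => Re (f x)) in *. set (v := fun x => Im (f x)) in *.
  assert (Hu : Derive u s = Re a) by (apply is_derive_unique; auto).
  assert (Hv : Derive v s = Im a) by (apply is_derive_unique; auto).
  assert (Eu : ex_derive u s) by (eexists; eauto). assert (Ev : ex_derive v s) by (eexists; eauto).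
  split; simpl.
  - change (is_derive (fun x => exp (u x) * cos (v x)) s (Re (a * Cexp (f s))%C)).
    auto_derive. auto. change (fun x => u x) with u. change (fun x => v x) with v. rewrite Hu, Hv. simpl.
    unfold u, v, Re, Im. ring.
  - change (is_derive (fun x => exp (u x) * sin (v x)) s (Im (a * Cexp (f s))%C)).
    auto_derive. auto. change (fun x => u x) with u. change (fun x => v x) with v. rewrite Hu, Hv. simpl.
    unfold u, v, Re, Im. ring.
Qed.

Lemma cder_csum : forall (f : nat -> R -> C) (d : nat -> C) s n,
  (forall i, (i < n)%nat -> cder (f i) s (d i)) -> cder (fun x => csum (fun i => f i x) n) s (csum d n).
Proof.
  induction n; intros; simpl. apply cder_const.
  apply (cder_plus (fun x => csum (fun i => f i x) n) (f n)); auto.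
Qed.

Lemma cder_pow : forall f s a n, cder f s a -> cder (fun x => f x ^ S n)%C s (RtoC (INR (S n)) * a * f s ^ n)%C.
Proof.
  induction n; intros.
  - simpl. eapply cder_eq. apply cder_mult. exact H. apply cder_const. simpl. ring.
  - apply cder_ext with (fun x => f x * f x ^ S n)%C. intros; reflexivity.
    eapply cder_eq. apply cder_mult. exact H. apply IHn; auto.
    rewrite (S_INR (S n)), RtoC_plus. simpl Cpow. ring.
Qed.

(** The mean value inequality: the growth of a curve is controlled by any
    real function whose derivative dominates the speed.  Projecting the curve on
    the direction of its chord reduces this to the real mean value theorem. *)
Lemma cder_mvt : forall (f : R -> C) (f' : R -> C) (phi phi' : R -> R) a b,
  a <= b ->
  (forall s, a <= s <= b -> cder f s (f' s)) ->
  (forall s, a <= s <= b -> is_derive phi s (phi' s)) ->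
  (forall s, a <= s <= b -> Cmod (f' s) <= phi' s) ->
  Cmod (f b - f a)%C <= phi b - phi a.
Proof.
  intros f f' phi phi' a b Hab Hf Hphi Hle.
  set (d := (f b - f a)%C).
  set (g := fun s => Cmod d * phi s - (Re d * Re (f s) + Im d * Im (f s))).
  set (g' := fun s => Cmod d * phi' s - (Re d * Re (f' s) + Im d * Im (f' s))).
  assert (Hg : forall s, a <= s <= b -> is_derive g s (g' s)).
  { intros s Hs. destruct (Hf s Hs) as [H1 H2]. specialize (Hphi s Hs).
    unfold g, g'.
    apply (is_derive_minus (V := R_NormedModule) (fun s => Cmod d * phi s)
             (fun s => Re d * Re (f s) + Im d * Im (f s))).
    - apply (is_derive_scal phi); auto.
    - apply (is_derive_plus (V := R_NormedModule) (fun s => Re d * Re (f s)) (fun s => Im d * Im (f s))).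
      apply (is_derive_scal (fun x => Re (f x))); auto. apply (is_derive_scal (fun x => Im (f x))); auto. }
  assert (Hpos : forall s, a <= s <= b -> 0 <= g' s).
  { intros s Hs. unfold g'. specialize (Hle s Hs).
    assert (Re d * Re (f' s) + Im d * Im (f' s) <= Cmod d * Cmod (f' s)).
    { pose proof (re_le_Cmod (Cconj d * f' s)%C). rewrite Cmod_mult, Cmod_conj in H.
      rewrite re_mult, re_conj, im_conj in H.
      eapply Rle_trans; [|exact H]. eapply Rle_trans; [|apply Rle_abs]. lra. }
    pose proof (Cmod_ge_0 d). nra. }
  assert (Hmono : 0 <= g b - g a).
  { destruct (MVT_gen g a b g') as [c [Hc Hc']].
    - intros x Hx. rewrite Rmin_left, Rmax_right in Hx by auto. apply Hg; lra.
    - intros x Hx. rewrite Rmin_left, Rmax_right in Hx by auto.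
      apply derivable_continuous_pt. exists (g' x). apply is_derive_Reals. apply Hg; auto.
    - rewrite Rmin_left, Rmax_right in Hc by auto. rewrite Hc'. apply Rmult_le_pos; [apply Hpos; auto|lra]. }
  assert (Hd : (Re d * Re (f b) + Im d * Im (f b)) - (Re d * Re (f a) + Im d * Im (f a)) = Cmod d ^ 2).
  { rewrite Cmod_sqr. replace (Re d ^ 2) with (Re d * (Re (f b) - Re (f a))).
    replace (Im d ^ 2) with (Im d * (Im (f b) - Im (f a))). ring.
    rewrite <- Im_minus. fold d. ring. rewrite <- Re_minus. fold d. ring. }
  unfold g in Hmono. destruct (Req_dec (Cmod d) 0) as [E|E].
  - rewrite E. 
    destruct (MVT_gen phi a b phi') as [c [Hc Hc']].
    + intros x Hx. rewrite Rmin_left, Rmax_right in Hx by auto. apply Hphi; lra.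
    + intros x Hx. rewrite Rmin_left, Rmax_right in Hx by auto.
      apply derivable_continuous_pt. exists (phi' x). apply is_derive_Reals. apply Hphi; auto.
    + rewrite Rmin_left, Rmax_right in Hc by auto. rewrite Hc'. apply Rmult_le_pos; [|lra].
      eapply Rle_trans; [apply Cmod_ge_0|apply Hle; auto].
  - pose proof (Cmod_ge_0 d). assert (0 < Cmod d) by lra. nra.
Qed.

Lemma cder_mvt_const : forall (f : R -> C) (f' : R -> C) K a b,
  a <= b ->
  (forall s, a <= s <= b -> cder f s (f' s)) ->
  (forall s, a <= s <= b -> Cmod (f' s) <= K) ->
  Cmod (f b - f a)%C <= K * (b - a).
Proof.
  intros. replace (K * (b - a)) with (K * b - K * a) by ring.
  apply (cder_mvt f f' (fun x => K * x) (fun _ => K)); auto.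
  intros. auto_derive; auto. ring.
Qed.

(** By induction on the order: along the segment from 0 to [u], the derivative of a
    Taylor remainder is [u] times the remainder of one order less. *)
Lemma Cexp_taylor : forall n u,
  Cmod (Cexp u - csum (fun j => / RtoC (INR (fact j)) * u ^ j) n)%C
  <= Cmod u ^ n / INR (fact n) * exp (Cmod u).
Proof.
  assert (G : forall n u s, 0 <= s <= 1 ->
    Cmod (Cexp (RtoC s * u) - csum (fun j => / RtoC (INR (fact j)) * (RtoC s * u) ^ j) n)%C
    <= (s * Cmod u) ^ n / INR (fact n) * exp (Cmod u)).
  { induction n; intros u s Hs.
    - simpl csum. replace (Cexp (RtoC s * u) - 0)%C with (Cexp (RtoC s * u)) by ring.
      rewrite Cmod_Cexp, re_scal_l. simpl. replace (1 / 1 * exp (Cmod u)) with (exp (Cmod u)) by field.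
      destruct (Rle_lt_dec (s * Re u) (Cmod u)).
      destruct r; [left; apply exp_increasing; auto | rewrite H; lra].
      pose proof (re_le_Cmod u). pose proof (Rle_abs (Re u)). pose proof (Cmod_ge_0 u). nra.
    - pose (f := fun x : R => (Cexp (RtoC x * u) - csum (fun j => / RtoC (INR (fact j)) * (RtoC x * u) ^ j) (S n))%C).
      assert (Hfd : forall x, cder f x
        (u * (Cexp (RtoC x * u) - csum (fun j => / RtoC (INR (fact j)) * (RtoC x * u) ^ j) n))%C).
      { intros x. unfold f.
        assert (Hl : cder (fun x => RtoC x * u)%C x u).
        { apply cder_ext with (fun x => 0 + RtoC x * u)%C. intros; ring. apply cder_affine. }
        eapply cder_eq. apply cder_minus. apply cder_Cexp. exact Hl.
        apply cder_ext with (fun x => 1 + csum (fun j => / RtoC (INR (fact (S j))) * (RtoC x * u) ^ (S j)) n)%C.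
        { intros y. rewrite csum_S_l. simpl fact. simpl INR. simpl Cpow. f_equal. field. }
        apply cder_plus. apply cder_const.
        apply cder_csum with (d := fun j => (/ RtoC (INR (fact (S j))) * (RtoC (INR (S j)) * u * (RtoC x * u) ^ j))%C).
        intros i _. apply cder_scal. apply (cder_pow (fun x => RtoC x * u)%C). exact Hl.
        rewrite Cplus_0_l.
        replace (csum (fun j => / RtoC (INR (fact (S j))) * (RtoC (INR (S j)) * u * (RtoC x * u) ^ j)) n)%C
          with (u * csum (fun j => / RtoC (INR (fact j)) * (RtoC x * u) ^ j) n)%C. ring.
        rewrite <- csum_scal. apply csum_ext. intros i _.
        rewrite fact_simpl, mult_INR, RtoC_mult. field. split; apply RtoC_neq; apply not_0_INR; try lia. apply fact_neq_0. }
      assert (H := cder_mvt f _ (fun x => (x * Cmod u) ^ S n / INR (fact (S n)) * exp (Cmod u))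
        (fun x => Cmod u * ((x * Cmod u) ^ n / INR (fact n) * exp (Cmod u))) 0 s (proj1 Hs)
        (fun x _ => Hfd x)).
      assert (E0 : f 0 = (RtoC 0)).
      { unfold f. replace ((RtoC 0) * u)%C with (RtoC 0) by ring. rewrite Cexp_0.
        rewrite csum_S_l. rewrite (csum_ext _ (fun _ => RtoC 0)). 2: intros; simpl Cpow; ring.
        replace (csum (fun _ => RtoC 0) n) with (RtoC 0) by (clear; induction n; simpl; [|rewrite <- IHn]; ring).
        simpl. field. }
      unfold f in H, E0. rewrite E0 in H.
      unfold Cminus at 2 in H. rewrite Copp_0, Cplus_0_r in H.
      replace ((0 * Cmod u) ^ S n) with 0 in H by (simpl; ring).
      replace (0 / INR (fact (S n)) * exp (Cmod u)) with 0 in H by (field; apply INR_fact_neq_0).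
      rewrite Rminus_0_r in H. apply H.
      + intros x Hx. rewrite fact_simpl, mult_INR. auto_derive; auto. change (Nat.pred (S n)) with n.
        replace (match n with 0%nat => 1 | S _ => INR n + 1 end) with (INR (S n)) by (destruct n; simpl; auto).
        field. split. apply INR_fact_neq_0. apply not_0_INR; lia.
      + intros x Hx. rewrite Cmod_mult. apply Rmult_le_compat_l. apply Cmod_ge_0. apply IHn; lra. }
  intros n u. pose proof (G n u 1 ltac:(lra)).
  replace ((RtoC 1) * u)%C with u in H by ring. rewrite Rmult_1_l in H. exact H.
Qed.

Lemma Cmod_Cexp_minus_1 : forall u, Cmod (Cexp u - 1)%C <= Cmod u * exp (Cmod u).
Proof.
  intros u. pose proof (Cexp_taylor 1 u). simpl in H.
  replace (0 + / 1 * 1)%C with (RtoC 1) in H by field.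
  eapply Rle_trans; [exact H|]. apply Req_le. field.
Qed.

(** Equality holds at the positive reals.  The constant matters: this is how the
    factors close to 1 that remain at a cusp enter the final bound. *)
Lemma Cmod_Cexp_minus_1_sharp : forall u, Cmod (Cexp u - 1)%C <= exp (Cmod u) - 1.
Proof.
  intros u.
  assert (Hl : forall x, cder (fun x => RtoC x * u)%C x u).
  { intros. apply cder_ext with (fun x => 0 + RtoC x * u)%C. intros; ring. apply cder_affine. }
  pose proof (cder_mvt (fun x => Cexp (RtoC x * u)) _ (fun x => exp (x * Cmod u)) (fun x => Cmod u * exp (x * Cmod u)) 0 1
    ltac:(lra) (fun s _ => cder_Cexp _ _ _ (Hl s))).
  simpl in H. rewrite Rmult_1_l, Rmult_0_l, exp_0 in H.
  replace ((RtoC 1) * u)%C with u in H by ring. replace ((RtoC 0) * u)%C with (RtoC 0) in H by ring. rewrite Cexp_0 in H.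
  apply H.
  - intros. auto_derive; auto. ring.
  - intros. rewrite Cmod_mult, Cmod_Cexp, re_scal_l. apply Rmult_le_compat_l. apply Cmod_ge_0.
    pose proof (re_le_Cmod u). pose proof (Rle_abs (Re u)).
    assert (s * Re u <= s * Cmod u) by nra.
    destruct H3; [left; apply exp_increasing; auto | rewrite H3; lra].
Qed.

Lemma Clim_Cexp : forall u a, Clim u a -> Clim (fun n => Cexp (u n)) (Cexp a).
Proof.
  intros u a H.
  apply Clim_squeeze with (fun n => Cmod (Cexp a) * (Cmod (u n - a)%C * exp (Cmod (u n - a)%C))).
  - intros n. replace (Cexp (u n) - Cexp a)%C with (Cexp a * (Cexp (u n - a) - 1))%C.
    rewrite Cmod_mult. apply Rmult_le_compat_l. apply Cmod_ge_0. apply Cmod_Cexp_minus_1.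
    rewrite Cexp_minus. field. apply Cexp_neq_0.
  - apply is_lim_seq_scal_0. replace (Finite 0) with (Finite (0 * exp 0)) by (f_equal; ring).
    apply is_lim_seq_mult'; auto.
    apply (is_lim_seq_continuous exp). apply derivable_continuous_pt. apply derivable_pt_exp. exact H.
Qed.

(** * The logarithm of Euler's product *)

Lemma is_lim_seq_pow_0 : forall x, 0 <= x < 1 -> is_lim_seq (fun n => x ^ n) 0.
Proof. intros. apply is_lim_seq_geom. rewrite Rabs_pos_eq; lra. Qed.

Lemma is_series_geom_S : forall x, 0 <= x < 1 -> is_series (fun n => x ^ S n) (x / (1 - x)).
Proof.
  intros x Hx. apply is_series_ext with (fun n => scal x (x ^ n)). intros; reflexivity.
  replace (x / (1 - x)) with (scal x (/ (1 - x))) by reflexivity.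
  apply (is_series_scal_l (V := R_NormedModule) x (fun n => x ^ n)). apply is_series_geom. rewrite Rabs_pos_eq; lra.
Qed.

Lemma pow_le_1 : forall x n, 0 <= x <= 1 -> 0 <= x ^ n <= 1.
Proof.
  induction n; intros; simpl. lra. destruct IHn; auto. split. apply Rmult_le_pos; lra. nra.
Qed.

Lemma pow_le_base : forall x n, 0 <= x <= 1 -> x ^ S n <= x.
Proof. intros. simpl. pose proof (pow_le_1 x n H). nra. Qed.

Lemma INR_S_neq : forall n, RtoC (INR (S n)) <> RtoC 0.
Proof. intros. apply RtoC_neq. apply not_0_INR; lia. Qed.

Lemma INR_S_ge1 : forall n, 1 <= INR (S n).
Proof. intros. rewrite S_INR. pose proof (pos_INR n). lra. Qed.

Lemma Cmod_div_INR : forall (z : C) r, Cmod (z / RtoC (INR (S r)))%C <= Cmod z.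
Proof.
  intros. rewrite Cmod_div by apply INR_S_neq. rewrite Cmod_RtoC by apply pos_INR.
  pose proof (INR_S_ge1 r). pose proof (Cmod_ge_0 z).
  apply Rle_trans with (Cmod z / 1). 2: lra.
  apply Rmult_le_compat_l; auto. apply Rinv_le_contravar; lra.
Qed.

(** - log (1 - u) *)
Definition nlog (u : C) : C := Cser (fun r => u ^ S r / RtoC (INR (S r)))%C.

Lemma nlog_term : forall u r, Cmod (u ^ S r / RtoC (INR (S r)))%C <= Cmod u ^ S r.
Proof. intros. eapply Rle_trans. apply Cmod_div_INR. rewrite Cmod_pow. lra. Qed.

Lemma nlog_lim : forall u, Cmod u < 1 -> Clim (csum (fun r => u ^ S r / RtoC (INR (S r)))%C) (nlog u).
Proof.
  intros u H. apply Cser_lim_le with (fun r => Cmod u ^ S r). apply nlog_term.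
  eexists. apply is_series_geom_S. split; auto. apply Cmod_ge_0.
Qed.

(** The derivative of [s |-> exp (sum_(r <= n) (s u)^r / r) (1 - s u)] is
    the n-th power of [s u] times a bounded function, so this product stays
    close to its value 1 at [s = 0]. *)
Lemma Cexp_nlog : forall u, Cmod u < 1 -> Cexp (- nlog u)%C = (1 - u)%C.
Proof.
  intros u Hu. set (x := Cmod u) in *. pose proof (Cmod_ge_0 u) as Hx. fold x in Hx.
  assert (K : (Cexp (nlog u) * (1 - u))%C = 1%R).
  { apply Clim_unique with (fun n => Cexp (csum (fun r => u ^ S r / RtoC (INR (S r))) n) * (1 - u))%C.
    - apply Clim_mult. apply Clim_Cexp. apply nlog_lim; auto. apply Clim_const.
    - set (B := exp (x / (1 - x))).
      apply Clim_squeeze with (fun n => B * x * x ^ n).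
      + intros n.
        set (f := fun s : R => (Cexp (csum (fun r => / RtoC (INR (S r)) * (RtoC s * u) ^ S r) n) * (1 - RtoC s * u))%C).
        assert (Hl : forall s, cder (fun s => RtoC s * u)%C s u).
        { intros. apply cder_ext with (fun s => 0 + RtoC s * u)%C. intros; ring. apply cder_affine. }
        assert (Hf : forall s, cder f s (Cexp (csum (fun r => / RtoC (INR (S r)) * (RtoC s * u) ^ S r) n) * (- u * (RtoC s * u) ^ n))%C).
        { intros s. eapply cder_eq. apply cder_mult.
          apply cder_Cexp. apply cder_csum with (d := fun r => (/ RtoC (INR (S r)) * (RtoC (INR (S r)) * u * (RtoC s * u) ^ r))%C).
          intros. apply cder_scal. apply (cder_pow (fun s => RtoC s * u)%C); auto.
          apply cder_minus. apply cder_const. apply Hl. cbv beta.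
          assert (G : (csum (fun r => / RtoC (INR (S r)) * (RtoC (INR (S r)) * u * (RtoC s * u) ^ r)) n * (1 - RtoC s * u) - u
             = - u * (RtoC s * u) ^ n)%C).
          { clear. induction n. simpl. ring. cbn [csum].
            rewrite (Cmult_plus_distr_r (csum _ n)).
            replace (csum (fun r => / RtoC (INR (S r)) * (RtoC (INR (S r)) * u * (RtoC s * u) ^ r)) n * (1 - RtoC s * u))%C
              with (u + - u * (RtoC s * u) ^ n)%C by (rewrite <- IHn; ring).
            simpl Cpow. field. apply INR_S_neq. }
          rewrite <- G. ring. }
        assert (Hb := cder_mvt_const f _ (B * x * x ^ n) 0 1 ltac:(lra) (fun s _ => Hf s)).
        replace (B * x * x ^ n * (1 - 0)) with (B * x * x ^ n) in Hb by ring.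
        replace (f 1) with (Cexp (csum (fun r => u ^ S r / RtoC (INR (S r))) n) * (1 - u))%C in Hb.
        replace (f 0) with (RtoC 1) in Hb. apply Hb.
        * intros s Hs. rewrite !Cmod_mult, Cmod_pow, Cmod_opp, Cmod_mult, Cmod_RtoC by lra. fold x.
          rewrite Cmod_Cexp.
          replace (B * x * x ^ n) with (B * (x * x ^ n)) by ring.
          apply Rmult_le_compat; [left; apply exp_pos| | |].
          { apply Rmult_le_pos; auto. apply pow_le. apply Rmult_le_pos; lra. }
          { assert (Re (csum (fun r => / RtoC (INR (S r)) * (RtoC s * u) ^ S r)%C n) <= x / (1 - x)).
            { eapply Rle_trans; [apply Rle_abs|]. eapply Rle_trans; [apply re_le_Cmod|].
              eapply Rle_trans; [apply Cmod_csum_le with (g := fun r => x ^ S r)|].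
              - intros i _. rewrite Cmult_comm. eapply Rle_trans. apply (Cmod_div_INR ((RtoC s * u) ^ S i)%C i).
                rewrite Cmod_pow, Cmod_mult, Cmod_RtoC by lra. fold x. apply pow_incr. split. apply Rmult_le_pos; lra. nra.
              - clear -Hx Hu. assert (rsum (fun r => x ^ S r) n = (x - x ^ S n) / (1 - x)).
                { induction n. simpl. field. lra. cbn [rsum]. rewrite IHn. simpl. field. lra. }
                rewrite H. apply Rmult_le_compat_r. left; apply Rinv_0_lt_compat; lra.
                pose proof (pow_le x (S n) Hx). lra. }
            unfold B. destruct H; [left; apply exp_increasing; auto | rewrite H; lra]. }
          { apply Rmult_le_compat_l; auto. apply pow_incr. split. apply Rmult_le_pos; lra. nra. }
        * unfold f. replace (RtoC 0 * u)%C with (RtoC 0) by ring.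
          rewrite (csum_ext _ (fun _ => RtoC 0)). 2: intros; simpl; ring.
          replace (csum (fun _ => RtoC 0) n) with (RtoC 0) by (clear; induction n; simpl; [|rewrite <- IHn]; ring).
          rewrite Cexp_0. ring.
        * unfold f. replace (RtoC 1 * u)%C with u by ring. f_equal. f_equal. apply csum_ext. intros; unfold Cdiv; ring.
      + apply is_lim_seq_scal_0. apply is_lim_seq_pow_0. lra. }
  rewrite Cexp_opp. pose proof (Cexp_neq_0 (nlog u)).
  transitivity (/ Cexp (nlog u) * (Cexp (nlog u) * (1 - u)))%C. rewrite K; ring. field; auto.
Qed.

Definition lamb_term (q : C) (r : nat) : C := (q ^ S r / (RtoC (INR (S r)) * (1 - q ^ S r)))%C.

(** The Lambert series of -log (q;q)_oo.  Working with this logarithm, and not with the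
    product, fixes the branch of the square root in the transformation law. *)
Definition lamb (q : C) : C := Cser (lamb_term q).

Lemma Cmod_1_minus_ge : forall (q : C), 1 - Cmod q <= Cmod (1 - q)%C.
Proof. intros. pose proof (Cmod_triangle_lower 1 q). rewrite Cmod_1 in H. exact H. Qed.

Lemma one_minus_neq : forall q : C, Cmod q < 1 -> (1 - q)%C <> RtoC 0.
Proof. intros q H E. pose proof (Cmod_1_minus_ge q). rewrite E, Cmod_0 in H0. lra. Qed.

Lemma Cmod_pow_S_lt : forall (q : C) r, Cmod q < 1 -> Cmod (q ^ S r)%C < 1.
Proof.
  intros. rewrite Cmod_pow. eapply Rle_lt_trans. apply pow_le_base. pose proof (Cmod_ge_0 q); lra. auto.
Qed.

Lemma lamb_term_le : forall q r, Cmod q < 1 -> Cmod (lamb_term q r) <= / (1 - Cmod q) * Cmod q ^ S r.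
Proof.
  intros q r H. unfold lamb_term. pose proof (Cmod_ge_0 q).
  replace (q ^ S r / (RtoC (INR (S r)) * (1 - q ^ S r)))%C with (q ^ S r / (1 - q ^ S r) / RtoC (INR (S r)))%C.
  2:{ field. split. apply one_minus_neq. apply Cmod_pow_S_lt; auto. apply INR_S_neq. }
  eapply Rle_trans. apply Cmod_div_INR. rewrite Cmod_div. 2: apply one_minus_neq; apply Cmod_pow_S_lt; auto.
  rewrite Rmult_comm, Cmod_pow. apply Rmult_le_compat_l. apply pow_le; auto.
  apply Rinv_le_contravar. lra. eapply Rle_trans; [|apply Cmod_1_minus_ge]. rewrite Cmod_pow.
  pose proof (pow_le_base (Cmod q) r). lra.
Qed.

Lemma lamb_dom_series : forall x, 0 <= x < 1 -> is_series (fun r => / (1 - x) * x ^ S r) (x / (1 - x) ^ 2).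
Proof.
  intros x Hx. replace (x / (1 - x) ^ 2) with (/ (1 - x) * (x / (1 - x))) by (field; lra).
  apply (is_series_scal_l (V := R_NormedModule) (/ (1 - x)) (fun r => x ^ S r)). apply is_series_geom_S; auto.
Qed.

Lemma lamb_lim : forall q, Cmod q < 1 -> Clim (csum (lamb_term q)) (lamb q).
Proof.
  intros q H. apply Cser_lim_le with (fun r => / (1 - Cmod q) * Cmod q ^ S r).
  intros; apply lamb_term_le; auto. eexists. apply lamb_dom_series. pose proof (Cmod_ge_0 q); lra.
Qed.

(** Because [|1 - q^r| >= 1 - |q|], the geometric series dominates. *)
Lemma lamb_bound : forall q, Cmod q < 1 -> Cmod (lamb q) <= Cmod q / (1 - Cmod q) ^ 2.
Proof.
  intros q H. apply Cser_bound with (fun r => / (1 - Cmod q) * Cmod q ^ S r).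
  intros; apply lamb_term_le; auto. apply lamb_dom_series. pose proof (Cmod_ge_0 q); lra.
Qed.

Lemma csum_nlog_lim : forall q N, Cmod q < 1 ->
  Clim (fun R => csum (fun r => csum (fun n => (q ^ S n) ^ S r / RtoC (INR (S r))) N) R)%C
       (csum (fun n => nlog (q ^ S n)%C) N).
Proof.
  intros q N H.
  apply Clim_ext with (fun R => csum (fun n => csum (fun r => (q ^ S n) ^ S r / RtoC (INR (S r))) R) N)%C.
  intros; apply csum_swap.
  induction N; cbn [csum]. apply Clim_const. apply Clim_plus; auto.
  apply nlog_lim. apply Cmod_pow_S_lt; auto.
Qed.

(** The double series of the [q^(n r) / r], summed over [r] first or over [n] first. *)
Lemma csum_nlog_lamb : forall q, Cmod q < 1 -> Clim (csum (fun n => nlog (q ^ S n)%C)) (lamb q).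
Proof.
  intros q H. set (x := Cmod q) in *. pose proof (Cmod_ge_0 q) as Hx. fold x in Hx.
  apply Clim_squeeze with (fun N => x / (1 - x) ^ 2 * x ^ N).
  2:{ apply is_lim_seq_scal_0. apply is_lim_seq_pow_0. lra. }
  intros N. rewrite Cmod_minus_sym.
  apply Clim_bound with (u := (fun R => csum (fun r => lamb_term q r - csum (fun n => (q ^ S n) ^ S r / RtoC (INR (S r))) N) R)%C)
    (e := fun R => x ^ N * rsum (fun r => / (1 - x) * x ^ S r) R).
  - apply Clim_ext with (fun R => csum (lamb_term q) R - csum (fun r => csum (fun n => (q ^ S n) ^ S r / RtoC (INR (S r))) N) R)%C.
    intros; symmetry; apply csum_minus.
    apply Clim_minus. apply lamb_lim; auto. apply csum_nlog_lim; auto.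
  - intros R. rewrite <- rsum_scal. apply Cmod_csum_le. intros r _.
    replace (lamb_term q r - csum (fun n => (q ^ S n) ^ S r / RtoC (INR (S r))) N)%C
      with ((q ^ S r) ^ N * lamb_term q r)%C.
    + rewrite Cmod_mult. apply Rmult_le_compat.
      apply Cmod_ge_0. apply Cmod_ge_0. rewrite !Cmod_pow. fold x. apply pow_incr.
      split. apply pow_le; auto. apply pow_le_base; lra. apply lamb_term_le; auto.
    + assert (HN : csum (fun n => (q ^ S n) ^ S r / RtoC (INR (S r)))%C N = ((1 - (q ^ S r) ^ N) * lamb_term q r)%C).
      { unfold lamb_term. assert (Hne := one_minus_neq _ (Cmod_pow_S_lt q r H)).
        induction N. cbn [csum]. simpl Cpow at 1. unfold Cdiv; ring.
        cbn [csum]. rewrite IHN. replace ((q ^ S N) ^ S r)%C with ((q ^ S r) ^ S N)%C.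
        rewrite (Cpow_S (q ^ S r)). field. split. exact Hne. apply INR_S_neq.
        rewrite <- !Cpow_mult_r. f_equal. lia. }
      rewrite HN. ring.
  - apply (is_lim_seq_ext_loc (fun R => x ^ N * rsum (fun r => / (1 - x) * x ^ S r) R)).
    exists O; auto.
    replace (Finite (x / (1 - x) ^ 2 * x ^ N)) with (Rbar_mult (Finite (x ^ N)) (Finite (x / (1 - x) ^ 2))) by (simpl; f_equal; ring).
    apply is_lim_seq_scal_l. apply is_series_rsum. apply lamb_dom_series; lra.
Qed.

Lemma qpoch_lamb : forall q, Cmod q < 1 -> qpoch q q = Cexp (- lamb q)%C.
Proof.
  intros q H. unfold qpoch. apply Clim_seq_correct.
  apply Clim_ext with (fun N => Cexp (- csum (fun n => nlog (q ^ S n)%C) N)%C).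
  - intros N. induction N.
    + simpl. replace (- 0)%C with (RtoC 0) by ring. apply Cexp_0.
    + cbn [Cprod]. rewrite <- IHN. cbn [csum].
      replace (- (csum (fun n => nlog (q ^ S n)) N + nlog (q ^ S N)))%C
        with (- csum (fun n => nlog (q ^ S n)) N + - nlog (q ^ S N))%C by ring.
      rewrite Cexp_plus, (Cexp_nlog (q ^ S N)%C). reflexivity. apply Cmod_pow_S_lt; auto.
  - apply Clim_Cexp. apply Clim_opp. apply csum_nlog_lamb; auto.
Qed.

(** * Partial fractions of the inverse square of sinh *)

(** 2 sinh w; the exponentials are kept free of denominators. *)
Definition sh2 (w : C) : C := (Cexp w - Cexp (- w))%C.
(** 1 / sinh^2 w *)
Definition isinh2 (w : C) : C := (4 / (sh2 w * sh2 w))%C.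

Lemma sh2_double : forall w, sh2 (2 * w)%C = (sh2 w * (Cexp w + Cexp (- w)))%C.
Proof.
  intros w. unfold sh2. replace (2 * w)%C with (w + w)%C by ring.
  replace (- (w + w))%C with (- w + - w)%C by ring. rewrite !Cexp_plus. ring.
Qed.

Lemma Cexp_iPI2 : Cexp (RtoC (PI / 2) * Ci)%C = Ci.
Proof.
  unfold Cexp; simpl. replace (PI / 2 * 0 - 0 * 1) with 0 by ring.
  replace (PI / 2 * 1 + 0 * 0) with (PI / 2) by ring. rewrite exp_0, cos_PI2, sin_PI2.
  unfold Ci; f_equal; ring.
Qed.

Lemma Ci_sqr : (Ci * Ci)%C = (- (1))%C.
Proof. apply C_eq; simpl; ring. Qed.

Lemma Cexp_shift_PI2 : forall w, Cexp (w + RtoC (PI / 2) * Ci)%C = (Ci * Cexp w)%C.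
Proof. intros. rewrite Cexp_plus, Cexp_iPI2. ring. Qed.

Lemma Cexp_shift_PI2_neg : forall w, Cexp (- (w + RtoC (PI / 2) * Ci))%C = (- Ci * Cexp (- w))%C.
Proof.
  intros. replace (- (w + RtoC (PI / 2) * Ci))%C with (- w + - (RtoC (PI / 2) * Ci))%C by ring.
  rewrite Cexp_plus, (Cexp_opp (RtoC (PI / 2) * Ci)%C), Cexp_iPI2, Ci_inv. ring.
Qed.

Lemma sh2_shift_PI : forall w, sh2 (w + RtoC PI * Ci)%C = (- sh2 w)%C.
Proof.
  intros w. replace (w + RtoC PI * Ci)%C with (w + RtoC (PI / 2) * Ci + RtoC (PI / 2) * Ci)%C.
  unfold sh2. rewrite !Cexp_shift_PI2, !Cexp_shift_PI2_neg.
  replace (Ci * (Ci * Cexp w) - - Ci * (- Ci * Cexp (- w)))%C with (Ci * Ci * (Cexp w - Cexp (- w)))%C by ring.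
  rewrite Ci_sqr. ring.
  rewrite <- Cplus_assoc, <- Cmult_plus_distr_r, <- RtoC_plus. do 3 f_equal. field.
Qed.

Lemma isinh2_shift_PI : forall w, isinh2 (w + RtoC PI * Ci)%C = isinh2 w.
Proof. intros. unfold isinh2. rewrite sh2_shift_PI.
  replace (- sh2 w * - sh2 w)%C with (sh2 w * sh2 w)%C by ring. reflexivity. Qed.

Lemma sh2_half_neq : forall w, sh2 (2 * w)%C <> RtoC 0 -> sh2 w <> RtoC 0.
Proof. intros w H E. apply H. rewrite sh2_double, E. ring. Qed.

(** From [sinh 2w = 2 sinh w cosh w] and [cosh w = -i sinh (w + i pi/2)]. *)
Lemma isinh2_halving : forall w, sh2 (2 * w)%C <> RtoC 0 ->
  isinh2 (2 * w)%C = (/ 4 * (isinh2 w + isinh2 (w + RtoC (PI / 2) * Ci)))%C.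
Proof.
  intros w H. unfold isinh2.
  assert (E : sh2 (w + RtoC (PI / 2) * Ci)%C = (Ci * (Cexp w + Cexp (- w)))%C).
  { unfold sh2. rewrite Cexp_shift_PI2, Cexp_shift_PI2_neg. ring. }
  rewrite sh2_double in *. rewrite E.
  set (a := Cexp w) in *. set (b := Cexp (- w)%C) in *.
  assert (Hab : (a * b)%C = RtoC 1).
  { unfold a, b. rewrite <- Cexp_plus. replace (w + - w)%C with (RtoC 0) by ring. apply Cexp_0. }
  unfold sh2 in *. fold a b in H. fold a b.
  assert (H1 : (a - b)%C <> RtoC 0) by (intro Z; apply H; rewrite Z; ring).
  assert (H2 : (a + b)%C <> RtoC 0) by (intro Z; apply H; rewrite Z; ring).
  replace (Ci * (a + b) * (Ci * (a + b)))%C with (- ((a + b) * (a + b)))%C.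
  2:{ replace (Ci * (a + b) * (Ci * (a + b)))%C with ((Ci * Ci) * ((a + b) * (a + b)))%C by ring. rewrite Ci_sqr. ring. }
  transitivity (4 * (a * b) / ((a - b) * (a + b) * ((a - b) * (a + b))))%C.
  rewrite Hab. field. split; auto. field. split; auto.
Qed.

Lemma RtoC_INR_pow2 : forall p, RtoC (INR (2 ^ p)) <> RtoC 0.
Proof. intros. apply RtoC_neq. apply not_0_INR. apply Nat.pow_nonzero. lia. Qed.

Lemma sh2_frac_neq : forall y, sh2 y <> RtoC 0 -> forall p j,
  sh2 ((y + RtoC (INR j) * (RtoC PI * Ci)) / RtoC (INR (2 ^ p)))%C <> RtoC 0.
Proof.
  intros y Hy. induction p; intros j.
  - simpl Nat.pow. simpl INR at 2.
    replace ((y + RtoC (INR j) * (RtoC PI * Ci)) / RtoC 1)%C with (y + RtoC (INR j) * (RtoC PI * Ci))%C by field.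
    induction j.
    + simpl. replace (y + RtoC 0 * (RtoC PI * Ci))%C with y by ring. exact Hy.
    + rewrite S_INR, RtoC_plus.
      replace (y + (RtoC (INR j) + RtoC 1) * (RtoC PI * Ci))%C with (y + RtoC (INR j) * (RtoC PI * Ci) + RtoC PI * Ci)%C by ring.
      rewrite sh2_shift_PI. intro E. apply IHj.
      replace (sh2 (y + RtoC (INR j) * (RtoC PI * Ci))%C) with (- - sh2 (y + RtoC (INR j) * (RtoC PI * Ci))%C)%C by ring.
      rewrite E. ring.
  - apply sh2_half_neq.
    replace (2 * ((y + RtoC (INR j) * (RtoC PI * Ci)) / RtoC (INR (2 ^ S p))))%C
      with ((y + RtoC (INR j) * (RtoC PI * Ci)) / RtoC (INR (2 ^ p)))%C; auto.
    replace (2 ^ S p)%nat with (2 * 2 ^ p)%nat by (simpl; lia). rewrite mult_INR, RtoC_mult. simpl (INR 2).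
    replace (RtoC (1 + 1)) with (RtoC 2) by (f_equal; ring). field. apply RtoC_INR_pow2.
Qed.

(** The halving identity iterated [p] times. *)
Lemma isinh2_sum_pow2 : forall y, sh2 y <> RtoC 0 -> forall p,
  csum (fun j => isinh2 ((y + RtoC (INR j) * (RtoC PI * Ci)) / RtoC (INR (2 ^ p))))%C (2 ^ p)
  = (RtoC (INR (2 ^ p)) * RtoC (INR (2 ^ p)) * isinh2 y)%C.
Proof.
  intros y Hy. induction p.
  - simpl. replace ((y + RtoC 0 * (RtoC PI * Ci)) / RtoC 1)%C with y by field. ring.
  - replace (2 ^ S p)%nat with (2 ^ p + 2 ^ p)%nat by (simpl; lia).
    rewrite csum_add, <- csum_plus.
    replace (RtoC (INR (2 ^ p + 2 ^ p))) with (2 * RtoC (INR (2 ^ p)))%C by (rewrite plus_INR, RtoC_plus; ring).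
    transitivity (4 * csum (fun j => isinh2 ((y + RtoC (INR j) * (RtoC PI * Ci)) / RtoC (INR (2 ^ p)))) (2 ^ p))%C.
    2:{ rewrite IHp. ring. }
    rewrite <- csum_scal. apply csum_ext. intros j _.
    pose proof (RtoC_INR_pow2 p) as Hp. assert (H2 : RtoC 2 <> RtoC 0) by (apply RtoC_neq; lra).
    set (w := ((y + RtoC (INR j) * (RtoC PI * Ci)) / (2 * RtoC (INR (2 ^ p))))%C).
    replace ((y + RtoC (INR j) * (RtoC PI * Ci)) / RtoC (INR (2 ^ p)))%C with (2 * w)%C.
    2:{ unfold w. field. auto. }
    replace ((y + RtoC (INR (2 ^ p + j)) * (RtoC PI * Ci)) / (2 * RtoC (INR (2 ^ p))))%C with (w + RtoC (PI / 2) * Ci)%C.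
    2:{ unfold w. rewrite plus_INR, RtoC_plus, RtoC_div by lra. field. auto. }
    rewrite isinh2_halving. field.
    replace (2 * w)%C with ((y + RtoC (INR j) * (RtoC PI * Ci)) / RtoC (INR (2 ^ p)))%C.
    apply sh2_frac_neq; auto. unfold w. field. auto.
Qed.

Lemma csum_rev : forall f n, csum f n = csum (fun i => f (n - 1 - i)%nat) n.
Proof.
  induction n; auto. rewrite (csum_S_l (fun i => f (S n - 1 - i)%nat)). cbn [csum]. rewrite IHn, Cplus_comm. f_equal.
  - f_equal. lia.
  - apply csum_ext. intros. f_equal. lia.
Qed.

(** The residues modulo [2^(p+1)] recentred at 0: with these representatives every argument
    stays in a fixed neighbourhood of 0, where 1 / sinh^2 is comparable with 1 / w^2. *)
Lemma isinh2_sum_centred : forall y, sh2 y <> RtoC 0 -> forall p,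
  let L := (2 ^ p)%nat in
  (csum (fun j => isinh2 ((y + RtoC (INR j) * (RtoC PI * Ci)) / RtoC (2 * INR L))) L
   + csum (fun j => isinh2 ((y - RtoC (INR (S j)) * (RtoC PI * Ci)) / RtoC (2 * INR L))) L)%C
  = (RtoC (2 * INR L) * RtoC (2 * INR L) * isinh2 y)%C.
Proof.
  intros y Hy p L. pose proof (isinh2_sum_pow2 y Hy (S p)) as H.
  replace (2 ^ S p)%nat with (L + L)%nat in H by (unfold L; simpl; lia).
  replace (INR (L + L)) with (2 * INR L) in H by (rewrite plus_INR; ring).
  rewrite <- H, csum_add. f_equal. rewrite csum_rev. apply csum_ext. intros i Hi.
  rewrite <- isinh2_shift_PI. f_equal.
  assert (HL : RtoC (INR L) <> RtoC 0) by apply RtoC_INR_pow2.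
  assert (H2 : RtoC 2 <> RtoC 0) by (apply RtoC_neq; lra).
  replace (INR (S (L - 1 - i))) with (INR L - INR i).
  2:{ rewrite <- minus_INR by lia. f_equal. lia. }
  rewrite plus_INR, RtoC_plus, RtoC_minus, RtoC_mult. field. auto.
Qed.

Lemma exp_minus_exp_opp_ge : forall u, 0 <= u -> 2 * u <= exp u - exp (- u).
Proof.
  intros u Hu.
  destruct (MVT_gen (fun u => exp u - exp (- u) - 2 * u) 0 u (fun u => exp u + exp (- u) - 2)) as [c [Hc E]].
  - intros. auto_derive; auto. ring.
  - intros. apply derivable_continuous_pt. eexists. apply is_derive_Reals. 
    instantiate (1 := exp x + exp (- x) - 2). auto_derive; auto. ring.
  - rewrite Ropp_0, exp_0 in E. 
    assert (2 <= exp c + exp (- c)).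
    { rewrite exp_Ropp. pose proof (exp_pos c). assert (exp c * / exp c = 1) by (apply Rinv_r; lra).
      assert (0 < / exp c) by (apply Rinv_0_lt_compat; auto).
      assert (0 <= (exp c - / exp c) ^ 2) by apply pow2_ge_0. nra. }
    nra.
Qed.

(** 17/8 is a convenient number above pi/2 for which the cubic Taylor polynomial of the sine
    still dominates the line; the crude bound pi <= 4 keeps the centred arguments below it. *)
Lemma sin_ge_fifth : forall v, 0 <= v <= 17 / 8 -> v / 5 <= sin v.
Proof.
  intros v Hv. pose proof (pre_sin_bound v 0 (proj1 Hv) ltac:(lra)) as [H _].
  eapply Rle_trans; [|exact H]. unfold sin_approx, sum_f_R0, sin_term; simpl. nra.
Qed.

Lemma sh2_lower : forall w, Rabs (Im w) <= 17 / 8 -> 2 / 5 * Cmod w <= Cmod (sh2 w).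
Proof.
  intros w Hw. apply Cmod_ge_of_sqr. rewrite Rpow_mult_distr, Cmod_sqr.
  replace (Re (sh2 w)) with (exp (Re w) * cos (Im w) - exp (- Re w) * cos (Im w)).
  2:{ destruct w; unfold sh2, Cexp; simpl. rewrite cos_neg. ring. }
  replace (Im (sh2 w)) with (exp (Re w) * sin (Im w) - exp (- Re w) * - sin (Im w)).
  2:{ destruct w; unfold sh2, Cexp; simpl. rewrite sin_neg. ring. }
  set (u := Re w). set (v := Im w). fold v in Hw.
  replace ((exp u * cos v - exp (- u) * cos v) ^ 2 + (exp u * sin v - exp (- u) * - sin v) ^ 2)
    with ((exp u - exp (- u)) ^ 2 * ((sin v)^2 + (cos v)^2) + 4 * (exp u * exp (- u)) * (sin v) ^ 2) by ring.
  rewrite <- exp_plus. replace (u + - u) with 0 by ring. rewrite exp_0.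
  pose proof (sin2_cos2 v) as Hsc. rewrite !Rsqr_pow2 in Hsc. rewrite Hsc.
  assert (A : 4 * u ^ 2 <= (exp u - exp (- u)) ^ 2).
  { destruct (Rle_dec 0 u).
    - pose proof (exp_minus_exp_opp_ge u r). nra.
    - pose proof (exp_minus_exp_opp_ge (- u) ltac:(lra)). rewrite Ropp_involutive in H. nra. }
  assert (B : v ^ 2 / 25 <= sin v ^ 2).
  { unfold Rabs in Hw. destruct (Rcase_abs v).
    - pose proof (sin_ge_fifth (- v) ltac:(lra)). rewrite sin_neg in H. nra.
    - pose proof (sin_ge_fifth v ltac:(lra)). nra. }
  nra.
Qed.

Lemma sh2_taylor : forall w, Cmod (sh2 w - 2 * w)%C <= Cmod w ^ 3 * exp (Cmod w).
Proof.
  intros w. pose proof (Cexp_taylor 3 w) as H1. pose proof (Cexp_taylor 3 (- w)%C) as H2.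
  rewrite Cmod_opp in H2.
  cbn [csum] in H1, H2.
  match type of H1 with Cmod ?A <= _ => match type of H2 with Cmod ?B <= _ =>
    replace (sh2 w - 2 * w)%C with (A - B)%C end end.
  - eapply Rle_trans. apply Cmod_minus_triangle.
    replace (INR (fact 3)) with 6 in H1, H2 by (simpl; ring). pose proof (Cmod_ge_0 w). pose proof (exp_pos (Cmod w)).
    assert (0 <= Cmod w ^ 3 * exp (Cmod w)) by (apply Rmult_le_pos; [apply pow_le; auto|lra]).
    replace (Cmod w ^ 3 / 6 * exp (Cmod w)) with (Cmod w ^ 3 * exp (Cmod w) / 6) in H1, H2 by field.
    lra.
  - unfold sh2. simpl fact. simpl INR. simpl Cpow.
    assert (RtoC (1 + 1) <> RtoC 0) by (apply RtoC_neq; lra). field. auto.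
Qed.

Lemma isinh2_near_0 : exists K, 0 <= K /\ forall w, w <> RtoC 0 -> Rabs (Re w) <= 1 -> Rabs (Im w) <= 17 / 8 ->
  Cmod (isinh2 w - / (w * w))%C <= K.
Proof.
  (* |w| <= 3 on this rectangle, the numerator is at most (|w|^3 e^3) |w| (4 + 9 e^3), and
     the denominator at least |w|^2 (2/5 |w|)^2. *)
  exists (25 / 4 * exp 3 * (4 + 9 * exp 3)). pose proof (exp_pos 3).
  split. nra. intros w Hw Hr Hi. set (x := Cmod w).
  assert (Hx : 0 < x) by (apply Cmod_gt_0; auto).
  assert (Hx3 : x <= 3).
  { apply Cmod_le_of_sqr. lra. rewrite <- (pow2_abs (Re w)), <- (pow2_abs (Im w)).
    pose proof (Rabs_pos (Re w)); pose proof (Rabs_pos (Im w)). nra. }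
  pose proof (sh2_lower w Hi) as Hlow. fold x in Hlow.
  pose proof (sh2_taylor w) as Ht. fold x in Ht.
  assert (He : exp x <= exp 3) by (destruct Hx3 as [Hx3|Hx3]; [left; apply exp_increasing; auto | rewrite Hx3; lra]).
  assert (Ht' : Cmod (sh2 w - 2 * w)%C <= x ^ 3 * exp 3).
  { eapply Rle_trans; [exact Ht|]. apply Rmult_le_compat_l; auto. apply pow_le; lra. }
  assert (Hs : sh2 w <> RtoC 0) by (apply Cmod_gt_0; lra).
  unfold isinh2.
  replace (4 / (sh2 w * sh2 w) - / (w * w))%C with (- (sh2 w - 2 * w) * (4 * w + (sh2 w - 2 * w)) / (w * w * (sh2 w * sh2 w)))%C
    by (field; auto).
  rewrite Cmod_div by (repeat apply Cmult_neq_0; auto). rewrite !Cmod_mult, Cmod_opp.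
  fold x.
  assert (H4 : Cmod (4 * w + (sh2 w - 2 * w))%C <= x * (4 + 9 * exp 3)).
  { eapply Rle_trans. apply Cmod_triangle. rewrite Cmod_mult, Cmod_RtoC by lra. fold x.
    assert (x ^ 3 * exp 3 <= x * 9 * exp 3). { apply Rmult_le_compat_r; [lra|]. simpl. nra. } nra. }
  assert (Hsq : 4 / 25 * x ^ 2 <= Cmod (sh2 w) * Cmod (sh2 w)) by nra.
  apply Rle_trans with ((x ^ 3 * exp 3) * (x * (4 + 9 * exp 3)) / (x * x * (4 / 25 * x ^ 2))).
  - unfold Rdiv. apply Rmult_le_compat.
    + apply Rmult_le_pos; apply Cmod_ge_0.
    + left. apply Rinv_0_lt_compat. apply Rmult_lt_0_compat; nra.
    + apply Rmult_le_compat; auto; apply Cmod_ge_0.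
    + apply Rinv_le_contravar. assert (0 < x ^ 2) by (apply pow_lt; auto). apply Rmult_lt_0_compat; nra.
      apply Rmult_le_compat_l; nra.
  - apply Req_le. field. lra.
Qed.

Lemma Clim_squeeze_loc : forall u l (e : nat -> R),
  eventually (fun n => Cmod (u n - l)%C <= e n) -> is_lim_seq e 0 -> Clim u l.
Proof.
  intros u l e [N H] He. unfold Clim.
  apply (is_lim_seq_le_le_loc (fun _ => 0) _ e); auto.
  - exists N. intros n Hn; split; auto. apply Cmod_ge_0.
  - apply is_lim_seq_const.
Qed.

Lemma is_lim_seq_pow2_inv : is_lim_seq (fun p => / INR (2 ^ p)) 0.
Proof.
  apply is_lim_seq_ext with (fun p => (/ 2) ^ p).
  - intros. rewrite pow_INR. simpl INR. rewrite pow_inv by lra. replace (1 + 1) with 2 by ring. reflexivity.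
  - apply is_lim_seq_pow_0. lra.
Qed.

Lemma pow2_INR_pos : forall p, 0 < INR (2 ^ p).
Proof. intros. apply lt_0_INR. apply Nat.neq_0_lt_0. apply Nat.pow_nonzero. lia. Qed.

Definition pf_pair (x : C) (l : nat) : C :=
  (/ ((x + RtoC (INR (S l)) * Ci) * (x + RtoC (INR (S l)) * Ci)) + / ((x - RtoC (INR (S l)) * Ci) * (x - RtoC (INR (S l)) * Ci)))%C.

Lemma seq_eventually_small : forall c d, 0 < d -> eventually (fun p => c * / INR (2 ^ p) <= d).
Proof.
  intros c d Hd. pose proof (is_lim_seq_scal_0 c _ is_lim_seq_pow2_inv) as H.
  apply is_lim_seq_spec in H. destruct (H (mkposreal d Hd)) as [N HN].
  exists N. intros n Hn. specialize (HN n Hn). simpl in HN. rewrite Rminus_0_r in HN.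
  apply Rabs_def2 in HN. lra.
Qed.

Lemma sh2_zero_frac : forall x (j : Z), (x + RtoC (IZR j) * Ci)%C = RtoC 0 -> sh2 (RtoC PI * x)%C = RtoC 0.
Proof.
  intros x j E.
  assert (x = - (RtoC (IZR j) * Ci))%C.
  { transitivity ((x + RtoC (IZR j) * Ci) + - (RtoC (IZR j) * Ci))%C. ring. rewrite E. ring. }
  subst x. unfold sh2.
  assert (H : Cexp (- (RtoC PI * - (RtoC (IZR j) * Ci)))%C = (Cexp (RtoC PI * - (RtoC (IZR j) * Ci)) * Cexp (RtoC (2 * PI * IZR j) * Ci))%C).
  { rewrite <- Cexp_plus. f_equal. rewrite !RtoC_mult. ring. }
  rewrite H, Cexp_2PI_Z. ring.
Qed.

(** pi^2 / sinh^2 (pi x) is the sum of the 1 / (x + i l)^2 over the integers l: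
    divide the argument by 2^p and use that 1 / sinh^2 w - 1 / w^2 stays bounded near 0. *)
Lemma isinh2_partial_fractions : forall x, sh2 (RtoC PI * x)%C <> RtoC 0 ->
  Clim (fun p => / (x * x) + csum (pf_pair x) (2 ^ p))%C (RtoC PI * RtoC PI * isinh2 (RtoC PI * x))%C.
Proof.
  intros x Hx. destruct isinh2_near_0 as [K [HK0 HK]].
  assert (HPI : RtoC PI <> RtoC 0) by (apply RtoC_neq; pose proof PI_RGT_0; lra).
  assert (Hn1 : forall j, (x + RtoC (INR j) * Ci)%C <> RtoC 0).
  { intros j E. apply Hx. rewrite INR_IZR_INZ in E. eapply sh2_zero_frac; eauto. }
  assert (Hn2 : forall j, (x - RtoC (INR j) * Ci)%C <> RtoC 0).
  { intros j E. apply Hx. rewrite INR_IZR_INZ in E. apply (sh2_zero_frac x (- Z.of_nat j)).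
    rewrite opp_IZR, RtoC_opp, <- E. ring. }
  set (u := fun p => (csum (fun j => / ((x + RtoC (INR j) * Ci) * (x + RtoC (INR j) * Ci))) (2 ^ p)
     + csum (fun j => / ((x - RtoC (INR (S j)) * Ci) * (x - RtoC (INR (S j)) * Ci))) (2 ^ p))%C).
  assert (Hu : Clim u (RtoC PI * RtoC PI * isinh2 (RtoC PI * x))%C).
  { apply Clim_squeeze_loc with (fun p => PI ^ 2 * K * / INR (2 ^ p)).
    2:{ apply is_lim_seq_scal_0. apply is_lim_seq_pow2_inv. }
    destruct (seq_eventually_small (PI * Rabs (Re x)) 1 ltac:(lra)) as [N1 HN1].
    destruct (seq_eventually_small (PI * Rabs (Im x)) (1 / 4) ltac:(lra)) as [N2 HN2].
    exists (Nat.max N1 N2). intros p Hp. specialize (HN1 p ltac:(lia)). specialize (HN2 p ltac:(lia)).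
    pose proof (isinh2_sum_centred _ Hx p) as HS. cbv zeta in HS.
    pose proof (pow2_INR_pos p) as HLp. 
    set (L := (2 ^ p)%nat) in *. set (LL := RtoC (2 * INR L)) in *.
    assert (HLL : LL <> RtoC 0) by (apply RtoC_neq; lra).
    assert (HLm : Cmod LL = 2 * INR L) by (apply Cmod_RtoC; lra).
    replace (RtoC PI * RtoC PI * isinh2 (RtoC PI * x))%C
      with (RtoC PI * RtoC PI / (LL * LL) * (LL * LL * isinh2 (RtoC PI * x)))%C by (field; auto).
    rewrite <- HS.
    assert (HB : forall w, w <> RtoC 0 -> Cmod (/ (w * w) - RtoC PI * RtoC PI / (LL * LL) * isinh2 (RtoC PI * w / LL))%C
       <= PI ^ 2 * K * / INR L * / INR L / 4 \/ ~ (Rabs (Re (RtoC PI * w / LL)%C) <= 1 /\ Rabs (Im (RtoC PI * w / LL)%C) <= 17 / 8)).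
    { intros w Hw. destruct (Rle_dec (Rabs (Re (RtoC PI * w / LL)%C)) 1). 2: right; tauto.
      destruct (Rle_dec (Rabs (Im (RtoC PI * w / LL)%C)) (17 / 8)). 2: right; tauto. left.
      replace (/ (w * w) - RtoC PI * RtoC PI / (LL * LL) * isinh2 (RtoC PI * w / LL))%C
        with (- (RtoC PI * RtoC PI / (LL * LL) * (isinh2 (RtoC PI * w / LL) - / (RtoC PI * w / LL * (RtoC PI * w / LL)))))%C.
      2:{ field. auto. }
      rewrite Cmod_opp, Cmod_mult, Cmod_div by (apply Cmult_neq_0; auto). rewrite !Cmod_mult, HLm, Cmod_RtoC by (pose proof PI_RGT_0; lra).
      replace (PI ^ 2 * K * / INR L * / INR L / 4) with (PI * PI / (2 * INR L * (2 * INR L)) * K) by (field; lra).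
      apply Rmult_le_compat_l. apply Rmult_le_pos. pose proof PI_RGT_0; nra. left; apply Rinv_0_lt_compat; nra.
      apply HK; auto. intro E. apply Hw. transitivity (LL / RtoC PI * (RtoC PI * w / LL))%C. field; auto. rewrite E; ring. }
    assert (Hre : forall w, Re (RtoC PI * w / LL)%C = PI * Re w / (2 * INR L) /\ Im (RtoC PI * w / LL)%C = PI * Im w / (2 * INR L)).
    { intros w. replace (RtoC PI * w / LL)%C with (RtoC (PI / (2 * INR L)) * w)%C.
      2:{ unfold LL. rewrite RtoC_div by lra. field. apply RtoC_neq; lra. }
      rewrite re_scal_l, im_scal_l. split; field; lra. }
    assert (Hrng : forall w, Re w = Re x -> Rabs (Im w) <= Rabs (Im x) + INR L ->
       Rabs (Re (RtoC PI * w / LL)%C) <= 1 /\ Rabs (Im (RtoC PI * w / LL)%C) <= 17 / 8).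
    { intros w E1 E2. destruct (Hre w) as [-> ->]. rewrite E1. pose proof PI_RGT_0 as HP. pose proof PI_4 as HP4.
      replace (PI * Re x / (2 * INR L)) with (Re x * (PI * / (2 * INR L))) by (field; lra).
      replace (PI * Im w / (2 * INR L)) with (Im w * (PI * / (2 * INR L))) by (field; lra).
      rewrite !Rabs_mult. rewrite (Rabs_pos_eq PI), (Rabs_pos_eq (/ (2 * INR L))) by (try lra; left; apply Rinv_0_lt_compat; lra).
      assert (Hi : / (2 * INR L) = / INR L / 2) by (field; lra).
      rewrite Hi. pose proof (Rinv_0_lt_compat _ HLp). assert (HLL1 : / INR L * INR L = 1) by (field; lra).
      pose proof (Rabs_pos (Re x)). pose proof (Rabs_pos (Im x)).
      split. nra.
      assert (Rabs (Im w) * (PI * (/ INR L / 2)) <= (Rabs (Im x) + INR L) * (PI * (/ INR L / 2))).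
      { apply Rmult_le_compat_r; [nra|auto]. }
      replace ((Rabs (Im x) + INR L) * (PI * (/ INR L / 2))) with ((PI * Rabs (Im x) * / INR L) / 2 + PI / 2) in H2 by (field; lra).
      lra. }
    unfold u. 
    match goal with |- Cmod ((?A + ?B) - ?k * (?A' + ?B'))%C <= _ =>
      replace ((A + B) - k * (A' + B'))%C with ((A - k * A') + (B - k * B'))%C by ring end.
    rewrite <- !csum_scal, <- !csum_minus.
    eapply Rle_trans. apply Cmod_triangle.
    apply Rle_trans with (INR L * (PI ^ 2 * K * / INR L * / INR L / 4) + INR L * (PI ^ 2 * K * / INR L * / INR L / 4)).
    - apply Rplus_le_compat; rewrite <- rsum_const; apply Cmod_csum_le; intros j Hj.
      + replace (RtoC PI * x + RtoC (INR j) * (RtoC PI * Ci))%C with (RtoC PI * (x + RtoC (INR j) * Ci))%C by ring.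
        destruct (HB _ (Hn1 j)) as [HH|HH]; auto. exfalso. apply HH. apply Hrng.
        * rewrite re_plus. simpl. ring.
        * rewrite im_plus. simpl. eapply Rle_trans. apply Rabs_triang. apply Rplus_le_compat_l.
          replace (INR j * 1 + 0 * 0) with (INR j) by ring. rewrite Rabs_pos_eq by apply pos_INR. apply le_INR; lia.
      + replace (RtoC PI * x - RtoC (INR (S j)) * (RtoC PI * Ci))%C with (RtoC PI * (x - RtoC (INR (S j)) * Ci))%C by ring.
        destruct (HB _ (Hn2 (S j))) as [HH|HH]; auto. exfalso. apply HH. apply Hrng.
        * rewrite Re_minus. simpl. ring.
        * rewrite Im_minus. cbn -[INR]. unfold Rminus. eapply Rle_trans. apply Rabs_triang. apply Rplus_le_compat_l.
          replace (INR (S j) * 1 + 0 * 0) with (INR (S j)) by ring. rewrite Rabs_Ropp, Rabs_pos_eq by apply pos_INR. apply le_INR; lia.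
    - assert (0 <= PI ^ 2 * K * / INR L).
      { apply Rmult_le_pos. apply Rmult_le_pos; auto. apply pow2_ge_0. left; apply Rinv_0_lt_compat; auto. }
      apply Rle_trans with (PI ^ 2 * K * / INR L / 2). apply Req_le; field; lra. lra. }
  assert (Hv : Clim (fun p => / ((x + RtoC (INR (2 ^ p)) * Ci) * (x + RtoC (INR (2 ^ p)) * Ci)))%C (RtoC 0)).
  { apply Clim_squeeze_loc with (fun p => 4 * (/ INR (2 ^ p) * / INR (2 ^ p))).
    2:{ apply is_lim_seq_scal_0. replace (Finite 0) with (Finite (0 * 0)) by (f_equal; ring).
        apply is_lim_seq_mult'; apply is_lim_seq_pow2_inv. }
    destruct (seq_eventually_small (Cmod x) (1 / 2) ltac:(lra)) as [N1 HN1].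
    exists N1. intros p Hp. specialize (HN1 p Hp). pose proof (pow2_INR_pos p) as HL. set (L := INR (2 ^ p)) in *.
    assert (Hw : L / 2 <= Cmod (x + RtoC L * Ci)%C).
    { pose proof (Cmod_triangle_lower (RtoC L * Ci)%C (- x)%C). rewrite Cmod_mult, Cmod_Ci, Cmod_RtoC, Cmod_opp in H by lra.
      replace (RtoC L * Ci - - x)%C with (x + RtoC L * Ci)%C in H by ring.
      assert (Cmod x <= L / 2). { replace (Cmod x) with (Cmod x * / L * L) by (field; lra). nra. } lra. }
    unfold Cminus. rewrite Copp_0, Cplus_0_r, Cmod_inv by (apply Cmult_neq_0; apply Cmod_gt_0; lra).
    rewrite Cmod_mult. replace (4 * (/ L * / L)) with (/ (L / 2 * (L / 2))) by (field; lra).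
    apply Rinv_le_contravar. nra. nra. }
  pose proof (Clim_plus _ _ _ _ Hu Hv) as H. rewrite Cplus_0_r in H.
  eapply Clim_ext; [|exact H]. intros p. unfold u, pf_pair. cbv beta. rewrite csum_plus.
  match goal with |- (?A + ?B + ?V = ?D + (?P + ?B))%C => assert (A + V = D + P)%C end.
  { transitivity (csum (fun j => / ((x + RtoC (INR j) * Ci) * (x + RtoC (INR j) * Ci)))%C (S (2 ^ p))).
    - reflexivity.
    - rewrite csum_S_l. f_equal. f_equal. simpl. ring. }
  match goal with |- (?A + ?B + ?V = ?D + (?P + ?B))%C =>
    replace (A + B + V)%C with (A + V + B)%C by ring; rewrite H0; ring end.
Qed.

(** * The transformation z -> 1/z of Euler's product *)

Lemma pow2_strict_incr : forall n, (2 ^ n < 2 ^ S n)%nat.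
Proof. intros. simpl. assert (0 < 2 ^ n)%nat by (apply Nat.neq_0_lt_0; apply Nat.pow_nonzero; lia). lia. Qed.

Definition zeta2_partial (n : nat) : R := rsum (fun r => / (INR (S r) ^ 2)) n.

Lemma zeta2_partial_cv : ex_finite_lim_seq zeta2_partial.
Proof.
  apply ex_finite_lim_seq_incr with 2.
  - intros n. unfold zeta2_partial. cbn [rsum]. pose proof (INR_S_ge1 n).
    assert (0 < / INR (S n) ^ 2) by (apply Rinv_0_lt_compat; apply pow_lt; lra). lra.
  - assert (H : forall n, zeta2_partial (S n) <= 2 - / INR (S n)).
    { unfold zeta2_partial. induction n.
      - simpl. lra.
      - cbn [rsum] in *. rewrite (S_INR (S n)). pose proof (INR_S_ge1 n). set (a := INR (S n)) in *.
        assert (E : / a - / (a + 1) = / (a * (a + 1))) by (field; lra).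
        assert (/ (a + 1) ^ 2 <= / (a * (a + 1))) by (apply Rinv_le_contravar; nra). lra. }
    intros [|n]. unfold zeta2_partial; simpl; lra. specialize (H n).
    assert (0 < / INR (S n)) by (apply Rinv_0_lt_compat; pose proof (INR_S_ge1 n); lra). lra.
Qed.

(** The partial fractions at [x = i/2] sum the inverse odd squares; the even ones are a
    quarter of the whole. *)
Lemma basel : is_lim_seq zeta2_partial (PI ^ 2 / 6).
Proof.
  (* The integers shifted by 1/2 are halves of odd numbers; each odd square but the last
     occurs twice in the partial sum. *)
  set (o := fun l => / (2 * INR l + 1) ^ 2).
  assert (Hodd : is_lim_seq (fun p => rsum o (2 ^ p)) (PI ^ 2 / 8)).
  { set (x := (RtoC (/ 2) * Ci)%C).
    assert (HC : Cexp (RtoC PI * x)%C = Ci).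
    { unfold x. rewrite Cmult_assoc, <- RtoC_mult. apply Cexp_iPI2. }
    assert (Hsh : sh2 (RtoC PI * x)%C = (2 * Ci)%C).
    { unfold sh2. rewrite Cexp_opp, HC, Ci_inv. ring. }
    assert (H2i : (2 * Ci)%C <> RtoC 0) by (apply Cmult_neq_0; [apply RtoC_neq; lra | apply Ci_nz]).
    assert (HP := isinh2_partial_fractions x ltac:(rewrite Hsh; exact H2i)).
    apply Clim_Re in HP.
    assert (HR : Re (RtoC PI * RtoC PI * isinh2 (RtoC PI * x))%C = - PI ^ 2).
    { unfold isinh2. rewrite Hsh. replace (2 * Ci * (2 * Ci))%C with (RtoC (-4)).
      2:{ apply C_eq; simpl; ring. }
      replace (RtoC PI * RtoC PI * (4 / RtoC (-4)))%C with (RtoC (- PI ^ 2)). reflexivity.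
      rewrite <- RtoC_div by lra. rewrite <- !RtoC_mult. f_equal. field. }
    rewrite HR in HP.
    assert (Hterm : forall L, Re (/ (x * x) + csum (pf_pair x) L)%C = - (8 * rsum o L + 4 * o L)).
    { intros L. replace (x * x)%C with (RtoC (- / 4)) by (unfold x; apply C_eq; simpl; field).
      rewrite <- RtoC_inv by lra. rewrite re_plus, re_RtoC.
      assert (Hp : forall l, pf_pair x l = RtoC (- (4 * o l + 4 * o (S l)))).
      { intros l. unfold pf_pair. pose proof (pos_INR l).
        replace ((x + RtoC (INR (S l)) * Ci) * (x + RtoC (INR (S l)) * Ci))%C with (RtoC (- (/ 2 + INR (S l)) ^ 2)).
        2:{ unfold x. apply C_eq; cbn -[INR]; field. }
        replace ((x - RtoC (INR (S l)) * Ci) * (x - RtoC (INR (S l)) * Ci))%C with (RtoC (- (/ 2 - INR (S l)) ^ 2)).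
        2:{ unfold x. apply C_eq; cbn -[INR]; field. }
        unfold o. rewrite S_INR. rewrite <- !RtoC_inv, <- RtoC_plus. f_equal. field.
        repeat split; nra. nra. nra. }
      induction L.
      - unfold o; simpl. field.
      - cbn [csum rsum]. rewrite re_plus, Hp, re_RtoC. lra. }
    apply is_lim_seq_ext with (fun p => / 8 * (- Re (/ (x * x) + csum (pf_pair x) (2 ^ p))%C - 4 * o (2 ^ p)%nat)).
    { intros p. rewrite Hterm. field. }
    replace (Finite (PI ^ 2 / 8)) with (Rbar_mult (/ 8) (Finite (- - PI ^ 2 - 0))) by (simpl; f_equal; field).
    apply is_lim_seq_scal_l. apply is_lim_seq_minus'.
    - apply is_lim_seq_opp with (l := Finite (- PI ^ 2)). exact HP.
    - apply (is_lim_seq_le_le (fun _ => 0) _ (fun p => / INR (2 ^ p))).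
      + intros p. unfold o. pose proof (pow2_INR_pos p) as HL.
        assert (1 <= INR (2 ^ p)). { replace 1 with (INR 1) by reflexivity. apply le_INR. apply Nat.neq_0_lt_0. apply Nat.pow_nonzero; lia. }
        set (L := INR (2 ^ p)) in *. split.
        apply Rmult_le_pos. lra. left; apply Rinv_0_lt_compat. apply pow_lt; lra.
        replace (/ L) with (4 * / (4 * L)) by (field; lra). apply Rmult_le_compat_l. lra.
        apply Rinv_le_contravar; nra.
      + apply is_lim_seq_const.
      + apply is_lim_seq_pow2_inv. }
  destruct zeta2_partial_cv as [z Hz].
  assert (Hsplit : forall n, zeta2_partial (n + n) = rsum o n + zeta2_partial n / 4).
  { intros n. unfold zeta2_partial. induction n. simpl; field.
    replace (S n + S n)%nat with (S (S (n + n))) by lia. cbn [rsum]. rewrite IHn.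
    unfold o. rewrite !S_INR, !plus_INR. pose proof (pos_INR n). field. repeat split; nra. }
  assert (H1 : is_lim_seq (fun p => zeta2_partial (2 ^ p + 2 ^ p)) z).
  { apply is_lim_seq_ext with (fun p => zeta2_partial (2 ^ S p)). intros; f_equal; simpl; lia.
    apply (is_lim_seq_subseq zeta2_partial z (fun p => 2 ^ S p)%nat); auto.
    apply eventually_subseq. intros; apply pow2_strict_incr. }
  assert (H2 : is_lim_seq (fun p => zeta2_partial (2 ^ p + 2 ^ p)) (PI ^ 2 / 8 + z / 4)).
  { apply is_lim_seq_ext with (fun p => rsum o (2 ^ p) + zeta2_partial (2 ^ p) * / 4).
    intros; rewrite Hsplit; reflexivity.
    apply is_lim_seq_plus'; auto. apply (is_lim_seq_scal_r _ (/ 4) (Finite z)).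
    apply (is_lim_seq_subseq zeta2_partial z (fun p => 2 ^ p)%nat); auto.
    apply eventually_subseq. intros; apply pow2_strict_incr. }
  apply is_lim_seq_unique in H1. apply is_lim_seq_unique in H2. rewrite H1 in H2. injection H2; intros E.
  replace (PI ^ 2 / 6) with z by lra. exact Hz.
Qed.

(** ** Truncated Eisenstein sums of weight two *)

(** A truncated sector: the estimates below are uniform on it, and it is stable under
    inversion.  A segment from 1 in the right half plane lies in one. *)
Definition sector (k B : R) (z : C) : Prop :=
  0 < k /\ k * Cmod z <= Re z /\ / B <= Cmod z /\ Cmod z <= B /\ 0 < B.

Lemma sector_neq : forall k B z, sector k B z -> z <> RtoC 0.
Proof.
  intros k B z (H1 & H2 & H3 & H4 & H5) E. subst z. rewrite Cmod_0 in H3.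
  pose proof (Rinv_0_lt_compat _ H5). lra.
Qed.

Lemma sector_inv : forall k B z, sector k B z -> sector k B (/ z)%C.
Proof.
  intros k B z Hs. pose proof (sector_neq _ _ _ Hs) as Hz. destruct Hs as (H1 & H2 & H3 & H4 & H5).
  assert (Hp : 0 < Cmod z) by (apply Cmod_gt_0; auto).
  unfold sector. rewrite (Cmod_inv z Hz). repeat split; auto.
  - replace (Re (/ z)%C) with (Re z * / (Cmod z ^ 2)).
    2:{ rewrite Cmod_sqr. destruct z; reflexivity. }
    replace (k * / Cmod z) with (k * Cmod z * / Cmod z ^ 2) by (field; lra).
    apply Rmult_le_compat_r; auto. left; apply Rinv_0_lt_compat; apply pow_lt; auto.
  - apply Rinv_le_contravar; auto.
  - replace B with (/ / B) by (field; lra). apply Rinv_le_contravar; auto. apply Rinv_0_lt_compat; auto.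
Qed.

Lemma sector_lower : forall k B z (r l : R), sector k B z -> k * Rabs l <= Cmod (RtoC r * z + RtoC l * Ci)%C.
Proof.
  intros k B z r l Hs. pose proof (sector_neq _ _ _ Hs) as Hz. destruct Hs as (H1 & H2 & H3 & H4 & H5).
  assert (Hp : 0 < Cmod z) by (apply Cmod_gt_0; auto).
  apply Cmod_ge_of_sqr. rewrite Rpow_mult_distr, pow2_abs.
  replace (Re (RtoC r * z + RtoC l * Ci)%C) with (r * Re z) by (destruct z; simpl; ring).
  replace (Im (RtoC r * z + RtoC l * Ci)%C) with (r * Im z + l) by (destruct z; simpl; ring).
  pose proof (Cmod_sqr z) as Hm. set (a := Re z) in *. set (b := Im z) in *. set (n := Cmod z) in *.
  assert (Hk : k ^ 2 * n ^ 2 <= a ^ 2) by (replace (k ^ 2 * n ^ 2) with ((k * n) ^ 2) by ring; apply pow_incr; split; [apply Rmult_le_pos; lra|auto]).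
  assert (Hid : n ^ 2 * ((r * a) ^ 2 + (r * b + l) ^ 2) = l ^ 2 * a ^ 2 + (r * n ^ 2 + b * l) ^ 2) by (rewrite Hm; ring).
  assert (0 < n ^ 2) by (apply pow_lt; auto).
  apply Rmult_le_reg_l with (n ^ 2); auto. rewrite Hid.
  assert (0 <= (r * n ^ 2 + b * l) ^ 2) by apply pow2_ge_0. pose proof (pow2_ge_0 l). nra.
Qed.

Lemma sh2_neq_Re : forall w, 0 < Re w -> sh2 w <> RtoC 0.
Proof.
  intros w Hw E. unfold sh2 in E.
  assert (Cexp w = Cexp (- w)%C). { transitivity (Cexp w - Cexp (- w) + Cexp (- w))%C. ring. rewrite E; ring. }
  apply (f_equal Cmod) in H. rewrite !Cmod_Cexp in H. apply exp_inv in H. rewrite re_opp in H. lra.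
Qed.

(** 1 / w^2 is almost the difference of 1 / w over the imaginary unit step centred at [w]. *)
Lemma inv_sqr_vs_step : forall (w : C) d, 0 < d -> d <= Cmod w -> d / 2 <= Cmod (w - RtoC (/ 2) * Ci)%C ->
  d / 2 <= Cmod (w + RtoC (/ 2) * Ci)%C ->
  Cmod (/ (w * w) - / ((w - RtoC (/ 2) * Ci) * (w + RtoC (/ 2) * Ci)))%C <= / d ^ 4.
Proof.
  intros w d Hd H1 H2 H3.
  assert (w <> RtoC 0) by (apply Cmod_gt_0; lra).
  assert (Ha : (w - RtoC (/ 2) * Ci)%C <> RtoC 0) by (apply Cmod_gt_0; lra).
  assert (Hb : (w + RtoC (/ 2) * Ci)%C <> RtoC 0) by (apply Cmod_gt_0; lra).
  replace (/ (w * w) - / ((w - RtoC (/ 2) * Ci) * (w + RtoC (/ 2) * Ci)))%C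
    with (RtoC (/ 4) / ((w * w) * ((w - RtoC (/ 2) * Ci) * (w + RtoC (/ 2) * Ci))))%C.
  - rewrite Cmod_div by (repeat apply Cmult_neq_0; auto). rewrite !Cmod_mult, Cmod_RtoC by lra.
    set (x := Cmod w) in *. set (y := Cmod (w - RtoC (/ 2) * Ci)%C) in *. set (t := Cmod (w + RtoC (/ 2) * Ci)%C) in *.
    apply Rle_trans with (/ 4 / ((d * d) * (d / 2 * (d / 2)))).
    + apply Rmult_le_compat_l. lra. apply Rinv_le_contravar. repeat apply Rmult_lt_0_compat; lra.
      apply Rmult_le_compat; try nra. 
    + apply Req_le. field. lra.
  - assert (Hh : (RtoC (/ 4) = - (RtoC (/ 2) * Ci) * (RtoC (/ 2) * Ci))%C) by (apply C_eq; simpl; field).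
    rewrite Hh. set (h := (RtoC (/ 2) * Ci)%C) in *. field. auto.
Qed.

(** By [inv_sqr_vs_step] the tail of the partial fractions telescopes, up to a summable
    error; what it telescopes to is the term in [M = N + 1/2]. *)
Lemma isinh2_truncated : forall k x N, 0 < k -> (1 <= N)%nat -> 0 < Re x ->
  (forall l, 0 <= l -> k * l <= Cmod (x + RtoC l * Ci)%C /\ k * l <= Cmod (x - RtoC l * Ci)%C) ->
  let M := RtoC (INR N + / 2) in
  Cmod (RtoC PI * RtoC PI * isinh2 (RtoC PI * x) - / (x * x) - csum (pf_pair x) N + 2 * M / (x * x + M * M))%C
  <= 2 / (k ^ 4 * INR N ^ 3).
Proof.
  intros k x N Hk HN Hx Hl M.
  assert (HPI := PI_RGT_0).
  assert (Hsh : sh2 (RtoC PI * x)%C <> RtoC 0).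
  { apply sh2_neq_Re. rewrite re_scal_l. nra. }
  pose proof (isinh2_partial_fractions x Hsh) as HP.
  set (T := fun n => (2 * RtoC (INR n + / 2) / (x * x + RtoC (INR n + / 2) * RtoC (INR n + / 2)))%C).
  assert (Hfac : forall l, 0 < l -> (x * x + RtoC l * RtoC l)%C = ((x + RtoC l * Ci) * (x - RtoC l * Ci))%C
     /\ (x + RtoC l * Ci)%C <> RtoC 0 /\ (x - RtoC l * Ci)%C <> RtoC 0).
  { intros l Hl0. destruct (Hl l ltac:(lra)). split; [|split].
    - replace ((x + RtoC l * Ci) * (x - RtoC l * Ci))%C with (x * x - RtoC l * RtoC l * (Ci * Ci))%C by ring. rewrite Ci_sqr. ring.
    - apply Cmod_gt_0. nra. - apply Cmod_gt_0. nra. }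
  assert (Hstep : forall l, Cmod (pf_pair x l - (T (S l) - T l))%C <= 2 * / (k * INR (S l)) ^ 4).
  { intros l. pose proof (pos_INR l) as Hl0. rewrite S_INR. set (m := INR l + 1).
    assert (Hm : 1 <= m) by (unfold m; lra).
    destruct (Hfac (m - / 2) ltac:(lra)) as (F1 & F2 & F3).
    destruct (Hfac (m + / 2) ltac:(lra)) as (G1 & G2 & G3).
    destruct (Hl (m - / 2) ltac:(lra)) as (A1 & A2). destruct (Hl (m + / 2) ltac:(lra)) as (B1 & B2).
    destruct (Hl m ltac:(lra)) as (C1 & C2).
    assert (E1 : (x + RtoC m * Ci - RtoC (/ 2) * Ci = x + RtoC (m - / 2) * Ci)%C) by (rewrite RtoC_minus; ring).
    assert (E2 : (x + RtoC m * Ci + RtoC (/ 2) * Ci = x + RtoC (m + / 2) * Ci)%C) by (rewrite RtoC_plus; ring).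
    assert (E3 : (x - RtoC m * Ci - RtoC (/ 2) * Ci = x - RtoC (m + / 2) * Ci)%C) by (rewrite RtoC_plus; ring).
    assert (E4 : (x - RtoC m * Ci + RtoC (/ 2) * Ci = x - RtoC (m - / 2) * Ci)%C) by (rewrite RtoC_minus; ring).
    pose proof (inv_sqr_vs_step (x + RtoC m * Ci)%C (k * m) ltac:(nra) C1 ltac:(rewrite E1; nra) ltac:(rewrite E2; nra)) as S1.
    pose proof (inv_sqr_vs_step (x - RtoC m * Ci)%C (k * m) ltac:(nra) C2 ltac:(rewrite E3; nra) ltac:(rewrite E4; nra)) as S2.
    rewrite E1, E2 in S1. rewrite E3, E4 in S2.
    match type of S1 with Cmod ?A <= _ => match type of S2 with Cmod ?B <= _ =>
      replace (pf_pair x l - (T (S l) - T l))%C with (A + B)%C end end.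
    - eapply Rle_trans. apply Cmod_triangle. lra.
    - unfold T, pf_pair. rewrite S_INR. replace (INR l + / 2) with (m - / 2) by (unfold m; lra).
      fold m. rewrite F1, G1.
      replace (2 * RtoC (m + / 2) / ((x + RtoC (m + / 2) * Ci) * (x - RtoC (m + / 2) * Ci)))%C
        with (Ci * (/ (x + RtoC (m + / 2) * Ci) - / (x - RtoC (m + / 2) * Ci)))%C.
      2:{ replace (2 * RtoC (m + / 2))%C with (- (2 * RtoC (m + / 2) * (Ci * Ci)))%C by (rewrite Ci_sqr; ring). field; auto. }
      replace (2 * RtoC (m - / 2) / ((x + RtoC (m - / 2) * Ci) * (x - RtoC (m - / 2) * Ci)))%C
        with (Ci * (/ (x + RtoC (m - / 2) * Ci) - / (x - RtoC (m - / 2) * Ci)))%C.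
      2:{ replace (2 * RtoC (m - / 2))%C with (- (2 * RtoC (m - / 2) * (Ci * Ci)))%C by (rewrite Ci_sqr; ring). field; auto. }
      assert (Ed1 : (x + RtoC (m + / 2) * Ci = (x + RtoC (m - / 2) * Ci) + Ci)%C).
      { rewrite RtoC_plus, RtoC_minus. replace (RtoC (/ 2)) with (/ RtoC 2)%C by (rewrite RtoC_inv; auto; lra). field. }
      assert (Ed2 : (x - RtoC (m - / 2) * Ci = (x - RtoC (m + / 2) * Ci) + Ci)%C).
      { rewrite RtoC_plus, RtoC_minus. replace (RtoC (/ 2)) with (/ RtoC 2)%C by (rewrite RtoC_inv; auto; lra). field. }
      set (a := (x + RtoC (m - / 2) * Ci)%C) in *. set (b := (x - RtoC (m + / 2) * Ci)%C) in *.
      rewrite Ed1 in *. rewrite Ed2 in *.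
      assert (I1 : (/ (a * (a + Ci)) = - (Ci * (/ a - / (a + Ci))))%C).
      { transitivity (- (Ci * Ci) / (a * (a + Ci)))%C. rewrite Ci_sqr. field; auto. field; auto. }
      assert (I2 : (/ (b * (b + Ci)) = - (Ci * (/ b - / (b + Ci))))%C).
      { transitivity (- (Ci * Ci) / (b * (b + Ci)))%C. rewrite Ci_sqr. field; auto. field; auto. }
      rewrite I1, I2. ring. }
  assert (HNR : 1 <= INR N) by (replace 1 with (INR 1) by reflexivity; apply le_INR; auto).
  set (E := 2 / (k ^ 4 * INR N ^ 3)).
  assert (Hk4 : 0 < k ^ 4) by (apply pow_lt; auto).
  assert (Hsum : forall j, Cmod (csum (pf_pair x) (N + j) - csum (pf_pair x) N - (T (N + j)%nat - T N))%C <= E).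
  { intros j.
    replace (csum (pf_pair x) (N + j) - csum (pf_pair x) N - (T (N + j)%nat - T N))%C
      with (csum (fun i => pf_pair x (N + i)%nat - (T (S (N + i)) - T (N + i)%nat))%C j).
    2:{ rewrite csum_add, csum_minus.
        replace (csum (fun i => T (S (N + i)) - T (N + i)%nat)%C j) with (T (N + j)%nat - T N)%C. ring.
        clear. induction j; cbn [csum]. rewrite Nat.add_0_r; ring. rewrite <- IHj, Nat.add_succ_r. ring. }
    eapply Rle_trans. apply Cmod_csum_le with (g := fun i => 2 / (k ^ 4 * INR N ^ 2) * (/ INR (N + i) - / INR (N + S i))).
    - intros i _. eapply Rle_trans. apply Hstep. rewrite Nat.add_succ_r, S_INR.
      assert (Hi : INR N <= INR (N + i)) by (apply le_INR; lia).
      set (a := INR (N + i)) in *.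
      replace (/ a - / (a + 1)) with (/ (a * (a + 1))) by (field; lra).
      replace (2 / (k ^ 4 * INR N ^ 2) * / (a * (a + 1))) with (2 * / (k ^ 4 * (INR N ^ 2 * (a * (a + 1))))) by (field; repeat split; lra).
      apply Rmult_le_compat_l. lra. apply Rinv_le_contravar.
      + apply Rmult_lt_0_compat; auto. apply Rmult_lt_0_compat. apply pow_lt; lra. nra.
      + rewrite Rpow_mult_distr. apply Rmult_le_compat_l. lra.
        replace ((a + 1) ^ 4) with ((a + 1) ^ 2 * ((a + 1) * (a + 1))) by ring.
        apply Rmult_le_compat. apply pow2_ge_0. nra. apply pow_incr. lra. nra.
    - rewrite rsum_scal. rewrite (rsum_telescope (fun i => / INR (N + i))). rewrite Nat.add_0_r.
      assert (0 < / INR (N + j)) by (apply Rinv_0_lt_compat; apply lt_0_INR; lia).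
      unfold E. replace (2 / (k ^ 4 * INR N ^ 3)) with (2 / (k ^ 4 * INR N ^ 2) * / INR N) by (field; split; lra).
      apply Rmult_le_compat_l. left. apply Rdiv_lt_0_compat. lra. apply Rmult_lt_0_compat; auto. apply pow_lt; lra. lra. }
  assert (HT : forall n, (1 <= n)%nat -> Cmod (T n) <= 2 / k ^ 2 * / INR n).
  { intros n Hn. assert (1 <= INR n) by (replace 1 with (INR 1) by reflexivity; apply le_INR; auto).
    unfold T. set (m := INR n + / 2). destruct (Hfac m ltac:(unfold m; lra)) as (F1 & F2 & F3).
    destruct (Hl m ltac:(unfold m; lra)) as (A1 & A2). rewrite F1.
    rewrite Cmod_div by (apply Cmult_neq_0; auto). rewrite !Cmod_mult, !Cmod_RtoC by (unfold m; lra).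
    apply Rle_trans with (2 * m / ((k * m) * (k * m))).
    - apply Rmult_le_compat_l. unfold m; lra. apply Rinv_le_contravar. unfold m; nra. apply Rmult_le_compat; auto; unfold m; nra.
    - replace (2 * m / (k * m * (k * m))) with (2 / k ^ 2 * / m) by (field; unfold m; lra).
      apply Rmult_le_compat_l. left. apply Rdiv_lt_0_compat. lra. apply pow_lt; lra. apply Rinv_le_contravar; unfold m; lra. }
  apply Clim_bound with (u := fun p => (/ (x * x) + csum (pf_pair x) (2 ^ (p + N)) + (- / (x * x) - csum (pf_pair x) N + T N))%C)
    (e := fun p => E + 2 / k ^ 2 * / INR (2 ^ (p + N))).
  - replace (RtoC PI * RtoC PI * isinh2 (RtoC PI * x) - / (x * x) - csum (pf_pair x) N + 2 * M / (x * x + M * M))%C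
      with (RtoC PI * RtoC PI * isinh2 (RtoC PI * x) + (- / (x * x) - csum (pf_pair x) N + T N))%C by (unfold T, M; ring).
    apply Clim_plus. 2: apply Clim_const.
    apply (Clim_incr (fun p => / (x * x) + csum (pf_pair x) (2 ^ p))%C). exact HP.
  - intros p. set (L := (2 ^ (p + N))%nat).
    assert (HL : (N <= L)%nat).
    { unfold L. pose proof (Nat.pow_gt_lin_r 2 (p + N) ltac:(lia)). lia. }
    specialize (Hsum (L - N)%nat). replace (N + (L - N))%nat with L in Hsum by lia.
    specialize (HT L ltac:(lia)).
    replace (/ (x * x) + csum (pf_pair x) L + (- / (x * x) - csum (pf_pair x) N + T N))%C
      with ((csum (pf_pair x) L - csum (pf_pair x) N - (T L - T N)) + T L)%C by ring.
    eapply Rle_trans. apply Cmod_triangle. lra.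
  - replace (Finite E) with (Finite (E + 0)) by (f_equal; ring). apply is_lim_seq_plus'. apply is_lim_seq_const.
    apply is_lim_seq_scal_0. apply (is_lim_seq_incr_n (fun p => / INR (2 ^ p)) N). apply is_lim_seq_pow2_inv.
Qed.

(** ** The square truncation and its boundary terms *)

Definition half (N : nat) : R := INR N + / 2.

(** Boundary terms left by the square truncation; a Riemann sum for
    [z / (1 + x^2 z^2) + z / (x^2 + z^2)] on [0,1], whose integral is pi/2 for all z. *)
Definition edge_sum (N : nat) (z : C) : C :=
  csum (fun r => let R := RtoC (INR (S r)) in let M := RtoC (half N) in
    M * z / (R * R * (z * z) + M * M) + M * z / (R * R + M * M * (z * z)))%C N.

(** The rows [1 <= r <= N] of the Eisenstein series of weight two, each summed over all [l];
    unlike a truncation to a square, this is not symmetric under inversion. *)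
Definition eis_partial (N : nat) (z : C) : C :=
  csum (fun r => RtoC PI * RtoC PI * isinh2 (RtoC PI * (RtoC (INR (S r)) * z)))%C N.

Lemma half_pos : forall N, 0 < half N.
Proof. intros. unfold half. pose proof (pos_INR N). lra. Qed.

Lemma sector_denom : forall k B z r m, sector k B z -> 0 <= m ->
  (k * m) ^ 2 <= Cmod (RtoC r * RtoC r * (z * z) + RtoC m * RtoC m)%C.
Proof.
  intros k B z r m Hs Hm.
  replace (RtoC r * RtoC r * (z * z) + RtoC m * RtoC m)%C with ((RtoC r * z + RtoC m * Ci) * (RtoC r * z + RtoC (- m) * Ci))%C.
  - rewrite Cmod_mult. pose proof (sector_lower k B z r m Hs). pose proof (sector_lower k B z r (- m) Hs).
    rewrite Rabs_Ropp in H0. rewrite Rabs_pos_eq in * by auto. destruct Hs.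
    replace ((k * m) ^ 2) with ((k * m) * (k * m)) by ring. apply Rmult_le_compat; auto; apply Rmult_le_pos; lra.
  - rewrite RtoC_opp. transitivity (RtoC r * RtoC r * (z * z) - RtoC m * RtoC m * (Ci * Ci))%C. ring. rewrite Ci_sqr. ring.
Qed.

Lemma sector_denom_neq : forall k B z r m, sector k B z -> 0 < m ->
  (RtoC r * RtoC r * (z * z) + RtoC m * RtoC m)%C <> RtoC 0.
Proof.
  intros. apply Cmod_gt_0. eapply Rlt_le_trans; [|apply (sector_denom k B); auto; lra].
  apply pow_lt. destruct H. apply Rmult_lt_0_compat; auto.
Qed.

Lemma sector_denom_neq' : forall k B z r m, sector k B z -> 0 < m ->
  (RtoC r * RtoC r + RtoC m * RtoC m * (z * z))%C <> RtoC 0.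
Proof.
  intros k B z r m Hs Hm E. pose proof (sector_neq _ _ _ Hs) as Hz.
  apply (sector_denom_neq k B (/ z)%C r m (sector_inv _ _ _ Hs) Hm).
  transitivity ((RtoC r * RtoC r + RtoC m * RtoC m * (z * z)) / (z * z))%C. field; auto.
  rewrite E. field. auto.
Qed.

(** Replace each row by its truncation to [l <= N], with the tail from [isinh2_truncated]. *)
Lemma eis_partial_est : forall k B z N, sector k B z -> (1 <= N)%nat ->
  Cmod (eis_partial N z - csum (fun r => / (RtoC (INR (S r)) * z * (RtoC (INR (S r)) * z)))%C N
        - csum (fun r => csum (pf_pair (RtoC (INR (S r)) * z)%C) N) N
        + csum (fun r => let R := RtoC (INR (S r)) in let M := RtoC (half N) in 2 * M / (R * R * (z * z) + M * M))%C N)%C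
  <= 2 / (k ^ 4 * INR N ^ 2).
Proof.
  intros k B z N Hs HN. unfold eis_partial. rewrite <- !csum_minus, <- csum_plus.
  assert (HNR : 1 <= INR N) by (replace 1 with (INR 1) by reflexivity; apply le_INR; auto).
  eapply Rle_trans. apply Cmod_csum_le with (g := fun _ => 2 / (k ^ 4 * INR N ^ 3)).
  - intros r _. cbv zeta. set (R := RtoC (INR (S r))).
    pose proof (isinh2_truncated k (R * z)%C N) as H.
    replace (R * R * (z * z))%C with (R * z * (R * z))%C by ring. apply H.
    + apply Hs.
    + auto.
    + unfold R. rewrite re_scal_l. pose proof (INR_S_ge1 r). pose proof (sector_neq _ _ _ Hs) as Hz. apply Cmod_gt_0 in Hz.
      destruct Hs as (H1 & H2 & _). assert (0 < k * Cmod z) by (apply Rmult_lt_0_compat; auto). nra.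
    + intros l Hl. split.
      * pose proof (sector_lower k B z (INR (S r)) l Hs). rewrite Rabs_pos_eq in H0; auto.
      * pose proof (sector_lower k B z (INR (S r)) (- l) Hs). rewrite Rabs_Ropp, Rabs_pos_eq in H0; auto.
        replace (R * z - RtoC l * Ci)%C with (R * z + RtoC (- l) * Ci)%C by (rewrite RtoC_opp; ring). exact H0.
  - rewrite rsum_const. apply Req_le. field. destruct Hs. lra.
Qed.

Lemma csum_zeta2 : forall c N, csum (fun r => c / (RtoC (INR (S r)) * RtoC (INR (S r))))%C N = (c * RtoC (zeta2_partial N))%C.
Proof.
  intros. unfold zeta2_partial. rewrite RtoC_rsum, <- csum_scal. apply csum_ext. intros.
  assert (INR (S i) <> 0) by (apply not_0_INR; lia).
  replace (INR (S i) ^ 2) with (INR (S i) * INR (S i)) by ring. rewrite RtoC_inv, RtoC_mult by (apply Rmult_integral_contrapositive_currified; auto).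
  field. apply INR_S_neq.
Qed.

(** The two double sums over the square [r, l <= N], at [z] and at [/ z], cancel on exchanging
    [r] and [l], because [(r / z + i l) z = i (l z - i r)] and [i^2 = -1].  What survives are the
    terms with [l = 0] and the boundary terms. *)
Lemma eis_partial_inversion : forall k B z N, sector k B z -> (1 <= N)%nat ->
  Cmod (eis_partial N z + eis_partial N (/ z) / (z * z) - (1 + / (z * z)) * RtoC (zeta2_partial N) + 2 / z * edge_sum N z)%C
  <= (1 + B ^ 2) * (2 / (k ^ 4 * INR N ^ 2)).
Proof.
  intros k B z N Hs HN. pose proof (sector_neq _ _ _ Hs) as Hz.
  pose proof (eis_partial_est k B z N Hs HN) as H1.
  pose proof (eis_partial_est k B (/ z)%C N (sector_inv _ _ _ Hs) HN) as H2.
  match type of H1 with Cmod ?A <= _ => match type of H2 with Cmod ?D <= _ => set (A1 := A) in *; set (D1 := D) in * end end.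
  replace (eis_partial N z + eis_partial N (/ z) / (z * z) - (1 + / (z * z)) * RtoC (zeta2_partial N) + 2 / z * edge_sum N z)%C
    with (A1 + D1 / (z * z))%C.
  - eapply Rle_trans. apply Cmod_triangle. rewrite Cmod_div by (apply Cmult_neq_0; auto). rewrite Cmod_mult.
    replace ((1 + B ^ 2) * (2 / (k ^ 4 * INR N ^ 2))) with (2 / (k ^ 4 * INR N ^ 2) + 2 / (k ^ 4 * INR N ^ 2) * B ^ 2) by ring.
    apply Rplus_le_compat; auto. apply Rmult_le_compat; auto. apply Cmod_ge_0.
    + left. apply Rinv_0_lt_compat. apply Cmod_gt_0 in Hz. nra.
    + destruct Hs as (_ & _ & H3 & H4 & H5). apply Cmod_gt_0 in Hz. 
      replace (B ^ 2) with (/ (/ B * / B)) by (field; lra). pose proof (Rinv_0_lt_compat _ H5).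
      apply Rinv_le_contravar. nra. nra.
  - unfold A1, D1. 
    assert (S1 : csum (fun r => / (RtoC (INR (S r)) * z * (RtoC (INR (S r)) * z)))%C N = (/ (z * z) * RtoC (zeta2_partial N))%C).
    { rewrite <- csum_zeta2. apply csum_ext. intros. field. split; auto. apply INR_S_neq. }
    assert (S2 : csum (fun r => / (RtoC (INR (S r)) * / z * (RtoC (INR (S r)) * / z)))%C N = ((z * z) * RtoC (zeta2_partial N))%C).
    { rewrite <- csum_zeta2. apply csum_ext. intros. field. split; auto. apply INR_S_neq. }
    assert (S3 : csum (fun r => csum (pf_pair (RtoC (INR (S r)) * / z)%C) N) N
       = (- (z * z) * csum (fun r => csum (pf_pair (RtoC (INR (S r)) * z)%C) N) N)%C).
    { rewrite <- csum_scal. rewrite (csum_swap (fun i j => pf_pair (RtoC (INR (S i)) * / z) j)).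
      apply csum_ext. intros j _. rewrite <- csum_scal. apply csum_ext. intros i _.
      unfold pf_pair.
      assert (N1 : forall (a b : nat) (e : R), (e = 1 \/ e = -1) -> (RtoC (INR (S a)) * z + RtoC (e * INR (S b)) * Ci)%C <> RtoC 0).
      { intros a b e He. apply Cmod_gt_0. eapply Rlt_le_trans; [|apply (sector_lower k B z (INR (S a)) (e * INR (S b)) Hs)].
        destruct Hs. apply Rmult_lt_0_compat; auto. apply Rabs_pos_lt. apply Rmult_integral_contrapositive_currified.
        destruct He; lra. apply not_0_INR; lia. }
      pose proof (N1 j i 1 (or_introl eq_refl)) as P1. pose proof (N1 j i (-1) (or_intror eq_refl)) as P2.
      rewrite Rmult_1_l in P1. replace (-1 * INR (S i)) with (- INR (S i)) in P2 by ring.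
      set (a := RtoC (INR (S i))) in *. set (b := RtoC (INR (S j))) in *.
      replace (RtoC (- INR (S i)) * Ci)%C with (- (a * Ci))%C in P2 by (rewrite RtoC_opp; unfold a; ring).
      assert (E1 : (a * / z + b * Ci = Ci * (b * z - a * Ci) / z)%C).
      { transitivity ((b * z * Ci - a * (Ci * Ci)) / z)%C. rewrite Ci_sqr. field; auto. field; auto. }
      assert (E2 : (a * / z - b * Ci = - Ci * (b * z + a * Ci) / z)%C).
      { transitivity ((- (b * z * Ci) - a * (Ci * Ci)) / z)%C. rewrite Ci_sqr. field; auto. field; auto. }
      rewrite E1, E2. unfold Cminus in *.
      assert (HC := Ci_nz).
      transitivity (z * z / (Ci * Ci) * (/ ((b * z + a * Ci) * (b * z + a * Ci)) + / ((b * z + - (a * Ci)) * (b * z + - (a * Ci)))))%C.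
      field. repeat split; auto. rewrite Ci_sqr. field. split; auto. }
    rewrite S1, S2, S3. unfold edge_sum. cbv zeta. rewrite csum_plus.
    set (M := RtoC (half N)).
    assert (HM : half N > 0) by apply half_pos.
    assert (S4 : csum (fun r => 2 * M / (RtoC (INR (S r)) * RtoC (INR (S r)) * (/ z * / z) + M * M))%C N
       = (2 * z * csum (fun r => M * z / (RtoC (INR (S r)) * RtoC (INR (S r)) + M * M * (z * z))) N)%C).
    { rewrite <- csum_scal. apply csum_ext. intros r _.
      pose proof (sector_denom_neq k B (/ z)%C (INR (S r)) (half N) (sector_inv _ _ _ Hs) HM) as Q1.
      pose proof (sector_denom_neq' k B z (INR (S r)) (half N) Hs HM) as Q2. fold M in Q1, Q2.
      field. repeat split; auto. }
    assert (S5 : csum (fun r => 2 * M / (RtoC (INR (S r)) * RtoC (INR (S r)) * (z * z) + M * M))%C N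
       = (2 / z * csum (fun r => M * z / (RtoC (INR (S r)) * RtoC (INR (S r)) * (z * z) + M * M)) N)%C).
    { rewrite <- csum_scal. apply csum_ext. intros r _.
      pose proof (sector_denom_neq k B z (INR (S r)) (half N) Hs HM) as Q1. fold M in Q1.
      field. repeat split; auto. }
    rewrite S4, S5. field. auto.
Qed.

Definition edge_der (M : C) (r : C) (z : C) : C :=
  (M * (M * M - r * r * (z * z)) / ((r * r * (z * z) + M * M) * (r * r * (z * z) + M * M)))%C.

Definition edge_prim (M : C) (r : C) (z : C) : C := (M * r / (r * r * (z * z) + M * M))%C.

(** The derivative in z of one edge term is, up to O(M^-3), a
    difference in r: the edge sum varies little with z. *)
Lemma edge_der_step : forall k B, exists K, 0 <= K /\ forall z N r, sector k B z -> (r < N)%nat ->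
  let M := RtoC (half N) in
  Cmod (edge_der M (RtoC (INR (S r))) z - (edge_prim M (RtoC (INR (S r) + / 2)) z - edge_prim M (RtoC (INR (S r) - / 2)) z))%C
  <= K / half N ^ 3.
Proof.
  intros k B. set (b := B ^ 2). assert (Hb : 0 <= b) by apply pow2_ge_0.
  set (K1 := (1 + b) * (2 * b ^ 2 + b) + b * (1 + b) ^ 2 / 4).
  assert (HK1 : 0 <= K1).
  { unfold K1. assert (0 <= b ^ 2) by apply pow2_ge_0. assert (0 <= (1 + b) ^ 2) by apply pow2_ge_0.
    assert (0 <= b * (1 + b) ^ 2) by (apply Rmult_le_pos; auto). assert (0 <= (1 + b) * (2 * b ^ 2 + b)) by (apply Rmult_le_pos; lra). lra. }
  exists (K1 / (k ^ 8)). split.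
  { destruct (Req_dec k 0) as [->|Hk]. unfold Rdiv. rewrite pow_i by lia. rewrite Rinv_0. lra.
    apply Rmult_le_pos; auto. left. apply Rinv_0_lt_compat.
    replace (k ^ 8) with ((k ^ 4) ^ 2) by ring. apply pow2_gt_0. apply pow_nonzero; auto. }
  intros z N r Hs Hr M.
  assert (Hm := half_pos N). set (m := half N) in *.
  assert (Hm1 : 1 <= m). { unfold m, half. assert (INR 1 <= INR N) by (apply le_INR; lia). simpl in H. lra. }
  set (rho := INR (S r)). assert (Hrho : 1 <= rho) by apply INR_S_ge1.
  assert (Hrm : rho <= m). { unfold m, half, rho. assert (INR (S r) <= INR N) by (apply le_INR; lia). lra. }
  assert (Hk : 0 < k) by apply Hs.
  pose proof (sector_denom k B z rho m Hs ltac:(lra)) as D0. pose proof (sector_denom_neq k B z rho m Hs Hm) as E0.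
  pose proof (sector_denom k B z (rho + / 2) m Hs ltac:(lra)) as D1. pose proof (sector_denom_neq k B z (rho + / 2) m Hs Hm) as E1.
  pose proof (sector_denom k B z (rho - / 2) m Hs ltac:(lra)) as D2. pose proof (sector_denom_neq k B z (rho - / 2) m Hs Hm) as E2.
  assert (Hz : Cmod (z * z)%C <= b).
  { rewrite Cmod_mult. unfold b. destruct Hs as (_ & _ & _ & H4 & H5). pose proof (Cmod_ge_0 z). simpl. nra. }
  unfold edge_der, edge_prim. fold M in D0, D1, D2, E0, E1, E2.
  set (R := RtoC rho) in *. set (Rp := RtoC (rho + / 2)) in *. set (Rm := RtoC (rho - / 2)) in *. set (a := (z * z)%C) in *.
  set (D := (R * R * a + M * M)%C) in *. set (Dp := (Rp * Rp * a + M * M)%C) in *. set (Dm := (Rm * Rm * a + M * M)%C) in *.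
  assert (Hh : RtoC (/ 2) = (/ RtoC 2)%C) by (apply RtoC_inv; lra).
  replace (M * (M * M - R * R * a) / (D * D) - (M * Rp / Dp - M * Rm / Dm))%C
    with (M * ((M * M - R * R * a) * (D * a / 2 + a * a / 16 - R * R * (a * a)) - a / 4 * (D * D)) / (D * D * (Dp * Dm)))%C.
  2:{ assert (I1 : (Dp * Dm = D * D + (D * a / 2 + a * a / 16 - R * R * (a * a)))%C).
      { unfold Dp, Dm, D, Rp, Rm. rewrite RtoC_plus, RtoC_minus. fold R. rewrite Hh. field. }
      assert (I2 : (M * Rp / Dp - M * Rm / Dm = M * (M * M - R * R * a + a / 4) / (Dp * Dm))%C).
      { transitivity (M * (Rp * Dm - Rm * Dp) / (Dp * Dm))%C. field; auto. f_equal. f_equal.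
        unfold Dp, Dm, Rp, Rm. rewrite RtoC_plus, RtoC_minus. fold R. rewrite Hh. field. }
      rewrite I2.
      transitivity (M * ((M * M - R * R * a) * (Dp * Dm) - (M * M - R * R * a + a / 4) * (D * D)) / (D * D * (Dp * Dm)))%C.
      - f_equal. f_equal. rewrite I1. field.
      - field. auto. }
  assert (HMm : Cmod M = m) by (apply Cmod_RtoC; lra). assert (HRm : Cmod R = rho) by (apply Cmod_RtoC; lra).
  rewrite Cmod_div by (repeat apply Cmult_neq_0; auto). rewrite !Cmod_mult. rewrite HMm.
  assert (HP : Cmod (M * M - R * R * a)%C <= m ^ 2 * (1 + b)).
  { eapply Rle_trans. apply Cmod_minus_triangle. rewrite !Cmod_mult, HMm, HRm.
    assert (rho * rho * Cmod a <= m * m * b).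
    { apply Rmult_le_compat; try nra. apply Cmod_ge_0. } nra. }
  assert (HD : Cmod D <= m ^ 2 * (1 + b)).
  { unfold D. eapply Rle_trans. apply Cmod_triangle. rewrite !Cmod_mult, HMm, HRm.
    assert (rho * rho * Cmod a <= m * m * b).
    { apply Rmult_le_compat; try nra. apply Cmod_ge_0. } nra. }
  assert (Ha0 := Cmod_ge_0 a). assert (HD0 := Cmod_ge_0 D).
  assert (HQ : Cmod (D * a / 2 + a * a / 16 - R * R * (a * a))%C <= m ^ 2 * (2 * b ^ 2 + b)).
  { eapply Rle_trans. apply Cmod_minus_triangle. eapply Rle_trans. apply Rplus_le_compat_r. apply Cmod_triangle.
    rewrite !Cmod_div by (apply RtoC_neq; lra). rewrite !Cmod_mult, HRm, !Cmod_RtoC by lra.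
    assert (Cmod D * Cmod a <= m ^ 2 * (1 + b) * b) by (apply Rmult_le_compat; auto).
    assert (Cmod a * Cmod a <= b * b) by (apply Rmult_le_compat; auto).
    assert (rho * rho * (Cmod a * Cmod a) <= m * m * (b * b)) by (apply Rmult_le_compat; nra).
    assert (b * b <= m ^ 2 * (b * b)). { assert (0 <= b * b) by nra. assert (1 <= m ^ 2) by nra. nra. }
    assert (0 <= m ^ 2 * (b * b)) by (apply Rmult_le_pos; nra). assert (0 <= m ^ 2 * b) by (apply Rmult_le_pos; nra). nra. }
  assert (Hnum : Cmod ((M * M - R * R * a) * (D * a / 2 + a * a / 16 - R * R * (a * a)) - a / 4 * (D * D))%C <= m ^ 4 * K1).
  { eapply Rle_trans. apply Cmod_minus_triangle. rewrite !Cmod_mult, Cmod_div by (apply RtoC_neq; lra). rewrite Cmod_RtoC by lra.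
    assert (X1 : Cmod (M * M - R * R * a)%C * Cmod (D * a / 2 + a * a / 16 - R * R * (a * a))%C <= (m ^ 2 * (1 + b)) * (m ^ 2 * (2 * b ^ 2 + b)))
      by (apply Rmult_le_compat; auto using Cmod_ge_0).
    assert (X2 : Cmod a / 4 * (Cmod D * Cmod D) <= b / 4 * ((m ^ 2 * (1 + b)) * (m ^ 2 * (1 + b)))).
    { apply Rmult_le_compat. lra. nra. lra. apply Rmult_le_compat; auto. }
    unfold K1. eapply Rle_trans. apply Rplus_le_compat; [exact X1|exact X2]. apply Req_le. field. }
  assert (Hkm : 0 < (k * m) ^ 2) by (apply pow_lt; apply Rmult_lt_0_compat; auto).
  replace (K1 / k ^ 8 / m ^ 3) with (m * (m ^ 4 * K1) / (((k * m) ^ 2 * (k * m) ^ 2) * ((k * m) ^ 2 * (k * m) ^ 2))) by (field; lra).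
  apply Rmult_le_compat.
  - apply Rmult_le_pos. lra. apply Cmod_ge_0.
  - left. apply Rinv_0_lt_compat. repeat apply Rmult_lt_0_compat; lra.
  - apply Rmult_le_compat_l. lra. exact Hnum.
  - apply Rinv_le_contravar. repeat apply Rmult_lt_0_compat; lra.
    apply Rmult_le_compat; try (apply Rmult_le_compat; lra); apply Rmult_le_pos; lra.
Qed.

Lemma edge_der_sum : forall k B, exists K, 0 <= K /\ forall z N, sector k B z ->
  Cmod (csum (fun r => edge_der (RtoC (half N)) (RtoC (INR (S r))) z) N - / (z * z + 1))%C <= K / half N.
Proof.
  intros k B. destruct (edge_der_step k B) as [K [HK HS]].
  exists (K + / k ^ 2 * / 2 ). split.
  { destruct (Req_dec k 0) as [->|Hk]. rewrite pow_i by lia. rewrite Rinv_0. lra.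
    assert (0 < / k ^ 2) by (apply Rinv_0_lt_compat; apply pow2_gt_0; auto). lra. }
  intros z N Hs. assert (Hk : 0 < k) by apply Hs. set (m := half N). assert (Hm : 0 < m) by apply half_pos. set (M := RtoC m).
  assert (Hm2 : / 2 <= m) by (unfold m, half; pose proof (pos_INR N); lra).
  set (p := fun r : nat => edge_prim M (RtoC (INR r + / 2)) z).
  assert (H1 : Cmod (csum (fun r => edge_der M (RtoC (INR (S r))) z) N - (p N - p O))%C <= K / m ^ 2).
  { replace (p N - p O)%C with (csum (fun r => p (S r) - p r)%C N).
    2:{ assert (G : forall n, csum (fun r => p (S r) - p r)%C n = (p n - p O)%C) by (induction n; cbn [csum]; [|rewrite IHn]; ring). apply G. }
    rewrite <- csum_minus. eapply Rle_trans. apply Cmod_csum_le with (g := fun _ => K / m ^ 3).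
    - intros r Hr. specialize (HS z N r Hs Hr). cbv zeta in HS. fold m M in HS. unfold p.
      replace (INR r + / 2) with (INR (S r) - / 2) by (rewrite S_INR; field). exact HS.
    - rewrite rsum_const. replace (K / m ^ 2) with (m * (K / m ^ 3)) by (field; lra). apply Rmult_le_compat_r.
      apply Rmult_le_pos; auto. left; apply Rinv_0_lt_compat; apply pow_lt; auto. unfold m, half. lra. }
  assert (Hz1 : (z * z + 1)%C <> RtoC 0).
  { pose proof (sector_denom_neq k B z 1 1 Hs ltac:(lra)) as Q. intro E. apply Q. rewrite <- E. ring. }
  assert (H2 : p N = (/ (z * z + 1))%C).
  { unfold p, edge_prim. change (INR N + / 2) with m. fold M.
    assert (HM : M <> RtoC 0) by (apply RtoC_neq; lra).
    replace (M * M * (z * z) + M * M)%C with (M * M * (z * z + 1))%C by ring. field. auto. }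
  assert (H3 : Cmod (p O) <= / k ^ 2 * / 2 / m).
  { unfold p, edge_prim. simpl INR. rewrite Rplus_0_l.
    pose proof (sector_denom k B z (/ 2) m Hs ltac:(lra)) as Q. pose proof (sector_denom_neq k B z (/ 2) m Hs ltac:(lra)) as Q'.
    fold M in Q, Q'. rewrite Cmod_div by auto. rewrite Cmod_mult. unfold M at 1. rewrite !Cmod_RtoC by lra.
    replace (/ k ^ 2 * / 2 / m) with (m * / 2 / (k * m) ^ 2) by (field; lra).
    apply Rmult_le_compat_l. nra. apply Rinv_le_contravar; auto. apply pow_lt; apply Rmult_lt_0_compat; auto. }
  rewrite <- H2.
  replace (csum (fun r => edge_der M (RtoC (INR (S r))) z) N - p N)%C
    with ((csum (fun r => edge_der M (RtoC (INR (S r))) z) N - (p N - p O)) - p O)%C by ring.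
  eapply Rle_trans. apply Cmod_minus_triangle.
  replace ((K + / k ^ 2 * / 2) / m) with (K / m + / k ^ 2 * / 2 / m) by (field; lra).
  apply Rplus_le_compat; auto. destruct N.
  - cbn [csum]. replace (RtoC 0 - (p O - p O))%C with (RtoC 0) by ring. rewrite Cmod_0. apply Rmult_le_pos; auto. left; apply Rinv_0_lt_compat; auto.
  - eapply Rle_trans. exact H1. apply Rmult_le_compat_l; auto. apply Rinv_le_contravar; auto.
    assert (1 <= m) by (unfold m, half; pose proof (INR_S_ge1 N); lra). nra.
Qed.

(** At [z = 1] both edge terms are [M / (r^2 + M^2)], a Riemann sum for 1 / (1 + x^2), compared
    with the arctangent by the mean value theorem. *)
Lemma edge_sum_at_1 : forall N, Cmod (edge_sum N 1 - RtoC (PI / 2))%C <= 3 / half N.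
Proof.
  intros N. set (m := half N). assert (Hm : 0 < m) by apply half_pos.
  assert (E : edge_sum N 1 = RtoC (2 * rsum (fun r => m / (INR (S r) ^ 2 + m ^ 2)) N)).
  { rewrite RtoC_mult, RtoC_rsum, <- csum_scal. unfold edge_sum. cbv zeta. apply csum_ext. intros r _. fold m.
    assert (H : INR (S r) ^ 2 + m ^ 2 <> 0) by nra.
    rewrite RtoC_div by auto. assert (H' := RtoC_neq _ H). rewrite RtoC_plus, !RtoC_pow in *. cbn [Cpow] in *.
    set (a := RtoC (INR (S r))) in *. set (b := RtoC m) in *.
    assert (H1 : (a * a * (1 * 1) + b * b)%C <> RtoC 0) by (intro E; apply H'; rewrite <- E; ring).
    assert (H2 : (a * a + b * b * (1 * 1))%C <> RtoC 0) by (intro E; apply H'; rewrite <- E; ring).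
    field. repeat split; auto. intro E; apply H'; rewrite <- E; ring. }
  rewrite E, <- RtoC_minus, Cmod_R.
  assert (Hs : Rabs (rsum (fun r => m / (INR (S r) ^ 2 + m ^ 2)) N - (atan 1 - atan (/ 2 / m))) <= 1 / m).
  { replace 1 with ((INR N + / 2) / m) at 1 by (unfold m, half; field; pose proof (pos_INR N); lra).
    assert (G : forall n, (n <= N)%nat -> Rabs (rsum (fun r => m / (INR (S r) ^ 2 + m ^ 2)) n - (atan ((INR n + / 2) / m) - atan (/ 2 / m))) <= INR n * / m ^ 2).
    { induction n; intros Hn.
      - simpl. rewrite Rplus_0_l. replace (0 - (atan (/ 2 / m) - atan (/ 2 / m))) with 0 by ring. rewrite Rabs_R0. lra.
      - cbn [rsum]. set (x := INR (S n)). 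
        assert (Hx : 1 <= x) by apply INR_S_ge1.
        assert (Hxm : x + / 2 <= m). { unfold x, m, half. assert (INR (S n) <= INR N) by (apply le_INR; auto). lra. }
        destruct (MVT_gen (fun y => atan (y / m)) (x - / 2) (x + / 2) (fun y => m / (y ^ 2 + m ^ 2))) as [c [Hc Hc']].
        + intros y _. auto_derive; auto. unfold Rsqr. field. split; nra.
        + intros y _. apply derivable_continuous_pt. eexists. apply is_derive_Reals.
          instantiate (1 := m / (y ^ 2 + m ^ 2)). auto_derive; auto. unfold Rsqr. field. split; nra.
        + rewrite Rmin_left, Rmax_right in Hc by lra.
          assert (Hd : Rabs (m / (x ^ 2 + m ^ 2) - m / (c ^ 2 + m ^ 2)) <= / m ^ 2).
          { replace (m / (x ^ 2 + m ^ 2) - m / (c ^ 2 + m ^ 2)) with (m * ((c - x) * (c + x)) / ((x ^ 2 + m ^ 2) * (c ^ 2 + m ^ 2))) by (field; split; nra).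
            unfold Rdiv. rewrite Rabs_mult, (Rabs_pos_eq (/ _)).
            2:{ left. apply Rinv_0_lt_compat. apply Rmult_lt_0_compat; nra. }
            rewrite !Rabs_mult, (Rabs_pos_eq m), (Rabs_pos_eq (c + x)) by lra.
            assert (Rabs (c - x) <= / 2) by (apply Rabs_le; lra).
            apply Rle_trans with (m * m * / (m ^ 2 * m ^ 2)).
            - apply Rmult_le_compat.
              + apply Rmult_le_pos. lra. apply Rmult_le_pos. apply Rabs_pos. lra.
              + left. apply Rinv_0_lt_compat. apply Rmult_lt_0_compat; nra.
              + apply Rmult_le_compat_l. lra. apply Rle_trans with (/ 2 * (2 * m)). apply Rmult_le_compat; try lra. apply Rabs_pos. lra.
              + apply Rinv_le_contravar. apply Rmult_lt_0_compat; apply pow_lt; auto. apply Rmult_le_compat; nra.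
            - apply Req_le. field. lra. }
          specialize (IHn ltac:(lia)).
          replace (INR n + / 2) with (x - / 2) in IHn by (unfold x; rewrite S_INR; field).
          unfold x at 3. rewrite S_INR. rewrite Rmult_plus_distr_r, Rmult_1_l.
          replace (x + / 2 - (x - / 2)) with 1 in Hc' by field. rewrite Rmult_1_r in Hc'.
          match goal with |- Rabs (?S + ?T - (?A - ?B)) <= _ =>
            replace (S + T - (A - B)) with ((S - (atan ((x - / 2) / m) - B)) + (T - (A - atan ((x - / 2) / m)))) by ring end.
          eapply Rle_trans. apply Rabs_triang. apply Rplus_le_compat; auto. rewrite Hc'. exact Hd. }
    eapply Rle_trans. apply G; auto. replace (1 / m) with (m * / m ^ 2) by (field; lra).
    apply Rmult_le_compat_r. left; apply Rinv_0_lt_compat; apply pow_lt; auto. unfold m, half; lra. }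
  rewrite atan_1 in Hs.
  assert (Ha : Rabs (atan (/ 2 / m)) <= / 2 / m).
  { assert (Hp : 0 < / 2 / m) by (apply Rdiv_lt_0_compat; lra).
    rewrite Rabs_pos_eq.
    destruct (MVT_gen atan 0 (/ 2 / m) (fun y => / (1 + y ^ 2))) as [c [Hc Hc']].
    - intros. auto_derive; auto. unfold Rsqr. field. nra.
    - intros. apply derivable_continuous_pt. apply derivable_pt_atan.
    - rewrite atan_0 in Hc'. assert (Hi : / (1 + c ^ 2) <= / 1) by (apply Rinv_le_contravar; nra). rewrite Rinv_1 in Hi.
      rewrite !Rminus_0_r in Hc'. rewrite Hc'. nra.
    - rewrite <- atan_0. left. apply atan_increasing. auto. }
  set (S := rsum (fun r => m / (INR (Datatypes.S r) ^ 2 + m ^ 2)) N) in *.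
  replace (2 * S - PI / 2) with (2 * (S - (PI / 4 - atan (/ 2 / m))) - 2 * atan (/ 2 / m)) by field.
  unfold Rminus at 1. eapply Rle_trans. apply Rabs_triang. rewrite Rabs_Ropp, !Rabs_mult, (Rabs_pos_eq 2) by lra.
  apply Rle_trans with (2 * (1 / m) + 2 * (/ 2 / m)). lra. apply Req_le. field. lra.
Qed.

(** ** The inversion formula *)

Lemma cder_div : forall f g s a b, g s <> RtoC 0 -> cder f s a -> cder g s b ->
  cder (fun x => f x / g x)%C s ((a * g s - f s * b) / (g s * g s))%C.
Proof.
  intros. eapply cder_eq. apply cder_mult. eassumption. apply cder_inv; eassumption. cbv beta. field. auto.
Qed.

(** The principal logarithm on the right half plane. *)
Definition Clog (z : C) : C := (ln (Re z ^ 2 + Im z ^ 2) / 2, atan (Im z / Re z)).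

Lemma cder_Clog : forall f s a, 0 < Re (f s) -> cder f s a -> cder (fun x => Clog (f x)) s (a / f s)%C.
Proof.
  intros f s a Hp [H1 H2].
  set (u := fun x => Re (f x)) in *. set (v := fun x => Im (f x)) in *.
  assert (Hu : Derive u s = Re a) by (apply is_derive_unique; auto).
  assert (Hv : Derive v s = Im a) by (apply is_derive_unique; auto).
  assert (Eu : ex_derive u s) by (eexists; eauto). assert (Ev : ex_derive v s) by (eexists; eauto).
  change (0 < u s) in Hp.
  assert (Hq : 0 < u s * u s + v s * v s) by nra.
  split.
  - change (is_derive (fun x => ln (u x ^ 2 + v x ^ 2) / 2) s (Re (a / f s)%C)).
    auto_derive. repeat split; auto. simpl. nra.
    change (fun x => u x) with u. change (fun x => v x) with v. rewrite Hu, Hv.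
    change (Re (a / f s)%C) with (Re a * (u s / (u s ^ 2 + v s ^ 2)) - Im a * (- v s / (u s ^ 2 + v s ^ 2))).
    field. simpl. nra.
  - change (is_derive (fun x => atan (v x / u x)) s (Im (a / f s)%C)).
    auto_derive. repeat split; auto. lra.
    change (fun x => u x) with u. change (fun x => v x) with v. rewrite Hu, Hv.
    change (Im (a / f s)%C) with (Re a * (- v s / (u s ^ 2 + v s ^ 2)) + Im a * (u s / (u s ^ 2 + v s ^ 2))).
    unfold Rsqr. field. repeat split; nra.
Qed.

Lemma edge_sum_der : forall k B (z : R -> C) s v N, sector k B (z s) -> cder z s v ->
  cder (fun x => edge_sum N (z x)) s
    (v * (csum (fun r => edge_der (RtoC (half N)) (RtoC (INR (S r))) (z s)) N
          - csum (fun r => edge_der (RtoC (half N)) (RtoC (INR (S r))) (/ z s)) N / (z s * z s)))%C.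
Proof.
  intros k B z s v N Hs Hz. set (m := half N). assert (Hm : 0 < m) by apply half_pos.
  pose proof (sector_neq _ _ _ Hs) as Hn.
  eapply cder_eq. apply (cder_csum (fun r x => let R := RtoC (INR (S r)) in let M := RtoC m in
    M * z x / (R * R * (z x * z x) + M * M) + M * z x / (R * R + M * M * (z x * z x)))%C)
    with (d := fun r => (v * (edge_der (RtoC m) (RtoC (INR (S r))) (z s) - edge_der (RtoC m) (RtoC (INR (S r))) (/ z s) / (z s * z s)))%C).
  - intros r _. cbv zeta.
    pose proof (sector_denom_neq k B (z s) (INR (S r)) m Hs Hm) as Q1.
    pose proof (sector_denom_neq' k B (z s) (INR (S r)) m Hs Hm) as Q2.
    pose proof (sector_denom_neq k B (/ z s)%C (INR (S r)) m (sector_inv _ _ _ Hs) Hm) as Q3.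
    set (R := RtoC (INR (S r))) in *. set (M := RtoC m) in *.
    eapply cder_eq. apply cder_plus.
    + apply cder_div. exact Q1. apply cder_scal. exact Hz.
      apply cder_plus. apply cder_scal. apply cder_mult; exact Hz. apply cder_const.
    + apply cder_div. exact Q2. apply cder_scal. exact Hz.
      apply cder_plus. apply cder_const. apply cder_scal. apply cder_mult; exact Hz.
    + cbv beta. unfold edge_der. field. repeat split; auto.
  - rewrite csum_scal, csum_minus. unfold Cdiv at 2. 
    replace (csum (fun r => edge_der (RtoC m) (RtoC (INR (S r))) (/ z s) / (z s * z s))%C N)
      with (csum (fun r => / (z s * z s) * edge_der (RtoC m) (RtoC (INR (S r))) (/ z s))%C N)
      by (apply csum_ext; intros; unfold Cdiv; ring).
    rewrite csum_scal. ring.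
Qed.

Definition ray (v : C) (s : R) : C := (1 + RtoC s * v)%C.

Lemma cder_ray : forall v s, cder (ray v) s v.
Proof. intros. apply cder_affine. Qed.

(** The derivative of [edge_sum] along the path is the difference of the two limits from
    [edge_der_sum], at [z] and at [/ z], and these cancel; so the value at 1 propagates. *)
Lemma edge_sum_limit : forall k B v, (forall s, 0 <= s <= 1 -> sector k B (ray v s)) ->
  exists K, 0 <= K /\ forall s N, 0 <= s <= 1 -> Cmod (edge_sum N (ray v s) - RtoC (PI / 2))%C <= K / half N.
Proof.
  intros k B v Hs. destruct (edge_der_sum k B) as [K [HK HE]].
  exists (Cmod v * (K * (1 + B ^ 2)) + 3). pose proof (Cmod_ge_0 v). pose proof (pow2_ge_0 B).
  assert (0 <= Cmod v * (K * (1 + B ^ 2))) by (repeat apply Rmult_le_pos; lra).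
  split. lra. intros s N Hs01. set (m := half N). assert (Hm : 0 < m) by apply half_pos.
  replace (edge_sum N (ray v s) - RtoC (PI / 2))%C with ((edge_sum N (ray v s) - edge_sum N (ray v 0)) + (edge_sum N (ray v 0) - RtoC (PI / 2)))%C by ring.
  replace ((Cmod v * (K * (1 + B ^ 2)) + 3) / m) with (Cmod v * (K * (1 + B ^ 2)) / m + 3 / m) by (field; lra).
  eapply Rle_trans. apply Cmod_triangle. apply Rplus_le_compat.
  - assert (Hs' : forall x, 0 <= x <= s -> sector k B (ray v x)) by (intros; apply Hs; lra).
    eapply Rle_trans. apply (cder_mvt_const (fun x => edge_sum N (ray v x)) _ (Cmod v * (K * (1 + B ^ 2)) / m) 0 s (proj1 Hs01)
      (fun x Hx => edge_sum_der k B (ray v) x v N (Hs' x Hx) (cder_ray v x))).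
    + intros x Hx. assert (Hsx : sector k B (ray v x)) by (apply Hs; lra).
      pose proof (sector_neq _ _ _ Hsx) as Hn.
      pose proof (HE (ray v x) N Hsx) as E1. pose proof (HE (/ ray v x)%C N (sector_inv _ _ _ Hsx)) as E2.
      assert (Hz1 : (ray v x * ray v x + 1)%C <> RtoC 0).
      { pose proof (sector_denom_neq k B (ray v x) 1 1 Hsx ltac:(lra)) as Q. intro E. apply Q. rewrite <- E. ring. }
      rewrite Cmod_mult. unfold Rdiv. rewrite Rmult_assoc. apply Rmult_le_compat_l; auto.
      match type of E1 with Cmod (?a - ?b)%C <= _ => match type of E2 with Cmod (?c - ?d)%C <= _ =>
        replace (a - c / (ray v x * ray v x))%C with ((a - b) - (c - d) / (ray v x * ray v x))%C end end.
      * eapply Rle_trans. apply Cmod_minus_triangle. rewrite Cmod_div by (apply Cmult_neq_0; auto).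
        replace (K * (1 + B ^ 2) * / m) with (K / m + K / m * B ^ 2) by (field; lra).
        apply Rplus_le_compat. exact E1. apply Rmult_le_compat. apply Cmod_ge_0.
        left; apply Rinv_0_lt_compat; apply Cmod_gt_0; apply Cmult_neq_0; auto. exact E2.
        rewrite Cmod_mult. apply Cmod_gt_0 in Hn. destruct Hsx as (_ & _ & H3 & H4 & H5).
        replace (B ^ 2) with (/ (/ B * / B)) by (field; lra). pose proof (Rinv_0_lt_compat _ H5).
        apply Rinv_le_contravar; nra.
      * field. repeat split; auto; intro E; apply Hz1; rewrite <- E; ring.
    + assert (0 <= Cmod v * (K * (1 + B ^ 2)) / m) by (apply Rmult_le_pos; [auto|left; apply Rinv_0_lt_compat; auto]). nra.
  - replace (ray v 0) with (RtoC 1) by (unfold ray; ring). apply edge_sum_at_1.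
Qed.

(** The geometric series of [exp (- 2 pi r x)]; [lamb] is the sum of the [geom (r z) / r]. *)
Definition geom (x : C) : C := (/ (Cexp (RtoC (2 * PI) * x) - 1))%C.

Lemma geom_denom : forall x, 0 < Re x -> (Cexp (RtoC (2 * PI) * x) - 1)%C <> RtoC 0.
Proof.
  intros x Hx E. assert (H : Cexp (RtoC (2 * PI) * x)%C = RtoC 1).
  { transitivity (Cexp (RtoC (2 * PI) * x) - 1 + 1)%C. ring. rewrite E; ring. }
  apply (f_equal Cmod) in H. rewrite Cmod_Cexp, Cmod_1, re_scal_l in H. rewrite <- exp_0 in H. apply exp_inv in H.
  pose proof PI_RGT_0. nra.
Qed.

Lemma cder_geom : forall f s a, 0 < Re (f s) -> cder f s a ->
  cder (fun x => geom (f x)) s (- RtoC (PI / 2) * a * isinh2 (RtoC PI * f s))%C.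
Proof.
  intros f s a Hp H. pose proof (geom_denom _ Hp) as Hd.
  eapply cder_eq. apply cder_inv. exact Hd. apply cder_minus. apply cder_Cexp. apply cder_scal. exact H. apply cder_const.
  cbv beta. unfold isinh2, sh2. set (w := (RtoC PI * f s)%C).
  replace (RtoC (2 * PI) * f s)%C with (w + w)%C in * by (unfold w; rewrite RtoC_mult; ring).
  rewrite Cexp_opp. rewrite Cexp_plus in *. pose proof (Cexp_neq_0 w) as He. set (e := Cexp w) in *.
  rewrite RtoC_mult, RtoC_div by lra.
  assert (He2 : (e - / e)%C <> RtoC 0).
  { intro E. apply Hd. transitivity (e * (e - / e))%C. field; auto. rewrite E; ring. }
  assert (R2 : RtoC 2 <> RtoC 0) by (apply RtoC_neq; lra).
  field. repeat split; auto.
Qed.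

(** What the inversion formula says to tend to 0; the term [log z / 2] has the
    derivative that compensates the edge sums. *)
Definition inversion_defect (N : nat) (z : C) : C :=
  (csum (fun r => (geom (RtoC (INR (S r)) * z) - geom (RtoC (INR (S r)) * / z)) / RtoC (INR (S r))) N
   - Clog z / 2 - RtoC (PI / 12) * (/ z - z))%C.

Lemma inversion_defect_der : forall k B (z : R -> C) s v N, sector k B (z s) -> cder z s v ->
  cder (fun x => inversion_defect N (z x)) s
    (v * (- / RtoC (2 * PI) * (eis_partial N (z s) + eis_partial N (/ z s) / (z s * z s)) - / (2 * z s)
          + RtoC (PI / 12) * (1 + / (z s * z s))))%C.
Proof.
  intros k B z s v N Hs Hz. pose proof (sector_neq _ _ _ Hs) as Hn.
  assert (Hre : forall w, sector k B w -> 0 < Re w).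
  { intros w Hw. pose proof (sector_neq _ _ _ Hw) as Q. apply Cmod_gt_0 in Q. destruct Hw as (W1 & W2 & _).
    assert (0 < k * Cmod w) by (apply Rmult_lt_0_compat; auto). lra. }
  pose proof PI_RGT_0 as HPI.
  assert (R2 : RtoC 2 <> RtoC 0) by (apply RtoC_neq; lra). assert (RP : RtoC PI <> RtoC 0) by (apply RtoC_neq; lra).
  assert (R12 : RtoC 12 <> RtoC 0) by (apply RtoC_neq; lra).
  assert (Hscal : forall r w, 0 < Re w -> 0 < Re (RtoC (INR (S r)) * w)%C).
  { intros. rewrite re_scal_l. pose proof (INR_S_ge1 r). nra. }
  eapply cder_eq. unfold inversion_defect. apply cder_minus. apply cder_minus.
  - apply (cder_csum (fun r x => (geom (RtoC (INR (S r)) * z x) - geom (RtoC (INR (S r)) * / z x)) / RtoC (INR (S r)))%C)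
      with (d := fun r => (- / RtoC (2 * PI) * v * (RtoC PI * RtoC PI * isinh2 (RtoC PI * (RtoC (INR (S r)) * z s))
         + / (z s * z s) * (RtoC PI * RtoC PI * isinh2 (RtoC PI * (RtoC (INR (S r)) * / z s)))))%C).
    intros r _. pose proof (INR_S_neq r) as HR. eapply cder_eq. apply cder_div. exact HR. apply cder_minus.
    apply cder_geom. apply Hscal; apply Hre; auto. apply cder_scal. exact Hz.
    apply cder_geom. apply Hscal; apply Hre; apply sector_inv; auto. apply cder_scal. apply cder_inv. exact Hn. exact Hz.
    apply cder_const. cbv beta.
    set (i1 := isinh2 _). set (i2 := isinh2 _). rewrite RtoC_mult, RtoC_div by lra. field. repeat split; auto.
  - apply cder_div. exact R2. apply cder_Clog. apply Hre; auto. exact Hz. apply cder_const.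
  - apply cder_scal. apply cder_minus. apply cder_inv. exact Hn. exact Hz. exact Hz.
  - cbv beta. rewrite (csum_scal (- / RtoC (2 * PI) * v)%C), csum_plus, (csum_scal (/ (z s * z s))%C).
    change (csum (fun r => RtoC PI * RtoC PI * isinh2 (RtoC PI * (RtoC (INR (S r)) * z s)))%C N) with (eis_partial N (z s)).
    change (csum (fun r => RtoC PI * RtoC PI * isinh2 (RtoC PI * (RtoC (INR (S r)) * / z s)))%C N) with (eis_partial N (/ z s)).
    set (e1 := eis_partial N (z s)). set (e2 := eis_partial N (/ z s)). rewrite RtoC_mult, RtoC_div by lra. field. repeat split; auto.
Qed.

Lemma Clog_1 : Clog 1 = RtoC 0.
Proof.
  unfold Clog; simpl. replace (1 * (1 * 1) + 0 * (0 * 1)) with 1 by ring. rewrite ln_1.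
  replace (0 / 1) with 0 by field. rewrite atan_0. unfold RtoC. f_equal. field.
Qed.

Lemma lamb_term_geom : forall z r, 0 < Re z -> lamb_term (Cexp (- (RtoC (2 * PI) * z))) r = (geom (RtoC (INR (S r)) * z) / RtoC (INR (S r)))%C.
Proof.
  intros z r Hz. unfold lamb_term, geom. rewrite Cexp_pow.
  replace (RtoC (INR (S r)) * - (RtoC (2 * PI) * z))%C with (- (RtoC (2 * PI) * (RtoC (INR (S r)) * z)))%C by ring.
  rewrite Cexp_opp.
  assert (H : 0 < Re (RtoC (INR (S r)) * z)%C) by (rewrite re_scal_l; pose proof (INR_S_ge1 r); nra).
  pose proof (geom_denom _ H) as Hd. pose proof (INR_S_neq r).
  set (e := Cexp (RtoC (2 * PI) * (RtoC (INR (S r)) * z))%C) in *. assert (He : e <> RtoC 0) by apply Cexp_neq_0.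
  field. repeat split; auto.
Qed.

Lemma Cmod_Cexp_neg_lt : forall w, 0 < Re w -> Cmod (Cexp (- w)) < 1.
Proof. intros. rewrite Cmod_Cexp, re_opp. rewrite <- exp_0. apply exp_increasing. lra. Qed.

Lemma Re_2PI_pos : forall z, 0 < Re z -> 0 < Re (RtoC (2 * PI) * z)%C.
Proof. intros. rewrite re_scal_l. pose proof PI_RGT_0. nra. Qed.

Lemma Re_inv_pos : forall z, 0 < Re z -> 0 < Re (/ z)%C.
Proof.
  intros z H. destruct z as [x y]. simpl in *. apply Rdiv_lt_0_compat; auto. nra.
Qed.

(** Dedekind's functional equation eta(i/z) = sqrt z eta(i z), on logarithms:
    the derivatives of the partial defects tend to 0 uniformly on the segment
    from 1 to z, and at 1 they vanish. *)
Theorem lamb_inversion : forall z, 0 < Re z ->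
  lamb (Cexp (- (RtoC (2 * PI) * z))) =
  (lamb (Cexp (- (RtoC (2 * PI) * / z))) + Clog z / 2 + RtoC (PI / 12) * (/ z - z))%C.
Proof.
  intros z Hz.
  (* On the segment from 1 to z the real part is at least d and the modulus at most B. *)
  set (d := Rmin 1 (Re z)). assert (Hd : 0 < d) by (unfold d; apply Rmin_glb_lt; lra).
  assert (Hd1 : d <= 1) by apply Rmin_l. assert (Hd2 : d <= Re z) by apply Rmin_r.
  set (B := 1 + Cmod z + / d). pose proof (Cmod_ge_0 z) as Hz0. pose proof (Rinv_0_lt_compat d Hd) as Hdi.
  set (k := d / B). assert (HB : 0 < B) by (unfold B; lra).
  set (v := (z - 1)%C).
  assert (Hsec : forall s, 0 <= s <= 1 -> sector k B (ray v s)).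
  { intros s Hs. unfold sector.
    assert (H1 : Cmod (ray v s) <= 1 + Cmod z).
    { replace (ray v s) with (RtoC (1 - s) + RtoC s * z)%C by (unfold ray, v; rewrite RtoC_minus; ring).
      eapply Rle_trans. apply Cmod_triangle. rewrite Cmod_mult, !Cmod_RtoC by lra. nra. }
    assert (H2 : d <= Re (ray v s)).
    { replace (Re (ray v s)) with ((1 - s) * 1 + s * Re z) by (unfold ray, v; destruct z; simpl; ring). nra. }
    assert (H3 : d <= Cmod (ray v s)).
    { eapply Rle_trans. exact H2. eapply Rle_trans. apply Rle_abs. apply re_le_Cmod. }
    repeat split; auto.
    - unfold k. apply Rdiv_lt_0_compat; auto.
    - apply Rle_trans with d; auto. unfold k. replace d with (d / B * B) at 2 by (field; lra).
      apply Rmult_le_compat_l. left; apply Rdiv_lt_0_compat; auto. unfold B; lra.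
    - apply Rle_trans with d; auto. replace d with (/ / d) by (field; lra). apply Rinv_le_contravar; auto. unfold B; lra.
    - unfold B; lra. }
  destruct (edge_sum_limit k B v Hsec) as [K [HK HE]].
  assert (Hk : 0 < k) by (unfold k; apply Rdiv_lt_0_compat; auto).
  pose proof PI_RGT_0 as HPI.
  (* Bound for the derivative of the defect along the segment; its three parts are the error
     of the square truncation, that of zeta(2), and that of the edge sum. *)
  set (e := fun N : nat => Cmod v * (/ (2 * PI) * ((1 + B ^ 2) * (2 / (k ^ 4 * INR N ^ 2)))
     + ((1 + B ^ 2) * Rabs (PI / 12 - zeta2_partial N / (2 * PI)) + B / PI * (K / half N)))).
  assert (He : is_lim_seq e 0).
  { unfold e. apply is_lim_seq_scal_0. apply is_lim_seq_plus_0; [|apply is_lim_seq_plus_0].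
    - apply is_lim_seq_scal_0. apply is_lim_seq_scal_0.
      apply is_lim_seq_ext_loc with (fun N => 2 / k ^ 4 * (/ INR N * / INR N)).
      exists 1%nat. intros n Hn. assert (0 < INR n) by (apply lt_0_INR; lia). field. split; lra.
      apply is_lim_seq_scal_0. replace (Finite 0) with (Finite (0 * 0)) by (f_equal; ring).
      apply is_lim_seq_mult'; apply (is_lim_seq_inv INR p_infty); try discriminate; apply is_lim_seq_INR.
    - apply is_lim_seq_scal_0. apply (proj1 (is_lim_seq_abs_0 _)).
      replace (Finite 0) with (Finite (PI / 12 - PI ^ 2 / 6 * / (2 * PI))) by (f_equal; field; lra).
      apply is_lim_seq_minus'. apply is_lim_seq_const. apply (is_lim_seq_scal_r zeta2_partial (/ (2 * PI)) (Finite (PI ^ 2 / 6))). apply basel.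
    - apply is_lim_seq_scal_0. apply (is_lim_seq_scal_0 K).
      apply (is_lim_seq_inv half p_infty); try discriminate.
      apply (is_lim_seq_plus INR (fun _ => / 2) p_infty (/ 2)). apply is_lim_seq_INR. apply is_lim_seq_const. reflexivity. }
  assert (Hlim0 : Clim (fun N => inversion_defect N z) (RtoC 0)).
  { apply Clim_squeeze_loc with e; auto. exists 1%nat. intros N HN.
    assert (HNR : 1 <= INR N) by (replace 1 with (INR 1) by reflexivity; apply le_INR; auto).
    replace (RtoC 0) with (inversion_defect N (ray v 0)).
    2:{ replace (ray v 0) with (RtoC 1) by (unfold ray; ring). unfold inversion_defect. rewrite Clog_1.
        replace (/ 1)%C with (RtoC 1) by field.
        assert (H0 : forall n, csum (fun r => (geom (RtoC (INR (S r)) * 1) - geom (RtoC (INR (S r)) * 1)) / RtoC (INR (S r)))%C n = RtoC 0).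
        { induction n; cbn [csum]. reflexivity. rewrite IHn. unfold Cdiv. ring. }
        rewrite H0. field. }
    replace (inversion_defect N z) with (inversion_defect N (ray v 1)) by (f_equal; unfold ray, v; ring).
    replace (e N) with (e N * (1 - 0)) by ring.
    apply (cder_mvt_const (fun s => inversion_defect N (ray v s)) _ (e N) 0 1 ltac:(lra)
      (fun s Hs => inversion_defect_der k B (ray v) s v N (Hsec s Hs) (cder_ray v s))).
    intros s Hs. specialize (Hsec s Hs). specialize (HE s N Hs). pose proof (sector_neq _ _ _ Hsec) as Hn.
    pose proof (eis_partial_inversion k B (ray v s) N Hsec HN) as HX.
    rewrite Cmod_mult. unfold e. apply Rmult_le_compat_l. apply Cmod_ge_0.
    set (w := ray v s) in *.
    match type of HX with Cmod ?x <= _ => set (X := x) in * end.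
    assert (R2 : RtoC 2 <> RtoC 0) by (apply RtoC_neq; lra). assert (RP : RtoC PI <> RtoC 0) by (apply RtoC_neq; lra).
    assert (R12 : RtoC 12 <> RtoC 0) by (apply RtoC_neq; lra).
    replace (- / RtoC (2 * PI) * (eis_partial N w + eis_partial N (/ w) / (w * w)) - / (2 * w) + RtoC (PI / 12) * (1 + / (w * w)))%C
      with (- (/ RtoC (2 * PI) * X) + ((1 + / (w * w)) * RtoC (PI / 12 - zeta2_partial N / (2 * PI)) + / (RtoC PI * w) * (edge_sum N w - RtoC (PI / 2))))%C.
    2:{ unfold X. rewrite RtoC_minus, !RtoC_div, !RtoC_mult by lra. field. repeat split; auto. }
    assert (Hwi : Cmod (/ w)%C <= B). { rewrite Cmod_inv by auto. apply Cmod_gt_0 in Hn. destruct Hsec as (_ & _ & Q1 & Q2 & Q3).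
      replace B with (/ / B) by (field; lra). apply Rinv_le_contravar; auto. apply Rinv_0_lt_compat; auto. }
    pose proof (Cmod_ge_0 (/ w)%C) as Hwi0.
    eapply Rle_trans. apply Cmod_triangle. apply Rplus_le_compat; [|eapply Rle_trans; [apply Cmod_triangle|apply Rplus_le_compat]].
    - rewrite Cmod_opp, Cmod_mult, Cmod_inv, Cmod_RtoC by (try (apply RtoC_neq); lra).
      apply Rmult_le_compat_l; auto. left; apply Rinv_0_lt_compat; lra.
    - rewrite Cmod_mult, Cmod_R. apply Rmult_le_compat_r. apply Rabs_pos.
      eapply Rle_trans. apply Cmod_triangle. rewrite Cmod_1. apply Rplus_le_compat_l.
      replace (/ (w * w))%C with (/ w * / w)%C by (field; auto). rewrite Cmod_mult. simpl. nra.
    - rewrite Cmod_mult. apply Rmult_le_compat; auto; try apply Cmod_ge_0.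
      replace (/ (RtoC PI * w))%C with (/ w * / RtoC PI)%C by (field; auto).
      rewrite Cmod_mult, (Cmod_inv (RtoC PI)), Cmod_RtoC by (auto; lra).
      apply Rmult_le_compat_r; auto. left; apply Rinv_0_lt_compat; auto. }
  assert (Hlim : Clim (fun N => inversion_defect N z)
    (lamb (Cexp (- (RtoC (2 * PI) * z))) - lamb (Cexp (- (RtoC (2 * PI) * / z))) - Clog z / 2 - RtoC (PI / 12) * (/ z - z))%C).
  { unfold inversion_defect. apply Clim_minus. apply Clim_minus. 2,3: apply Clim_const.
    apply Clim_ext with (fun N => csum (lamb_term (Cexp (- (RtoC (2 * PI) * z)))) N - csum (lamb_term (Cexp (- (RtoC (2 * PI) * / z)))) N)%C.
    - intros N. rewrite <- csum_minus. apply csum_ext. intros r _. rewrite !lamb_term_geom; auto. field. apply INR_S_neq.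
      apply Re_inv_pos; auto.
    - apply Clim_minus; apply lamb_lim; apply Cmod_Cexp_neg_lt; apply Re_2PI_pos; auto. apply Re_inv_pos; auto. }
  pose proof (Clim_unique _ _ _ Hlim Hlim0) as E.
  match type of E with (?a - ?b - ?c - ?d)%C = _ => transitivity ((a - b - c - d) + (b + c + d))%C; [ring|rewrite E; ring] end.
Qed.

(** * Dedekind sums and the general transformation *)

Open Scope Z_scope.

Fixpoint zsum (f : nat -> Z) (n : nat) : Z :=
  match n with O => 0 | S n' => zsum f n' + f n' end.

Lemma zsum_ext : forall f g n, (forall i, (i < n)%nat -> f i = g i) -> zsum f n = zsum g n.
Proof. induction n; intros; simpl; auto. rewrite IHn, H; auto. Qed.

Lemma zsum_plus : forall f g n, zsum (fun i => f i + g i) n = zsum f n + zsum g n.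
Proof. induction n; simpl; lia. Qed.

Lemma zsum_scal : forall c f n, zsum (fun i => c * f i) n = c * zsum f n.
Proof. induction n; simpl; lia. Qed.

Lemma zsum_swap : forall (f : nat -> nat -> Z) n m,
  zsum (fun i => zsum (fun j => f i j) m) n = zsum (fun j => zsum (fun i => f i j) n) m.
Proof.
  induction n; intros; simpl.
  - induction m; simpl; lia.
  - rewrite IHn, <- zsum_plus. reflexivity.
Qed.

Lemma zsum_S_l : forall f n, zsum f (S n) = f O + zsum (fun i => f (S i)) n.
Proof. induction n. simpl; lia. cbn [zsum] in *. lia. Qed.

Lemma zsum_list : forall f n, zsum f n = fold_right Z.add 0 (map f (seq 0 n)).
Proof.
  induction n; auto. rewrite seq_S, map_app. cbn [zsum]. rewrite IHn. simpl.
  generalize (map f (seq 0 n)). induction l; simpl; lia.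
Qed.

Lemma fold_add_perm : forall l l', Permutation l l' -> fold_right Z.add 0 l = fold_right Z.add 0 l'.
Proof. induction 1; simpl; lia. Qed.

(** Multiplication by [h] permutes the residues modulo [k]. *)
Lemma zsum_perm_mod : forall (F : nat -> Z) h k, (0 < k)%nat -> Nat.gcd h k = 1%nat ->
  zsum (fun r => F ((h * r) mod k)%nat) k = zsum F k.
Proof.
  intros F h k Hk Hg. rewrite !zsum_list. apply fold_add_perm.
  rewrite <- (map_map (fun r => (h * r) mod k)%nat F). apply Permutation_map.
  apply NoDup_Permutation_bis.
  - assert (G : forall n, (n <= k)%nat -> NoDup (map (fun r => (h * r) mod k)%nat (seq 0 n))).
    { induction n; intros Hn. constructor. rewrite seq_S, map_app. apply NoDup_app; auto. apply IHn; lia.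
      repeat constructor. intros []. simpl. intros a Ha [Hb|[]]. subst a.
      apply in_map_iff in Ha. destruct Ha as [r [E Hr]]. apply in_seq in Hr.
      assert (D : Nat.divide k (h * (n - r))).
      { exists ((h * n) / k - (h * r) / k)%nat. pose proof (Nat.div_mod_eq (h * n) k). pose proof (Nat.div_mod_eq (h * r) k).
        rewrite Nat.mul_sub_distr_l, Nat.mul_sub_distr_r. nia. }
      apply Nat.gauss in D. 2: rewrite Nat.gcd_comm; auto. destruct D as [c Hc].
      destruct c; [lia|]. nia. }
    apply G; auto.
  - rewrite length_map, !length_seq. lia.
  - intros a Ha. apply in_map_iff in Ha. destruct Ha as [r [E Hr]]. subst. apply in_seq.
    pose proof (Nat.mod_upper_bound (h * r) k). lia.
Qed.

Lemma zsum_id : forall n, 2 * zsum Z.of_nat n = Z.of_nat n * (Z.of_nat n - 1).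
Proof. induction n. reflexivity. cbn [zsum]. lia. Qed.

Lemma zsum_sqr : forall n, 6 * zsum (fun r => Z.of_nat r * Z.of_nat r) n = (Z.of_nat n - 1) * Z.of_nat n * (2 * Z.of_nat n - 1).
Proof. induction n. reflexivity. cbn [zsum]. rewrite Nat2Z.inj_succ. nia. Qed.

Lemma sqr_as_odd_sum : forall f n, (f <= n)%nat ->
  zsum (fun j => if (j <? f)%nat then 2 * Z.of_nat j + 1 else 0) n = Z.of_nat f * Z.of_nat f.
Proof.
  intros f n. 
  assert (G : zsum (fun j => if (j <? f)%nat then 2 * Z.of_nat j + 1 else 0) n = Z.of_nat (Nat.min f n) * Z.of_nat (Nat.min f n)).
  { induction n. rewrite Nat.min_0_r; reflexivity. cbn [zsum]. rewrite IHn. destruct (Nat.ltb_spec n f).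
    - rewrite !Nat.min_r by lia. lia. - rewrite !Nat.min_l by lia. lia. }
  intros. rewrite G, Nat.min_l; auto.
Qed.

Lemma count_above : forall g n, (g < n)%nat ->
  zsum (fun r => if (g <? r)%nat then 1 else 0) n = Z.of_nat n - 1 - Z.of_nat g.
Proof.
  intros g n. induction n; intros. lia. cbn [zsum]. destruct (Nat.ltb_spec g n).
  - rewrite IHn by lia. lia.
  - replace g with n in * by lia.
    assert (forall m, (m <= n)%nat -> zsum (fun r => if (n <? r)%nat then 1 else 0) m = 0).
    { induction m; intros; auto. cbn [zsum]. rewrite IHm by lia. destruct (Nat.ltb_spec n m); lia. }
    rewrite H1 by lia. lia.
Qed.

Definition floor_sum (h k : nat) : Z := zsum (fun r => Z.of_nat (h * r / k)) k.
Definition floor_moment (h k : nat) : Z := zsum (fun r => Z.of_nat r * Z.of_nat (h * r / k)) k.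
Definition residue_moment (h k : nat) : Z := zsum (fun r => Z.of_nat r * Z.of_nat ((h * r) mod k)) k.

Lemma residue_moment_floor : forall h k,
  residue_moment h k = Z.of_nat h * zsum (fun r => Z.of_nat r * Z.of_nat r) k - Z.of_nat k * floor_moment h k.
Proof.
  intros. unfold residue_moment, floor_moment. rewrite <- !zsum_scal.
  assert (E : forall a b n, zsum a n = zsum b n + zsum (fun r => a r - b r) n) by (induction n; simpl; lia).
  rewrite (E (fun r => Z.of_nat h * (Z.of_nat r * Z.of_nat r)) (fun r => Z.of_nat k * (Z.of_nat r * Z.of_nat (h * r / k)))).
  rewrite Z.add_simpl_l. apply zsum_ext. intros r _.
  pose proof (Nat.div_mod_eq (h * r) k). nia.
Qed.

Lemma floor_sum_eq : forall h k, (0 < k)%nat -> Nat.gcd h k = 1%nat ->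
  2 * floor_sum h k = (Z.of_nat k - 1) * (Z.of_nat h - 1).
Proof.
  intros h k Hk Hg. pose proof (zsum_perm_mod Z.of_nat h k Hk Hg) as H.
  assert (E : zsum (fun r => Z.of_nat ((h * r) mod k)) k + Z.of_nat k * floor_sum h k = Z.of_nat h * zsum Z.of_nat k).
  { unfold floor_sum. rewrite <- !zsum_scal, <- zsum_plus. apply zsum_ext. intros r _.
    pose proof (Nat.div_mod_eq (h * r) k). nia. }
  rewrite H in E. pose proof (zsum_id k). nia.
Qed.

(** Lattice points under the line [y = h r / k], with weight [2 j + 1] on row [j], counted by
    columns and by rows. *)
Lemma floor_sqr_count : forall h k, (0 < h)%nat -> (0 < k)%nat -> Nat.gcd h k = 1%nat ->
  zsum (fun r => Z.of_nat (h * r / k) * Z.of_nat (h * r / k)) k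
  = (Z.of_nat k - 1) * (Z.of_nat h - 1) * (Z.of_nat h - 1) - 2 * floor_moment k h + floor_sum k h.
Proof.
  intros h k Hh Hk Hg.
  transitivity (zsum (fun r => zsum (fun j => if (j <? h * r / k)%nat then 2 * Z.of_nat j + 1 else 0) (h - 1)) k).
  { apply zsum_ext. intros r Hr. symmetry. apply sqr_as_odd_sum.
    assert (h * r / k < h)%nat by (apply Nat.Div0.div_lt_upper_bound; nia). lia. }
  rewrite zsum_swap.
  transitivity (zsum (fun j => (2 * Z.of_nat j + 1) * (Z.of_nat k - 1 - Z.of_nat (k * S j / h))) (h - 1)).
  { (* no lattice point lies on the line strictly between the ends, as h and k are coprime *)
    apply zsum_ext. intros j Hj.
    assert (Hgk : (k * S j / h < k)%nat) by (apply Nat.Div0.div_lt_upper_bound; nia).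
    rewrite <- (count_above (k * S j / h) k Hgk), <- zsum_scal. apply zsum_ext. intros r Hr.
    destruct (Nat.ltb_spec j (h * r / k)) as [A|A]; destruct (Nat.ltb_spec (k * S j / h) r) as [D|D]; try lia; exfalso.
    - assert (A' : (k * S j <= h * r)%nat) by (pose proof (Nat.Div0.mul_div_le (h * r) k); nia).
      assert (D' : (r * h <= k * S j)%nat) by (pose proof (Nat.Div0.mul_div_le (k * S j) h); nia).
      assert (E : (h * r = k * S j)%nat) by lia.
      assert (Dv : Nat.divide k (h * r)) by (exists (S j); lia). apply Nat.gauss in Dv. 2: rewrite Nat.gcd_comm; auto.
      destruct Dv as [c Hc]. destruct c; nia.
    - pose proof (Nat.mul_succ_div_gt (h * r) k ltac:(lia)). pose proof (Nat.mul_succ_div_gt (k * S j) h ltac:(lia)). nia. }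
  unfold floor_moment, floor_sum.
  destruct h as [|h']; [lia|]. rewrite !zsum_S_l. rewrite Nat.mul_0_r, Nat.Div0.div_0_l.
  replace (S h' - 1)%nat with h' by lia. clear.
  replace (Z.of_nat 0 * Z.of_nat 0) with 0 by reflexivity. replace (Z.of_nat 0) with 0 by reflexivity.
  assert (G : forall a n, zsum (fun j => (2 * Z.of_nat j + 1) * (a - Z.of_nat (k * S j / S h'))) n =
     a * (Z.of_nat n * Z.of_nat n) - 2 * (0 + zsum (fun i => Z.of_nat (S i) * Z.of_nat (k * S i / S h')) n) + (0 + zsum (fun i => Z.of_nat (k * S i / S h')) n)).
  { induction n. simpl; lia. cbn [zsum]. rewrite IHn. rewrite Nat2Z.inj_succ. generalize (Z.of_nat (k * S n / S h')). intros. nia. }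
  rewrite G. rewrite Nat2Z.inj_succ. nia.
Qed.

(** The squares of the residues [h r mod k], expanded through the floors and summed, give
    the sum of all squares; [floor_sqr_count] then trades the squared floors for the moment
    with [h] and [k] exchanged. *)
Lemma floor_moment_reciprocity : forall h k, (0 < h)%nat -> (0 < k)%nat -> Nat.gcd h k = 1%nat ->
  let a := Z.of_nat h in let b := Z.of_nat k in
  4 * a * b * floor_moment h k + 4 * b * b * floor_moment k h
  = b * b * (b - 1) * (a - 1) * (2 * a - 1) + 2 * (a * a - 1) * zsum (fun r => Z.of_nat r * Z.of_nat r) k.
Proof.
  intros h k Hh Hk Hg a b.
  pose proof (floor_sqr_count h k Hh Hk Hg) as H1.
  pose proof (floor_sum_eq k h Hh ltac:(rewrite Nat.gcd_comm; auto)) as H2.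
  pose proof (zsum_perm_mod (fun r => Z.of_nat r * Z.of_nat r) h k Hk Hg) as H3.
  assert (E : zsum (fun r => Z.of_nat ((h * r) mod k) * Z.of_nat ((h * r) mod k)) k + 2 * a * b * floor_moment h k
    = a * a * zsum (fun r => Z.of_nat r * Z.of_nat r) k + b * b * zsum (fun r => Z.of_nat (h * r / k) * Z.of_nat (h * r / k)) k).
  { unfold floor_moment. rewrite <- !zsum_scal, <- !zsum_plus. apply zsum_ext. intros r _.
    assert (Q : Z.of_nat ((h * r) mod k) = a * Z.of_nat r - b * Z.of_nat (h * r / k)) by (pose proof (Nat.div_mod_eq (h * r) k); nia).
    rewrite Q. ring. }
  rewrite H3, H1 in E. fold a b in E, H2.
  set (P := floor_moment h k) in *. set (Q := floor_moment k h) in *. set (F := floor_sum k h) in *.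
  set (T := zsum (fun r => Z.of_nat r * Z.of_nat r) k) in *.
  assert (b * b * (2 * F) = b * b * ((a - 1) * (b - 1))) by (rewrite H2; reflexivity).
  nia.
Qed.

Close Scope Z_scope.

Lemma IZR_zsum : forall f n, IZR (zsum f n) = rsum (fun i => IZR (f i)) n.
Proof. induction n; simpl; auto. rewrite plus_IZR, IHn; auto. Qed.

Lemma Int_part_div : forall a b : Z, (0 < b)%Z -> Int_part (IZR a / IZR b) = (a / b)%Z.
Proof.
  intros a b Hb. apply IZR_lt in Hb as Hb'. 
  pose proof (Z.div_mod a b ltac:(lia)) as E. pose proof (Z.mod_pos_bound a b Hb) as M.
  assert (E' : IZR a / IZR b = IZR (a / b) + IZR (a mod b) / IZR b).
  { rewrite E at 1. rewrite plus_IZR, mult_IZR. field. lra. }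
  destruct M as [M1 M2]. apply IZR_le in M1. apply IZR_lt in M2.
  assert (0 <= IZR (a mod b) / IZR b < 1).
  { split. apply Rmult_le_pos; auto. left; apply Rinv_0_lt_compat; auto.
    apply Rmult_lt_reg_r with (IZR b); auto. unfold Rdiv. rewrite Rmult_assoc, Rinv_l by lra. lra. }
  unfold Int_part. rewrite <- (tech_up (IZR a / IZR b) (a / b + 1)). lia.
  rewrite plus_IZR. lra. rewrite plus_IZR. lra.
Qed.

Lemma sum_n_m_rsum : forall f k, (0 < k)%nat -> f O = 0 -> sum_n_m f 1 (k - 1) = rsum f k.
Proof.
  intros f k Hk H0. destruct k; [lia|]. clear Hk. replace (S k - 1)%nat with k by lia.
  induction k. rewrite sum_n_m_zero by lia. simpl. rewrite H0. unfold zero; simpl. ring.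
  rewrite sum_n_Sm by lia. rewrite IHk. reflexivity.
Qed.

(** The fractional part of [h r / k] is a residue divided by [k], which reduces Dedekind sums
    to integer arithmetic. *)
Lemma dedekind_sum_residues : forall (h : Z) k, (0 < k)%nat ->
  dedekind_sum h k = rsum (fun r => INR r * IZR ((h * Z.of_nat r) mod Z.of_nat k)) k / INR k ^ 2 - (INR k - 1) / 4.
Proof.
  intros h k Hk. assert (Hk' : 0 < INR k) by (apply lt_0_INR; auto).
  unfold dedekind_sum. rewrite sum_n_m_rsum; auto. 2:{ simpl. field. lra. }
  assert (Hi : forall n, rsum INR n = INR n * (INR n - 1) / 2).
  { induction n. simpl. field. cbn [rsum]. rewrite IHn, S_INR. field. }
  replace ((INR k - 1) / 4) with (/ (2 * INR k) * rsum INR k) by (rewrite Hi; field; lra).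
  unfold Rdiv. rewrite (Rmult_comm (rsum _ _)), <- !rsum_scal.
  assert (Hm : forall f g n, rsum f n - rsum g n = rsum (fun i => f i - g i) n) by (induction n; simpl; lra).
  rewrite Hm. apply rsum_ext. intros r _.
  assert (E : IZR h * INR r * / INR k = IZR (h * Z.of_nat r) / IZR (Z.of_nat k)).
  { rewrite mult_IZR, <- !INR_IZR_INZ. reflexivity. }
  rewrite E, Int_part_div by lia.
  replace (IZR (h * Z.of_nat r) / IZR (Z.of_nat k) - IZR (h * Z.of_nat r / Z.of_nat k)) with (IZR ((h * Z.of_nat r) mod Z.of_nat k) * / INR k).
  field. lra.
  rewrite (Z.div_mod (h * Z.of_nat r) (Z.of_nat k)) at 2 by lia.
  rewrite plus_IZR, mult_IZR, <- !INR_IZR_INZ. field. lra.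
Qed.

Lemma dedekind_sum_mod : forall h1 h2 k, (0 < k)%nat -> (h1 mod Z.of_nat k = h2 mod Z.of_nat k)%Z ->
  dedekind_sum h1 k = dedekind_sum h2 k.
Proof.
  intros. rewrite !dedekind_sum_residues by auto. f_equal. f_equal. apply rsum_ext. intros. f_equal. f_equal.
  rewrite (Z.mul_mod h1), (Z.mul_mod h2), H0 by lia. reflexivity.
Qed.

(** The residues of [h r] and [- h r] add up to [k], except at [r = 0]. *)
Lemma dedekind_sum_opp : forall h k, (0 < k)%nat -> Z.gcd h (Z.of_nat k) = 1%Z ->
  dedekind_sum (- h) k = - dedekind_sum h k.
Proof.
  intros h k Hk Hg. assert (Hk' : 0 < INR k) by (apply lt_0_INR; auto).
  rewrite !dedekind_sum_residues by auto.
  assert (Hi : forall n, rsum INR n = INR n * (INR n - 1) / 2).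
  { induction n. simpl. field. cbn [rsum]. rewrite IHn, S_INR. field. }
  assert (E : rsum (fun r => INR r * IZR ((- h * Z.of_nat r) mod Z.of_nat k)) k + rsum (fun r => INR r * IZR ((h * Z.of_nat r) mod Z.of_nat k)) k
    = INR k * rsum INR k).
  { rewrite <- rsum_plus, <- rsum_scal. apply rsum_ext. intros r Hr.
    destruct (Nat.eq_dec r 0) as [->|Hr0]. simpl. ring.
    assert (Hnz : ((h * Z.of_nat r) mod Z.of_nat k <> 0)%Z).
    { intro Z0. apply Z.mod_divide in Z0; [|lia]. apply Z.gauss in Z0. 2: rewrite Z.gcd_comm; auto.
      apply Z.divide_pos_le in Z0; lia. }
    rewrite Z.mul_opp_l, Z.mod_opp_l_nz by lia. rewrite minus_IZR, <- INR_IZR_INZ. ring. }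
  rewrite Hi in E.
  match type of E with ?A + ?B = _ => replace A with (INR k * (INR k * (INR k - 1) / 2) - B) by lra end. field. lra.
Qed.

Lemma dedekind_reciprocity : forall h k, (0 < h)%nat -> (0 < k)%nat -> Nat.gcd h k = 1%nat ->
  dedekind_sum (Z.of_nat h) k + dedekind_sum (Z.of_nat k) h
  = / 12 * (INR h / INR k + INR k / INR h + / (INR h * INR k)) - / 4.
Proof.
  intros h k Hh Hk Hg. assert (Hk' : 0 < INR k) by (apply lt_0_INR; auto). assert (Hh' : 0 < INR h) by (apply lt_0_INR; auto).
  rewrite !dedekind_sum_residues by auto.
  assert (R : forall a b, (0 < b)%nat -> rsum (fun r => INR r * IZR ((Z.of_nat a * Z.of_nat r) mod Z.of_nat b)) b = IZR (residue_moment a b)).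
  { intros a b Hb. unfold residue_moment. rewrite IZR_zsum. apply rsum_ext. intros r _. rewrite mult_IZR, <- INR_IZR_INZ.
    f_equal. f_equal. rewrite Nat2Z.inj_mod, Nat2Z.inj_mul. reflexivity. }
  rewrite !R by auto. rewrite !residue_moment_floor, !minus_IZR, !mult_IZR, <- !INR_IZR_INZ.
  pose proof (floor_moment_reciprocity h k Hh Hk Hg) as E. cbv zeta in E. apply (f_equal IZR) in E.
  repeat rewrite ?plus_IZR, ?minus_IZR, ?mult_IZR, <- ?INR_IZR_INZ in E.
  pose proof (f_equal IZR (zsum_sqr k)) as E1. pose proof (f_equal IZR (zsum_sqr h)) as E2.
  repeat rewrite ?plus_IZR, ?minus_IZR, ?mult_IZR, <- ?INR_IZR_INZ in E1.
  repeat rewrite ?plus_IZR, ?minus_IZR, ?mult_IZR, <- ?INR_IZR_INZ in E2.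
  set (a := INR h) in *. set (b := INR k) in *.
  set (T := IZR (zsum (fun r => (Z.of_nat r * Z.of_nat r)%Z) k)) in *. set (U := IZR (zsum (fun r => (Z.of_nat r * Z.of_nat r)%Z) h)) in *.
  set (P := IZR (floor_moment h k)) in *. set (Q := IZR (floor_moment k h)) in *.
  replace T with ((b - 1) * b * (2 * b - 1) / 6) in * by lra. replace U with ((a - 1) * a * (2 * a - 1) / 6) in * by lra.
  assert (EP : P = (b * b * (b - 1) * (a - 1) * (2 * a - 1) + 2 * (a * a - 1) * ((b - 1) * b * (2 * b - 1) / 6) - 4 * b * b * Q) / (4 * a * b)).
  { apply Rmult_eq_reg_l with (4 * a * b). 2: nra. field_simplify. lra. lra. }
  rewrite EP. field. lra.
Qed.

(** ** Transformation at an arbitrary cusp *)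

Lemma Cexp_Clog : forall z, 0 < Re z -> Cexp (Clog z) = z.
Proof.
  intros z Hz. set (x := Re z) in *. set (y := Im z).
  assert (Hn : 0 < x ^ 2 + y ^ 2) by nra.
  assert (Hs : sqrt (x ^ 2 + y ^ 2) = x * sqrt (1 + (y / x)²)).
  { replace (x ^ 2 + y ^ 2) with (x ^ 2 * (1 + (y / x)²)) by (unfold Rsqr; field; lra).
    rewrite sqrt_mult_alt by (apply pow2_ge_0). rewrite sqrt_pow2 by lra. reflexivity. }
  assert (He : exp (ln (x ^ 2 + y ^ 2) / 2) = sqrt (x ^ 2 + y ^ 2)).
  { rewrite <- (sqrt_pow2 (exp (ln (x ^ 2 + y ^ 2) / 2))) by (left; apply exp_pos). f_equal.
    set (l := ln (x ^ 2 + y ^ 2)). replace (exp (l / 2) ^ 2) with (exp (l / 2) * exp (l / 2)) by ring.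
    rewrite <- exp_plus. replace (l / 2 + l / 2) with l by field. unfold l.
    rewrite exp_ln by auto. reflexivity. }
  assert (Hq : 0 < sqrt (1 + (y / x)²)) by (apply sqrt_lt_R0; pose proof (Rle_0_sqr (y / x)); lra).
  unfold Cexp, Clog. cbn [Re Im fst snd]. fold x y. rewrite He, Hs, cos_atan, sin_atan.
  apply C_eq; cbn [Re Im fst snd]; fold (Re z) (Im z); fold x y; field; lra.
Qed.

(** The two sides have the same exponential, and their imaginary parts differ by less than
    2 pi since each logarithm has argument below pi/2. *)
Lemma Clog_mult_quarter : forall a b z, 0 < Re a -> 0 < Re b -> 0 < Re z -> (a * b = - Ci * z)%C ->
  (Clog a + Clog b = Clog z - RtoC (PI / 2) * Ci)%C.
Proof.
  intros a b z Ha Hb Hz E.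
  set (d := (Clog a + Clog b - Clog z + RtoC (PI / 2) * Ci)%C).
  assert (Hd : Cexp d = RtoC 1).
  { unfold d. rewrite Cexp_plus, Cexp_minus, Cexp_plus, !Cexp_Clog, Cexp_iPI2, E by auto.
    assert (z <> RtoC 0) by (apply Cneq_Re; lra).
    transitivity (- (Ci * Ci) * (z / z))%C. unfold Cdiv; ring. rewrite Ci_sqr. field. auto. }
  assert (Hre : Re d = 0).
  { pose proof (f_equal Cmod Hd) as H. rewrite Cmod_Cexp, Cmod_1, <- exp_0 in H. apply exp_inv in H. exact H. }
  assert (Him : Im d = 0).
  { apply cos_eq_1_small.
    - unfold d. unfold Clog; simpl. 
      pose proof (atan_bound (Im a / Re a)). pose proof (atan_bound (Im b / Re b)). pose proof (atan_bound (Im z / Re z)).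
      unfold Re, Im in *. pose proof PI_RGT_0. lra.
    - pose proof (f_equal Re Hd) as H. unfold Cexp in H. cbn [Re fst] in H. rewrite Hre, exp_0 in H. rewrite Rmult_1_l in H. exact H. }
  assert (d = RtoC 0) by (apply C_eq; auto).
  transitivity (d + (Clog z - RtoC (PI / 2) * Ci))%C. unfold d; ring. rewrite H; ring.
Qed.

(** 2 pi i (h + i z) / k *)
Definition cusp_exp (h : Z) (k : nat) (z : C) : C :=
  (RtoC (2 * PI * IZR h / INR k) * Ci - RtoC (2 * PI / INR k) * z)%C.

Lemma cusp_exp_shift : forall h1 h2 k z, (0 < k)%nat -> (Z.of_nat k | h1 - h2)%Z ->
  Cexp (cusp_exp h1 k z) = Cexp (cusp_exp h2 k z).
Proof.
  intros h1 h2 k z Hk [c Hc]. assert (Hk' : 0 < INR k) by (apply lt_0_INR; auto).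
  assert (E : cusp_exp h1 k z = (cusp_exp h2 k z + RtoC (2 * PI * IZR c) * Ci)%C).
  { unfold cusp_exp. replace h1 with (h2 + c * Z.of_nat k)%Z by lia.
    rewrite plus_IZR, mult_IZR, <- INR_IZR_INZ.
    replace (2 * PI * (IZR h2 + IZR c * INR k) / INR k) with (2 * PI * IZR h2 / INR k + 2 * PI * IZR c) by (field; lra).
    rewrite RtoC_plus. ring. }
  rewrite E, Cexp_plus, Cexp_2PI_Z. ring.
Qed.

Lemma Zdivide_mod_congr : forall h k, (0 < k)%nat -> (Z.of_nat k | h - h mod Z.of_nat k)%Z.
Proof. intros. exists (h / Z.of_nat k)%Z. pose proof (Z.div_mod h (Z.of_nat k) ltac:(lia)). lia. Qed.

Lemma coprime_of_inverse : forall h h' k, (k | h * h' + 1)%Z -> Z.gcd h k = 1%Z.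
Proof.
  intros h h' k [c Hc]. apply Z.bezout_1_gcd. exists (- h')%Z, c. lia.
Qed.

Lemma Z_of_nat_gcd : forall a b, Z.of_nat (Nat.gcd a b) = Z.gcd (Z.of_nat a) (Z.of_nat b).
Proof.
  intros a b. apply Z.divide_antisym_nonneg; try lia. apply Z.gcd_nonneg.
  - apply Z.gcd_greatest.
    + destruct (Nat.gcd_divide_l a b) as [c Hc]. exists (Z.of_nat c). lia.
    + destruct (Nat.gcd_divide_r a b) as [c Hc]. exists (Z.of_nat c). lia.
  - pose proof (Z.gcd_nonneg (Z.of_nat a) (Z.of_nat b)) as Hg.
    assert (D : Nat.divide (Z.to_nat (Z.gcd (Z.of_nat a) (Z.of_nat b))) (Nat.gcd a b)).
    { apply Nat.gcd_greatest.
      - destruct (Z.gcd_divide_l (Z.of_nat a) (Z.of_nat b)) as [c Hc].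
        exists (Z.to_nat c). destruct (Z_le_gt_dec 0 c); [nia|]. assert (a = 0)%nat by nia. subst. nia.
      - destruct (Z.gcd_divide_r (Z.of_nat a) (Z.of_nat b)) as [c Hc].
        exists (Z.to_nat c). destruct (Z_le_gt_dec 0 c); [nia|]. assert (b = 0)%nat by nia. subst. nia. }
    destruct D as [c Hc]. exists (Z.of_nat c). rewrite Hc, Nat2Z.inj_mul, Z2Nat.id by auto. reflexivity.
Qed.

(** The transformation law of the eta function at the cusp h/k, on
    logarithms, proved by running Euclid's algorithm on (h, k): each step is
    an inversion, and the Dedekind sums obey the matching reciprocity law. *)
Theorem lamb_transform : forall k, (0 < k)%nat -> forall h h' z, (Z.of_nat k | h * h' + 1)%Z -> 0 < Re z ->
  lamb (Cexp (cusp_exp h k z)) =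
  (lamb (Cexp (cusp_exp h' k (/ z))) + Clog z / 2 + RtoC (PI / (12 * INR k)) * (/ z - z)
   + RtoC (PI * dedekind_sum h k) * Ci)%C.
Proof.
  induction k as [k IH] using lt_wf_ind. intros Hk h h' z Hdiv Hz.
  assert (Hk' : 0 < INR k) by (apply lt_0_INR; auto).
  destruct (Nat.eq_dec k 1) as [->|Hk1].
  - assert (E1 : forall g w, Cexp (cusp_exp g 1 w) = Cexp (- (RtoC (2 * PI) * w))%C).
    { intros. rewrite (cusp_exp_shift g 0) by (auto; exists (g - 0)%Z; lia).
      f_equal. unfold cusp_exp. simpl. replace (2 * PI * 0 / 1) with 0 by field. replace (2 * PI / 1) with (2 * PI) by field. ring. }
    rewrite !E1, (lamb_inversion z Hz).
    replace (dedekind_sum h 1) with 0. 2:{ unfold dedekind_sum. rewrite sum_n_m_zero by lia. reflexivity. }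
    rewrite Rmult_0_r. replace (PI / (12 * INR 1)) with (PI / 12) by (simpl; field). ring.
  - set (h0z := (h mod Z.of_nat k)%Z).
    assert (Hmod := Zdivide_mod_congr h k Hk). fold h0z in Hmod.
    assert (Hr : (0 <= h0z < Z.of_nat k)%Z) by (apply Z.mod_pos_bound; lia).
    set (n := Z.to_nat h0z). assert (Hn : Z.of_nat n = h0z) by (apply Z2Nat.id; lia).
    assert (Hdiv0 : (Z.of_nat k | h0z * h' + 1)%Z).
    { destruct Hmod as [c1 Hc1]. destruct Hdiv as [c2 Hc2]. exists (c2 - c1 * h')%Z. nia. }
    assert (Hn0 : (0 < n)%nat).
    { destruct n; [|lia]. exfalso. rewrite <- Hn in Hdiv0. simpl in Hdiv0. apply Z.divide_1_r_nonneg in Hdiv0; lia. }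
    assert (Hn' : 0 < INR n) by (apply lt_0_INR; auto).
    rewrite (cusp_exp_shift h h0z) by auto.
    rewrite (dedekind_sum_mod h h0z) by (auto; unfold h0z; rewrite Z.mod_mod; lia).
    destruct Hdiv0 as [c Hc]. rewrite <- Hn in *.
    (* With i z1 = (n + i z) / k, inversion leads to i / z1 = (- k + i w) / n, the cusp of the
       smaller denominator n. *)
    set (u := (z - RtoC (INR n) * Ci)%C).
    assert (Hu : u <> RtoC 0).
    { apply Cneq_Re. unfold u. rewrite Re_minus. simpl. unfold Re in *. lra. }
    assert (Hzn : z <> RtoC 0) by (apply Cneq_Re; lra).
    assert (RK : RtoC (INR k) <> RtoC 0) by (apply RtoC_neq; lra).
    assert (RN : RtoC (INR n) <> RtoC 0) by (apply RtoC_neq; lra).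
    set (z1 := (u / RtoC (INR k))%C).
    set (w := (- Ci * RtoC (INR k) * z / u)%C).
    assert (Hz1 : 0 < Re z1).
    { unfold z1. unfold Cdiv. rewrite <- RtoC_inv by lra. rewrite re_scal_r. unfold u. rewrite Re_minus. simpl.
      assert (0 < / INR k) by (apply Rinv_0_lt_compat; auto). unfold Re in *. nra. }
    assert (HwE : (/ w = RtoC (INR n / INR k) * / z + RtoC (/ INR k) * Ci)%C).
    { unfold w. rewrite RtoC_div, RtoC_inv by lra. pose proof Ci_nz.
      transitivity (u * Ci / (RtoC (INR k) * z * - (Ci * Ci)))%C. field. repeat split; auto.
      rewrite Ci_sqr. transitivity ((z * Ci - RtoC (INR n) * (Ci * Ci)) / (RtoC (INR k) * z))%C. unfold u. field; auto.
      rewrite Ci_sqr. field. auto. }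
    assert (Hwn : w <> RtoC 0).
    { unfold w. pose proof Ci_nz. unfold Cdiv. repeat apply Cmult_neq_0; auto.
      intro E. apply H. replace Ci with (- - Ci)%C by ring. rewrite E. ring.
      intro E. apply C1_nz. transitivity (u * / u)%C. field; auto. rewrite E. ring. }
    assert (Hw : 0 < Re w).
    { replace w with (/ / w)%C by (field; auto). apply Re_inv_pos. rewrite HwE, re_plus, !re_scal_l. change (Re Ci) with 0.
      pose proof (Re_inv_pos z Hz). assert (0 < INR n / INR k) by (apply Rdiv_lt_0_compat; auto). nra. }
    assert (Hw1 : (w * z1 = - Ci * z)%C) by (unfold w, z1; field; auto).
    assert (F1 : cusp_exp (Z.of_nat n) k z = (- (RtoC (2 * PI) * z1))%C).
    { unfold cusp_exp, z1, u. rewrite <- INR_IZR_INZ. rewrite !RtoC_div, !RtoC_mult by lra. field. auto. }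
    assert (F2 : (- (RtoC (2 * PI) * / z1))%C = cusp_exp (- Z.of_nat k) n w).
    { unfold cusp_exp, z1, w. rewrite opp_IZR, <- INR_IZR_INZ.
      rewrite !RtoC_div, !RtoC_mult, RtoC_opp by lra.
      transitivity (RtoC 2 * RtoC PI * RtoC (INR k) * (- (u * Ci) + z * Ci) / (RtoC (INR n) * u))%C.
      - replace (- (u * Ci) + z * Ci)%C with (RtoC (INR n) * (Ci * Ci))%C by (unfold u; ring). rewrite Ci_sqr. field. auto.
      - field. auto. }
    assert (F3 : cusp_exp c n (/ w) = cusp_exp h' k (/ z)).
    { unfold cusp_exp. rewrite HwE.
      assert (Hc' : IZR c * INR k = INR n * IZR h' + 1).
      { rewrite !INR_IZR_INZ, <- !mult_IZR. rewrite <- plus_IZR. f_equal. lia. }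
      replace (IZR c) with ((INR n * IZR h' + 1) / INR k) by (rewrite <- Hc'; field; lra).
      rewrite !RtoC_div, RtoC_inv, !RtoC_mult, !RtoC_div, RtoC_plus, RtoC_mult by lra. field. auto. }
    rewrite F1, (lamb_inversion z1 Hz1), F2.
    rewrite (IH n ltac:(lia) Hn0 (- Z.of_nat k)%Z c w).
    2:{ exists (- h')%Z. lia. }
    2: exact Hw.
    rewrite F3.
    assert (Hgcd : Nat.gcd n k = 1%nat).
    { apply Nat2Z.inj. rewrite Z_of_nat_gcd. apply (coprime_of_inverse _ h'). exists c. lia. }
    rewrite dedekind_sum_opp; auto.
    2:{ rewrite Z.gcd_comm. rewrite <- Z_of_nat_gcd, Hgcd. reflexivity. }
    pose proof (dedekind_reciprocity n k Hn0 Hk Hgcd) as HR.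
    pose proof (Clog_mult_quarter w z1 z Hw Hz1 Hz Hw1) as HL.
    assert (R2 : RtoC 2 <> RtoC 0) by (apply RtoC_neq; lra). assert (R12 : RtoC 12 <> RtoC 0) by (apply RtoC_neq; lra).
    assert (R4 : RtoC 4 <> RtoC 0) by (apply RtoC_neq; lra).
    assert (RP : RtoC PI <> RtoC 0) by (apply RtoC_neq; pose proof PI_RGT_0; lra).
    replace (dedekind_sum (Z.of_nat n) k) with (/ 12 * (INR n / INR k + INR k / INR n + / (INR n * INR k)) - / 4 - dedekind_sum (Z.of_nat k) n) by lra.
    assert (HZ1 : (/ z1 = RtoC (INR k) / u)%C) by (unfold z1; field; auto).
    assert (HZ2 : (/ z1 - w / RtoC (INR n) = RtoC (INR k / INR n) * Ci)%C).
    { rewrite HZ1. unfold w. rewrite RtoC_div by lra.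
      transitivity (RtoC (INR k) * (RtoC (INR n) + z * Ci) / (RtoC (INR n) * u))%C. field; auto.
      replace (RtoC (INR n) + z * Ci)%C with (u * Ci)%C. field; auto.
      unfold u. transitivity (z * Ci - RtoC (INR n) * (Ci * Ci))%C. ring. rewrite Ci_sqr. ring. }
    transitivity (lamb (Cexp (cusp_exp h' k (/ z))) + (Clog w + Clog z1) / 2
      + RtoC (PI / 12) * (/ w / RtoC (INR n) - z1 + (/ z1 - w / RtoC (INR n))) - RtoC (PI * dedekind_sum (Z.of_nat k) n) * Ci)%C.
    { rewrite <- Ropp_mult_distr_r, RtoC_opp.
      replace (RtoC (PI / (12 * INR n))) with (RtoC (PI / 12) / RtoC (INR n))%C by (rewrite <- RtoC_div by lra; f_equal; field; lra).
      assert (Hz1n : z1 <> RtoC 0) by (apply Cneq_Re; lra). field. repeat split; auto. }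
    rewrite HL, HZ2, HwE. unfold z1, u.
    set (L := Clog z). set (T := lamb _). set (D := dedekind_sum _ _).
    rewrite Rmult_minus_distr_l, Rmult_minus_distr_l.
    rewrite !RtoC_minus, !RtoC_mult, !RtoC_plus, !RtoC_div, !RtoC_inv, !RtoC_mult by (try lra; try (apply Rmult_integral_contrapositive_currified; lra)).
    field. repeat split; auto.
Qed.

(** * The quotient near a cusp *)

Lemma Clog_scal : forall x z, 0 < x -> 0 < Re z -> Clog (RtoC x * z)%C = (RtoC (ln x) + Clog z)%C.
Proof.
  intros x z Hx Hz. unfold Clog. rewrite re_scal_l, im_scal_l.
  assert (0 < Re z ^ 2 + Im z ^ 2) by nra.
  replace ((x * Re z) ^ 2 + (x * Im z) ^ 2) with (x * x * (Re z ^ 2 + Im z ^ 2)) by ring.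
  rewrite !ln_mult by nra. replace (x * Im z / (x * Re z)) with (Im z / Re z) by (field; lra).
  apply C_eq; simpl; field.
Qed.

(** The inverse has the sign that the transformation law requires. *)
Lemma cusp_inverse : forall h k, Z.gcd h (Z.of_nat k) = 1%Z -> exists h', (Z.of_nat k | h * h' + 1)%Z.
Proof.
  intros h k Hg. destruct (Z.gcd_bezout h (Z.of_nat k) 1) as [a [b E]]; auto.
  exists (- a)%Z. exists b. lia.
Qed.

Lemma Z_gcd_mul_eq_1 : forall a b n, Z.gcd a n = 1%Z -> Z.gcd b n = 1%Z -> Z.gcd (a * b) n = 1%Z.
Proof.
  intros a b n Ha Hb. destruct (Z.gcd_bezout a n 1 Ha) as [x [y E]]. destruct (Z.gcd_bezout b n 1 Hb) as [u [v F]].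
  apply Z.bezout_1_gcd. exists (x * u)%Z, (y * (u * b) + v * (x * a) + y * v * n)%Z. nia.
Qed.

(** The exponent of [exp (2 pi i h / k - 2 pi w)]: [w] is the local parameter at the cusp. *)
Definition root_arg (h : Z) (k : nat) (w : C) : C := (RtoC (2 * PI * IZR h / INR k) * Ci - RtoC (2 * PI) * w)%C.

(** [k^2] times the coefficient of [1 / w] in the principal part; its sign decides whether the
    quotient is unbounded at a cusp of denominator [k]. *)
Definition pole_weight (t m k : nat) : R :=
  INR m * PI / 12 * (INR (Nat.gcd t k) ^ 2 / INR t - 1).

Definition cusp_phase (t m n : nat) (h : Z) (k : nat) : R :=
  let d := Nat.gcd t k in
  PI * INR m * (dedekind_sum (Z.of_nat (t / d) * h) (k / d) - dedekind_sum h k) - 2 * PI * INR n * IZR h / INR k.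

Definition cusp_coef (t m n : nat) (h : Z) (k : nat) : C :=
  (RtoC (Rpower (INR t / INR (Nat.gcd t k)) (INR m / 2)) * Cexp (RtoC (cusp_phase t m n h k) * Ci))%C.

Definition principal_part (t m n : nat) (h : Z) (k : nat) (w : C) : C :=
  (cusp_coef t m n h k * Cexp (RtoC (2 * PI * (INR n - mu t m)) * w + RtoC (pole_weight t m k / INR k ^ 2) * / w))%C.

Definition log_quotient (t m : nat) (q : C) : C := (RtoC (INR m) * (lamb (q ^ t) - lamb q))%C.

(** Apply [lamb_transform] to [q] and to [q^t]; [q^t] belongs to the cusp with denominator
    [k / gcd (t, k)], and its parameter is [t / gcd (t, k)] times that of [q]. *)
Lemma quotient_local : forall t m n h k w, (0 < t)%nat -> (0 < k)%nat -> Z.gcd h (Z.of_nat k) = 1%Z -> 0 < Re w ->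
  let d := Nat.gcd t k in
  let rho := Re (/ w)%C / INR k ^ 2 in
  exists q1 q2, Cmod q1 = exp (- (2 * PI * rho)) /\ Cmod q2 = exp (- (2 * PI * (INR d ^ 2 / INR t) * rho)) /\
  (Cexp (log_quotient t m (Cexp (root_arg h k w))) * Cexp (- (RtoC (INR n) * root_arg h k w))
   = principal_part t m n h k w * Cexp (RtoC (INR m) * (lamb q2 - lamb q1)))%C.
Proof.
  intros t m n h k w Ht Hk Hg Hw d rho.
  assert (Hd : (0 < d)%nat).
  { unfold d. destruct (Nat.eq_dec (Nat.gcd t k) 0) as [E|E]; [|lia]. apply Nat.gcd_eq_0 in E. lia. }
  destruct (Nat.gcd_divide_l t k) as [t1 Ht1]. destruct (Nat.gcd_divide_r t k) as [k1 Hk1]. fold d in Ht1, Hk1.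
  assert (Htd : (t / d = t1)%nat) by (rewrite Ht1; apply Nat.div_mul; lia).
  assert (Hkd : (k / d = k1)%nat) by (rewrite Hk1; apply Nat.div_mul; lia).
  assert (Hk1p : (0 < k1)%nat) by nia. assert (Ht1p : (0 < t1)%nat) by nia.
  assert (HtR : 0 < INR t) by (apply lt_0_INR; auto). assert (HkR : 0 < INR k) by (apply lt_0_INR; auto).
  assert (HdR : 0 < INR d) by (apply lt_0_INR; auto). assert (Hk1R : 0 < INR k1) by (apply lt_0_INR; auto).
  assert (Ht1R : 0 < INR t1) by (apply lt_0_INR; auto).
  assert (EtR : INR t = INR t1 * INR d) by (rewrite <- mult_INR, <- Ht1; reflexivity).
  assert (EkR : INR k = INR k1 * INR d) by (rewrite <- mult_INR, <- Hk1; reflexivity).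
  assert (Hg1 : Z.gcd h (Z.of_nat k1) = 1%Z).
  { destruct (Z.gcd_bezout h (Z.of_nat k) 1 Hg) as [a [b E]]. apply Z.bezout_1_gcd. exists a, (b * Z.of_nat d)%Z. nia. }
  assert (Hgt : Z.gcd (Z.of_nat t1) (Z.of_nat k1) = 1%Z).
  { rewrite <- Z_of_nat_gcd. pose proof (Nat.gcd_div_gcd t k d ltac:(lia) eq_refl) as G. rewrite Htd, Hkd in G. rewrite G. reflexivity. }
  assert (Hg2 : Z.gcd (Z.of_nat t1 * h) (Z.of_nat k1) = 1%Z) by (apply Z_gcd_mul_eq_1; auto).
  destruct (cusp_inverse h k Hg) as [h1 Hh1]. destruct (cusp_inverse _ _ Hg2) as [h2 Hh2].
  set (z1 := (RtoC (INR k) * w)%C). set (z2 := (RtoC (INR t1) * z1)%C).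
  assert (Hz1 : 0 < Re z1) by (unfold z1; rewrite re_scal_l; nra).
  assert (Hz2 : 0 < Re z2) by (unfold z2; rewrite re_scal_l; nra).
  assert (Hwn : w <> RtoC 0) by (apply Cneq_Re; lra).
  assert (RK : RtoC (INR k) <> RtoC 0) by (apply RtoC_neq; lra). assert (RT : RtoC (INR t) <> RtoC 0) by (apply RtoC_neq; lra).
  assert (RT1 : RtoC (INR t1) <> RtoC 0) by (apply RtoC_neq; lra).
  assert (RK1 : RtoC (INR k1) <> RtoC 0) by (apply RtoC_neq; lra).
  assert (RD : RtoC (INR d) <> RtoC 0) by (apply RtoC_neq; lra).
  assert (R12 : RtoC 12 <> RtoC 0) by (apply RtoC_neq; lra).
  assert (R2 : RtoC 2 <> RtoC 0) by (apply RtoC_neq; lra).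
  exists (Cexp (cusp_exp h1 k (/ z1))), (Cexp (cusp_exp h2 k1 (/ z2))).
  assert (Hre1 : Re (/ z1)%C = Re (/ w)%C / INR k).
  { unfold z1. replace (/ (RtoC (INR k) * w))%C with (RtoC (/ INR k) * / w)%C by (rewrite RtoC_inv by lra; field; auto).
    rewrite re_scal_l. field. lra. }
  assert (Hre2 : Re (/ z2)%C = Re (/ w)%C / (INR k * INR t1)).
  { unfold z2, z1. replace (/ (RtoC (INR t1) * (RtoC (INR k) * w)))%C with (RtoC (/ (INR k * INR t1)) * / w)%C.
    rewrite re_scal_l. field. split; lra. rewrite RtoC_inv, RtoC_mult by nra. field; auto. }
  assert (Hmod : forall g j z, Cmod (Cexp (cusp_exp g j z)) = exp (- (2 * PI / INR j * Re z))).
  { intros. rewrite Cmod_Cexp. f_equal. unfold cusp_exp. rewrite Re_minus, !re_scal_l. simpl. ring. }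
  split; [|split].
  - rewrite Hmod, Hre1. f_equal. unfold rho. field. lra.
  - rewrite Hmod, Hre2. f_equal. unfold rho. rewrite EtR, EkR. field. repeat split; lra.
  - assert (Q1 : Cexp (root_arg h k w) = Cexp (cusp_exp h k z1)).
    { f_equal. unfold root_arg, cusp_exp, z1. f_equal. rewrite (RtoC_div (2 * PI)) by lra. field. auto. }
    assert (Q2 : (Cexp (root_arg h k w) ^ t)%C = Cexp (cusp_exp (Z.of_nat t1 * h) k1 z2)).
    { rewrite Cexp_pow. f_equal. unfold root_arg, cusp_exp, z2, z1. rewrite mult_IZR, <- INR_IZR_INZ.
      rewrite EtR, EkR. rewrite !RtoC_div, !RtoC_mult by nra. field. auto. }
    unfold log_quotient. rewrite Q2. rewrite Q1 at 1.
    rewrite (lamb_transform k Hk h h1 z1 Hh1 Hz1), (lamb_transform k1 Hk1p _ h2 z2 Hh2 Hz2).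
    unfold z2 at 2. rewrite Clog_scal by auto.
    unfold principal_part, cusp_coef. fold d.
    replace (INR t / INR d) with (INR t1) by (rewrite EtR; field; lra).
    unfold Rpower. rewrite <- Cexp_RtoC.
    rewrite <- !Cexp_plus. f_equal.
    unfold cusp_phase, pole_weight, mu. cbv zeta. fold d. rewrite Htd, Hkd.
    set (l1 := lamb _). set (l2 := lamb _). set (L := Clog z1). set (s1 := dedekind_sum _ k1). set (s2 := dedekind_sum h k).
    set (M := RtoC (INR m)).
    transitivity (M * (l1 - l2) + RtoC (INR m / 2 * ln (INR t1))
      + RtoC (INR m) * RtoC (PI / 12) * ((/ z2 - z2) / RtoC (INR k1) - (/ z1 - z1) / RtoC (INR k))
      + RtoC (PI * INR m * (s1 - s2)) * Ci - RtoC (INR n) * root_arg h k w)%C.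
    + replace (RtoC (PI / (12 * INR k1))) with (RtoC (PI / 12) / RtoC (INR k1))%C by (rewrite <- RtoC_div by lra; f_equal; field; lra).
      replace (RtoC (PI / (12 * INR k))) with (RtoC (PI / 12) / RtoC (INR k))%C by (rewrite <- RtoC_div by lra; f_equal; field; lra).
      replace (RtoC (INR m / 2 * ln (INR t1))) with (M * RtoC (ln (INR t1)) / 2)%C.
      2:{ unfold M. rewrite RtoC_mult, RtoC_div by lra. field. }
      replace (RtoC (PI * INR m * (s1 - s2))) with (M * (RtoC (PI * s1) - RtoC (PI * s2)))%C.
      2:{ unfold M. rewrite <- RtoC_minus, <- RtoC_mult. f_equal. ring. }
      fold M. set (p12 := RtoC (PI / 12)). set (ra := root_arg h k w). set (ph1 := RtoC (PI * s1)). set (ph2 := RtoC (PI * s2)).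
      assert (Hz1n : z1 <> RtoC 0) by (apply Cneq_Re; lra). assert (Hz2n : z2 <> RtoC 0) by (apply Cneq_Re; lra).
      field. repeat split; auto.
    + assert (I2 : ((/ z2 - z2) / RtoC (INR k1) = RtoC (/ (INR k * INR t1 * INR k1)) * / w - RtoC (INR t1 * INR k / INR k1) * w)%C).
      { unfold z2, z1. rewrite RtoC_inv, RtoC_div, !RtoC_mult by (repeat apply Rmult_integral_contrapositive_currified; lra). field. auto. }
      assert (I1 : ((/ z1 - z1) / RtoC (INR k) = RtoC (/ (INR k * INR k)) * / w - w)%C).
      { unfold z1. rewrite RtoC_inv, !RtoC_mult by (repeat apply Rmult_integral_contrapositive_currified; lra). field. auto. }
      rewrite I1, I2. unfold root_arg, M.
      set (r1 := / (INR k * INR t1 * INR k1)). set (r2 := INR t1 * INR k / INR k1). set (r3 := / (INR k * INR k)).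
      replace (RtoC (2 * PI * (INR n - INR m * (INR t - 1) / 24))) with (RtoC (INR m) * RtoC (PI / 12) * (1 - RtoC r2) + RtoC (INR n) * RtoC (2 * PI))%C.
      2:{ rewrite <- RtoC_minus, <- !RtoC_mult, <- RtoC_plus. f_equal. unfold r2. rewrite EtR, EkR. field. lra. }
      replace (RtoC (INR m * PI / 12 * (INR d ^ 2 / INR t - 1) / INR k ^ 2)) with (RtoC (INR m) * RtoC (PI / 12) * (RtoC r1 - RtoC r3))%C.
      2:{ rewrite <- RtoC_minus, <- !RtoC_mult. f_equal. unfold r1, r3. rewrite EtR, EkR. field. lra. }
      replace (2 * PI * INR n * IZR h / INR k) with (INR n * (2 * PI * IZR h / INR k)) by (field; lra).
      rewrite (RtoC_minus (PI * INR m * (s1 - s2))), (RtoC_mult (INR n)). ring.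
Qed.

(** ** Bounds near a cusp *)

Definition log_bound (t m : nat) : R :=
  INR m * (exp (- PI) / (1 - exp (- PI)) ^ 2 + exp (- PI / INR t) / (1 - exp (- PI / INR t)) ^ 2).

(** The last term of the error bound, divided by [2 t]. *)
Definition regular_bound (t m : nat) : R :=
  exp 2 * Rpower (INR t) (INR m / 2) * exp (PI * mu t m + log_bound t m).

Lemma exp_le : forall x y, x <= y -> exp x <= exp y.
Proof. intros x y [H|H]. left; apply exp_increasing; auto. subst; lra. Qed.

Lemma exp_lt_1 : forall x, x < 0 -> exp x < 1.
Proof. intros. rewrite <- exp_0. apply exp_increasing; auto. Qed.

Lemma euler_bound_scaled : forall x x0 l, 0 <= x -> x <= l * x0 -> 0 <= l <= 1 -> 0 <= x0 < 1 ->
  x / (1 - x) ^ 2 <= l * (x0 / (1 - x0) ^ 2).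
Proof.
  intros x x0 l Hx H Hl H0. assert (x <= x0) by nra.
  replace (l * (x0 / (1 - x0) ^ 2)) with (l * x0 / (1 - x0) ^ 2) by (field; lra).
  apply Rmult_le_compat; auto. left; apply Rinv_0_lt_compat; apply pow_lt; lra.
  apply Rinv_le_contravar. apply pow_lt; lra. apply pow_incr. lra.
Qed.

Lemma log_bound_ge_0 : forall t m, (0 < t)%nat -> 0 <= log_bound t m.
Proof.
  intros t m Ht. pose proof PI_RGT_0. assert (0 < INR t) by (apply lt_0_INR; auto).
  assert (G : forall x, x < 0 -> 0 <= exp x / (1 - exp x) ^ 2).
  { intros. pose proof (exp_lt_1 x H1). apply Rmult_le_pos. left; apply exp_pos. left; apply Rinv_0_lt_compat; apply pow_lt; lra. }
  apply Rmult_le_pos. apply pos_INR. apply Rplus_le_le_0_compat; apply G. lra.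
  unfold Rdiv. rewrite <- Ropp_mult_distr_l. apply Ropp_lt_gt_0_contravar. apply Rdiv_lt_0_compat; auto.
Qed.

(** The factor [l] records the decay of the nomes beyond [Re (1/w) = k^2 / 2]. *)
Lemma log_quotient_bound : forall t m b rho l q1 q2, (0 < t)%nat -> / INR t <= b ->
  0 <= l <= 1 -> exp (- (2 * PI * rho)) <= l * exp (- PI) -> exp (- (2 * PI * b * rho)) <= l * exp (- (PI * b)) ->
  Cmod q1 = exp (- (2 * PI * rho)) -> Cmod q2 = exp (- (2 * PI * b * rho)) ->
  Cmod (RtoC (INR m) * (lamb q2 - lamb q1))%C <= l * log_bound t m.
Proof.
  intros t m b rho l q1 q2 Ht Hb Hl H1 H2 E1 E2. pose proof PI_RGT_0 as HP.
  assert (HtR : 0 < INR t) by (apply lt_0_INR; auto).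
  assert (Hti : 0 < / INR t) by (apply Rinv_0_lt_compat; auto).
  assert (X1 : 0 <= exp (- PI) < 1) by (split; [left; apply exp_pos|apply exp_lt_1; lra]).
  assert (X2 : 0 <= exp (- PI / INR t) < 1).
  { split; [left; apply exp_pos|apply exp_lt_1]. unfold Rdiv. nra. }
  assert (X3 : exp (- (PI * b)) <= exp (- PI / INR t)) by (apply exp_le; unfold Rdiv; nra).
  assert (Hq1 : Cmod q1 <= l * exp (- PI)) by lra.
  assert (Hq2 : Cmod q2 <= l * exp (- PI / INR t)) by (rewrite E2; eapply Rle_trans; [exact H2|apply Rmult_le_compat_l; lra]).
  pose proof (Cmod_ge_0 q1). pose proof (Cmod_ge_0 q2).
  rewrite Cmod_mult, Cmod_RtoC by apply pos_INR. unfold log_bound.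
  replace (l * (INR m * (exp (- PI) / (1 - exp (- PI)) ^ 2 + exp (- PI / INR t) / (1 - exp (- PI / INR t)) ^ 2)))
    with (INR m * (l * (exp (- PI / INR t) / (1 - exp (- PI / INR t)) ^ 2) + l * (exp (- PI) / (1 - exp (- PI)) ^ 2))) by ring.
  apply Rmult_le_compat_l. apply pos_INR. eapply Rle_trans. apply Cmod_minus_triangle.
  apply Rplus_le_compat; (eapply Rle_trans; [apply lamb_bound; nra|]); apply euler_bound_scaled; auto.
Qed.

Lemma mu_ge_0 : forall t m, (0 < t)%nat -> 0 <= mu t m.
Proof.
  intros. unfold mu. assert (1 <= INR t) by (replace 1 with (INR 1) by reflexivity; apply le_INR; lia).
  pose proof (pos_INR m). unfold Rdiv. apply Rmult_le_pos; [|lra]. apply Rmult_le_pos; lra.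
Qed.

Section Cusp.
Variables (t m n : nat) (h : Z) (k : nat) (w : C).
Hypothesis Ht : (0 < t)%nat.
Hypothesis Hk : (0 < k)%nat.
Hypothesis Hg : Z.gcd h (Z.of_nat k) = 1%Z.
Hypothesis Hw : 0 < Re w.
Hypothesis Hnu : 2 * PI * (INR n - mu t m) * Re w <= 2.

Let d := Nat.gcd t k.

Lemma gcd_range : 1 <= INR d <= INR t.
Proof.
  assert (Hd : (1 <= d <= t)%nat).
  { split. unfold d. destruct (Nat.gcd t k) eqn:E; [|lia]. apply Nat.gcd_eq_0 in E. lia.
    apply Nat.divide_pos_le; auto. apply Nat.gcd_divide_l. }
  split. replace 1 with (INR 1) by reflexivity. apply le_INR; lia. apply le_INR; lia.
Qed.

Lemma Cmod_principal_part : Cmod (principal_part t m n h k w)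
  = Rpower (INR t / INR d) (INR m / 2) * exp (2 * PI * (INR n - mu t m) * Re w) * exp (pole_weight t m k * (Re (/ w)%C / INR k ^ 2)).
Proof.
  assert (HkR : 0 < INR k) by (apply lt_0_INR; auto).
  unfold principal_part, cusp_coef. fold d. rewrite !Cmod_mult, !Cmod_Cexp, Cmod_RtoC by (left; apply exp_pos).
  rewrite re_plus, !re_scal_l. change (Re Ci) with 0. rewrite Rmult_0_r, exp_0, Rmult_1_r, exp_plus, <- Rmult_assoc.
  f_equal. f_equal. field. lra.
Qed.

Lemma Rpower_cusp_le : Rpower (INR t / INR d) (INR m / 2) <= Rpower (INR t) (INR m / 2).
Proof.
  pose proof gcd_range as [D1 D2]. unfold Rpower. apply exp_le. apply Rmult_le_compat_l.
  pose proof (pos_INR m); lra.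
  destruct D1 as [D1|D1]. 2: rewrite <- D1; replace (INR t / 1) with (INR t) by field; lra.
  left. apply ln_increasing. apply Rdiv_lt_0_compat; lra.
  apply Rmult_lt_reg_r with (INR d). lra. unfold Rdiv. rewrite Rmult_assoc, Rinv_l by lra. nra.
Qed.

Lemma inv_le_gcd_sqr_div : / INR t <= INR d ^ 2 / INR t.
Proof.
  pose proof gcd_range as [D1 D2]. replace (/ INR t) with (1 / INR t) by (field; lra).
  apply Rmult_le_compat_r. left; apply Rinv_0_lt_compat; lra. nra.
Qed.

Hypothesis Hrho : / 2 <= Re (/ w)%C / INR k ^ 2.

Lemma quotient_regular : INR d ^ 2 <= INR t ->
  Cmod (Cexp (log_quotient t m (Cexp (root_arg h k w))) * Cexp (- (RtoC (INR n) * root_arg h k w)))%C <= regular_bound t m.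
Proof.
  intros Hd. pose proof PI_RGT_0 as HP. pose proof gcd_range as [D1 D2].
  destruct (quotient_local t m n h k w Ht Hk Hg Hw) as (q1 & q2 & E1 & E2 & ->). fold d in E2.
  set (rho := Re (/ w)%C / INR k ^ 2) in *. set (b := INR d ^ 2 / INR t) in *.
  pose proof inv_le_gcd_sqr_div as Hb. fold b in Hb. assert (Hti : 0 < / INR t) by (apply Rinv_0_lt_compat; lra).
  rewrite Cmod_mult, Cmod_principal_part, Cmod_Cexp. fold rho. unfold regular_bound.
  rewrite exp_plus. pose proof Rpower_cusp_le.
  apply Rle_trans with (Rpower (INR t) (INR m / 2) * exp 2 * 1 * exp (log_bound t m)).
  - apply Rmult_le_compat; try (left; apply exp_pos).
    + apply Rmult_le_pos; [|left; apply exp_pos]. apply Rmult_le_pos; left; apply exp_pos.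
    + apply Rmult_le_compat; try (left; apply exp_pos).
      * apply Rmult_le_pos; left; apply exp_pos.
      * apply Rmult_le_compat; try (left; apply exp_pos); auto. apply exp_le; auto.
      * rewrite <- exp_0. apply exp_le.
        assert (pole_weight t m k <= 0).
        { unfold pole_weight. fold d. fold b. assert (b <= 1).
          { unfold b. apply Rmult_le_reg_r with (INR t). lra. unfold Rdiv. rewrite Rmult_assoc, Rinv_l by lra. lra. }
          assert (0 <= INR m * PI / 12) by (pose proof (pos_INR m); unfold Rdiv; nra). nra. }
        nra.
    + apply exp_le. eapply Rle_trans. apply Rle_abs. eapply Rle_trans. apply re_le_Cmod.
      replace (log_bound t m) with (1 * log_bound t m) by ring.
      apply (log_quotient_bound t m b rho); auto; try lra; rewrite Rmult_1_l; apply exp_le.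
      nra. assert (0 <= PI * b * (rho - / 2)) by (apply Rmult_le_pos; [apply Rmult_le_pos|]; lra). nra.
  - pose proof (exp_pos 2). pose proof (exp_pos (log_bound t m)). pose proof (mu_ge_0 t m Ht).
    assert (1 <= exp (PI * mu t m)) by (rewrite <- exp_0; apply exp_le; nra).
    assert (0 < Rpower (INR t) (INR m / 2)) by apply exp_pos.
    assert (0 < exp 2 * Rpower (INR t) (INR m / 2) * exp (log_bound t m)) by (repeat apply Rmult_lt_0_compat; auto). nra.
Qed.

(** Equality holds when [t] divides [k]. *)
Lemma pole_weight_le : pole_weight t m k <= 2 * PI * mu t m.
Proof.
  pose proof PI_RGT_0 as HP. pose proof gcd_range as [D1 D2]. unfold pole_weight, mu. fold d.
  replace (2 * PI * (INR m * (INR t - 1) / 24)) with (INR m * PI / 12 * (INR t - 1)) by field.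
  apply Rmult_le_compat_l. pose proof (pos_INR m); unfold Rdiv; nra.
  assert (INR d ^ 2 / INR t <= INR t); [|lra].
  apply Rmult_le_reg_r with (INR t). lra. unfold Rdiv. rewrite Rmult_assoc, Rinv_l by lra. nra.
Qed.

(** The condition [mu <= 1] enters here.  With [rho = Re (1/w) / k^2], the principal part
    grows like [exp (pole_weight * rho)], at most [exp (2 pi mu rho)], while the neglected factor
    differs from 1 by a multiple of [exp (- 2 pi rho)]. *)
Lemma quotient_singular : INR t < INR d ^ 2 -> mu t m <= 1 ->
  Cmod (Cexp (log_quotient t m (Cexp (root_arg h k w))) * Cexp (- (RtoC (INR n) * root_arg h k w))
        - principal_part t m n h k w)%C <= regular_bound t m.
Proof.
  intros Hd Hmu. pose proof PI_RGT_0 as HP. pose proof gcd_range as [D1 D2].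
  destruct (quotient_local t m n h k w Ht Hk Hg Hw) as (q1 & q2 & E1 & E2 & ->). fold d in E2.
  set (rho := Re (/ w)%C / INR k ^ 2) in *. set (b := INR d ^ 2 / INR t) in *.
  pose proof inv_le_gcd_sqr_div as Hb. fold b in Hb. assert (Hti : 0 < / INR t) by (apply Rinv_0_lt_compat; lra).
  assert (Hb1 : 1 <= b).
  { unfold b. apply Rmult_le_reg_r with (INR t). lra. unfold Rdiv. rewrite Rmult_assoc, Rinv_l by lra. lra. }
  set (L := (RtoC (INR m) * (lamb q2 - lamb q1))%C).
  replace (principal_part t m n h k w * Cexp L - principal_part t m n h k w)%C
    with (principal_part t m n h k w * (Cexp L - 1))%C by ring.
  set (l := exp (- (2 * PI * (rho - / 2)))).
  assert (Hl : 0 < l <= 1) by (unfold l; split; [apply exp_pos|rewrite <- exp_0; apply exp_le; nra]).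
  assert (HL : Cmod L <= l * log_bound t m).
  { apply (log_quotient_bound t m b rho); auto; try lra; unfold l; rewrite <- exp_plus; apply exp_le;
    [|assert (0 <= PI * (b - 1) * (rho - / 2)) by (apply Rmult_le_pos; [apply Rmult_le_pos|]; lra)]; nra. }
  pose proof (log_bound_ge_0 t m Ht) as Hg0. set (g := log_bound t m) in *.
  assert (HE : Cmod (Cexp L - 1)%C <= l * exp g).
  { eapply Rle_trans. apply Cmod_Cexp_minus_1_sharp.
    apply Rle_trans with (exp (l * g) - 1). pose proof (exp_le _ _ HL); lra.
    (* convexity of exp between 0 and g: exp (l g) - 1 <= l (exp g - 1) *)
    assert (Hc : exp (l * g) * (1 - l) + exp (l * g) * (l * g) * (l - 1) + 0 <= exp (l * g) * (1 - l)).
    { assert (0 <= exp (l * g) * (l * g)). apply Rmult_le_pos. left; apply exp_pos. nra. nra. }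
    pose proof (exp_ineq1_le (g - l * g)) as I1. pose proof (exp_ineq1_le (- (l * g))) as I2.
    assert (J1 : exp g = exp (l * g) * exp (g - l * g)) by (rewrite <- exp_plus; f_equal; ring).
    assert (J2 : 1 = exp (l * g) * exp (- (l * g))) by (rewrite <- exp_plus; replace (l * g + - (l * g)) with 0 by ring; rewrite exp_0; reflexivity).
    pose proof (exp_pos (l * g)) as Hp. set (e := exp (l * g)) in *.
    assert (e * (1 + (g - l * g)) <= exp g) by (rewrite J1; apply Rmult_le_compat_l; lra).
    assert (e * (1 + - (l * g)) <= 1) by (rewrite J2 at 2; apply Rmult_le_compat_l; lra).
    assert (e <= l * exp g + (1 - l)).
    { assert (l * (e * (1 + (g - l * g))) + (1 - l) * (e * (1 + - (l * g))) = e) by ring. nra. }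
    lra. }
  rewrite Cmod_mult, Cmod_principal_part. fold rho. unfold regular_bound. fold g.
  pose proof Rpower_cusp_le. pose proof pole_weight_le as Hpw.
  apply Rle_trans with ((Rpower (INR t) (INR m / 2) * exp 2) * (exp (pole_weight t m k * rho) * (l * exp g))).
  - rewrite Rmult_assoc. apply Rmult_le_compat.
    + apply Rmult_le_pos; left; apply exp_pos.
    + apply Rmult_le_pos. left; apply exp_pos. apply Cmod_ge_0.
    + apply Rmult_le_compat; try (left; apply exp_pos); auto. apply exp_le; auto.
    + apply Rmult_le_compat_l. left; apply exp_pos. exact HE.
  - replace (exp 2 * Rpower (INR t) (INR m / 2) * exp (PI * mu t m + g)) with ((Rpower (INR t) (INR m / 2) * exp 2) * exp (PI * mu t m + g)) by ring.
    apply Rmult_le_compat_l. apply Rmult_le_pos; left; apply exp_pos.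
    unfold l. rewrite <- !exp_plus. apply exp_le.
    assert (pole_weight t m k * (rho - / 2) <= 2 * PI * (rho - / 2)) by (apply Rmult_le_compat_r; [lra|nra]). lra.
Qed.

Lemma pole_weight_ge_0 : INR t < INR d ^ 2 -> 0 <= pole_weight t m k.
Proof.
  intros Hd. pose proof PI_RGT_0 as HP. pose proof gcd_range as [D1 D2].
  unfold pole_weight. fold d. apply Rmult_le_pos. pose proof (pos_INR m); unfold Rdiv; nra.
  assert (1 <= INR d ^ 2 / INR t); [|lra].
  apply Rmult_le_reg_r with (INR t). lra. unfold Rdiv. rewrite Rmult_assoc, Rinv_l by lra. lra.
Qed.

(** The worst case of the weight and of the prefactor is [d = t]. *)
Lemma pole_growth : Rpower (INR t / INR d) (INR m / 2) * exp (4 * pole_weight t m k) <= exp (8 * PI * mu t m).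
Proof.
  pose proof PI_RGT_0 as HP. pose proof gcd_range as [D1 D2].
  unfold Rpower. rewrite <- exp_plus. apply exp_le.
  assert (Hln : ln (INR t / INR d) <= INR t - INR d).
  { assert (Hp : 0 < INR t / INR d) by (apply Rdiv_lt_0_compat; lra).
    pose proof (exp_ineq1_le (ln (INR t / INR d))). rewrite exp_ln in H by auto.
    assert (INR t / INR d - 1 <= INR t - INR d).
    { replace (INR t / INR d - 1) with ((INR t - INR d) * / INR d) by (field; lra).
      assert (/ INR d <= / 1) by (apply Rinv_le_contravar; lra). rewrite Rinv_1 in H0.
      assert (0 < / INR d) by (apply Rinv_0_lt_compat; lra). nra. }
    lra. }
  assert (Hq : INR d ^ 2 / INR t <= INR d).
  { apply Rmult_le_reg_r with (INR t). lra. unfold Rdiv. rewrite Rmult_assoc, Rinv_l by lra. nra. }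
  unfold pole_weight, mu. fold d.
  pose proof (pos_INR m) as Hm. pose proof PI2_3_2 as HP3.
  assert (INR m / 2 * ln (INR t / INR d) <= INR m / 2 * (INR t - INR d)) by (apply Rmult_le_compat_l; lra).
  assert (INR m * (INR t - INR d) * / 2 <= INR m * (INR t - INR d) * (PI / 3)) by (apply Rmult_le_compat_l; [apply Rmult_le_pos; lra|lra]).
  assert (INR m * PI * (INR d ^ 2 / INR t) <= INR m * PI * INR d) by (apply Rmult_le_compat_l; [apply Rmult_le_pos; lra|auto]).
  lra.
Qed.

(** The hypothesis on [Re (1/w)] holds outside the chord of the cusp. *)
Lemma principal_part_bound : INR t < INR d ^ 2 -> Re (/ w)%C <= 4 * INR k ^ 2 ->
  Cmod (principal_part t m n h k w) <= exp (2 + 8 * PI * mu t m).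
Proof.
  intros Hd Hr. assert (HkR : 0 < INR k) by (apply lt_0_INR; auto).
  assert (Hk2 : 0 < INR k ^ 2) by (apply pow_lt; auto).
  rewrite Cmod_principal_part. set (rho := Re (/ w)%C / INR k ^ 2) in *.
  assert (Hr4 : rho <= 4).
  { unfold rho. apply Rmult_le_reg_r with (INR k ^ 2); auto. unfold Rdiv. rewrite Rmult_assoc, Rinv_l by lra. lra. }
  pose proof (pole_weight_ge_0 Hd) as Hpw. pose proof pole_growth as HG.
  rewrite exp_plus. set (p := Rpower _ _) in *. assert (Hp : 0 < p) by apply exp_pos.
  apply Rle_trans with (p * exp 2 * exp (4 * pole_weight t m k)).
  - apply Rmult_le_compat; try (left; apply exp_pos). apply Rmult_le_pos; left; auto; apply exp_pos.
    apply Rmult_le_compat_l; [lra|apply exp_le; auto]. apply exp_le. nra.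
  - pose proof (exp_pos 2). nra.
Qed.

End Cusp.

(** * Integrals of complex functions and the rectangular contour *)

Definition cint (f : R -> C) (a b : R) (I : C) : Prop :=
  is_RInt (fun s => Re (f s)) a b (Re I) /\ is_RInt (fun s => Im (f s)) a b (Im I).

Definition CInt (f : R -> C) (a b : R) : C := (RInt (fun s => Re (f s)) a b, RInt (fun s => Im (f s)) a b).

Lemma cint_unique : forall f a b I, cint f a b I -> CInt f a b = I.
Proof. intros f a b I [H1 H2]. apply C_eq; apply is_RInt_unique; auto. Qed.

Lemma cint_ext : forall f g a b I, (forall s, Rmin a b < s < Rmax a b -> f s = g s) -> cint f a b I -> cint g a b I.
Proof. intros f g a b I H [H1 H2]. split; eapply is_RInt_ext; eauto; intros; simpl; rewrite H; auto. Qed.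

Lemma cint_plus : forall f g a b I J, cint f a b I -> cint g a b J -> cint (fun s => f s + g s)%C a b (I + J)%C.
Proof.
  intros f g a b I J [H1 H2] [H3 H4]. split.
  - apply (is_RInt_plus (V := R_NormedModule) (fun s => Re (f s)) (fun s => Re (g s))); auto.
  - apply (is_RInt_plus (V := R_NormedModule) (fun s => Im (f s)) (fun s => Im (g s))); auto.
Qed.

Lemma cint_scal : forall k f a b I, cint f a b I -> cint (fun s => k * f s)%C a b (k * I)%C.
Proof.
  intros k f a b I [H1 H2]. split; simpl.
  - apply (is_RInt_minus (V := R_NormedModule) (fun s => fst k * fst (f s)) (fun s => snd k * snd (f s))).
    apply (is_RInt_scal (V := R_NormedModule) (fun s => Re (f s))); auto.
    apply (is_RInt_scal (V := R_NormedModule) (fun s => Im (f s))); auto.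
  - apply (is_RInt_plus (V := R_NormedModule) (fun s => fst k * snd (f s)) (fun s => snd k * fst (f s))).
    apply (is_RInt_scal (V := R_NormedModule) (fun s => Im (f s))); auto.
    apply (is_RInt_scal (V := R_NormedModule) (fun s => Re (f s))); auto.
Qed.

Lemma cint_minus : forall f g a b I J, cint f a b I -> cint g a b J -> cint (fun s => f s - g s)%C a b (I - J)%C.
Proof.
  intros. apply cint_ext with (fun s => f s + (- (1)) * g s)%C. intros; ring.
  replace (I - J)%C with (I + (- (1)) * J)%C by ring. apply cint_plus; auto. apply cint_scal; auto.
Qed.

Lemma cint_bound : forall f a b I M, a <= b -> (forall s, a <= s <= b -> Cmod (f s) <= M) -> cint f a b I ->
  Cmod I <= M * (b - a).
Proof.
  intros f a b I M Hab HM [H1 H2].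
  pose proof (is_RInt_fct_extend_pair (U := R_NormedModule) (V := R_NormedModule) f a b (Re I) (Im I) H1 H2) as H.
  rewrite Cmod_norm. rewrite Rmult_comm.
  apply (norm_RInt_le (V := C_R_NormedModule) f (fun _ => M) a b I ((b - a) * M)); auto.
  - intros x Hx. rewrite <- Cmod_norm. auto.
  - apply (is_RInt_const (V := R_NormedModule)).
Qed.

Lemma cder_continuous_Re : forall f s l, cder f s l -> continuous (fun x => Re (f x)) s.
Proof. intros f s l [H _]. apply (ex_derive_continuous (V := R_NormedModule)). eexists; eauto. Qed.
Lemma cder_continuous_Im : forall f s l, cder f s l -> continuous (fun x => Im (f x)) s.
Proof. intros f s l [_ H]. apply (ex_derive_continuous (V := R_NormedModule)). eexists; eauto. Qed.

Lemma cint_exists : forall f a b, a <= b -> (forall s, a <= s <= b -> exists l, cder f s l) -> cint f a b (CInt f a b).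
Proof.
  intros f a b Hab H. split; simpl; apply (RInt_correct (V := R_CompleteNormedModule)); apply (ex_RInt_continuous (V := R_CompleteNormedModule));
  intros z Hz; rewrite Rmin_left, Rmax_right in Hz by auto; destruct (H z Hz) as [l Hl].
  eapply cder_continuous_Re; eauto. eapply cder_continuous_Im; eauto.
Qed.

Lemma cint_FTC : forall F f a b, a <= b -> (forall s, a <= s <= b -> cder F s (f s)) ->
  (forall s, a <= s <= b -> exists l, cder f s l) -> cint f a b (F b - F a)%C.
Proof.
  intros F f a b Hab H1 H2. split; [rewrite Re_minus|rewrite Im_minus].
  - apply (is_RInt_derive (V := R_CompleteNormedModule) (fun s => Re (F s)) (fun s => Re (f s))); intros x Hx; rewrite Rmin_left, Rmax_right in Hx by auto.
    apply H1; auto. destruct (H2 x Hx). eapply cder_continuous_Re; eauto.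
  - apply (is_RInt_derive (V := R_CompleteNormedModule) (fun s => Im (F s)) (fun s => Im (f s))); intros x Hx; rewrite Rmin_left, Rmax_right in Hx by auto.
    apply H1; auto. destruct (H2 x Hx). eapply cder_continuous_Im; eauto.
Qed.

(** Complex differentiability on the punctured plane, tested along curves: enough for
    integrals over the sides of a rectangle. *)
Definition holo (f f' : C -> C) : Prop :=
  forall (g : R -> C) s v, g s <> RtoC 0 -> cder g s v -> cder (fun x => f (g x)) s (f' (g s) * v)%C.

Lemma holo_ext : forall f f' g g', (forall w, w <> RtoC 0 -> f' w = g' w) -> (forall w, f w = g w) -> holo f f' -> holo g g'.
Proof.
  intros f f' g g' H1 H2 Hf u s v Hu Hv. rewrite <- H1 by auto.
  apply cder_ext with (fun x => f (u x)). intros; apply H2. apply Hf; auto.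
Qed.

Lemma holo_const : forall c, holo (fun _ => c) (fun _ => RtoC 0).
Proof. intros c g s v _ _. eapply cder_eq. apply cder_const. ring. Qed.

Lemma holo_id : holo (fun w => w) (fun _ => RtoC 1).
Proof. intros g s v _ H. eapply cder_eq. exact H. ring. Qed.

Lemma holo_plus : forall f f' g g', holo f f' -> holo g g' -> holo (fun w => f w + g w)%C (fun w => f' w + g' w)%C.
Proof. intros f f' g g' Hf Hg u s v Hu Hv. eapply cder_eq. apply cder_plus; eauto. ring. Qed.

Lemma holo_mult : forall f f' g g', holo f f' -> holo g g' -> holo (fun w => f w * g w)%C (fun w => f' w * g w + f w * g' w)%C.
Proof. intros f f' g g' Hf Hg u s v Hu Hv. eapply cder_eq. apply cder_mult; eauto. cbv beta. ring. Qed.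

Lemma holo_inv : holo (fun w => / w)%C (fun w => - (/ w * / w))%C.
Proof. intros u s v Hu Hv. eapply cder_eq. apply cder_inv; eauto. cbv beta. field. auto. Qed.

Lemma holo_Cexp : forall f f', holo f f' -> holo (fun w => Cexp (f w)) (fun w => f' w * Cexp (f w))%C.
Proof. intros f f' Hf u s v Hu Hv. eapply cder_eq. apply cder_Cexp; eauto. cbv beta. ring. Qed.

Lemma holo_pow : forall f f' n, holo f f' -> holo (fun w => f w ^ S n)%C (fun w => RtoC (INR (S n)) * f' w * f w ^ n)%C.
Proof. intros f f' n Hf u s v Hu Hv. eapply cder_eq. apply (cder_pow (fun x => f (u x))). apply Hf; eauto. cbv beta. ring. Qed.

Lemma holo_pow_any : forall f f' n, holo f f' -> exists g, holo (fun w => f w ^ n)%C g.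
Proof.
  intros f f' [|n] Hf. exists (fun _ => RtoC 0). apply (holo_const 1). eexists. apply holo_pow; eauto.
Qed.

Lemma holo_scal : forall k f f', holo f f' -> holo (fun w => k * f w)%C (fun w => k * f' w)%C.
Proof. intros k f f' Hf u s v Hu Hv. eapply cder_eq. apply cder_scal; eauto. ring. Qed.

Section Rectangle.
Variables y r : R.
Hypothesis Hy : 0 < y.
Hypothesis Hr : 0 < r.

Definition side_right (v : R) : C := (RtoC y + RtoC v * Ci)%C.
Definition side_left (v : R) : C := (RtoC (- r) + RtoC v * Ci)%C.
Definition side_top (x : R) : C := (RtoC r * Ci + RtoC x * 1)%C.
Definition side_bottom (x : R) : C := (RtoC (- r) * Ci + RtoC x * 1)%C.

Lemma side_right_neq : forall v, side_right v <> RtoC 0.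
Proof. intros v E. apply (f_equal Re) in E. unfold side_right in E. simpl in E. lra. Qed.
Lemma side_left_neq : forall v, side_left v <> RtoC 0.
Proof. intros v E. apply (f_equal Re) in E. unfold side_left in E. simpl in E. lra. Qed.
Lemma side_top_neq : forall v, side_top v <> RtoC 0.
Proof. intros v E. apply (f_equal Im) in E. unfold side_top in E. simpl in E. lra. Qed.
Lemma side_bottom_neq : forall v, side_bottom v <> RtoC 0.
Proof. intros v E. apply (f_equal Im) in E. unfold side_bottom in E. simpl in E. lra. Qed.

(** The integral over the boundary of [-r, y] x [-r, r], counterclockwise.  The origin is
    inside; the right side is the piece of the circle of integration next to a cusp, in the
    local parameter. *)
Definition is_rect (f : C -> C) (I : C) : Prop :=
  exists R T L B, cint (fun v => f (side_right v)) (- r) r R /\ cint (fun x => f (side_top x)) (- r) y T /\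
    cint (fun v => f (side_left v)) (- r) r L /\ cint (fun x => f (side_bottom x)) (- r) y B /\
    I = (Ci * R - T - Ci * L + B)%C.

Lemma is_rect_exists : forall f f', holo f f' -> exists I, is_rect f I.
Proof.
  intros f f' Hf.
  assert (H : forall (g : R -> C) u v p q, (forall s, g s <> RtoC 0) -> (forall s, g s = (u + RtoC s * v)%C) -> p <= q ->
    cint (fun s => f (g s)) p q (CInt (fun s => f (g s)) p q)).
  { intros g u v p q H1 H2 H3. apply cint_exists; auto. intros s _. eexists. apply Hf; auto.
    apply cder_ext with (fun s => u + RtoC s * v)%C. intros; symmetry; apply H2. apply cder_affine. }
  eexists. exists (CInt (fun s => f (side_right s)) (- r) r), (CInt (fun s => f (side_top s)) (- r) y),
    (CInt (fun s => f (side_left s)) (- r) r), (CInt (fun s => f (side_bottom s)) (- r) y).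
  split; [|split; [|split; [|split]]].
  - apply (H side_right (RtoC y) Ci). apply side_right_neq. reflexivity. lra.
  - apply (H side_top (RtoC r * Ci)%C (RtoC 1)). apply side_top_neq. reflexivity. lra.
  - apply (H side_left (RtoC (- r)) Ci). apply side_left_neq. reflexivity. lra.
  - apply (H side_bottom (RtoC (- r) * Ci)%C (RtoC 1)). apply side_bottom_neq. reflexivity. lra.
  - reflexivity.
Qed.

Lemma is_rect_ext : forall f g I, (forall w, w <> RtoC 0 -> f w = g w) -> is_rect f I -> is_rect g I.
Proof.
  intros f g I H (R1 & T1 & L1 & B1 & H1 & H2 & H3 & H4 & E).
  exists R1, T1, L1, B1. split; [|split; [|split; [|split; auto]]].
  - eapply cint_ext; [|exact H1]. intros; apply H; apply side_right_neq.
  - eapply cint_ext; [|exact H2]. intros; apply H; apply side_top_neq.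
  - eapply cint_ext; [|exact H3]. intros; apply H; apply side_left_neq.
  - eapply cint_ext; [|exact H4]. intros; apply H; apply side_bottom_neq.
Qed.

Lemma is_rect_plus : forall f g I J, is_rect f I -> is_rect g J -> is_rect (fun w => f w + g w)%C (I + J)%C.
Proof.
  intros f g I J (R1 & T1 & L1 & B1 & H1 & H2 & H3 & H4 & ->) (R2 & T2 & L2 & B2 & K1 & K2 & K3 & K4 & ->).
  exists (R1 + R2)%C, (T1 + T2)%C, (L1 + L2)%C, (B1 + B2)%C.
  split; [|split; [|split; [|split]]].
  - apply (cint_plus (fun v => f (side_right v)) (fun v => g (side_right v))); auto.
  - apply (cint_plus (fun v => f (side_top v)) (fun v => g (side_top v))); auto.
  - apply (cint_plus (fun v => f (side_left v)) (fun v => g (side_left v))); auto.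
  - apply (cint_plus (fun v => f (side_bottom v)) (fun v => g (side_bottom v))); auto.
  - ring.
Qed.

Lemma is_rect_scal : forall k f I, is_rect f I -> is_rect (fun w => k * f w)%C (k * I)%C.
Proof.
  intros k f I (R1 & T1 & L1 & B1 & H1 & H2 & H3 & H4 & ->).
  exists (k * R1)%C, (k * T1)%C, (k * L1)%C, (k * B1)%C.
  split; [|split; [|split; [|split]]].
  - apply (cint_scal k (fun v => f (side_right v))); auto.
  - apply (cint_scal k (fun v => f (side_top v))); auto.
  - apply (cint_scal k (fun v => f (side_left v))); auto.
  - apply (cint_scal k (fun v => f (side_bottom v))); auto.
  - ring.
Qed.

Lemma is_rect_zero : is_rect (fun _ => RtoC 0) (RtoC 0).
Proof.
  destruct (is_rect_exists _ _ (holo_const 0)) as [I HI].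
  pose proof (is_rect_scal (RtoC 0) _ _ HI) as H. rewrite Cmult_0_l in H.
  eapply is_rect_ext; [|exact H]. intros; cbv beta; ring.
Qed.

Lemma is_rect_csum : forall (f : nat -> C -> C) (I : nat -> C) n,
  (forall j, (j < n)%nat -> is_rect (f j) (I j)) -> is_rect (fun w => csum (fun j => f j w) n) (csum I n).
Proof.
  induction n; intros; cbn [csum]. apply is_rect_zero.
  apply (is_rect_plus (fun w => csum (fun j => f j w) n) (f n)); auto.
Qed.

Lemma is_rect_primitive : forall F f f', holo F f -> holo f f' -> is_rect f (RtoC 0).
Proof.
  intros F f f' HF Hf.
  exists (/ Ci * (F (side_right r) - F (side_right (- r))))%C, (F (side_top y) - F (side_top (- r)))%C,
    (/ Ci * (F (side_left r) - F (side_left (- r))))%C, (F (side_bottom y) - F (side_bottom (- r)))%C.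
  pose proof Ci_nz as HC.
  split; [|split; [|split; [|split]]].
  - apply cint_ext with (fun v => / Ci * (f (side_right v) * Ci))%C. intros; field; auto.
    apply cint_scal. apply (cint_FTC (fun v => F (side_right v))). lra.
    intros s _. apply HF. apply side_right_neq. apply cder_affine.
    intros s _. eexists. apply cder_mult. apply Hf. apply side_right_neq. apply cder_affine. apply cder_const.
  - apply cint_ext with (fun v => f (side_top v) * 1)%C. intros; ring.
    apply (cint_FTC (fun v => F (side_top v))). lra.
    intros s _. apply HF. apply side_top_neq. apply cder_affine.
    intros s _. eexists. apply cder_mult. apply Hf. apply side_top_neq. apply cder_affine. apply cder_const.
  - apply cint_ext with (fun v => / Ci * (f (side_left v) * Ci))%C. intros; field; auto.
    apply cint_scal. apply (cint_FTC (fun v => F (side_left v))). lra.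
    intros s _. apply HF. apply side_left_neq. apply cder_affine.
    intros s _. eexists. apply cder_mult. apply Hf. apply side_left_neq. apply cder_affine. apply cder_const.
  - apply cint_ext with (fun v => f (side_bottom v) * 1)%C. intros; ring.
    apply (cint_FTC (fun v => F (side_bottom v))). lra.
    intros s _. apply HF. apply side_bottom_neq. apply cder_affine.
    intros s _. eexists. apply cder_mult. apply Hf. apply side_bottom_neq. apply cder_affine. apply cder_const.
  - replace (side_top y) with (side_right r) by (apply C_eq; unfold side_top, side_right; simpl; ring).
    replace (side_top (- r)) with (side_left r) by (apply C_eq; unfold side_top, side_left; simpl; ring).
    replace (side_bottom y) with (side_right (- r)) by (apply C_eq; unfold side_bottom, side_right; simpl; ring).
    replace (side_bottom (- r)) with (side_left (- r)) by (apply C_eq; unfold side_bottom, side_left; simpl; ring).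
    field. auto.
Qed.

Lemma rect_Cmod_ge : (forall v, Rmin y r <= Cmod (side_right v)) /\ (forall x, Rmin y r <= Cmod (side_top x)) /\
  (forall v, Rmin y r <= Cmod (side_left v)) /\ (forall x, Rmin y r <= Cmod (side_bottom x)).
Proof.
  pose proof (Rmin_l y r). pose proof (Rmin_r y r).
  repeat split; intros.
  - eapply Rle_trans; [|apply re_le_Cmod]. unfold side_right. simpl. replace (y + (v * 0 - 0 * 1)) with y by ring. rewrite Rabs_pos_eq; lra.
  - eapply Rle_trans; [|apply im_le_Cmod]. unfold side_top. simpl. replace (r * 1 + 0 * 0 + (x * 0 + 0 * 1)) with r by ring. rewrite Rabs_pos_eq; lra.
  - eapply Rle_trans; [|apply re_le_Cmod]. unfold side_left. simpl. replace (- r + (v * 0 - 0 * 1)) with (- r) by ring. rewrite Rabs_Ropp, Rabs_pos_eq; lra.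
  - eapply Rle_trans; [|apply im_le_Cmod]. unfold side_bottom. simpl. replace (- r * 1 + 0 * 0 + (x * 0 + 0 * 1)) with (- r) by ring. rewrite Rabs_Ropp, Rabs_pos_eq; lra.
Qed.

Lemma rect_Cmod_le : (forall v, - r <= v <= r -> Cmod (side_right v) <= y + r) /\ (forall x, - r <= x <= y -> Cmod (side_top x) <= y + 2 * r) /\
  (forall v, - r <= v <= r -> Cmod (side_left v) <= 2 * r) /\ (forall x, - r <= x <= y -> Cmod (side_bottom x) <= y + 2 * r).
Proof.
  assert (A : forall v, - r <= v <= r -> Cmod (RtoC v * Ci)%C <= r).
  { intros. rewrite Cmod_mult, Cmod_Ci, Cmod_R, Rmult_1_r. apply Rabs_le. auto. }
  assert (B : forall x, - r <= x <= y -> Cmod (RtoC x * 1)%C <= y + r).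
  { intros. rewrite Cmod_mult, Cmod_1, Cmod_R, Rmult_1_r. apply Rabs_le. lra. }
  assert (Hrr : Cmod (RtoC (- r))%C = r) by (rewrite Cmod_R, Rabs_Ropp, Rabs_pos_eq; lra).
  assert (Hrp : Cmod (RtoC r)%C = r) by (rewrite Cmod_R, Rabs_pos_eq; lra).
  repeat split; intros; (eapply Rle_trans; [apply Cmod_triangle|]); rewrite ?(Cmod_mult _ Ci).
  - pose proof (A v H). rewrite Cmod_mult in H0. rewrite Cmod_RtoC by lra. lra.
  - pose proof (B x H). rewrite Hrp, Cmod_Ci. lra.
  - pose proof (A v H). rewrite Cmod_mult in H0. rewrite Hrr. lra.
  - pose proof (B x H). rewrite Hrr, Cmod_Ci. lra.
Qed.

Lemma is_rect_bound : forall f I M,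
  (forall w, Rmin y r <= Cmod w -> Cmod w <= y + 2 * r -> Cmod (f w) <= M) -> is_rect f I ->
  Cmod I <= M * (2 * y + 6 * r).
Proof.
  intros f I M HM (R1 & T1 & L1 & B1 & H1 & H2 & H3 & H4 & ->).
  destruct rect_Cmod_ge as (G1 & G2 & G3 & G4). destruct rect_Cmod_le as (U1 & U2 & U3 & U4).
  assert (K1 : Cmod R1 <= M * (r - - r)).
  { apply cint_bound with (fun v => f (side_right v)); auto. lra. intros s Hs. apply HM; auto. specialize (U1 s Hs); lra. }
  assert (K2 : Cmod T1 <= M * (y - - r)).
  { apply cint_bound with (fun v => f (side_top v)); auto. lra. }
  assert (K3 : Cmod L1 <= M * (r - - r)).
  { apply cint_bound with (fun v => f (side_left v)); auto. lra. intros s Hs. apply HM; auto. specialize (U3 s Hs); lra. }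
  assert (K4 : Cmod B1 <= M * (y - - r)).
  { apply cint_bound with (fun v => f (side_bottom v)); auto. lra. }
  eapply Rle_trans. apply Cmod_triangle. eapply Rle_trans. apply Rplus_le_compat_r. apply Cmod_minus_triangle.
  eapply Rle_trans. apply Rplus_le_compat_r. apply Rplus_le_compat_r. apply Cmod_minus_triangle.
  rewrite !Cmod_mult, Cmod_Ci. lra.
Qed.

Lemma Clog_rotate : forall z, 0 < Re z -> 0 < Im z -> (Clog (- Ci * z) = Clog z - RtoC (PI / 2) * Ci)%C.
Proof.
  intros z H1 H2. pose proof (Clog_mult_quarter 1 (- Ci * z)%C z) as H. rewrite Clog_1 in H.
  rewrite <- H; try ring; auto. simpl; lra. destruct z; simpl in *; lra.
Qed.

(** Each side lies in a rotated half plane, where a rotated principal logarithm is a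
    primitive; going around, the four logarithms pick up a quarter turn each. *)
Lemma is_rect_inv : is_rect (fun w => / w)%C (RtoC (2 * PI) * Ci)%C.
Proof.
  pose proof Ci_nz as HC.
  assert (HCi : (/ Ci = - Ci)%C) by apply Ci_inv.
  assert (Hi : forall (g : R -> C) s v, g s <> RtoC 0 -> cder g s v -> exists l, cder (fun x => / g x)%C s l).
  { intros. eexists. apply cder_inv; eauto. }
  assert (Hlog : forall e (g : R -> C) s v, e <> RtoC 0 -> 0 < Re (e * g s)%C -> cder g s v -> cder (fun x => Clog (e * g x)) s (v / g s)%C).
  { intros e g s v He Hp Hg. assert (Hgn : g s <> RtoC 0) by (intro E; rewrite E in Hp; rewrite Cmult_0_r in Hp; simpl in Hp; lra).
    eapply cder_eq. apply cder_Clog. exact Hp. apply cder_scal. exact Hg. cbv beta. field. auto. }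
  exists (/ Ci * (Clog (1 * side_right r) - Clog (1 * side_right (- r))))%C, (Clog (- Ci * side_top y) - Clog (- Ci * side_top (- r)))%C,
    (/ Ci * (Clog (- (1) * side_left r) - Clog (- (1) * side_left (- r))))%C, (Clog (Ci * side_bottom y) - Clog (Ci * side_bottom (- r)))%C.
  assert (N1 : (- Ci)%C <> RtoC 0) by (intro E; apply HC; replace Ci with (- - Ci)%C by ring; rewrite E; ring).
  assert (N2 : (- (1))%C <> RtoC 0) by (intro E; apply C1_nz; replace (RtoC 1) with (- - (1))%C by ring; rewrite E; ring).
  split; [|split; [|split; [|split]]].
  - apply cint_ext with (fun v => / Ci * (Ci / side_right v))%C. intros; field; split; auto. apply side_right_neq.
    apply cint_scal. apply (cint_FTC (fun v => Clog (1 * side_right v))). lra.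
    intros s _. apply (Hlog 1%R side_right). apply C1_nz. unfold side_right; simpl; lra. apply cder_affine.
    intros s _. eexists. apply cder_div. apply side_right_neq. apply cder_const. apply cder_affine.
  - apply cint_ext with (fun v => 1 / side_top v)%C. intros; field; apply side_top_neq.
    apply (cint_FTC (fun v => Clog (- Ci * side_top v))). lra.
    intros s _. apply (Hlog (- Ci)%C side_top); auto. unfold side_top; simpl; lra. apply cder_affine.
    intros s _. eexists. apply cder_div. apply side_top_neq. apply cder_const. apply cder_affine.
  - apply cint_ext with (fun v => / Ci * (Ci / side_left v))%C. intros; field; split; auto. apply side_left_neq.
    apply cint_scal. apply (cint_FTC (fun v => Clog (- (1) * side_left v))). lra.
    intros s _. apply (Hlog (- (1))%C side_left); auto. unfold side_left; simpl; lra. apply cder_affine.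
    intros s _. eexists. apply cder_div. apply side_left_neq. apply cder_const. apply cder_affine.
  - apply cint_ext with (fun v => 1 / side_bottom v)%C. intros; field; apply side_bottom_neq.
    apply (cint_FTC (fun v => Clog (Ci * side_bottom v))). lra.
    intros s _. apply (Hlog Ci side_bottom); auto. unfold side_bottom; simpl; lra. apply cder_affine.
    intros s _. eexists. apply cder_div. apply side_bottom_neq. apply cder_const. apply cder_affine.
  - (* up to rotation, the corners are p1, p2, p2 and p4 *)
    set (p1 := (RtoC y + RtoC r * Ci)%C). set (p2 := (RtoC r + RtoC r * Ci)%C). set (p4 := (RtoC r + RtoC y * Ci)%C).
    replace (1 * side_right r)%C with p1 by (unfold p1, side_right; ring).
    replace (- Ci * side_top y)%C with (- Ci * p1)%C by (unfold p1, side_top; ring).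
    replace (- Ci * side_top (- r))%C with p2 by (apply C_eq; unfold side_top, p2; simpl; ring).
    replace (- (1) * side_left r)%C with (- Ci * p2)%C by (apply C_eq; unfold side_left, p2; simpl; ring).
    replace (- (1) * side_left (- r))%C with p2 by (apply C_eq; unfold side_left, p2; simpl; ring).
    replace (Ci * side_bottom (- r))%C with (- Ci * p2)%C by (apply C_eq; unfold side_bottom, p2; simpl; ring).
    replace (Ci * side_bottom y)%C with p4 by (apply C_eq; unfold side_bottom, p4; simpl; ring).
    replace (1 * side_right (- r))%C with (- Ci * p4)%C by (apply C_eq; unfold side_right, p4; simpl; ring).
    rewrite !Clog_rotate by (unfold p1, p2, p4; simpl; lra).
    replace (2 * PI) with (PI / 2 * 4) by field. rewrite RtoC_mult. field. auto.
Qed.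

End Rectangle.

(** * The contour integral of the Bessel function *)

Lemma pow_fact_lim : forall x, is_lim_seq (fun n => x ^ n / INR (fact n)) 0.
Proof. intros x. apply is_lim_seq_Reals. apply cv_speed_pow_fact. Qed.

(** The contour lies in the annulus on which the convergence is uniform. *)
Lemma is_rect_limit : forall y r, 0 < y -> 0 < r -> forall f f' (fn : nat -> C -> C) In I (e : nat -> R),
  holo f f' -> (forall n, is_rect y r (fn n) (In n)) ->
  (forall n w, Rmin y r <= Cmod w -> Cmod w <= y + 2 * r -> Cmod (f w - fn n w)%C <= e n) ->
  is_lim_seq e 0 -> Clim In I -> is_rect y r f I.
Proof.
  intros y r Hy Hr f f' fn In I e Hf Hn He Hl HI.
  destruct (is_rect_exists y r Hy Hr f f' Hf) as [I' HI'].
  replace I with I'; auto. apply Clim_unique with In; auto.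
  apply Clim_squeeze with (fun n => (2 * y + 6 * r) * e n). 2: apply is_lim_seq_scal_0; auto.
  intros n. rewrite Cmod_minus_sym, Rmult_comm. apply (is_rect_bound y r Hy Hr (fun w => f w - fn n w)%C). apply He.
  apply (is_rect_ext y r Hy Hr (fun w => f w + (- (1)) * fn n w)%C); auto. intros; ring.
  replace (I' - In n)%C with (I' + (- (1)) * In n)%C by ring. apply is_rect_plus; auto. apply is_rect_scal; auto.
Qed.

Lemma holo_Cexp_lin : forall a, holo (fun w => Cexp (RtoC a * w))%C (fun w => RtoC a * Cexp (RtoC a * w))%C.
Proof.
  intros a. eapply holo_ext; [| |apply (holo_Cexp (fun w => RtoC a * w)%C); apply (holo_scal (RtoC a)); apply holo_id].
  intros; cbv beta; ring. intros; reflexivity.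
Qed.

Section BesselContour.
Variables (y r a b : R).
Hypothesis Hy : 0 < y.
Hypothesis Hr : 0 < r.
Hypothesis Ha : 0 < a.
Hypothesis Hb : 0 <= b.

Lemma rho_pos : 0 < Rmin y r.
Proof. apply Rmin_glb_lt; auto. Qed.

Lemma neq_of_rho : forall w, Rmin y r <= Cmod w -> w <> RtoC 0.
Proof. intros w H. apply Cmod_gt_0. pose proof rho_pos. lra. Qed.

Lemma rect_exp : is_rect y r (fun w => Cexp (RtoC a * w))%C (RtoC 0).
Proof.
  apply (is_rect_primitive y r Hy Hr (fun w => / RtoC a * Cexp (RtoC a * w))%C _ (fun w => RtoC a * Cexp (RtoC a * w))%C).
  - eapply holo_ext; [| |apply (holo_scal (/ RtoC a)); apply (holo_Cexp_lin a)].
    intros w _; cbv beta. set (e := Cexp (RtoC a * w)%C). field. apply RtoC_neq; lra. intros; reflexivity.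
  - apply holo_Cexp_lin.
Qed.

Lemma rect_pow : forall j, is_rect y r (fun w => w ^ j)%C (RtoC 0).
Proof.
  intros j. destruct (holo_pow_any _ _ j holo_id) as [g Hg].
  apply (is_rect_primitive y r Hy Hr (fun w => / RtoC (INR (S j)) * w ^ S j)%C _ g); auto.
  eapply holo_ext; [| |apply (holo_scal (/ RtoC (INR (S j)))); apply (holo_pow (fun w => w) (fun _ => RtoC 1) j); apply holo_id].
  intros w _. cbv beta. set (p := (w ^ j)%C). field. apply INR_S_neq. intros; reflexivity.
Qed.

(** Only the constant term of the exponential series contributes. *)
Lemma rect_exp_inv : is_rect y r (fun w => Cexp (RtoC a * w) * / w)%C (RtoC (2 * PI) * Ci)%C.
Proof.
  set (rho := Rmin y r). pose proof rho_pos as Hrho. fold rho in Hrho. set (B := y + 2 * r).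
  eapply (is_rect_limit y r Hy Hr _ _ (fun n w => csum (fun j => / RtoC (INR (fact j)) * (RtoC a * w) ^ j * / w) (S n))%C
    (fun n => csum (fun j => match j with O => RtoC (2 * PI) * Ci | S _ => RtoC 0 end)%C (S n)) _
    (fun n => exp (a * B) * / rho * ((a * B) ^ S n / INR (fact (S n))))).
  - apply holo_mult. apply holo_Cexp_lin. apply holo_inv.
  - intros n. apply (is_rect_csum y r Hy Hr (fun j w => / RtoC (INR (fact j)) * (RtoC a * w) ^ j * / w)%C).
    intros [|j] _.
    + apply (is_rect_ext y r Hy Hr (fun w => / w)%C). intros; simpl. field; auto. apply is_rect_inv; auto.
    + replace (RtoC 0) with (/ RtoC (INR (fact (S j))) * RtoC a ^ S j * RtoC 0)%C by ring.
      apply (is_rect_ext y r Hy Hr (fun w => / RtoC (INR (fact (S j))) * RtoC a ^ S j * (w ^ j))%C).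
      intros. rewrite Cpow_mult_l. rewrite (Cpow_S w). field. split; auto. apply RtoC_neq. apply INR_fact_neq_0.
      apply is_rect_scal; auto. apply rect_pow.
  - intros n w H1 H2. fold B in H2. fold rho in H1. assert (Hw := neq_of_rho w H1).
    replace (csum (fun j => / RtoC (INR (fact j)) * (RtoC a * w) ^ j * / w)%C (S n))
      with (/ w * csum (fun j => / RtoC (INR (fact j)) * (RtoC a * w) ^ j)%C (S n))%C.
    2:{ rewrite <- csum_scal. apply csum_ext. intros; ring. }
    replace (Cexp (RtoC a * w) * / w - / w * csum (fun j => / RtoC (INR (fact j)) * (RtoC a * w) ^ j) (S n))%C
      with (/ w * (Cexp (RtoC a * w) - csum (fun j => / RtoC (INR (fact j)) * (RtoC a * w) ^ j) (S n)))%C by ring.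
    rewrite Cmod_mult, Cmod_inv by auto.
    replace (exp (a * B) * / rho * ((a * B) ^ S n / INR (fact (S n)))) with (/ rho * ((a * B) ^ S n / INR (fact (S n)) * exp (a * B))) by ring.
    pose proof (INR_fact_lt_0 (S n)) as Hf.
    assert (HaB : Cmod (RtoC a * w)%C <= a * B) by (rewrite Cmod_mult, Cmod_RtoC by lra; apply Rmult_le_compat_l; lra).
    pose proof (Cmod_ge_0 (RtoC a * w)%C).
    apply Rmult_le_compat. left; apply Rinv_0_lt_compat; lra. apply Cmod_ge_0. apply Rinv_le_contravar; auto.
    eapply Rle_trans. apply Cexp_taylor.
    apply Rmult_le_compat. apply Rmult_le_pos. apply pow_le; auto. left; apply Rinv_0_lt_compat; auto. left; apply exp_pos.
    apply Rmult_le_compat_r. left; apply Rinv_0_lt_compat; auto. apply pow_incr; auto. apply exp_le; auto.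
  - apply is_lim_seq_scal_0. apply (is_lim_seq_incr_1 (fun n => (a * B) ^ n / INR (fact n))). apply pow_fact_lim.
  - apply Clim_ext with (fun _ => RtoC (2 * PI) * Ci)%C. 2: apply Clim_const.
    intros n. rewrite csum_S_l. replace (csum (fun _ => RtoC 0) n) with (RtoC 0) by (clear; induction n; simpl; [|rewrite <- IHn]; ring). ring.
Qed.

(** By induction, integrating [w^-(j+1)] by parts. *)
Lemma rect_exp_inv_pow : forall j, is_rect y r (fun w => Cexp (RtoC a * w) * (/ w) ^ S j)%C (RtoC (2 * PI * (a ^ j / INR (fact j))) * Ci)%C.
Proof.
  induction j.
  - apply (is_rect_ext y r Hy Hr (fun w => Cexp (RtoC a * w) * / w)%C). intros; simpl; ring.
    replace (2 * PI * (a ^ 0 / INR (fact 0))) with (2 * PI) by (simpl; field). apply rect_exp_inv.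
  - set (F := fun w => (Cexp (RtoC a * w) * (/ w) ^ S j)%C).
    set (f := fun w => (RtoC a * (Cexp (RtoC a * w) * (/ w) ^ S j) + - RtoC (INR (S j)) * (Cexp (RtoC a * w) * (/ w) ^ S (S j)))%C).
    assert (HF : holo F f).
    { eapply holo_ext; [| |apply (holo_mult (fun w => Cexp (RtoC a * w))%C (fun w => RtoC a * Cexp (RtoC a * w))%C (fun w => (/ w) ^ S j)%C (fun w => RtoC (INR (S j)) * (- (/ w * / w)) * (/ w) ^ j)%C);
         [apply (holo_Cexp_lin a)|apply (holo_pow (fun w => / w)%C (fun w => - (/ w * / w))%C j); apply holo_inv]].
      - intros w Hw. unfold f. cbv beta. rewrite (Cpow_S (/ w) (S j)), (Cpow_S (/ w) j). ring.
      - intros; reflexivity. }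
    assert (Hf : exists f', holo f f').
    { eexists. unfold f. apply holo_plus; apply holo_scal; (apply holo_mult; [apply (holo_Cexp_lin a)|apply (holo_pow (fun w => / w)%C (fun w => - (/ w * / w))%C); apply holo_inv]). }
    destruct Hf as [f' Hf].
    pose proof (is_rect_primitive y r Hy Hr F f f' HF Hf) as H0.
    pose proof (INR_S_neq j) as Hj.
    apply (is_rect_ext y r Hy Hr (fun w => - / RtoC (INR (S j)) * (f w + - RtoC a * (Cexp (RtoC a * w) * (/ w) ^ S j)))%C).
    intros w _. unfold f. set (p := ((/ w) ^ S j)%C). set (q := ((/ w) ^ S (S j))%C). field. auto. auto.
    replace (RtoC (2 * PI * (a ^ S j / INR (fact (S j)))) * Ci)%C
      with (- / RtoC (INR (S j)) * (RtoC 0 + - RtoC a * (RtoC (2 * PI * (a ^ j / INR (fact j))) * Ci)))%C.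
    apply is_rect_scal; auto. apply is_rect_plus; auto. apply is_rect_scal; auto.
    rewrite fact_simpl, mult_INR.
    replace (2 * PI * (a ^ S j / (INR (S j) * INR (fact j)))) with (/ INR (S j) * a * (2 * PI * (a ^ j / INR (fact j)))).
    rewrite !(RtoC_mult (/ INR (S j) * a)), (RtoC_mult (/ INR (S j))), RtoC_inv by (apply not_0_INR; lia). ring.
    simpl pow. field. split. apply INR_fact_neq_0. apply not_0_INR; lia.
Qed.

End BesselContour.

Definition bessel_term (a b : R) (j : nat) : R := b ^ S j / INR (fact (S j)) * (a ^ j / INR (fact j)).
(** sqrt (b/a) I_1 (2 sqrt (a b)), free of square roots. *)
Definition bessel_value (a b : R) : R := Series (bessel_term a b).

Lemma is_series_exp : forall x, is_series (fun n => x ^ n / INR (fact n)) (exp x).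
Proof.
  intros x. pose proof (is_exp_Reals x) as H. unfold is_pseries in H.
  eapply is_series_ext; [|exact H]. intros n. simpl. unfold scal; simpl. unfold mult; simpl. rewrite pow_n_pow. reflexivity.
Qed.

Lemma bessel_term_le : forall a b j, 0 <= a -> 0 <= b -> 0 <= bessel_term a b j <= b * ((a * b) ^ j / INR (fact j)).
Proof.
  intros a b j Ha Hb. unfold bessel_term. pose proof (INR_fact_lt_0 j). pose proof (INR_fact_lt_0 (S j)).
  assert (0 <= b ^ S j) by (apply pow_le; auto). assert (0 <= a ^ j) by (apply pow_le; auto).
  assert (0 <= a ^ j / INR (fact j)) by (apply Rmult_le_pos; auto; left; apply Rinv_0_lt_compat; auto).
  split. apply Rmult_le_pos; auto. apply Rmult_le_pos; auto. left; apply Rinv_0_lt_compat; auto.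
  replace (b * ((a * b) ^ j / INR (fact j))) with (b ^ S j * (a ^ j / INR (fact j))) by (rewrite Rpow_mult_distr; simpl; field; lra).
  apply Rmult_le_compat_r; auto. apply Rle_trans with (b ^ S j / 1). 2: lra.
  apply Rmult_le_compat_l; auto. apply Rinv_le_contravar. lra.
  replace 1 with (INR 1) by reflexivity. apply le_INR. pose proof (lt_O_fact (S j)). lia.
Qed.

Lemma ex_series_bessel : forall a b, 0 <= a -> 0 <= b -> ex_series (bessel_term a b).
Proof.
  intros a b Ha Hb. apply (ex_series_le (V := R_CompleteNormedModule) _ (fun j => b * ((a * b) ^ j / INR (fact j)))).
  - intros j. unfold norm; simpl; unfold abs; simpl. pose proof (bessel_term_le a b j Ha Hb). rewrite Rabs_pos_eq; lra.
  - eexists. apply (is_series_scal_l (V := R_NormedModule) b (fun j => (a * b) ^ j / INR (fact j))). apply is_series_exp.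
Qed.

(** Expand [exp (b / w)]: the residue at the essential singularity is a sum over its terms. *)
Lemma rect_bessel : forall y r a b, 0 < y -> 0 < r -> 0 < a -> 0 <= b ->
  is_rect y r (fun w => Cexp (RtoC a * w + RtoC b * / w))%C (RtoC (2 * PI * bessel_value a b) * Ci)%C.
Proof.
  intros y r a b Hy Hr Ha Hb.
  set (rho := Rmin y r). pose proof (rho_pos y r Hy Hr) as Hrho. fold rho in Hrho. set (B := y + 2 * r).
  eapply (is_rect_limit y r Hy Hr _ _ (fun n w => csum (fun j => / RtoC (INR (fact j)) * RtoC b ^ j * (Cexp (RtoC a * w) * (/ w) ^ j)) (S n))%C
    (fun n => csum (fun j => match j with O => RtoC 0 | S j => RtoC (2 * PI * bessel_term a b j) * Ci end)%C (S n)) _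
    (fun n => exp (a * B) * exp (b * / rho) * ((b * / rho) ^ S n / INR (fact (S n))))).
  - apply (holo_Cexp (fun w => RtoC a * w + RtoC b * / w)%C). apply holo_plus; apply holo_scal. apply holo_id. apply holo_inv.
  - intros n. apply (is_rect_csum y r Hy Hr (fun j w => / RtoC (INR (fact j)) * RtoC b ^ j * (Cexp (RtoC a * w) * (/ w) ^ j))%C).
    intros [|j] _.
    + apply (is_rect_ext y r Hy Hr (fun w => Cexp (RtoC a * w))%C); auto. intros; simpl. field; auto. apply rect_exp; auto.
    + replace (RtoC (2 * PI * bessel_term a b j) * Ci)%C
        with (/ RtoC (INR (fact (S j))) * RtoC b ^ S j * (RtoC (2 * PI * (a ^ j / INR (fact j))) * Ci))%C.
      apply is_rect_scal; auto. apply rect_exp_inv_pow; auto.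
      unfold bessel_term. rewrite <- RtoC_inv, <- RtoC_pow by apply INR_fact_neq_0.
      replace (2 * PI * (b ^ S j / INR (fact (S j)) * (a ^ j / INR (fact j))))
        with (/ INR (fact (S j)) * b ^ S j * (2 * PI * (a ^ j / INR (fact j)))) by (unfold Rdiv; ring).
      rewrite !(RtoC_mult (/ INR (fact (S j)) * b ^ S j)), (RtoC_mult (/ INR (fact (S j)))). ring.
  - intros n w H1 H2. fold B in H2. fold rho in H1. assert (Hw : w <> RtoC 0) by (apply Cmod_gt_0; lra).
    replace (csum (fun j => / RtoC (INR (fact j)) * RtoC b ^ j * (Cexp (RtoC a * w) * (/ w) ^ j))%C (S n))
      with (Cexp (RtoC a * w) * csum (fun j => / RtoC (INR (fact j)) * (RtoC b * / w) ^ j)%C (S n))%C.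
    2:{ rewrite <- csum_scal. apply csum_ext. intros. rewrite Cpow_mult_l. ring. }
    rewrite Cexp_plus.
    match goal with |- Cmod (?u * ?v - ?u * ?x)%C <= _ => replace (u * v - u * x)%C with (u * (v - x))%C by ring end.
    rewrite Cmod_mult.
    replace (exp (a * B) * exp (b * / rho) * ((b * / rho) ^ S n / INR (fact (S n)))) with (exp (a * B) * ((b * / rho) ^ S n / INR (fact (S n)) * exp (b * / rho))) by ring.
    pose proof (INR_fact_lt_0 (S n)) as Hf.
    assert (Hbw : Cmod (RtoC b * / w)%C <= b * / rho).
    { rewrite Cmod_mult, Cmod_inv, Cmod_RtoC by auto. apply Rmult_le_compat_l; auto. apply Rinv_le_contravar; auto. }
    pose proof (Cmod_ge_0 (RtoC b * / w)%C).
    apply Rmult_le_compat. apply Cmod_ge_0. apply Cmod_ge_0.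
    rewrite Cmod_Cexp, re_scal_l. apply exp_le. apply Rmult_le_compat_l. lra.
    eapply Rle_trans. apply Rle_abs. eapply Rle_trans. apply re_le_Cmod. auto.
    eapply Rle_trans. apply Cexp_taylor.
    apply Rmult_le_compat. apply Rmult_le_pos. apply pow_le; auto. left; apply Rinv_0_lt_compat; auto. left; apply exp_pos.
    apply Rmult_le_compat_r. left; apply Rinv_0_lt_compat; auto. apply pow_incr; auto. apply exp_le; auto.
  - apply is_lim_seq_scal_0. apply (is_lim_seq_incr_1 (fun n => (b * / rho) ^ n / INR (fact n))). apply pow_fact_lim.
  - apply Clim_ext with (fun n => RtoC (2 * PI * rsum (bessel_term a b) n) * Ci)%C.
    + intros n. rewrite csum_S_l, Cplus_0_l. induction n; cbn [csum rsum].
      * rewrite Rmult_0_r. ring.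
      * rewrite <- IHn, Rmult_plus_distr_l, RtoC_plus. ring.
    + apply Clim_of_components.
      * apply is_lim_seq_ext with (fun _ => 0). intros; simpl; ring.
        replace (Re (RtoC (2 * PI * bessel_value a b) * Ci)%C) with 0 by (simpl; ring). apply is_lim_seq_const.
      * apply is_lim_seq_ext with (fun n => 2 * PI * rsum (bessel_term a b) n). intros; simpl; ring.
        replace (Im (RtoC (2 * PI * bessel_value a b) * Ci)%C) with (2 * PI * bessel_value a b) by (simpl; ring).
        apply (is_lim_seq_scal_l _ (2 * PI) (Finite (bessel_value a b))). apply is_series_rsum. apply Series_correct. apply ex_series_bessel; lra.
Qed.

Lemma cint_reflect : forall f c r I, cint f (- r) r I -> cint (fun x => f (c - x)) (c - r) (c + r) I.
Proof.
  assert (G : forall (f : R -> R) c r (I : R), is_RInt f (- r) r I -> is_RInt (fun x => f (c - x)) (c - r) (c + r) I).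
  { intros f c r I H. apply is_RInt_swap in H.
    pose proof (is_RInt_comp_lin f (-1) c (c - r) (c + r) (opp I)) as H1.
    replace (-1 * (c - r) + c) with r in H1 by ring. replace (-1 * (c + r) + c) with (- r) in H1 by ring.
    specialize (H1 H). apply (is_RInt_scal (V := R_NormedModule) _ _ _ (-1)) in H1.
    assert (E : I = scal (-1) (opp I)) by (unfold scal, opp; simpl; unfold mult; simpl; ring).
    rewrite E. eapply is_RInt_ext; [|exact H1]. intros x _. simpl. unfold scal; simpl; unfold mult; simpl.
    replace (-1 * x + c) with (c - x) by ring. ring. }
  intros f c r I [H1 H2]. split.
  apply (G (fun s => Re (f s))); auto. apply (G (fun s => Im (f s))); auto.
Qed.

Lemma Re_inv_coord : forall z, z <> RtoC 0 -> Re (/ z)%C = Re z / (Re z ^ 2 + Im z ^ 2).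
Proof. intros [u v] H. reflexivity. Qed.

(** Close the chord to the rectangle.  The other three sides
    contribute the error, because there [Re (1/w)] is at most [y / r^2]. *)
Lemma chord_integral : forall y r a b c, 0 < y -> 0 < r -> 0 < a -> 0 <= b ->
  exists J, cint (fun phi => let w := (RtoC y - RtoC (phi - c) * Ci)%C in Cexp (RtoC a * w + RtoC b * / w)%C) (c - r) (c + r) J /\
    Cmod (J - RtoC (2 * PI * bessel_value a b))%C <= (2 * y + 4 * r) * exp (a * y + b * (y / r ^ 2)).
Proof.
  intros y r a b c Hy Hr Ha Hb.
  set (f := fun w => Cexp (RtoC a * w + RtoC b * / w)%C).
  destruct (rect_bessel y r a b Hy Hr Ha Hb) as (R1 & T1 & L1 & B1 & H1 & H2 & H3 & H4 & E).
  exists R1. split.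
  - pose proof (cint_reflect _ c r R1 H1) as H. eapply cint_ext; [|exact H]. intros s _. cbv zeta beta. unfold side_right.
    replace (RtoC y - RtoC (s - c) * Ci)%C with (RtoC y + RtoC (c - s) * Ci)%C by (rewrite !RtoC_minus; ring). reflexivity.
  - set (M := exp (a * y + b * (y / r ^ 2))).
    assert (Hyr : 0 <= y / r ^ 2) by (apply Rmult_le_pos; [lra|left; apply Rinv_0_lt_compat; apply pow_lt; auto]).
    assert (Hhor : forall x v, v ^ 2 = r ^ 2 -> x <= y -> forall w, Re w = x -> Im w = v -> Cmod (f w) <= M).
    { intros x v Hv Hx w E1 E2. assert (Hr2 : 0 < r ^ 2) by (apply pow_lt; auto).
      assert (Hw : w <> RtoC 0). { intro Z. rewrite Z in E2. simpl in E2. subst v. simpl in Hv. nra. }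
      unfold f, M. rewrite Cmod_Cexp, re_plus, !re_scal_l, Re_inv_coord by auto. rewrite E1, E2, Hv. apply exp_le.
      apply Rplus_le_compat. apply Rmult_le_compat_l; lra. apply Rmult_le_compat_l; auto.
      destruct (Rle_dec 0 x).
      - apply Rmult_le_compat; auto. left; apply Rinv_0_lt_compat; nra. apply Rinv_le_contravar; nra.
      - apply Rle_trans with 0; auto. assert (0 < / (x ^ 2 + r ^ 2)) by (apply Rinv_0_lt_compat; nra). unfold Rdiv. nra. }
    assert (K2 : Cmod T1 <= M * (y - - r)).
    { apply cint_bound with (fun v => f (side_top r v)); auto. lra. intros s Hs. apply (Hhor s r); auto. lra.
      unfold side_top; simpl; ring. unfold side_top; simpl; ring. }
    assert (K4 : Cmod B1 <= M * (y - - r)).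
    { apply cint_bound with (fun v => f (side_bottom r v)); auto. lra. intros s Hs. apply (Hhor s (- r)); auto. simpl; ring. lra.
      unfold side_bottom; simpl; ring. unfold side_bottom; simpl; ring. }
    assert (K3 : Cmod L1 <= M * (r - - r)).
    { apply cint_bound with (fun v => f (side_left r v)); auto. lra. intros s Hs. unfold f, M. rewrite Cmod_Cexp, re_plus, !re_scal_l.
      rewrite Re_inv_coord by (apply side_left_neq; auto). apply exp_le.
      replace (Re (side_left r s)) with (- r) by (unfold side_left; simpl; ring).
      assert (0 < / ((- r) ^ 2 + Im (side_left r s) ^ 2)) by (apply Rinv_0_lt_compat; nra).
      assert (0 <= b * (y / r ^ 2)) by (apply Rmult_le_pos; auto).
      assert (0 <= b * (r * / ((- r) ^ 2 + Im (side_left r s) ^ 2))) by (apply Rmult_le_pos; auto; apply Rmult_le_pos; lra).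
      unfold Rdiv at 1. nra. }
    assert (HE : (R1 - RtoC (2 * PI * bessel_value a b) = L1 - Ci * T1 + Ci * B1)%C).
    { assert (E' : (Ci * (Ci * R1 - T1 - Ci * L1 + B1) = Ci * (RtoC (2 * PI * bessel_value a b) * Ci))%C) by (rewrite E; reflexivity).
      assert (E'' : (- R1 - Ci * T1 + L1 + Ci * B1 = - RtoC (2 * PI * bessel_value a b))%C).
      { transitivity (Ci * Ci * RtoC (2 * PI * bessel_value a b))%C. 2: rewrite Ci_sqr; ring.
        replace (Ci * Ci * RtoC (2 * PI * bessel_value a b))%C with (Ci * (RtoC (2 * PI * bessel_value a b) * Ci))%C by ring.
        rewrite <- E'. replace (Ci * (Ci * R1 - T1 - Ci * L1 + B1))%C with (Ci * Ci * (R1 - L1) - Ci * T1 + Ci * B1)%C by ring. rewrite Ci_sqr. ring. }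
      transitivity (R1 + - RtoC (2 * PI * bessel_value a b))%C. ring. rewrite <- E''. ring. }
    rewrite HE. eapply Rle_trans. apply Cmod_triangle. eapply Rle_trans. apply Rplus_le_compat_r. apply Cmod_minus_triangle.
    rewrite !Cmod_mult, Cmod_Ci. fold M. lra.
Qed.

(** * Cauchy's coefficient formula *)

Lemma is_RInt_uniform_limit : forall (f : R -> R) (fn : nat -> R -> R) (In : nat -> R) (I a b : R) (e : nat -> R),
  (forall n, is_RInt (fn n) a b (In n)) -> (forall n s, Rabs (fn n s - f s) <= e n) -> is_lim_seq e 0 ->
  is_lim_seq In I -> is_RInt f a b I.
Proof.
  intros f fn In I a b e Hn He Hl HI.
  destruct (filterlim_RInt (V := R_CompleteNormedModule) fn a b eventually eventually_filter f In Hn) as [If [H1 H2]].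
  - apply (filterlim_locally (U := fct_UniformSpace R R_UniformSpace)). intros eps.
    apply is_lim_seq_spec in Hl. destruct (Hl eps) as [N HN]. exists N. intros n Hn' s.
    specialize (HN n Hn'). rewrite Rminus_0_r in HN. unfold ball; simpl. unfold AbsRing_ball, abs, minus, plus, opp; simpl.
    eapply Rle_lt_trans. apply He. eapply Rle_lt_trans. apply Rle_abs. exact HN.
  - assert (is_lim_seq In If) by exact H1. apply is_lim_seq_unique in H. apply is_lim_seq_unique in HI.
    rewrite H in HI. injection HI; intros; subst; auto.
Qed.

Lemma cint_uniform_limit : forall (f : R -> C) (fn : nat -> R -> C) (In : nat -> C) I a b (e : nat -> R),
  (forall n, cint (fn n) a b (In n)) -> (forall n s, Cmod (fn n s - f s)%C <= e n) -> is_lim_seq e 0 ->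
  Clim In I -> cint f a b I.
Proof.
  intros f fn In I a b e Hn He Hl HI. split.
  - apply (is_RInt_uniform_limit (fun s => Re (f s)) (fun n s => Re (fn n s)) (fun n => Re (In n)) (Re I) a b e).
    + intros n. exact (proj1 (Hn n)).
    + intros n s. rewrite <- Re_minus. eapply Rle_trans. apply re_le_Cmod. apply He.
    + exact Hl.
    + apply Clim_Re. exact HI.
  - apply (is_RInt_uniform_limit (fun s => Im (f s)) (fun n s => Im (fn n s)) (fun n => Im (In n)) (Im I) a b e).
    + intros n. exact (proj2 (Hn n)).
    + intros n s. rewrite <- Im_minus. eapply Rle_trans. apply im_le_Cmod. apply He.
    + exact Hl.
    + apply Clim_Im. exact HI.
Qed.

Lemma cint_zero : forall a b, cint (fun _ => RtoC 0) a b (RtoC 0).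
Proof.
  intros. assert (H : is_RInt (fun _ : R => 0) a b 0).
  { pose proof (is_RInt_const (V := R_NormedModule) a b 0) as H. unfold scal in H; simpl in H; unfold mult in H; simpl in H.
    rewrite Rmult_0_r in H. exact H. }
  split; exact H.
Qed.

Lemma cint_csum : forall (f : nat -> R -> C) (I : nat -> C) a b n,
  (forall j, (j < n)%nat -> cint (f j) a b (I j)) -> cint (fun s => csum (fun j => f j s) n) a b (csum I n).
Proof.
  induction n; intros; cbn [csum]. apply cint_zero.
  apply (cint_plus (fun s => csum (fun j => f j s) n) (f n)); auto.
Qed.

Lemma sum_n_csum : forall (a : nat -> C) n, sum_n (G := C_AbelianMonoid) a n = csum a (S n).
Proof.
  induction n. rewrite sum_O. simpl. ring. rewrite sum_Sn, IHn. reflexivity.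
Qed.

Lemma is_series_Clim : forall (a : nat -> C) (l : C),
  is_series (K := C_AbsRing) (V := C_NormedModule) a l -> Clim (csum a) l.
Proof.
  intros a l H. assert (H' : forall eps : posreal, eventually (fun n => Rabs (Re (csum a (S n)) - Re l) < eps /\ Rabs (Im (csum a (S n)) - Im l) < eps)).
  { intros eps. pose proof (proj1 (filterlim_locally (F := eventually) (U := C_UniformSpace) (sum_n a) l) H eps) as [N HN].
    exists N. intros n Hn. specialize (HN n Hn). rewrite <- sum_n_csum. destruct HN as [A B]. split; assumption. }
  apply Clim_of_components; apply is_lim_seq_incr_1; apply is_lim_seq_spec; intros eps; destruct (H' eps) as [N HN]; exists N; intros n Hn; apply HN; auto.
Qed.

Lemma Clim_series_terms_bounded : forall a l, Clim (csum a) l -> exists K, 0 <= K /\ forall n, Cmod (a n) <= K.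
Proof.
  intros a l H.
  assert (H0 : is_lim_seq (fun n => Cmod (a n)) 0).
  { assert (HS : Clim (fun n => csum a (S n)) l) by (apply (Clim_subseq (csum a) l S); auto).
    pose proof (Clim_minus _ _ _ _ HS H) as HD. unfold Clim in HD.
    eapply is_lim_seq_ext; [|exact HD]. intros n. simpl. f_equal. ring. }
  apply is_lim_seq_Reals in H0. destruct (maj_by_pos _ (exist _ 0 H0)) as [K [HK HK']].
  exists K. split. lra. intros n. eapply Rle_trans. apply Rle_abs. apply HK'.
Qed.

Definition circle_arg (y phi : R) : C := (RtoC (2 * PI * phi) * Ci - RtoC (2 * PI * y))%C.

Lemma cint_character : forall y (k : Z), k <> 0%Z -> cint (fun phi => Cexp (RtoC (IZR k) * circle_arg y phi)) 0 1 (RtoC 0).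
Proof.
  intros y k Hk. pose proof PI_RGT_0 as HP. pose proof Ci_nz as HC.
  assert (Hc : RtoC (2 * PI * IZR k) <> RtoC 0).
  { apply RtoC_neq. apply Rmult_integral_contrapositive_currified. lra. apply not_0_IZR; auto. }
  assert (Hd : forall s, cder (fun phi => RtoC (IZR k) * circle_arg y phi)%C s (RtoC (2 * PI * IZR k) * Ci)%C).
  { intros s. apply cder_ext with (fun phi => - (RtoC (IZR k) * RtoC (2 * PI * y)) + RtoC phi * (RtoC (2 * PI * IZR k) * Ci))%C.
    intros. unfold circle_arg. rewrite !RtoC_mult. ring. apply cder_affine. }
  set (F := fun phi => (/ (RtoC (2 * PI * IZR k) * Ci) * Cexp (RtoC (IZR k) * circle_arg y phi))%C).
  replace (RtoC 0) with (F 1 - F 0)%C.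
  - apply cint_FTC. lra.
    + intros s _. eapply cder_eq. apply cder_scal. apply cder_Cexp. apply Hd. cbv beta.
      set (e := Cexp (RtoC (IZR k) * circle_arg y s)%C). field. auto.
    + intros s _. eexists. apply cder_Cexp. apply Hd.
  - unfold F. replace (RtoC (IZR k) * circle_arg y 1)%C with (RtoC (IZR k) * circle_arg y 0 + RtoC (2 * PI * IZR k) * Ci)%C.
    rewrite Cexp_plus, Cexp_2PI_Z. ring.
    unfold circle_arg. rewrite !RtoC_mult. ring.
Qed.

Lemma ctm_log_series : forall t m c q, (0 < t)%nat -> is_ctm t m c -> Cmod q < 1 ->
  Clim (csum (fun n => (RtoC (IZR (c n)) * q ^ n)%C)) (Cexp (log_quotient t m q)).
Proof.
  intros t m c q Ht H Hq. specialize (H q Hq). apply is_series_Clim in H.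
  assert (Hqt : Cmod (q ^ t)%C < 1) by (destruct t; [lia|apply Cmod_pow_S_lt; auto]).
  rewrite (qpoch_lamb q), (qpoch_lamb (q ^ t)%C) in H by auto.
  replace (Cexp (log_quotient t m q)) with (Cexp (- lamb q) ^ m / Cexp (- lamb (q ^ t)) ^ m)%C; auto.
  rewrite !Cexp_pow, <- Cexp_minus. f_equal. unfold log_quotient. ring.
Qed.

(** Integrate the power series term by term: on a fixed circle it converges geometrically,
    since its terms are bounded on a larger one. *)
Lemma coefficient_integral : forall t m c n y, (0 < t)%nat -> is_ctm t m c -> 0 < y ->
  cint (fun phi => Cexp (log_quotient t m (Cexp (circle_arg y phi))) * Cexp (- (RtoC (INR n) * circle_arg y phi)))%C 0 1
    (RtoC (IZR (c n))).
Proof.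
  intros t m c n y Ht Hc Hy. pose proof PI_RGT_0 as HP.
  (* x^2 is the radius of the circle; boundedness is taken at radius x. *)
  set (x := exp (- (PI * y))). assert (Hx : 0 < x < 1) by (unfold x; split; [apply exp_pos|apply exp_lt_1; nra]).
  assert (Hcirc : forall phi, Cmod (Cexp (circle_arg y phi)) = x * x).
  { intros. rewrite Cmod_Cexp. unfold x. rewrite <- exp_plus. f_equal. unfold circle_arg. rewrite Re_minus. simpl. ring. }
  destruct (Clim_series_terms_bounded _ _ (ctm_log_series t m c (RtoC x) Ht Hc ltac:(rewrite Cmod_RtoC; lra))) as [K [HK HKb]].
  set (rn := exp (INR n * (2 * PI * y))).
  assert (Hrn : forall phi, Cmod (Cexp (- (RtoC (INR n) * circle_arg y phi))) = rn).
  { intros. rewrite Cmod_Cexp. unfold rn. f_equal. unfold circle_arg. rewrite re_opp, re_scal_l, Re_minus. simpl. ring. }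
  apply (cint_uniform_limit _ (fun J phi => csum (fun j => RtoC (IZR (c j)) * Cexp (RtoC (IZR (Z.of_nat j - Z.of_nat n)) * circle_arg y phi)) J)%C
    (fun J => csum (fun j => if Nat.eqb j n then RtoC (IZR (c n)) else RtoC 0) J) _ 0 1 (fun J => rn * (K / (1 - x)) * x ^ J)).
  - intros J. apply (cint_csum (fun j phi => RtoC (IZR (c j)) * Cexp (RtoC (IZR (Z.of_nat j - Z.of_nat n)) * circle_arg y phi))%C).
    intros j _. destruct (Nat.eqb_spec j n) as [->|Hj].
    + assert (Hone : cint (fun _ => RtoC (IZR (c n)) * RtoC 1)%C 0 1 (RtoC (IZR (c n)) * RtoC 1)%C).
      { apply (cint_scal (RtoC (IZR (c n))) (fun _ => RtoC 1)).
        pose proof (cint_FTC (fun s => RtoC 0 + RtoC s * RtoC 1)%C (fun _ => RtoC 1) 0 1 ltac:(lra) (fun s _ => cder_affine 0 1 s)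
          (fun s _ => ex_intro _ _ (cder_const 1 s))) as H.
        cbv beta in H. replace (RtoC 0 + RtoC 1 * RtoC 1 - (RtoC 0 + RtoC 0 * RtoC 1))%C with (RtoC 1) in H by ring. exact H. }
      rewrite Cmult_1_r in Hone. eapply cint_ext; [|exact Hone].
      intros. cbv beta. rewrite Z.sub_diag. replace (RtoC 0 * circle_arg y s)%C with (RtoC 0) by ring. rewrite Cexp_0. ring.
    + replace (RtoC 0) with (RtoC (IZR (c j)) * RtoC 0)%C by ring.
      apply (cint_scal (RtoC (IZR (c j))) (fun phi => Cexp (RtoC (IZR (Z.of_nat j - Z.of_nat n)) * circle_arg y phi))).
      apply cint_character. lia.
  - intros J phi. set (q := Cexp (circle_arg y phi)).
    assert (Hq : Cmod q < 1) by (unfold q; rewrite Hcirc; nra).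
    replace (csum (fun j => RtoC (IZR (c j)) * Cexp (RtoC (IZR (Z.of_nat j - Z.of_nat n)) * circle_arg y phi)) J)%C
      with (Cexp (- (RtoC (INR n) * circle_arg y phi)) * csum (fun j => RtoC (IZR (c j)) * q ^ j) J)%C.
    2:{ rewrite <- csum_scal. apply csum_ext. intros j _. unfold q. rewrite Cexp_pow.
        replace (RtoC (IZR (Z.of_nat j - Z.of_nat n)) * circle_arg y phi)%C with (RtoC (INR j) * circle_arg y phi + - (RtoC (INR n) * circle_arg y phi))%C.
        rewrite Cexp_plus. ring. rewrite minus_IZR, <- !INR_IZR_INZ, RtoC_minus. ring. }
    match goal with |- Cmod (?e * ?s - ?f * ?e)%C <= _ => replace (e * s - f * e)%C with (e * (s - f))%C by ring end.
    rewrite Cmod_mult, Hrn. rewrite Rmult_assoc. apply Rmult_le_compat_l. left; apply exp_pos.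
    rewrite Cmod_minus_sym.
    apply Clim_bound with (u := fun p => csum (fun i => RtoC (IZR (c (J + i)%nat)) * q ^ (J + i))%C p) (e := fun _ => K / (1 - x) * x ^ J).
    + apply Clim_ext with (fun p => csum (fun j => RtoC (IZR (c j)) * q ^ j) (J + p) - csum (fun j => RtoC (IZR (c j)) * q ^ j) J)%C.
      intros p. rewrite csum_add. ring.
      apply Clim_minus. 2: apply Clim_const.
      apply (Clim_subseq (csum (fun j => RtoC (IZR (c j)) * q ^ j)%C) _ (fun p => (J + p)%nat)). intros; lia.
      apply ctm_log_series; auto.
    + intros p. eapply Rle_trans. apply Cmod_csum_le with (g := fun i => K * x ^ J * x ^ i).
      * intros i _. rewrite Cmod_mult, Cmod_pow. unfold q. rewrite Hcirc. rewrite Rpow_mult_distr.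
        specialize (HKb (J + i)%nat). rewrite Cmod_mult, Cmod_pow, (Cmod_RtoC x) in HKb by lra.
        rewrite <- Rmult_assoc. rewrite (Rmult_assoc K), <- pow_add. apply Rmult_le_compat_r; auto. apply pow_le; lra.
      * rewrite rsum_scal. replace (K / (1 - x) * x ^ J) with (K * x ^ J * (/ (1 - x))) by (field; lra).
        apply Rmult_le_compat_l. apply Rmult_le_pos; auto. apply pow_le; lra.
        assert (E : rsum (fun i => x ^ i) p = (1 - x ^ p) / (1 - x)).
        { clear - Hx. induction p. simpl. field. lra. cbn [rsum]. rewrite IHp. simpl. field. lra. }
        change (rsum (pow x) p) with (rsum (fun i => x ^ i) p). rewrite E. unfold Rdiv. assert (0 < / (1 - x)) by (apply Rinv_0_lt_compat; lra). pose proof (pow_le x p ltac:(lra)). nra.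
    + apply is_lim_seq_const.
  - apply is_lim_seq_scal_0. apply is_lim_seq_pow_0. lra.
  - apply (Clim_squeeze_loc _ _ (fun _ => 0)). 2: apply is_lim_seq_const.
    exists (S n). intros J HJ.
    assert (G : forall p, csum (fun j => if Nat.eqb j n then RtoC (IZR (c n)) else RtoC 0) p = if (n <? p)%nat then RtoC (IZR (c n)) else RtoC 0).
    { induction p. reflexivity. cbn [csum]. rewrite IHp. destruct (Nat.ltb_spec n p); destruct (Nat.ltb_spec n (S p)); destruct (Nat.eqb_spec p n); try lia; ring. }
    rewrite G. destruct (Nat.ltb_spec n J); [|lia]. replace (RtoC (IZR (c n)) - RtoC (IZR (c n)))%C with (RtoC 0) by ring. rewrite Cmod_0. lra.
Qed.

(** * Dissection of the circle *)

(** Neighbours of [phi] in the Farey sequence of order [N], refined by inserting mediants; the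
    case of equality is harmless, so the inequalities are weak. *)
Lemma farey_neighbours : forall N, (1 <= N)%nat -> forall phi, 0 <= phi <= 1 ->
  exists a b c d : nat, (b * c = a * d + 1)%nat /\ (1 <= b <= N)%nat /\ (1 <= d <= N)%nat /\ (N < b + d)%nat /\ (c <= d)%nat /\
    INR a <= phi * INR b /\ phi * INR d <= INR c.
Proof.
  induction N as [|N IH]; intros HN phi Hphi. lia.
  destruct (Nat.eq_dec N 0) as [->|HN0].
  - exists 0%nat, 1%nat, 1%nat, 1%nat. simpl. repeat split; try lia; lra.
  - destruct (IH ltac:(lia) phi Hphi) as (a & b & c & d & E & Hb & Hd & Hs & Hcd & H1 & H2).
    assert (Hab : (a <= b)%nat) by (apply INR_le; assert (0 < INR b) by (apply lt_0_INR; lia); nra).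
    destruct (Nat.eq_dec (b + d) (S N)) as [Es|Es].
    + destruct (Rle_lt_dec (phi * INR (b + d)) (INR (a + c))) as [L|L].
      * exists a, b, (a + c)%nat, (b + d)%nat. repeat split; try lia; auto.
      * exists (a + c)%nat, (b + d)%nat, c, d. repeat split; try lia; auto; lra.
    + exists a, b, c, d. repeat split; try lia; auto.
Qed.

(** [phi] lies between two Farey neighbours; take the one on the same side of their
    mediant, whose denominator exceeds [N]. *)
Lemma dirichlet_approx : forall N, (1 <= N)%nat -> forall phi, 0 <= phi <= 1 ->
  exists h k : nat, Nat.gcd h k = 1%nat /\ (1 <= k <= N)%nat /\ (h <= k)%nat /\
    Rabs (phi - INR h / INR k) <= 1 / (INR k * INR N).
Proof.
  intros N HN phi Hphi. destruct (farey_neighbours N HN phi Hphi) as (a & b & c & d & E & Hb & Hd & Hs & Hcd & H1 & H2).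
  assert (HbR : 0 < INR b) by (apply lt_0_INR; lia). assert (HdR : 0 < INR d) by (apply lt_0_INR; lia).
  assert (HNR : 0 < INR N) by (apply lt_0_INR; lia).
  assert (HsR : INR N <= INR b + INR d) by (rewrite <- plus_INR; apply le_INR; lia).
  assert (ER : INR b * INR c = INR a * INR d + 1) by (rewrite <- !mult_INR; rewrite E, plus_INR; reflexivity).
  assert (Hab : (a <= b)%nat) by (apply INR_le; nra).
  destruct (Rle_lt_dec (phi * (INR b + INR d)) (INR a + INR c)) as [L|L].
  - exists a, b. split; [|split; [lia|split; [auto|]]].
    + destruct (Nat.gcd_divide_l a b) as [u Hu]. destruct (Nat.gcd_divide_r a b) as [v Hv].
      set (g := Nat.gcd a b) in *. assert (Nat.divide g 1). { apply (Nat.divide_add_cancel_r g (a * d) 1). exists (u * d)%nat; nia. rewrite <- E. exists (v * c)%nat; nia. }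
      apply Nat.divide_1_r in H. exact H.
    + rewrite Rabs_pos_eq. 2:{ apply Rmult_le_reg_r with (INR b); auto. unfold Rdiv. rewrite Rmult_minus_distr_r, Rmult_assoc, Rinv_l by lra. lra. }
      apply Rle_trans with (1 / (INR b * (INR b + INR d))).
      * apply Rmult_le_reg_r with (INR b * (INR b + INR d)). nra.
        replace (1 / (INR b * (INR b + INR d)) * (INR b * (INR b + INR d))) with 1 by (field; lra).
        replace ((phi - INR a / INR b) * (INR b * (INR b + INR d))) with (phi * (INR b + INR d) * INR b - INR a * (INR b + INR d)) by (field; lra).
        nra.
      * apply Rmult_le_compat_l. lra. apply Rinv_le_contravar; nra.
  - exists c, d. split; [|split; [lia|split; [auto|]]].
    + destruct (Nat.gcd_divide_l c d) as [u Hu]. destruct (Nat.gcd_divide_r c d) as [v Hv].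
      set (g := Nat.gcd c d) in *. assert (Nat.divide g 1). { apply (Nat.divide_add_cancel_r g (a * d) 1). exists (v * a)%nat; nia. rewrite <- E. exists (u * b)%nat; nia. }
      apply Nat.divide_1_r in H. exact H.
    + rewrite Rabs_minus_sym, Rabs_pos_eq. 2:{ apply Rmult_le_reg_r with (INR d); auto. unfold Rdiv. rewrite Rmult_minus_distr_r, Rmult_assoc, Rinv_l by lra. lra. }
      apply Rle_trans with (1 / (INR d * (INR b + INR d))).
      * apply Rmult_le_reg_r with (INR d * (INR b + INR d)). nra.
        replace (1 / (INR d * (INR b + INR d)) * (INR d * (INR b + INR d))) with 1 by (field; lra).
        replace ((INR c / INR d - phi) * (INR d * (INR b + INR d))) with (INR c * (INR b + INR d) - phi * (INR b + INR d) * INR d) by (field; lra).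
        nra.
      * apply Rmult_le_compat_l. lra. apply Rinv_le_contravar; nra.
Qed.

(** The cusps [h / k] where the quotient is unbounded. *)
Definition singular (t h k : nat) : bool :=
  (Nat.eqb (Nat.gcd h k) 1 && Nat.ltb t (Nat.gcd t k * Nat.gcd t k))%bool.

Lemma singular_spec : forall t h k, singular t h k = true -> Nat.gcd h k = 1%nat /\ INR t < INR (Nat.gcd t k) ^ 2.
Proof.
  intros t h k H. apply andb_prop in H. destruct H as [H1 H2]. apply Nat.eqb_eq in H1. apply Nat.ltb_lt in H2.
  split; auto. apply lt_INR in H2. rewrite mult_INR in H2. simpl. lra.
Qed.

Lemma singular_ge_2 : forall t h k, (0 < t)%nat -> (0 < k)%nat -> singular t h k = true -> (2 <= k)%nat.
Proof.
  intros t h k Ht Hk H. apply andb_prop in H. destruct H as [H1 H2]. apply Nat.ltb_lt in H2.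
  destruct k as [|[|k]]; try lia. rewrite (Nat.gcd_comm t 1) in H2. simpl in H2. lia.
Qed.

(** Half of the distance within which Dirichlet's theorem places a point: the factor 1/2
    makes chords of distinct cusps disjoint. *)
Definition half_chord (N k : nat) : R := 1 / (2 * INR k * INR N).

Definition chord_point (y : R) (h k : nat) (phi : R) : C := (RtoC y - RtoC (phi - INR h / INR k) * Ci)%C.

(** Distinct fractions are at least [1 / (k k')] apart, and the half lengths add up to less
    unless [k = k' = N]; in that case the distance is a multiple of [1 / N], which is
    larger than [1 / N^2] as singular denominators exceed 1. *)
Lemma chords_disjoint : forall t N h k h' k' phi, (0 < t)%nat -> (0 < k <= N)%nat -> (0 < k' <= N)%nat ->
  singular t h k = true -> singular t h' k' = true ->
  Rabs (phi - INR h / INR k) <= half_chord N k -> Rabs (phi - INR h' / INR k') <= half_chord N k' ->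
  h = h' /\ k = k'.
Proof.
  intros t N h k h' k' phi Ht Hk Hk' S1 S2 H1 H2.
  pose proof (singular_ge_2 _ _ _ Ht (proj1 Hk) S1) as K2.
  destruct (singular_spec _ _ _ S1) as [G1 _]. destruct (singular_spec _ _ _ S2) as [G2 _].
  assert (HkR : 0 < INR k) by (apply lt_0_INR; lia). assert (HkR' : 0 < INR k') by (apply lt_0_INR; lia).
  assert (HNR : 0 < INR N) by (apply lt_0_INR; lia).
  set (X := (Z.of_nat h * Z.of_nat k' - Z.of_nat h' * Z.of_nat k)%Z).
  assert (HX : IZR X = INR k * INR k' * (INR h / INR k - INR h' / INR k')).
  { unfold X. rewrite minus_IZR, !mult_IZR, <- !INR_IZR_INZ. field. lra. }
  assert (Hd : Rabs (INR h / INR k - INR h' / INR k') <= half_chord N k + half_chord N k').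
  { replace (INR h / INR k - INR h' / INR k') with (- (phi - INR h / INR k) + (phi - INR h' / INR k')) by ring.
    eapply Rle_trans. apply Rabs_triang. rewrite Rabs_Ropp. lra. }
  assert (HXb : Rabs (IZR X) * (2 * INR N) <= INR k + INR k').
  { rewrite HX, Rabs_mult, (Rabs_pos_eq (INR k * INR k')) by nra.
    apply Rle_trans with (INR k * INR k' * (half_chord N k + half_chord N k') * (2 * INR N)).
    apply Rmult_le_compat_r. lra. apply Rmult_le_compat_l; auto. nra.
    unfold half_chord. apply Req_le. field. lra. }
  rewrite <- abs_IZR in HXb.
  assert (HZ : (Z.abs X * (2 * Z.of_nat N) <= Z.of_nat k + Z.of_nat k')%Z).
  { apply le_IZR. rewrite mult_IZR, mult_IZR, plus_IZR, <- !INR_IZR_INZ. exact HXb. }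
  assert (HX1 : (Z.abs X = 0 \/ 1 <= Z.abs X)%Z) by lia. destruct HX1 as [HX0|HX1].
  - assert (E : (h * k' = h' * k)%nat) by (unfold X in HX0; lia).
    assert (D1 : Nat.divide k k').
    { apply (Nat.gauss k h k'). exists h'. lia. rewrite Nat.gcd_comm; auto. }
    assert (D2 : Nat.divide k' k).
    { apply (Nat.gauss k' h' k). exists h. lia. rewrite Nat.gcd_comm; auto. }
    assert (k = k') by (apply Nat.divide_antisym; auto). subst k'. split; auto. nia.
  - assert (Z.abs X = 1)%Z by nia. assert (k = N /\ k' = N)%nat by nia. destruct H0; subst k k'.
    exfalso. assert (Z.abs X = Z.abs (Z.of_nat h - Z.of_nat h') * Z.of_nat N)%Z by (unfold X; rewrite <- Z.mul_sub_distr_r, Z.abs_mul, (Z.abs_eq (Z.of_nat N)) by lia; reflexivity).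
    rewrite H in H0. clear - H0 K2. set (A := Z.abs (Z.of_nat h - Z.of_nat h')) in *. assert (A <= 0 \/ 1 <= A)%Z by lia. destruct H; nia.
Qed.

Definition chord_term (t m n N : nat) (h k : nat) (phi : R) : C :=
  if singular t h k then
    if Rle_dec (Rabs (phi - INR h / INR k)) (half_chord N k)
    then principal_part t m n (Z.of_nat h) k (chord_point (1 / INR N ^ 2) h k phi) else RtoC 0
  else RtoC 0.

Lemma csum_only : forall (f : nat -> C) n i, (i < n)%nat -> (forall j, (j < n)%nat -> j <> i -> f j = RtoC 0) -> csum f n = f i.
Proof.
  induction n; intros i Hi H. lia. cbn [csum]. destruct (Nat.eq_dec i n) as [->|Hn].
  - replace (csum f n) with (RtoC 0). ring. symmetry.
    assert (G : forall p, (p <= n)%nat -> csum f p = RtoC 0).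
    { induction p; intros; cbn [csum]; auto. rewrite IHp by lia. rewrite H by lia. ring. }
    apply G; lia.
  - rewrite (IHn i) by (try lia; intros; apply H; lia). rewrite (H n) by lia. ring.
Qed.

Lemma csum_all_zero : forall (f : nat -> C) n, (forall j, (j < n)%nat -> f j = RtoC 0) -> csum f n = RtoC 0.
Proof. induction n; intros; cbn [csum]; auto. rewrite IHn, H by auto. ring. Qed.

(** At most one chord covers [phi].  If one does, its cusp governs the integrand; if none
    does, a cusp from Dirichlet's theorem does, and its principal part is bounded off its chord. *)
Lemma integrand_minus_principal_parts : forall t m n N phi, (0 < t)%nat -> mu t m <= 1 -> (1 <= N)%nat ->
  0 < INR n - mu t m -> PI * (INR n - mu t m) <= INR N ^ 2 -> 0 <= phi <= 1 ->
  Cmod (Cexp (log_quotient t m (Cexp (circle_arg (1 / INR N ^ 2) phi))) * Cexp (- (RtoC (INR n) * circle_arg (1 / INR N ^ 2) phi))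
    - csum (fun k => csum (fun h => chord_term t m n N h k phi) k) (S N))%C
  <= exp (2 + 8 * PI * mu t m) + regular_bound t m.
Proof.
  intros t m n N phi Ht Hmu HN Hnu HN2 Hphi. pose proof PI_RGT_0 as HP.
  assert (HNR : 1 <= INR N) by (replace 1 with (INR 1) by reflexivity; apply le_INR; auto).
  assert (HN2p : 0 < INR N ^ 2) by (apply pow_lt; lra).
  set (y := 1 / INR N ^ 2). assert (Hy : 0 < y) by (apply Rdiv_lt_0_compat; lra).
  assert (Hny : 2 * PI * (INR n - mu t m) * y <= 2).
  { unfold y. apply Rmult_le_reg_r with (INR N ^ 2); auto. replace (2 * PI * (INR n - mu t m) * (1 / INR N ^ 2) * INR N ^ 2) with (2 * (PI * (INR n - mu t m))) by (field; lra). lra. }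
  assert (Hroot : forall h k, circle_arg y phi = root_arg (Z.of_nat h) k (chord_point y h k phi)).
  { intros. unfold circle_arg, root_arg, chord_point. rewrite <- INR_IZR_INZ.
    replace (2 * PI * INR h / INR k) with (2 * PI * (INR h / INR k)) by (unfold Rdiv; ring).
    rewrite RtoC_minus, !RtoC_mult. ring. }
  assert (Hre : forall h k, Re (chord_point y h k phi) = y) by (intros; unfold chord_point; rewrite Re_minus; simpl; ring).
  assert (Him : forall h k, Im (chord_point y h k phi) = - (phi - INR h / INR k)) by (intros; unfold chord_point; rewrite Im_minus; simpl; ring).
  assert (Hinv : forall h k, Re (/ chord_point y h k phi)%C = y / (y ^ 2 + (phi - INR h / INR k) ^ 2)).
  { intros. rewrite Re_inv_coord. rewrite Hre, Him. f_equal. ring. apply Cneq_Re. rewrite Hre. lra. }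
  assert (Hrho : forall h k, (1 <= k <= N)%nat -> Rabs (phi - INR h / INR k) <= 1 / (INR k * INR N) ->
    / 2 <= Re (/ chord_point y h k phi)%C / INR k ^ 2).
  { intros h k Hk Hd. rewrite Hinv. assert (HkR : 1 <= INR k) by (replace 1 with (INR 1) by reflexivity; apply le_INR; lia).
    assert (HkN : INR k <= INR N) by (apply le_INR; lia).
    assert (Hd2 : (phi - INR h / INR k) ^ 2 <= (1 / (INR k * INR N)) ^ 2).
    { rewrite <- (pow2_abs (phi - INR h / INR k)). apply pow_incr. split; auto. apply Rabs_pos. }
    assert (Hy2 : y ^ 2 <= (1 / (INR k * INR N)) ^ 2).
    { apply pow_incr. split. lra. unfold y. apply Rmult_le_compat_l. lra. apply Rinv_le_contravar. nra. simpl; nra. }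
    set (s := y ^ 2 + (phi - INR h / INR k) ^ 2) in *.
    assert (Hs : 0 < s) by (unfold s; assert (0 < y ^ 2) by (apply pow_lt; auto); pose proof (pow2_ge_0 (phi - INR h / INR k)); lra).
    assert (Hs2 : s <= 2 * (1 / (INR k * INR N)) ^ 2) by (unfold s; lra).
    apply Rmult_le_reg_r with (s * INR k ^ 2). apply Rmult_lt_0_compat; auto. apply pow_lt; lra.
    replace (y / s / INR k ^ 2 * (s * INR k ^ 2)) with y by (field; lra).
    apply Rle_trans with (/ 2 * (2 * (1 / (INR k * INR N)) ^ 2 * INR k ^ 2)).
    apply Rmult_le_compat_l. lra. apply Rmult_le_compat_r; auto. apply pow2_ge_0.
    unfold y. apply Req_le. field. lra. }
  assert (HB3 : 0 <= regular_bound t m) by (unfold regular_bound; apply Rmult_le_pos; [apply Rmult_le_pos|]; left; apply exp_pos).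
  assert (Hg : forall h k, Nat.gcd h k = 1%nat -> Z.gcd (Z.of_nat h) (Z.of_nat k) = 1%Z) by (intros h k E; rewrite <- Z_of_nat_gcd, E; reflexivity).
  set (G := (Cexp (log_quotient t m (Cexp (circle_arg y phi))) * Cexp (- (RtoC (INR n) * circle_arg y phi)))%C).
  assert (Hsing : forall h k, (1 <= k <= N)%nat -> singular t h k = true -> Rabs (phi - INR h / INR k) <= 1 / (INR k * INR N) ->
    Cmod (G - principal_part t m n (Z.of_nat h) k (chord_point y h k phi))%C <= regular_bound t m).
  { intros h k Hk HS Hd. destruct (singular_spec _ _ _ HS) as [G1 G2]. unfold G. rewrite (Hroot h k).
    apply quotient_singular; auto; try lia. rewrite Hre; auto. rewrite Hre; auto. }
  assert (Hdec : (exists h k, (k < S N)%nat /\ (h < k)%nat /\ singular t h k = true /\ Rabs (phi - INR h / INR k) <= half_chord N k)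
     \/ (forall h k, (k < S N)%nat -> (h < k)%nat -> chord_term t m n N h k phi = RtoC 0)).
  { assert (D : forall K, (exists h k, (k < K)%nat /\ (h < k)%nat /\ singular t h k = true /\ Rabs (phi - INR h / INR k) <= half_chord N k)
     \/ (forall h k, (k < K)%nat -> (h < k)%nat -> chord_term t m n N h k phi = RtoC 0)).
    { induction K. right; intros; lia. destruct IHK as [(h & k & A & B)|IHK]. left; exists h, k; split; auto.
      assert (D : forall q, (exists h, (h < q)%nat /\ singular t h K = true /\ Rabs (phi - INR h / INR K) <= half_chord N K)
        \/ (forall h, (h < q)%nat -> chord_term t m n N h K phi = RtoC 0)).
      { induction q. right; intros; lia. destruct IHq as [(h & A & B)|IHq]. left; exists h; split; auto.
        destruct (singular t q K) eqn:ES. destruct (Rle_dec (Rabs (phi - INR q / INR K)) (half_chord N K)) as [L|L].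
        - left. exists q. auto.
        - right. intros h Hh. destruct (Nat.eq_dec h q) as [->|]. unfold chord_term. rewrite ES. destruct (Rle_dec _ _); tauto. apply IHq; lia.
        - right. intros h Hh. destruct (Nat.eq_dec h q) as [->|]. unfold chord_term. rewrite ES. auto. apply IHq; lia. }
      destruct (D K) as [(h & A & B & C)|D']. left. exists h, K. repeat split; auto.
      right. intros h k Hk Hh. destruct (Nat.eq_dec k K) as [->|]. apply D'; auto. apply IHK; lia. }
    apply D. }
  destruct Hdec as [(h & k & Hk & Hh & HS & Hd)|Hzero].
  - (* phi lies on exactly one chord *)
    assert (HkR : 1 <= INR k) by (replace 1 with (INR 1) by reflexivity; apply le_INR; lia).
    rewrite (csum_only _ (S N) k Hk). rewrite (csum_only _ k h Hh).
    + unfold chord_term. rewrite HS. destruct (Rle_dec _ _); [|tauto]. fold y.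
      apply Rle_trans with (regular_bound t m). 2: pose proof (exp_pos (2 + 8 * PI * mu t m)); lra.
      apply Hsing; auto. lia. eapply Rle_trans. exact Hd. unfold half_chord. apply Rmult_le_compat_l. lra.
      apply Rinv_le_contravar; nra.
    + intros h' Hh' Hne. unfold chord_term. destruct (singular t h' k) eqn:ES; auto. destruct (Rle_dec _ _) as [L|L]; auto.
      exfalso. apply Hne. apply (chords_disjoint t N h' k h k phi); auto; lia.
    + intros k' Hk' Hne. apply csum_all_zero. intros h' Hh'. unfold chord_term. destruct (singular t h' k') eqn:ES; auto. destruct (Rle_dec _ _) as [L|L]; auto.
      exfalso. apply Hne. apply (chords_disjoint t N h' k' h k phi); auto; lia.
  - rewrite csum_all_zero. 2: intros k Hk; apply csum_all_zero; intros; apply Hzero; auto.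
    replace (G - RtoC 0)%C with G by ring.
    destruct (dirichlet_approx N HN phi Hphi) as (h & k & Hgcd & Hk & Hhk & Hd).
    assert (HkR : 1 <= INR k) by (replace 1 with (INR 1) by reflexivity; apply le_INR; lia).
    destruct (Nat.ltb t (Nat.gcd t k * Nat.gcd t k)) eqn:ES.
    + assert (HS : singular t h k = true) by (unfold singular; rewrite Hgcd, ES; reflexivity).
      pose proof (singular_ge_2 t h k Ht ltac:(lia) HS) as K2.
      assert (Hlt : (h < k)%nat). { destruct (Nat.eq_dec h k) as [E|]; [|lia]. subst h. rewrite Nat.gcd_diag in Hgcd. lia. }
      specialize (Hzero h k ltac:(lia) Hlt).
      destruct (singular_spec _ _ _ HS) as [_ G2].
      specialize (Hsing h k ltac:(lia) HS Hd).
      destruct (Rle_dec (Rabs (phi - INR h / INR k)) (half_chord N k)) as [L|L].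
      * unfold chord_term in Hzero. rewrite HS in Hzero. destruct (Rle_dec _ _); [|tauto]. fold y in Hzero. rewrite Hzero in Hsing.
        replace (G - RtoC 0)%C with G in Hsing by ring. pose proof (exp_pos (2 + 8 * PI * mu t m)). lra.
      * set (P := principal_part t m n (Z.of_nat h) k (chord_point y h k phi)) in *.
        replace G with (P + (G - P))%C by ring. eapply Rle_trans. apply Cmod_triangle. apply Rplus_le_compat; auto.
        apply principal_part_bound; auto; try lia; try (rewrite Hre; auto; fail).
        rewrite Hinv. apply Rnot_le_lt in L.
        assert (Hh0 : 0 < half_chord N k) by (unfold half_chord; apply Rdiv_lt_0_compat; nra).
        assert (Hd2 : half_chord N k ^ 2 <= (phi - INR h / INR k) ^ 2).
        { rewrite <- (pow2_abs (phi - INR h / INR k)). apply pow_incr. lra. }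
        assert (Hh2 : 0 < half_chord N k ^ 2) by (apply pow_lt; auto).
        apply Rle_trans with (y / half_chord N k ^ 2).
        { apply Rmult_le_compat_l. lra. apply Rinv_le_contravar; auto. pose proof (pow2_ge_0 y). lra. }
        unfold y, half_chord. apply Req_le. field. lra.
    + apply Nat.ltb_ge in ES. apply le_INR in ES. rewrite mult_INR in ES.
      apply Rle_trans with (regular_bound t m). 2: pose proof (exp_pos (2 + 8 * PI * mu t m)); lra.
      unfold G. rewrite (Hroot h k). apply quotient_regular; auto; try lia. rewrite Hre; auto. rewrite Hre; auto. simpl. lra.
Qed.

(** * The coefficient as a sum over cusps *)

Lemma cint_Chasles : forall f a b c I J, cint f a b I -> cint f b c J -> cint f a c (I + J)%C.
Proof.
  intros f a b c I J [H1 H2] [H3 H4]. split.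
  - apply (is_RInt_Chasles (V := R_NormedModule) (fun s => Re (f s)) a b c (Re I) (Re J)); assumption.
  - apply (is_RInt_Chasles (V := R_NormedModule) (fun s => Im (f s)) a b c (Im I) (Im J)); assumption.
Qed.

(** What a principal part contributes once its chord is closed to a rectangle. *)
Definition cusp_main (t m n h k : nat) : C :=
  if singular t h k then
    (cusp_coef t m n (Z.of_nat h) k * RtoC (2 * PI * bessel_value (2 * PI * (INR n - mu t m)) (pole_weight t m k / INR k ^ 2)))%C
  else RtoC 0.

Definition chord_error (t m N h k : nat) : R :=
  if singular t h k then (2 / INR N ^ 2 + 2 / (INR k * INR N)) * exp (2 + 8 * PI * mu t m) else 0.

Lemma chord_term_integral : forall t m n N h k, (0 < t)%nat -> (1 <= N)%nat -> (k <= N)%nat -> (h < k)%nat ->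
  0 < INR n - mu t m -> PI * (INR n - mu t m) <= INR N ^ 2 ->
  exists J, cint (chord_term t m n N h k) 0 1 J /\ Cmod (J - cusp_main t m n h k)%C <= chord_error t m N h k.
Proof.
  intros t m n N h k Ht HN HkN Hhk Hnu HN2. pose proof PI_RGT_0 as HP. unfold cusp_main, chord_error.
  destruct (singular t h k) eqn:ES.
  2:{ exists (RtoC 0). split. eapply cint_ext; [|apply cint_zero]. intros. unfold chord_term. rewrite ES. reflexivity.
      replace (RtoC 0 - RtoC 0)%C with (RtoC 0) by ring. rewrite Cmod_0. lra. }
  assert (Hk2 : (2 <= k)%nat) by (apply (singular_ge_2 t h k); auto; lia).
  destruct (singular_spec _ _ _ ES) as [Hg Hd].
  assert (Hh1 : (1 <= h)%nat). { destruct h; [|lia]. simpl in Hg. lia. }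
  assert (HNR : 1 <= INR N) by (replace 1 with (INR 1) by reflexivity; apply le_INR; auto).
  assert (HkR : 2 <= INR k) by (replace 2 with (INR 2) by reflexivity; apply le_INR; auto).
  assert (HhR : 1 <= INR h) by (replace 1 with (INR 1) by reflexivity; apply le_INR; auto).
  assert (HhkR : INR h + 1 <= INR k) by (rewrite <- S_INR; apply le_INR; lia).
  set (y := 1 / INR N ^ 2). set (r := half_chord N k). set (c := INR h / INR k).
  assert (HN2p : 0 < INR N ^ 2) by (apply pow_lt; lra).
  assert (Hy : 0 < y) by (apply Rdiv_lt_0_compat; lra).
  assert (Hr : 0 < r) by (unfold r, half_chord; apply Rdiv_lt_0_compat; nra).
  pose proof (pole_weight_ge_0 t m k Ht ltac:(lia) Hd) as Hpw.
  assert (Hk2p : 0 < INR k ^ 2) by (apply pow_lt; lra).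
  assert (Hb : 0 <= pole_weight t m k / INR k ^ 2) by (apply Rmult_le_pos; auto; left; apply Rinv_0_lt_compat; auto).
  destruct (chord_integral y r (2 * PI * (INR n - mu t m)) (pole_weight t m k / INR k ^ 2) c Hy Hr ltac:(nra) Hb) as [J [HJ1 HJ2]].
  set (co := cusp_coef t m n (Z.of_nat h) k).
  exists (co * J)%C. 
  assert (Hrk : r <= / INR k).
  { unfold r, half_chord. replace (/ INR k) with (1 / (INR k * 1)) by (field; lra). apply Rmult_le_compat_l. lra. apply Rinv_le_contravar; nra. }
  assert (Hc0 : r <= c). { eapply Rle_trans. exact Hrk. unfold c, Rdiv. assert (0 < / INR k) by (apply Rinv_0_lt_compat; lra). nra. }
  assert (Hc1 : c + r <= 1).
  { assert (c <= 1 - / INR k). { unfold c. apply Rmult_le_reg_r with (INR k). lra. field_simplify. lra. lra. lra. } lra. }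
  split.
  - replace (co * J)%C with (RtoC 0 + co * J + RtoC 0)%C by ring.
    apply cint_Chasles with (c + r). apply cint_Chasles with (c - r).
    + eapply cint_ext; [|apply cint_zero]. intros s Hs. rewrite Rmin_left, Rmax_right in Hs by lra.
      unfold chord_term. rewrite ES. destruct (Rle_dec _ _) as [L|L]; auto. exfalso. fold c r in L. apply Rabs_le_between in L. lra.
    + pose proof (cint_scal co _ _ _ _ HJ1) as H. eapply cint_ext; [|exact H].
      intros s Hs. rewrite Rmin_left, Rmax_right in Hs by lra.
      unfold chord_term. rewrite ES. fold c r. destruct (Rle_dec _ _) as [L|L].
      * reflexivity.
      * exfalso. apply L. apply Rabs_le. lra.
    + eapply cint_ext; [|apply cint_zero]. intros s Hs. rewrite Rmin_left, Rmax_right in Hs by lra.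
      unfold chord_term. rewrite ES. destruct (Rle_dec _ _) as [L|L]; auto. exfalso. fold c r in L. apply Rabs_le_between in L. lra.
  - replace (co * J - co * RtoC (2 * PI * bessel_value (2 * PI * (INR n - mu t m)) (pole_weight t m k / INR k ^ 2)))%C
      with (co * (J - RtoC (2 * PI * bessel_value (2 * PI * (INR n - mu t m)) (pole_weight t m k / INR k ^ 2))))%C by ring.
    rewrite Cmod_mult.
    assert (Hco : Cmod co = Rpower (INR t / INR (Nat.gcd t k)) (INR m / 2)).
    { unfold co, cusp_coef. rewrite Cmod_mult, Cmod_RtoC, Cmod_Cexp by (left; apply exp_pos).
      rewrite re_scal_l. change (Re Ci) with 0. rewrite Rmult_0_r, exp_0. ring. }
    rewrite Hco. set (om := Rpower _ _). assert (Hom : 0 < om) by apply exp_pos.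
    apply Rle_trans with (om * ((2 * y + 4 * r) * exp (2 * PI * (INR n - mu t m) * y + pole_weight t m k / INR k ^ 2 * (y / r ^ 2)))).
    apply Rmult_le_compat_l; [lra|exact HJ2].
    assert (Hyr : pole_weight t m k / INR k ^ 2 * (y / r ^ 2) = 4 * pole_weight t m k).
    { unfold y, r, half_chord. field. lra. }
    rewrite Hyr, exp_plus.
    assert (Hny : exp (2 * PI * (INR n - mu t m) * y) <= exp 2).
    { apply exp_le. unfold y. apply Rmult_le_reg_r with (INR N ^ 2); auto.
      replace (2 * PI * (INR n - mu t m) * (1 / INR N ^ 2) * INR N ^ 2) with (2 * (PI * (INR n - mu t m))) by (field; lra). lra. }
    pose proof (pole_growth t m k Ht ltac:(lia)) as HG. fold om in HG.
    replace (2 * y + 4 * r) with (2 / INR N ^ 2 + 2 / (INR k * INR N)) by (unfold y, r, half_chord; field; lra).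
    assert (HL : 0 <= 2 / INR N ^ 2 + 2 / (INR k * INR N)).
    { apply Rplus_le_le_0_compat; left; apply Rdiv_lt_0_compat; nra. }
    rewrite exp_plus. set (L := 2 / INR N ^ 2 + 2 / (INR k * INR N)) in *.
    set (e1 := exp (2 * PI * (INR n - mu t m) * y)) in *. set (e2 := exp (4 * pole_weight t m k)) in *.
    replace (om * (L * (e1 * e2))) with (L * (e1 * (om * e2))) by ring.
    apply Rmult_le_compat_l; auto. apply Rmult_le_compat; auto. left; apply exp_pos. apply Rmult_le_pos; left; auto; apply exp_pos.
Qed.

Lemma rsum_S_l : forall f n, rsum f (S n) = f O + rsum (fun i => f (S i)) n.
Proof. induction n. simpl; ring. cbn [rsum] in *. rewrite IHn. ring. Qed.

Lemma rsum_nonneg_le_const : forall f n k, (forall i, (i < n)%nat -> f i <= k) -> rsum f n <= INR n * k.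
Proof. intros. rewrite <- rsum_const. apply rsum_le. auto. Qed.

(** There are fewer than [k] cusps of denominator [k], each with error O(1 / (k N)). *)
Lemma chord_error_sum : forall t m N, (0 < t)%nat -> (1 <= N)%nat ->
  rsum (fun k => rsum (fun h => chord_error t m N h k) k) (S N) <= 3 * exp (2 + 8 * PI * mu t m).
Proof.
  intros t m N Ht HN. set (E := exp (2 + 8 * PI * mu t m)). assert (HE : 0 < E) by apply exp_pos.
  assert (HNR : 1 <= INR N) by (replace 1 with (INR 1) by reflexivity; apply le_INR; auto).
  rewrite rsum_S_l. change (rsum (fun h => chord_error t m N h 0) 0) with 0. rewrite Rplus_0_l.
  apply Rle_trans with (rsum (fun j => E * (INR j * (2 / INR N ^ 2) + 2 / INR N)) N).
  - apply rsum_le. intros j Hj. rewrite rsum_S_l.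
    replace (chord_error t m N 0 (S j)) with 0.
    2:{ unfold chord_error. destruct (singular t 0 (S j)) eqn:ES; auto.
        pose proof (singular_ge_2 t 0 (S j) Ht ltac:(lia) ES). apply singular_spec in ES. destruct ES as [ES _]. simpl in ES. lia. }
    rewrite Rplus_0_l. pose proof (INR_S_ge1 j) as Hj1. pose proof (pos_INR j) as Hj0.
    assert (HL : 0 < 2 / INR N ^ 2 + 2 / (INR (S j) * INR N)).
    { apply Rplus_lt_0_compat; apply Rdiv_lt_0_compat; try lra. apply pow_lt; lra. nra. }
    eapply Rle_trans. apply rsum_nonneg_le_const with (k := (2 / INR N ^ 2 + 2 / (INR (S j) * INR N)) * E).
    + intros i _. unfold chord_error. fold E. destruct (singular t (S i) (S j)). lra. apply Rmult_le_pos; lra.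
    + replace (INR j * ((2 / INR N ^ 2 + 2 / (INR (S j) * INR N)) * E)) with (E * (INR j * (2 / INR N ^ 2) + (INR j / INR (S j)) * (2 / INR N))) by (field; lra).
      apply Rmult_le_compat_l. lra. apply Rplus_le_compat_l.
      assert (INR j / INR (S j) <= 1). { apply Rmult_le_reg_r with (INR (S j)). lra. unfold Rdiv. rewrite Rmult_assoc, Rinv_l, S_INR by lra. lra. }
      assert (0 < 2 / INR N) by (apply Rdiv_lt_0_compat; lra). nra.
  - rewrite rsum_scal, rsum_plus, rsum_const.
    assert (Hs : forall n, rsum (fun j => INR j * (2 / INR N ^ 2)) n = INR n * (INR n - 1) / INR N ^ 2).
    { induction n. simpl. field. lra. cbn [rsum]. rewrite IHn, S_INR. field. lra. }
    rewrite Hs. rewrite Rmult_comm. apply Rmult_le_compat_r. lra.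
    replace (INR N * (INR N - 1) / INR N ^ 2 + INR N * (2 / INR N)) with (3 - / INR N) by (field; lra).
    assert (0 < / INR N) by (apply Rinv_0_lt_compat; lra). lra.
Qed.

(** The uniform bound for the integrand is integrated, and each chord is closed separately. *)
Lemma coefficient_approx : forall t m c n N, (0 < t)%nat -> is_ctm t m c -> mu t m <= 1 -> (1 <= N)%nat ->
  0 < INR n - mu t m -> PI * (INR n - mu t m) <= INR N ^ 2 ->
  Cmod (RtoC (IZR (c n)) - csum (fun k => csum (fun h => cusp_main t m n h k) k) (S N))%C
  <= exp (2 + 8 * PI * mu t m) + regular_bound t m
     + rsum (fun k => rsum (fun h => chord_error t m N h k) k) (S N).
Proof.
  intros t m c n N Ht Hc Hmu HN Hnu HN2.
  assert (HNR : 1 <= INR N) by (replace 1 with (INR 1) by reflexivity; apply le_INR; auto).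
  assert (Hy : 0 < 1 / INR N ^ 2) by (apply Rdiv_lt_0_compat; [lra|apply pow_lt; lra]).
  set (Jf := fun h k => CInt (chord_term t m n N h k) 0 1).
  assert (HJ : forall k h, (k < S N)%nat -> (h < k)%nat -> cint (chord_term t m n N h k) 0 1 (Jf h k) /\ Cmod (Jf h k - cusp_main t m n h k)%C <= chord_error t m N h k).
  { intros k h Hk Hh. destruct (chord_term_integral t m n N h k Ht HN ltac:(lia) Hh Hnu HN2) as [J [H1 H2]].
    unfold Jf. rewrite (cint_unique _ _ _ _ H1). auto. }
  pose proof (coefficient_integral t m c n (1 / INR N ^ 2) Ht Hc Hy) as HI.
  assert (HS : cint (fun phi => csum (fun k => csum (fun h => chord_term t m n N h k phi) k) (S N)) 0 1 (csum (fun k => csum (fun h => Jf h k) k) (S N))).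
  { apply (cint_csum (fun k phi => csum (fun h => chord_term t m n N h k phi) k)). intros k Hk.
    apply (cint_csum (fun h phi => chord_term t m n N h k phi)). intros h Hh. apply HJ; auto. }
  pose proof (cint_minus _ _ _ _ _ _ HI HS) as HD.
  apply (cint_bound _ _ _ _ (exp (2 + 8 * PI * mu t m) + regular_bound t m)) in HD; [|lra|].
  2:{ intros s Hs. apply integrand_minus_principal_parts; auto. }
  replace (RtoC (IZR (c n)) - csum (fun k => csum (fun h => cusp_main t m n h k) k) (S N))%C
    with ((RtoC (IZR (c n)) - csum (fun k => csum (fun h => Jf h k) k) (S N)) + csum (fun k => csum (fun h => Jf h k - cusp_main t m n h k) k) (S N))%C.
  2:{ rewrite (csum_ext (fun k => csum (fun h => Jf h k - cusp_main t m n h k) k)%C (fun k => csum (fun h => Jf h k) k - csum (fun h => cusp_main t m n h k) k)%C).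
      rewrite csum_minus. ring. intros; apply csum_minus. }
  eapply Rle_trans. apply Cmod_triangle.
  apply Rplus_le_compat. lra.
  apply Cmod_csum_le. intros k Hk. apply Cmod_csum_le. intros h Hh. apply HJ; auto.
Qed.

(** ** Bounds for the Bessel function *)

(** A central binomial coefficient is at most a power of 4. *)
Lemma fact_odd_le : forall j, INR (fact (2 * j + 1)) <= 4 ^ j * (INR (fact j) * INR (fact (S j))).
Proof.
  induction j. simpl. lra.
  replace (2 * S j + 1)%nat with (S (S (2 * j + 1))) by lia.
  rewrite (fact_simpl (S (2 * j + 1))), (fact_simpl (2 * j + 1)), (fact_simpl (S j)), !mult_INR.
  replace (INR (S (S (2 * j + 1)))) with (2 * INR j + 3) by (rewrite !S_INR, plus_INR, mult_INR; simpl; ring).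
  replace (INR (S (2 * j + 1))) with (2 * INR j + 2) by (rewrite !S_INR, plus_INR, mult_INR; simpl; ring).
  rewrite (S_INR (S j)). assert (HSj : INR (S j) = INR j + 1) by apply S_INR.
  replace (INR (fact (S j))) with (INR (S j) * INR (fact j)) in * by (rewrite fact_simpl, mult_INR; reflexivity).
  rewrite HSj in *. pose proof (pos_INR j) as Hj. pose proof (INR_fact_lt_0 j) as Hf.
  set (f := INR (fact j)) in *. set (x := INR j) in *. set (g := INR (fact (2 * j + 1))) in *.
  assert (Hp : 0 < 4 ^ j) by (apply pow_lt; lra). simpl pow. set (p := 4 ^ j) in *.
  apply Rle_trans with ((2 * x + 3) * ((2 * x + 2) * (p * (f * ((x + 1) * f))))).
  - apply Rmult_le_compat_l. lra. apply Rmult_le_compat_l. lra. exact IHj.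
  - assert (0 <= p * (f * f) * ((x + 1) * (x + 1))) by (repeat apply Rmult_le_pos; lra). nra.
Qed.

Lemma series_le_partial : forall (a : nat -> R) (B : R), (forall n, 0 <= a n) -> ex_series a -> (forall n, rsum a n <= B) -> Series a <= B.
Proof.
  intros a B Ha Hex HB. pose proof (is_series_rsum _ _ (Series_correct _ Hex)) as H.
  apply (is_lim_seq_le (rsum a) (fun _ => B) (Finite (Series a)) (Finite B)); auto. apply is_lim_seq_const.
Qed.

Lemma rsum_le_series : forall (a : nat -> R) (l : R) n, (forall n, 0 <= a n) -> is_series a l -> rsum a n <= l.
Proof.
  intros a l n Ha H. apply is_series_rsum in H.
  apply (is_lim_seq_incr_compare (rsum a) l); auto. intros k. cbn [rsum]. specialize (Ha k). lra.
Qed.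

Lemma odd_exp_partial : forall x n, 0 <= x -> rsum (fun j => x ^ (2 * j + 1) / INR (fact (2 * j + 1))) n <= exp x / 2.
Proof.
  intros x n Hx.
  set (u := fun i => / 2 * (x ^ i / INR (fact i) - (- x) ^ i / INR (fact i))).
  assert (Hu : is_series u (/ 2 * (exp x - exp (- x)))).
  { apply (is_series_scal_l (V := R_NormedModule) (/ 2) (fun i => x ^ i / INR (fact i) - (- x) ^ i / INR (fact i))).
    apply (is_series_minus (V := R_NormedModule) (fun i => x ^ i / INR (fact i)) (fun i => (- x) ^ i / INR (fact i))); apply is_series_exp. }
  assert (Hev : forall j, u (2 * j)%nat = 0).
  { intros j. unfold u. replace ((- x) ^ (2 * j)) with (x ^ (2 * j)). ring. rewrite !pow_mult. f_equal. ring. }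
  assert (Hod : forall j, u (2 * j + 1)%nat = x ^ (2 * j + 1) / INR (fact (2 * j + 1))).
  { intros j. unfold u. replace ((- x) ^ (2 * j + 1)) with (- x ^ (2 * j + 1)). field. apply INR_fact_neq_0.
    rewrite !pow_add, !pow_mult, !pow_1. replace ((- x) ^ 2) with (x ^ 2) by ring. ring. }
  assert (Hpos : forall i, 0 <= u i).
  { intros i. destruct (Nat.Even_or_Odd i) as [[j ->]|[j ->]]. rewrite Hev; lra. rewrite Hod.
    apply Rmult_le_pos. apply pow_le; auto. left; apply Rinv_0_lt_compat; apply INR_fact_lt_0. }
  assert (Hr : rsum (fun j => x ^ (2 * j + 1) / INR (fact (2 * j + 1))) n = rsum u (2 * n)).
  { induction n. reflexivity. replace (2 * S n)%nat with (S (S (2 * n))) by lia. cbn [rsum]. rewrite IHn, Hev.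
    replace (S (2 * n)) with (2 * n + 1)%nat by lia. rewrite Hod. ring. }
  rewrite Hr. pose proof (rsum_le_series u _ (2 * n) Hpos Hu). pose proof (exp_pos (- x)). lra.
Qed.

(** I_1(x) <= sinh(x)/2, term by term, from the central binomial bound. *)
Lemma bessel_value_le : forall a b, 0 < a -> 0 < b -> bessel_value a b <= sqrt (b / a) * (exp (2 * sqrt (a * b)) / 4).
Proof.
  intros a b Ha Hb. set (s := sqrt (a * b)).
  assert (Hs : 0 < s) by (apply sqrt_lt_R0; nra). assert (Hs2 : s * s = a * b) by (apply sqrt_sqrt; nra).
  assert (Hba : sqrt (b / a) = b / s).
  { apply Rmult_eq_reg_r with s; [|lra]. unfold s. rewrite <- sqrt_mult_alt.
    replace (b / a * (a * b)) with (b * b) by (field; lra). rewrite sqrt_square by lra. fold s. field. lra.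
    left; apply Rdiv_lt_0_compat; auto. }
  rewrite Hba. apply series_le_partial.
  - intros; apply bessel_term_le; lra.
  - apply ex_series_bessel; lra.
  - intros n. apply Rle_trans with (rsum (fun j => b / s * / 2 * ((2 * s) ^ (2 * j + 1) / INR (fact (2 * j + 1)))) n).
    + apply rsum_le. intros j _. unfold bessel_term.
      pose proof (fact_odd_le j) as HF. pose proof (INR_fact_lt_0 j). pose proof (INR_fact_lt_0 (S j)). pose proof (INR_fact_lt_0 (2 * j + 1)).
      replace (b ^ S j / INR (fact (S j)) * (a ^ j / INR (fact j))) with (b * (s * s) ^ j * / (INR (fact j) * INR (fact (S j)))).
      2:{ rewrite Hs2, Rpow_mult_distr. change (b ^ S j) with (b * b ^ j). set (u := a ^ j). set (v := b ^ j). set (f1 := INR (fact (S j))) in *. set (f2 := INR (fact j)) in *. field. split; lra. }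
      replace (b / s * / 2 * ((2 * s) ^ (2 * j + 1) / INR (fact (2 * j + 1)))) with (b * (s * s) ^ j * (4 ^ j * / INR (fact (2 * j + 1)))).
      2:{ rewrite pow_add, pow_mult, pow_1. replace ((2 * s) ^ 2) with (4 * (s * s)) by ring. rewrite (Rpow_mult_distr 4). set (u := 4 ^ j). set (v := (s * s) ^ j). field. split; lra. }
      apply Rmult_le_compat_l. apply Rmult_le_pos. lra. apply pow_le; nra.
      apply Rmult_le_reg_r with (INR (fact j) * INR (fact (S j)) * INR (fact (2 * j + 1))). apply Rmult_lt_0_compat; auto. apply Rmult_lt_0_compat; auto.
      replace (/ (INR (fact j) * INR (fact (S j))) * (INR (fact j) * INR (fact (S j)) * INR (fact (2 * j + 1)))) with (INR (fact (2 * j + 1))) by (field; lra).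
      replace (4 ^ j * / INR (fact (2 * j + 1)) * (INR (fact j) * INR (fact (S j)) * INR (fact (2 * j + 1)))) with (4 ^ j * (INR (fact j) * INR (fact (S j)))) by (field; lra).
      exact HF.
    + rewrite rsum_scal. replace (b / s * (exp (2 * s) / 4)) with (b / s * / 2 * (exp (2 * s) / 2)) by (field; lra).
      apply Rmult_le_compat_l. apply Rmult_le_pos. left; apply Rdiv_lt_0_compat; auto. lra. apply odd_exp_partial. lra.
Qed.

(** Preferable to [bessel_value_le] when [a b] is small: the prefactor does not involve [a]. *)
Lemma bessel_value_le_small : forall a b, 0 < a -> 0 <= b -> bessel_value a b <= b * exp (2 * sqrt (a * b)).
Proof.
  intros a b Ha Hb. set (s := sqrt (a * b)).
  assert (Hs : 0 <= s) by apply sqrt_pos. assert (Hs2 : s * s = a * b) by (apply sqrt_sqrt; nra).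
  apply series_le_partial.
  - intros; apply bessel_term_le; lra.
  - apply ex_series_bessel; lra.
  - intros n. apply Rle_trans with (rsum (fun j => b * ((2 * s) ^ (2 * j) / INR (fact (2 * j)))) n).
    + apply rsum_le. intros j _. unfold bessel_term.
      pose proof (fact_odd_le j) as HF. pose proof (INR_fact_lt_0 j). pose proof (INR_fact_lt_0 (S j)). pose proof (INR_fact_lt_0 (2 * j)).
      assert (HF' : INR (fact (2 * j)) <= 4 ^ j * (INR (fact j) * INR (fact (S j)))).
      { eapply Rle_trans; [|exact HF]. apply le_INR. apply fact_le. lia. }
      replace (b ^ S j / INR (fact (S j)) * (a ^ j / INR (fact j))) with (b * (s * s) ^ j * / (INR (fact j) * INR (fact (S j)))).
      2:{ rewrite Hs2, Rpow_mult_distr. change (b ^ S j) with (b * b ^ j). set (u := a ^ j). set (v := b ^ j). set (f1 := INR (fact (S j))) in *. set (f2 := INR (fact j)) in *. field. split; lra. }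
      replace (b * ((2 * s) ^ (2 * j) / INR (fact (2 * j)))) with (b * (s * s) ^ j * (4 ^ j * / INR (fact (2 * j)))).
      2:{ rewrite pow_mult. replace ((2 * s) ^ 2) with (4 * (s * s)) by ring. rewrite (Rpow_mult_distr 4). set (u := 4 ^ j). set (v := (s * s) ^ j). field. lra. }
      apply Rmult_le_compat_l. apply Rmult_le_pos. lra. apply pow_le; nra.
      apply Rmult_le_reg_r with (INR (fact j) * INR (fact (S j)) * INR (fact (2 * j))). apply Rmult_lt_0_compat; auto. apply Rmult_lt_0_compat; auto.
      replace (/ (INR (fact j) * INR (fact (S j))) * (INR (fact j) * INR (fact (S j)) * INR (fact (2 * j)))) with (INR (fact (2 * j))) by (field; lra).
      replace (4 ^ j * / INR (fact (2 * j)) * (INR (fact j) * INR (fact (S j)) * INR (fact (2 * j)))) with (4 ^ j * (INR (fact j) * INR (fact (S j)))) by (field; lra).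
      exact HF'.
    + rewrite rsum_scal. apply Rmult_le_compat_l. lra.
      assert (Hpos : forall i, 0 <= (2 * s) ^ i / INR (fact i)).
      { intros. apply Rmult_le_pos. apply pow_le; lra. left; apply Rinv_0_lt_compat; apply INR_fact_lt_0. }
      assert (HE : rsum (fun j => (2 * s) ^ (2 * j) / INR (fact (2 * j))) n <= rsum (fun i => (2 * s) ^ i / INR (fact i)) (2 * n)).
      { induction n. simpl; lra. replace (2 * S n)%nat with (S (S (2 * n))) by lia. cbn [rsum].
        pose proof (Hpos (S (2 * n))). lra. }
      eapply Rle_trans. exact HE. apply rsum_le_series; auto. apply is_series_exp.
Qed.

(** * The main term *)

Lemma dedekind_sum_1 : forall h, dedekind_sum h 1 = 0.
Proof. intros. unfold dedekind_sum. rewrite sum_n_m_zero by lia. reflexivity. Qed.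

Lemma alpha_csum : forall t m n, (0 < t)%nat -> alpha t m n = csum (fun h =>
  if Nat.eqb (Nat.gcd h t) 1 then Cexp (RtoC (- (INR m * PI * dedekind_sum (Z.of_nat h) t) - 2 * PI * INR n * INR h / INR t) * Ci) else RtoC 0) t.
Proof.
  intros t m n Ht. assert (HtR : 0 < INR t) by (apply lt_0_INR; auto).
  unfold alpha. change (sum_n_m (G := C_AbelianMonoid)) with (@sum_n_m C_AbelianMonoid).
  match goal with |- sum_n_m ?f 0 (t - 1) = _ => change (sum_n_m f 0 (t - 1)) with (sum_n f (t - 1)) end.
  rewrite sum_n_csum. replace (S (t - 1)) with t by lia. apply csum_ext. intros h _.
  destruct (Nat.eqb (Nat.gcd h t) 1); auto. f_equal.
  rewrite RtoC_minus, RtoC_opp, RtoC_div, !RtoC_mult by lra. field. apply RtoC_neq; lra.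
Qed.

(** The first term of the series of I_(-1) vanishes with 1/Gamma(0); the others are those of I_1. *)
Lemma bessel_value_BesselI : forall mu nu t, 0 < mu -> 0 < nu -> 0 < t ->
  2 * PI * bessel_value (2 * PI * nu) (2 * PI * mu / t ^ 2)
  = 2 * PI * sqrt mu / t * / sqrt nu * BesselI (-1) (4 * PI * sqrt (mu * nu) / t).
Proof.
  intros mu nu t Hm Hn Ht. pose proof PI_RGT_0 as HP.
  assert (Hsm : 0 < sqrt mu) by (apply sqrt_lt_R0; auto). assert (Hsn : 0 < sqrt nu) by (apply sqrt_lt_R0; auto).
  assert (Em : sqrt mu * sqrt mu = mu) by (apply sqrt_sqrt; lra). assert (En : sqrt nu * sqrt nu = nu) by (apply sqrt_sqrt; lra).
  rewrite sqrt_mult by lra.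
  unfold BesselI. rewrite Series_incr_1_aux.
  2:{ unfold inv_Gamma_Z. simpl. ring. }
  replace (2 * PI * sqrt mu / t * / sqrt nu) with (2 * PI * (sqrt mu / t * / sqrt nu)) by (field; lra).
  rewrite (Rmult_assoc (2 * PI) (sqrt mu / t * / sqrt nu)). f_equal. rewrite <- Series_scal_l. unfold bessel_value. apply Series_ext. intros j.
  unfold bessel_term, inv_Gamma_Z.
  replace (Z.leb (Z.of_nat (S j) + -1 + 1) 0) with false by (symmetry; apply Z.leb_gt; lia).
  replace (Z.to_nat (Z.of_nat (S j) + -1 + 1 - 1)) with j by lia.
  replace (2 * Z.of_nat (S j) + -1)%Z with (Z.of_nat (2 * j + 1)) by lia.
  rewrite <- pow_powerRZ.
  replace (4 * PI * (sqrt mu * sqrt nu) / t / 2) with (2 * PI * (sqrt mu * sqrt nu) / t) by (field; lra).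
  rewrite pow_add, pow_mult, pow_1.
  replace ((2 * PI * (sqrt mu * sqrt nu) / t) ^ 2) with (2 * PI * mu / t ^ 2 * (2 * PI * nu)).
  2:{ rewrite <- Em at 1. rewrite <- En at 1. field. lra. }
  rewrite (Rpow_mult_distr (2 * PI * mu / t ^ 2)), <- (tech_pow_Rmult _ j).
  assert (F1 := INR_fact_neq_0 j). assert (F2 := INR_fact_neq_0 (S j)).
  set (p := (2 * PI * mu / t ^ 2) ^ j). set (q := (2 * PI * nu) ^ j). set (g := INR (fact j)) in *. set (g' := INR (fact (S j))) in *.
  replace (2 * PI * mu / t ^ 2) with (2 * PI * (sqrt mu * sqrt mu) / t ^ 2) by (rewrite Em; reflexivity).
  field. lra.
Qed.

(** When [k = t] the gcd is [t]: the prefactor is 1, one Dedekind sum has modulus 1 and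
    vanishes, and the weight is [2 pi mu]. *)
Lemma cusp_main_t : forall t m n, (2 <= t)%nat -> (0 < m)%nat -> 0 < INR n - mu t m ->
  csum (fun h => cusp_main t m n h t) t =
  (RtoC (2 * PI * sqrt (mu t m) / INR t * / sqrt (INR n - mu t m)) * alpha t m n
   * RtoC (BesselI (-1) (4 * PI * sqrt (mu t m * (INR n - mu t m)) / INR t)))%C.
Proof.
  intros t m n Ht Hm Hnu. pose proof PI_RGT_0 as HP.
  assert (HtR : 2 <= INR t) by (replace 2 with (INR 2) by reflexivity; apply le_INR; auto).
  assert (HmR : 0 < INR m) by (apply lt_0_INR; auto).
  assert (Hmu : 0 < mu t m) by (unfold mu; nra).
  assert (Ep : pole_weight t m t = 2 * PI * mu t m).
  { unfold pole_weight, mu. rewrite Nat.gcd_diag. field. lra. }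
  rewrite alpha_csum by lia.
  match goal with |- _ = (?a * ?b * ?c)%C => replace (a * b * c)%C with ((a * c) * b)%C by ring end.
  rewrite <- RtoC_mult, <- csum_scal. apply csum_ext. intros h Hh.
  rewrite <- bessel_value_BesselI by lra. unfold cusp_main, singular.
  rewrite Nat.gcd_diag. replace (Nat.ltb t (t * t)) with true by (symmetry; apply Nat.ltb_lt; nia).
  rewrite Bool.andb_true_r. destruct (Nat.eqb (Nat.gcd h t) 1) eqn:EG. 2: ring.
  rewrite Ep, Cmult_comm. f_equal. unfold cusp_coef, cusp_phase. rewrite Nat.gcd_diag.
  replace (INR t / INR t) with 1 by (field; lra).
  replace (Rpower 1 (INR m / 2)) with 1 by (unfold Rpower; rewrite ln_1, Rmult_0_r, exp_0; reflexivity).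
  rewrite Cmult_1_l. rewrite Nat.div_same, dedekind_sum_1 by lia. rewrite <- INR_IZR_INZ.
  do 3 f_equal. ring.
Qed.

(** All cusps of denominator [k] together, in absolute value, except for the main term. *)
Definition rest_term (t m n k : nat) : R :=
  if Nat.eqb k t then 0 else if Nat.ltb t (Nat.gcd t k * Nat.gcd t k) then
    INR k * (Rpower (INR t / INR (Nat.gcd t k)) (INR m / 2)
      * (2 * PI * bessel_value (2 * PI * (INR n - mu t m)) (pole_weight t m k / INR k ^ 2)))
  else 0.

Lemma csum_remove : forall (f : nat -> C) i n, (i < n)%nat ->
  csum f n = (f i + csum (fun k => if Nat.eqb k i then RtoC 0 else f k) n)%C.
Proof.
  intros f i n Hi.
  assert (E : f i = csum (fun k => if Nat.eqb k i then f k else RtoC 0) n).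
  { rewrite (csum_only _ n i Hi). rewrite Nat.eqb_refl; auto.
    intros j _ Hj. apply Nat.eqb_neq in Hj. rewrite Hj; auto. }
  rewrite E, <- csum_plus. apply csum_ext. intros k _. destruct (Nat.eqb k i); ring.
Qed.

Lemma bessel_value_ge_0 : forall a b, 0 <= a -> 0 <= b -> 0 <= bessel_value a b.
Proof.
  intros a b Ha Hb. apply (rsum_le_series (bessel_term a b) _ 0).
  - intros; apply bessel_term_le; auto.
  - apply Series_correct, ex_series_bessel; auto.
Qed.

Lemma coefficient_minus_main : forall t m c n N, (2 <= t)%nat -> (0 < m)%nat -> is_ctm t m c -> mu t m <= 1 -> (t <= N)%nat ->
  0 < INR n - mu t m -> PI * (INR n - mu t m) <= INR N ^ 2 ->
  Cmod (RtoC (IZR (c n)) -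
    RtoC (2 * PI * sqrt (mu t m) / INR t * / sqrt (INR n - mu t m)) * alpha t m n
   * RtoC (BesselI (-1) (4 * PI * sqrt (mu t m * (INR n - mu t m)) / INR t)))%C
  <= 4 * exp (2 + 8 * PI * mu t m) + regular_bound t m + rsum (rest_term t m n) (S N).
Proof.
  intros t m c n N Ht Hm Hc Hmu HN Hnu HN2. pose proof PI_RGT_0 as HP.
  pose proof (coefficient_approx t m c n N ltac:(lia) Hc Hmu ltac:(lia) Hnu HN2) as H.
  pose proof (chord_error_sum t m N ltac:(lia) ltac:(lia)) as HE.
  set (g := fun k => csum (fun h => cusp_main t m n h k) k) in H.
  rewrite (csum_remove g t (S N)) in H by lia. unfold g at 1 in H. rewrite cusp_main_t in H by auto.
  match type of H with Cmod (?x - (?y + ?r))%C <= _ => set (X := x) in *; set (Y := y) in *; set (Rr := r) in * end.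
  replace (X - Y)%C with ((X - (Y + Rr)) + Rr)%C by ring.
  eapply Rle_trans. apply Cmod_triangle.
  assert (HR : Cmod Rr <= rsum (rest_term t m n) (S N)).
  { apply Cmod_csum_le. intros k Hk. unfold rest_term. destruct (Nat.eqb k t). rewrite Cmod_0; lra.
    unfold g. destruct (Nat.ltb t (Nat.gcd t k * Nat.gcd t k)) eqn:EB.
    - eapply Rle_trans. apply Cmod_csum_le with (g := fun _ => (Rpower (INR t / INR (Nat.gcd t k)) (INR m / 2)
      * (2 * PI * bessel_value (2 * PI * (INR n - mu t m)) (pole_weight t m k / INR k ^ 2)))).
      2: rewrite rsum_const; lra.
      intros h Hh. assert (Hk0 : (0 < k)%nat) by lia.
      assert (HkR : 0 < INR k) by (apply lt_0_INR; auto).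
      assert (HB : 0 <= bessel_value (2 * PI * (INR n - mu t m)) (pole_weight t m k / INR k ^ 2)).
      { apply bessel_value_ge_0. nra. apply Rmult_le_pos. apply pole_weight_ge_0; auto. lia.
        apply Nat.ltb_lt in EB. apply lt_INR in EB. rewrite mult_INR in EB. simpl. lra.
        left. apply Rinv_0_lt_compat. apply pow_lt; auto. }
      set (B := bessel_value _ _) in *.
      assert (0 <= 2 * PI * B) by nra.
      unfold cusp_main. destruct (singular t h k).
      + fold B. rewrite Cmod_mult, (Cmod_RtoC (2 * PI * B)) by auto. apply Req_le. f_equal.
        unfold cusp_coef. rewrite Cmod_mult, Cmod_RtoC, Cmod_Cexp by (left; apply exp_pos).
        rewrite re_scal_l. change (Re Ci) with 0. rewrite Rmult_0_r, exp_0. ring.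
      + rewrite Cmod_0. apply Rmult_le_pos; auto. left; apply exp_pos.
    - rewrite csum_all_zero. rewrite Cmod_0; lra. intros h _. unfold cusp_main, singular. rewrite EB, Bool.andb_false_r. reflexivity. }
  lra.
Qed.

(** * The remaining cusps *)

Lemma large_gcd_ltb : forall t l, large_gcd t l = Nat.ltb t (Nat.gcd t l * Nat.gcd t l).
Proof.
  intros t l. unfold large_gcd. set (d := Nat.gcd t l). pose proof (pos_INR t) as Ht. pose proof (pos_INR d) as Hd.
  pose proof (sqrt_pos (INR t)) as Hs. pose proof (sqrt_sqrt (INR t) Ht) as Hss.
  destruct (Rlt_dec _ _) as [L|L]; destruct (Nat.ltb_spec t (d * d)) as [K|K]; auto; exfalso.
  - apply le_INR in K. rewrite mult_INR in K. nra.
  - apply lt_INR in K. rewrite mult_INR in K. nra.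
Qed.

Lemma gcd_gcd_l : forall t k, Nat.gcd t (Nat.gcd t k) = Nat.gcd t k.
Proof. intros. rewrite Nat.gcd_assoc, Nat.gcd_diag. reflexivity. Qed.

Lemma gcd_pos_le : forall t k, (0 < t)%nat -> (0 < k)%nat -> (1 <= Nat.gcd t k <= t /\ Nat.gcd t k <= k)%nat.
Proof.
  intros t k Ht Hk. pose proof (Nat.divide_pos_le _ _ Ht (Nat.gcd_divide_l t k)).
  pose proof (Nat.divide_pos_le _ _ Hk (Nat.gcd_divide_r t k)).
  assert (Nat.gcd t k <> 0)%nat by (intros E; apply Nat.gcd_eq_0 in E; lia). lia.
Qed.

Lemma fold_max_ge : forall l s x, In x l -> (x <= fold_right Nat.max s l)%nat.
Proof.
  induction l; simpl; intros s x H. tauto. destruct H as [->|H]. lia. specialize (IHl s x H). lia.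
Qed.

Lemma fold_Rmax_ge : forall l s x, In x l -> x <= fold_right Rmax s l.
Proof.
  induction l; simpl; intros s x H. tauto. destruct H as [->|H]. apply Rmax_l.
  eapply Rle_trans; [apply (IHl s x H)|apply Rmax_r].
Qed.

Lemma fold_Rmax_ge_seed : forall l s, s <= fold_right Rmax s l.
Proof. induction l; simpl; intros. lra. eapply Rle_trans; [apply IHl|apply Rmax_r]. Qed.

(** The maximum runs over [l <= t]; the value at [k] is attained at [l = gcd (t, k)]. *)
Lemma maxA_ge : forall t k, (0 < t)%nat -> (0 < k)%nat -> (t < Nat.gcd t k * Nat.gcd t k)%nat ->
  INR t / INR (Nat.gcd t k) <= INR (maxA t).
Proof.
  intros t k Ht Hk HL. destruct (gcd_pos_le t k Ht Hk) as [H1 H2]. set (d := Nat.gcd t k) in *.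
  destruct (Nat.gcd_divide_l t k) as [q Hq]. fold d in Hq.
  assert (HdR : 0 < INR d) by (apply lt_0_INR; lia).
  replace (INR t / INR d) with (INR (t / d)).
  2:{ rewrite Hq, Nat.div_mul, mult_INR by lia. field. lra. }
  apply le_INR. unfold maxA. apply fold_max_ge. apply in_map_iff. exists d. split.
  unfold d at 1. rewrite gcd_gcd_l. reflexivity.
  apply filter_In. split. apply in_seq. lia. rewrite large_gcd_ltb. unfold d. rewrite gcd_gcd_l. apply Nat.ltb_lt. exact HL.
Qed.

(** Again [l = gcd (t, k) <= k] does at least as well, unless it equals [t]; then [k >= 2 t] and
    the first member of the set, the value at [2 t], takes over. *)
Lemma maxM_ge : forall t m k, (0 < t)%nat -> (0 < k)%nat -> k <> t -> (t < Nat.gcd t k * Nat.gcd t k)%nat ->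
  sqrt (INR m * (INR (Nat.gcd t k) ^ 2 - INR t) / INR t) / INR k <= maxM t m.
Proof.
  intros t m k Ht Hk Hkt HL. destruct (gcd_pos_le t k Ht Hk) as [H1 H2].
  assert (HtR : 0 < INR t) by (apply lt_0_INR; auto). assert (HkR : 0 < INR k) by (apply lt_0_INR; auto).
  destruct (Nat.eq_dec (Nat.gcd t k) t) as [E|E].
  - rewrite E in *. assert (H2t : (2 * t <= k)%nat).
    { destruct (Nat.gcd_divide_r t k) as [q Hq]. rewrite E in Hq. destruct q as [|[|q]]; nia. }
    eapply Rle_trans; [|apply fold_Rmax_ge_seed].
    replace (INR m * (INR t ^ 2 - INR t) / INR t) with (INR m * (INR t - 1)) by (field; lra).
    apply Rmult_le_compat_l. apply sqrt_pos. apply le_INR in H2t. rewrite mult_INR in H2t. simpl in H2t.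
    apply Rinv_le_contravar; lra.
  - set (d := Nat.gcd t k) in *. assert (HdR : 0 < INR d) by (apply lt_0_INR; lia).
    apply Rle_trans with (1 / INR d * sqrt (INR m * (INR d ^ 2 - INR t) / INR t)).
    + unfold Rdiv at 1. rewrite Rmult_comm. apply Rmult_le_compat_r. apply sqrt_pos.
      unfold Rdiv. rewrite Rmult_1_l. apply Rinv_le_contravar; auto. apply le_INR; lia.
    + apply fold_Rmax_ge. apply in_map_iff. exists d. split. unfold d at 2. rewrite gcd_gcd_l. reflexivity.
      apply filter_In. split. apply in_seq. lia. rewrite large_gcd_ltb. unfold d. rewrite gcd_gcd_l. apply Nat.ltb_lt. exact HL.
Qed.

Lemma rest_term_0 : forall t m n, (0 < t)%nat -> rest_term t m n 0 = 0.
Proof.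
  intros. unfold rest_term. destruct (Nat.eqb 0 t); auto. destruct (Nat.ltb _ _); auto. simpl INR. ring.
Qed.

Lemma rest_term_1 : forall t m n, (0 < t)%nat -> rest_term t m n 1 = 0.
Proof.
  intros. unfold rest_term. destruct (Nat.eqb 1 t); auto.
  rewrite (Nat.gcd_comm t 1). simpl Nat.gcd. destruct (Nat.ltb_spec t (1 * 1)); auto. lia.
Qed.

(** The factor [k] for the number of cusps cancels against the [1 / k] in [sqrt (b / a)], so the
    bound is the same for all denominators. *)
Lemma rest_term_le_growth : forall t m n k, (0 < t)%nat -> (0 < m)%nat -> (0 < k)%nat -> 0 < INR n - mu t m ->
  rest_term t m n k <= Rpower (INR (maxA t)) (INR m / 2) * (PI / 2 * sqrt (mu t m / (INR n - mu t m))
    * exp (sqrt 6 * PI * maxM t m / 3 * sqrt (INR n - mu t m))).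
Proof.
  intros t m n k Ht Hm Hk Hnu. pose proof PI_RGT_0 as HP. pose proof (mu_ge_0 t m Ht) as Hmu.
  set (nu := INR n - mu t m) in *.
  assert (H0 : 0 <= Rpower (INR (maxA t)) (INR m / 2) * (PI / 2 * sqrt (mu t m / nu) * exp (sqrt 6 * PI * maxM t m / 3 * sqrt nu))).
  { apply Rmult_le_pos. left; apply exp_pos. apply Rmult_le_pos. apply Rmult_le_pos. lra. apply sqrt_pos. left; apply exp_pos. }
  unfold rest_term. fold nu. destruct (Nat.eqb_spec k t) as [E|Hkt]; auto.
  destruct (Nat.ltb_spec t (Nat.gcd t k * Nat.gcd t k)) as [HL|HL]; auto. clear H0.
  pose proof (maxA_ge t k Ht Hk HL) as HA. pose proof (maxM_ge t m k Ht Hk Hkt HL) as HM.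
  pose proof (pole_weight_le t m k Ht Hk) as Hpw.
  assert (HtR : 0 < INR t) by (apply lt_0_INR; auto). assert (HkR : 0 < INR k) by (apply lt_0_INR; auto).
  assert (HmR : 0 < INR m) by (apply lt_0_INR; auto).
  assert (HLR : INR t < INR (Nat.gcd t k) ^ 2) by (apply lt_INR in HL; rewrite mult_INR in HL; simpl; lra).
  destruct (gcd_pos_le t k Ht Hk) as [Hd _].
  set (d := Nat.gcd t k) in *. assert (HdR : 0 < INR d) by (apply lt_0_INR; lia).
  set (pw := pole_weight t m k) in *.
  assert (Epw : pw = PI / 12 * (INR m * (INR d ^ 2 - INR t) / INR t)) by (unfold pw, pole_weight; fold d; field; lra).
  set (Q := INR m * (INR d ^ 2 - INR t) / INR t) in *.
  assert (HQ : 0 < Q) by (unfold Q; apply Rdiv_lt_0_compat; [apply Rmult_lt_0_compat; lra|auto]).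
  assert (Hpw0 : 0 < pw) by nra.
  assert (Hk2 : 0 < INR k ^ 2) by (apply pow_lt; auto).
  assert (Hb : 0 < pw / INR k ^ 2) by (apply Rdiv_lt_0_compat; auto).
  pose proof (bessel_value_le (2 * PI * nu) (pw / INR k ^ 2) ltac:(nra) Hb) as HB.
  set (bv := bessel_value _ _) in *.
  assert (S1 : sqrt (pw / INR k ^ 2 / (2 * PI * nu)) <= sqrt (mu t m / nu) / INR k).
  { replace (sqrt (mu t m / nu) / INR k) with (sqrt (mu t m / nu / INR k ^ 2)).
    apply sqrt_le_1_alt. replace (pw / INR k ^ 2 / (2 * PI * nu)) with (pw / (2 * PI) / nu / INR k ^ 2) by (field; lra).
    apply Rmult_le_compat_r. left; apply Rinv_0_lt_compat; auto. apply Rmult_le_compat_r. left; apply Rinv_0_lt_compat; auto.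
    apply Rmult_le_reg_r with (2 * PI). lra. field_simplify; lra.
    rewrite sqrt_div_alt by auto. rewrite sqrt_pow2 by lra. reflexivity. }
  assert (S2 : 2 * sqrt (2 * PI * nu * (pw / INR k ^ 2)) <= sqrt 6 * PI * maxM t m / 3 * sqrt nu).
  { assert (H6 : sqrt 6 * sqrt 6 = 6) by (apply sqrt_sqrt; lra). pose proof (sqrt_lt_R0 6 ltac:(lra)) as H6p.
    replace (2 * PI * nu * (pw / INR k ^ 2)) with (Rsqr (sqrt 6 * PI / 6 * (sqrt Q / INR k) * sqrt nu)).
    2:{ unfold Rsqr. replace (sqrt 6 * PI / 6 * (sqrt Q / INR k) * sqrt nu * (sqrt 6 * PI / 6 * (sqrt Q / INR k) * sqrt nu))
          with ((sqrt 6 * sqrt 6) * PI * PI / 36 * (sqrt Q * sqrt Q) / INR k ^ 2 * (sqrt nu * sqrt nu)) by (field; lra).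
        rewrite H6, !sqrt_sqrt, Epw by lra. field. lra. }
    pose proof (sqrt_pos nu). pose proof (sqrt_lt_R0 Q HQ).
    assert (0 <= sqrt Q / INR k) by (left; apply Rdiv_lt_0_compat; auto).
    rewrite sqrt_Rsqr. 2: apply Rmult_le_pos; auto; apply Rmult_le_pos; auto; nra.
    replace (sqrt 6 * PI * maxM t m / 3 * sqrt nu) with (2 * (sqrt 6 * PI / 6 * maxM t m * sqrt nu)) by field.
    apply Rmult_le_compat_l. lra. apply Rmult_le_compat_r; auto. apply Rmult_le_compat_l; auto. nra. }
  apply exp_le in S2. set (X := exp (sqrt 6 * PI * maxM t m / 3 * sqrt nu)) in *. set (X' := exp (2 * sqrt _)) in *.
  assert (HX' : 0 < X') by apply exp_pos.
  assert (HR : Rpower (INR t / INR d) (INR m / 2) <= Rpower (INR (maxA t)) (INR m / 2)).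
  { apply Rle_Rpower_l. lra. split; auto. apply Rdiv_lt_0_compat; auto. }
  set (R1 := Rpower (INR t / INR d) _) in *. set (R2 := Rpower (INR (maxA t)) _) in *.
  assert (HR1 : 0 < R1) by apply exp_pos.
  set (q := sqrt (mu t m / nu)) in *. assert (Hq : 0 <= q) by apply sqrt_pos.
  assert (HB' : bv <= q / INR k * (X / 4)).
  { eapply Rle_trans. exact HB. apply Rmult_le_compat; auto. apply sqrt_pos. lra. lra. }
  apply Rle_trans with (INR k * (R2 * (2 * PI * (q / INR k * (X / 4))))).
  - apply Rmult_le_compat_l. lra. apply Rle_trans with (R1 * (2 * PI * (q / INR k * (X / 4)))).
    + apply Rmult_le_compat_l. lra. apply Rmult_le_compat_l. lra. exact HB'.
    + apply Rmult_le_compat_r; auto. apply Rmult_le_pos. lra. apply Rmult_le_pos. apply Rmult_le_pos; auto. left; apply Rinv_0_lt_compat; auto. lra.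
  - apply Req_le. field. lra.
Qed.

(** The Taylor bound for the cosine is negative at 8/5. *)
Lemma PI_lt_16_5 : PI < 16 / 5.
Proof.
  destruct (Rlt_or_le PI (16 / 5)) as [H|H]; auto. exfalso.
  pose proof (cos_ge_0 (8 / 5) ltac:(lra) ltac:(lra)) as H1.
  pose proof (pre_cos_bound (8 / 5) 0 ltac:(lra) ltac:(lra)) as [_ H2].
  unfold cos_approx, cos_term in H2. simpl in H2. lra.
Qed.

Lemma PI_gt_3 : 3 < PI.
Proof. pose proof PI2_3_2. lra. Qed.

(** At most [sqrt (pi (n - mu))] denominators contribute, each at most the bound of
    [rest_term_le_growth]; then [mu <= 1] gives [sqrt mu <= mu^(1/4)]. *)
Lemma rest_sum_fine : forall t m n N, (0 < t)%nat -> (0 < m)%nat -> mu t m <= 1 -> 0 < INR n - mu t m -> (1 <= N)%nat ->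
  INR N - 1 <= sqrt (PI * (INR n - mu t m)) ->
  rsum (rest_term t m n) (S N) <= Rpower PI (7 / 4) / Rpower 2 (3 / 4)
    * Rpower (INR (maxA t)) (INR m / 2) * sqrt (sqrt (mu t m))
    * exp (sqrt 6 * PI * maxM t m / 3 * sqrt (INR n - mu t m)).
Proof.
  intros t m n N Ht Hm Hmu Hnu HN HNle. pose proof PI_RGT_0 as HP. pose proof PI_gt_3 as HP3. pose proof (mu_ge_0 t m Ht) as Hmu0.
  set (K := Rpower (INR (maxA t)) (INR m / 2) * (PI / 2 * sqrt (mu t m / (INR n - mu t m))
    * exp (sqrt 6 * PI * maxM t m / 3 * sqrt (INR n - mu t m)))).
  assert (HK : 0 <= K).
  { unfold K. apply Rmult_le_pos. left; apply exp_pos. apply Rmult_le_pos. apply Rmult_le_pos. lra. apply sqrt_pos. left; apply exp_pos. }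
  assert (H1 : rsum (rest_term t m n) (S N) <= (INR N - 1) * K).
  { rewrite rsum_S_l, rest_term_0 by auto. destruct N; [lia|]. rewrite rsum_S_l, rest_term_1 by auto.
    replace (INR (S N) - 1) with (INR N) by (rewrite S_INR; ring). rewrite !Rplus_0_l.
    apply rsum_nonneg_le_const. intros i _. apply rest_term_le_growth; auto. lia. }
  eapply Rle_trans. exact H1. eapply Rle_trans. apply Rmult_le_compat_r; [exact HK|exact HNle].
  unfold K. set (nu := INR n - mu t m) in *. set (A := Rpower (INR (maxA t)) _). set (X := exp _).
  rewrite sqrt_mult, sqrt_div_alt by lra.
  assert (Hsn : 0 < sqrt nu) by (apply sqrt_lt_R0; auto).
  replace (sqrt PI * sqrt nu * (A * (PI / 2 * (sqrt (mu t m) / sqrt nu) * X))) with (PI * sqrt PI / 2 * A * sqrt (mu t m) * X) by (field; lra).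
  apply Rmult_le_compat_r. left; apply exp_pos.
  assert (HA : 0 < A) by apply exp_pos.
  apply Rmult_le_compat.
  - apply Rmult_le_pos; [|lra]. apply Rmult_le_pos; [|lra]. apply Rmult_le_pos. lra. apply sqrt_pos.
  - apply sqrt_pos.
  - apply Rmult_le_compat_r. lra.
    assert (E1 : PI * sqrt PI = Rpower PI (3 / 2)).
    { rewrite <- Rpower_sqrt by auto. rewrite <- (Rpower_1 PI) at 1 by auto. rewrite <- Rpower_plus. f_equal. lra. }
    rewrite E1. apply Rmult_le_compat. left; apply exp_pos. lra.
    apply Rle_Rpower; lra. apply Rinv_le_contravar. apply exp_pos.
    rewrite <- (Rpower_1 2) at 2 by lra. apply Rle_Rpower; lra.
  - pose proof (sqrt_pos (mu t m)) as Hs. pose proof (sqrt_sqrt _ Hmu0) as Hss.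
    assert (Hs1 : sqrt (mu t m) <= 1) by nra.
    pose proof (sqrt_pos (sqrt (mu t m))). pose proof (sqrt_sqrt _ Hs). nra.
Qed.

(** From [exp (- s) >= 1 - s] with [s = pi / t]. *)
Lemma log_bound_ge : forall t m, (6 <= t)%nat -> INR m * (INR t ^ 2 / PI ^ 2 - INR t / PI) <= log_bound t m.
Proof.
  intros t m Ht. pose proof PI_RGT_0 as HP. pose proof PI_lt_16_5 as HP3.
  assert (HtR : 6 <= INR t) by (replace 6 with (INR 6) by (simpl; ring); apply le_INR; auto).
  unfold log_bound. apply Rmult_le_compat_l. apply pos_INR.
  assert (G1 : 0 <= exp (- PI) / (1 - exp (- PI)) ^ 2).
  { pose proof (exp_lt_1 (- PI) ltac:(lra)). apply Rmult_le_pos. left; apply exp_pos. left; apply Rinv_0_lt_compat; apply pow_lt; lra. }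
  set (s := PI / INR t). assert (Hs : 0 < s) by (apply Rdiv_lt_0_compat; lra).
  assert (Hs1 : s < 1) by (apply Rmult_lt_reg_r with (INR t); [lra|unfold s; field_simplify; lra]).
  replace (- PI / INR t) with (- s) by (unfold s; field; lra).
  replace (INR t ^ 2 / PI ^ 2 - INR t / PI) with ((1 - s) / s ^ 2) by (unfold s; field; lra).
  pose proof (exp_ineq1_le (- s)) as He. pose proof (exp_lt_1 (- s) ltac:(lra)) as Hl.
  assert ((1 - s) / s ^ 2 <= exp (- s) / (1 - exp (- s)) ^ 2).
  { apply Rmult_le_compat. lra. left; apply Rinv_0_lt_compat, pow_lt; auto. lra.
    apply Rinv_le_contravar. apply pow_lt; lra. apply pow_incr. lra. }
  lra.
Qed.

(** Denominators below [t] have [d = gcd (t, k)] with [2 d <= t < d^2], which forces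
    [t >= 6] and keeps the weight, hence the Bessel argument, well below that of the main term. *)
Lemma rest_term_le_coarse : forall t m n k, (0 < t)%nat -> (0 < m)%nat -> (0 < k < t)%nat -> 0 < INR n - mu t m ->
  PI * (INR n - mu t m) <= INR t ^ 2 ->
  (t < Nat.gcd t k * Nat.gcd t k)%nat ->
  (6 <= t)%nat /\ rest_term t m n k <= 2 * PI * (INR m * PI / 24) * Rpower (INR t) (INR m / 2) * exp (INR m * PI / 6 * (INR t - 4) + 1).
Proof.
  intros t m n k Ht Hm Hk Hnu HN HL. pose proof PI_RGT_0 as HP.
  destruct (gcd_pos_le t k Ht ltac:(lia)) as [Hd Hdk]. pose proof (pole_weight_ge_0 t m k Ht ltac:(lia)) as Hpw.
  pose proof (Rpower_cusp_le t m k Ht ltac:(lia)) as HR.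
  assert (HLR : INR t < INR (Nat.gcd t k) ^ 2) by (apply lt_INR in HL; rewrite mult_INR in HL; simpl; lra).
  specialize (Hpw HLR). unfold rest_term. destruct (Nat.eqb_spec k t) as [E|_]; [lia|].
  replace (Nat.ltb t (Nat.gcd t k * Nat.gcd t k)) with true by (symmetry; apply Nat.ltb_lt; auto).
  set (d := Nat.gcd t k) in *.
  assert (H2d : (2 * d <= t)%nat).
  { destruct (Nat.gcd_divide_l t k) as [q Hq]. fold d in Hq. destruct q as [|[|q]]; nia. }
  assert (Hd3 : (3 <= d)%nat) by nia. split. lia.
  assert (HtR : 0 < INR t) by (apply lt_0_INR; auto). assert (HkR : 0 < INR k) by (apply lt_0_INR; lia).
  assert (HdR : 3 <= INR d) by (replace 3 with (INR 3) by (simpl; ring); apply le_INR; auto).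
  assert (HmR : 0 < INR m) by (apply lt_0_INR; auto).
  assert (H2dR : 2 * INR d <= INR t) by (apply le_INR in H2d; rewrite mult_INR in H2d; simpl in H2d; lra).
  assert (HdkR : INR d <= INR k) by (apply le_INR; auto).
  set (nu := INR n - mu t m) in *. set (pw := pole_weight t m k) in *.
  assert (Hk2 : 0 < INR k ^ 2) by (apply pow_lt; auto).
  assert (Hb : 0 <= pw / INR k ^ 2) by (apply Rmult_le_pos; auto; left; apply Rinv_0_lt_compat; auto).
  pose proof (bessel_value_le_small (2 * PI * nu) (pw / INR k ^ 2) ltac:(nra) Hb) as HB.
  assert (Epw : pw = INR m * PI / 12 * (INR d ^ 2 / INR t - 1)) by reflexivity.
  assert (Hmp : 0 < INR m * PI) by (apply Rmult_lt_0_compat; lra).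
  assert (B1 : pw <= INR m * PI / 24 * INR k).
  { rewrite Epw. assert (INR d ^ 2 / INR t <= INR k / 2).
    { apply Rmult_le_reg_r with (2 * INR t). lra. replace (INR d ^ 2 / INR t * (2 * INR t)) with (INR d * (2 * INR d)) by (field; lra).
      replace (INR k / 2 * (2 * INR t)) with (INR k * INR t) by field. apply Rmult_le_compat; lra. }
    replace (INR m * PI / 24 * INR k) with (INR m * PI / 12 * (INR k / 2)) by field. apply Rmult_le_compat_l; lra. }
  set (ab := 2 * PI * nu * (pw / INR k ^ 2)) in *.
  assert (Hab0 : 0 <= ab) by (unfold ab; apply Rmult_le_pos; auto; nra).
  assert (B2 : ab <= INR m * PI / 6 * (INR t - 4)).
  { unfold ab. apply Rle_trans with (2 * INR t ^ 2 * (pw / INR k ^ 2)). apply Rmult_le_compat_r; auto. lra.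
    apply Rle_trans with (2 * INR t ^ 2 * (pw / INR d ^ 2)).
    - apply Rmult_le_compat_l. nra. apply Rmult_le_compat_l; auto. apply Rinv_le_contravar. nra. apply pow_incr; lra.
    - rewrite Epw. replace (2 * INR t ^ 2 * (INR m * PI / 12 * (INR d ^ 2 / INR t - 1) / INR d ^ 2)) with (INR m * PI / 6 * (INR t - (INR t / INR d) ^ 2)) by (field; lra).
      apply Rmult_le_compat_l. lra. assert (2 <= INR t / INR d) by (apply Rmult_le_reg_r with (INR d); [lra|field_simplify; lra]). nra. }
  assert (B3 : 2 * sqrt ab <= INR m * PI / 6 * (INR t - 4) + 1).
  { pose proof (sqrt_sqrt ab Hab0). pose proof (Rle_0_sqr (sqrt ab - 1)) as Hq. unfold Rsqr in Hq. nra. }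
  apply exp_le in B3. set (X := exp (INR m * PI / 6 * (INR t - 4) + 1)) in *. set (X' := exp (2 * sqrt ab)) in *.
  assert (HX' : 0 < X') by apply exp_pos.
  set (bv := bessel_value _ _) in *.
  set (R1 := Rpower (INR t / INR d) _) in *. set (R2 := Rpower (INR t) _) in *.
  assert (HR1 : 0 < R1) by apply exp_pos.
  assert (B4 : INR k * bv <= INR m * PI / 24 * X).
  { apply Rle_trans with (INR k * (pw / INR k ^ 2 * X')). apply Rmult_le_compat_l; lra.
    replace (INR k * (pw / INR k ^ 2 * X')) with (pw / INR k * X') by (field; lra).
    apply Rmult_le_compat; try lra. apply Rmult_le_pos; auto. left; apply Rinv_0_lt_compat; auto.
    apply Rmult_le_reg_r with (INR k); auto. replace (pw / INR k * INR k) with pw by (field; lra). exact B1. }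
  replace (INR k * (R1 * (2 * PI * bv))) with (R1 * (2 * PI) * (INR k * bv)) by ring.
  apply Rle_trans with (R1 * (2 * PI) * (INR m * PI / 24 * X)). apply Rmult_le_compat_l; [nra|exact B4].
  replace (2 * PI * (INR m * PI / 24) * R2 * X) with (R2 * (2 * PI) * (INR m * PI / 24 * X)) by ring.
  apply Rmult_le_compat_r. apply Rmult_le_pos; [lra|left; apply exp_pos]. apply Rmult_le_compat_r; lra.
Qed.

(** In [u = t / pi] this is a quadratic inequality with negative discriminant. *)
Lemma coarse_exponent : forall t m, (6 <= t)%nat -> INR m * PI / 6 * (INR t - 4) <= PI * mu t m + log_bound t m.
Proof.
  intros t m Ht. pose proof PI_gt_3 as HP. pose proof PI_lt_16_5 as HP3. pose proof (log_bound_ge t m Ht) as HL.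
  assert (INR m * PI / 6 * (INR t - 4) <= PI * mu t m + INR m * (INR t ^ 2 / PI ^ 2 - INR t / PI)); [|lra].
  unfold mu. set (u := INR t / PI). replace (INR t ^ 2 / PI ^ 2) with (u ^ 2) by (unfold u; field; lra).
  replace (INR t) with (PI * u) by (unfold u; field; lra).
  replace (PI * (INR m * (PI * u - 1) / 24) + INR m * (u ^ 2 - u)) with (INR m * (PI * (PI * u - 1) / 24 + u ^ 2 - u)) by field.
  replace (INR m * PI / 6 * (PI * u - 4)) with (INR m * (PI / 6 * (PI * u - 4))) by field.
  apply Rmult_le_compat_l. apply pos_INR.
  assert (HPP : PI * PI <= 10.24) by nra. assert (HPP0 : 9 <= PI * PI) by nra.
  set (p := PI * PI) in *.
  assert (0 <= u ^ 2 - (1 + p / 8) * u + 15 * PI / 24).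
  { replace (u ^ 2 - (1 + p / 8) * u + 15 * PI / 24) with ((u - (1 + p / 8) / 2) ^ 2 + (15 * PI / 24 - (1 + p / 8) ^ 2 / 4)) by field.
    assert ((1 + p / 8) ^ 2 <= 5.2) by nra. pose proof (pow2_ge_0 (u - (1 + p / 8) / 2)). lra. }
  unfold p in *. nra.
Qed.

(** Here the truncation is at [t], and [n] does not control the number of denominators; instead
    of the first error term, the last one absorbs the remaining cusps, leaving one of its
    [2 t] shares for the regular part. *)
Lemma rest_sum_coarse : forall t m n, (2 <= t)%nat -> (0 < m)%nat -> mu t m <= 1 -> 0 < INR n - mu t m ->
  PI * (INR n - mu t m) <= INR t ^ 2 ->
  rsum (rest_term t m n) (S t) <= (2 * INR t - 1) * regular_bound t m.
Proof.
  intros t m n Ht Hm Hmu Hnu HN. pose proof PI_gt_3 as HP. pose proof PI_lt_16_5 as HP3.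
  assert (HtR : 2 <= INR t) by (replace 2 with (INR 2) by reflexivity; apply le_INR; auto).
  assert (Hmu0 := mu_ge_0 t m ltac:(lia)). assert (HmR : 0 < INR m) by (apply lt_0_INR; auto).
  set (B := (2 * INR t - 1) * regular_bound t m / (INR t - 1)).
  assert (Hreg : 0 < regular_bound t m).
  { unfold regular_bound. apply Rmult_lt_0_compat. apply Rmult_lt_0_compat. apply exp_pos. apply exp_pos. apply exp_pos. }
  assert (HB : 0 <= B). { unfold B. apply Rmult_le_pos. apply Rmult_le_pos; lra. left; apply Rinv_0_lt_compat; lra. }
  assert (HT : forall k, (0 < k < t)%nat -> rest_term t m n k <= B).
  { intros k Hk. destruct (Nat.ltb_spec t (Nat.gcd t k * Nat.gcd t k)) as [HL|HL].
    - destruct (rest_term_le_coarse t m n k ltac:(lia) Hm Hk Hnu HN HL) as [H6 H].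
      eapply Rle_trans. exact H. unfold B. apply Rmult_le_reg_r with (INR t - 1). lra.
      replace ((2 * INR t - 1) * regular_bound t m / (INR t - 1) * (INR t - 1)) with ((2 * INR t - 1) * regular_bound t m) by (field; lra).
      match goal with |- ?a * ?b * ?c * ?d * (INR t - 1) <= _ => replace (a * b * c * d * (INR t - 1)) with (2 * (PI * PI) * mu t m * (c * d)) by (unfold mu; field) end.
      assert (H6R : 6 <= INR t) by (replace 6 with (INR 6) by (simpl; ring); apply le_INR; auto).
      set (R2 := Rpower (INR t) (INR m / 2)). assert (HR2 : 0 < R2) by apply exp_pos.
      unfold regular_bound. fold R2.
      pose proof (exp_le _ _ (coarse_exponent t m H6)) as HE. rewrite exp_plus.
      set (X := exp (INR m * PI / 6 * (INR t - 4))) in *. set (Y := exp (PI * mu t m + log_bound t m)) in *.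
      assert (HX : 0 < X) by apply exp_pos.
      replace (exp 2) with (exp 1 * exp 1) by (rewrite <- exp_plus; f_equal; ring).
      pose proof (exp_ineq1_le 1) as He. set (e := exp 1) in *.
      (* 2 pi^2 <= 22 since pi < 16/5, and 22 <= (2 t - 1) e since t >= 6 *)
      apply Rle_trans with (22 * (R2 * (X * e))).
      + apply Rmult_le_compat_r. apply Rmult_le_pos. lra. apply Rmult_le_pos; lra.
        assert (PI * PI <= 10.24) by nra. nra.
      + replace ((2 * INR t - 1) * (e * e * R2 * Y)) with (((2 * INR t - 1) * e) * (R2 * (Y * e))) by ring.
        apply Rmult_le_compat. lra. apply Rmult_le_pos. lra. apply Rmult_le_pos; lra. nra.
        apply Rmult_le_compat_l. lra. apply Rmult_le_compat_r; lra.
    - unfold rest_term. destruct (Nat.eqb k t); auto. destruct (Nat.ltb_spec t (Nat.gcd t k * Nat.gcd t k)); auto. lia. }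
  rewrite rsum_S_l, rest_term_0 by lia. destruct t as [|t']; [lia|]. cbn [rsum].
  replace (rest_term (S t') m n (S t')) with 0 by (unfold rest_term; rewrite Nat.eqb_refl; reflexivity).
  assert (Hs : rsum (fun i => rest_term (S t') m n (S i)) t' <= INR t' * B).
  { apply rsum_nonneg_le_const. intros i Hi. apply HT. lia. }
  assert (INR t' * B = (2 * INR (S t') - 1) * regular_bound (S t') m).
  { unfold B. replace (INR t') with (INR (S t') - 1) by (rewrite S_INR; ring). field. lra. }
  lra.
Qed.

Lemma regular_bound_Ebar : forall t m, (0 < t)%nat ->
  2 * INR t * regular_bound t m = 2 * exp 2 * Rpower (INR t) (INR m / 2 + 1)
    * exp (PI * mu t m
           + INR m * (exp (- PI) / (1 - exp (- PI)) ^ 2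
                      + exp (- PI / INR t) / (1 - exp (- PI / INR t)) ^ 2)).
Proof.
  intros t m Ht. rewrite Rpower_plus, Rpower_1 by (apply lt_0_INR; auto). unfold regular_bound, log_bound. ring.
Qed.

Theorem theorem1p1 :
  forall (t m : nat) (c : nat -> Z),
    (0 < t)%nat -> (0 < m)%nat -> (m * (t - 1) <= 24)%nat ->
    is_ctm t m c ->
    forall n : nat, (0 < n)%nat -> mu t m < INR n ->
    exists E : C,
      RtoC (IZR (c n)) =
        (RtoC (2 * PI * sqrt (mu t m) / INR t * / sqrt (INR n - mu t m))
         * alpha t m n
         * RtoC (BesselI (-1)
                   (4 * PI * sqrt (mu t m * (INR n - mu t m)) / INR t))
         + E)%C
      /\ Cmod E <= Ebar t m n.
Proof.
  intros t m c Ht Hm H24 Hc n Hn Hmun. pose proof PI_RGT_0 as HP.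
  assert (HtR : 1 <= INR t) by (replace 1 with (INR 1) by reflexivity; apply le_INR; lia).
  assert (Hmu1 : mu t m <= 1).
  { unfold mu. apply le_INR in H24. rewrite mult_INR, minus_INR in H24 by lia. simpl in H24. lra. }
  assert (Hnu : 0 < INR n - mu t m) by lra.
  set (M := (RtoC (2 * PI * sqrt (mu t m) / INR t * / sqrt (INR n - mu t m)) * alpha t m n
         * RtoC (BesselI (-1) (4 * PI * sqrt (mu t m * (INR n - mu t m)) / INR t)))%C).
  exists (RtoC (IZR (c n)) - M)%C. split. ring.
  (* The least admissible order of dissection is about x, but the main term lives at
     denominator t, so the order must also reach t. *)
  set (x := sqrt (PI * (INR n - mu t m))).
  assert (Hx : 0 < x) by (apply sqrt_lt_R0; nra).
  assert (Hxx : x * x = PI * (INR n - mu t m)) by (apply sqrt_sqrt; nra).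
  destruct (archimed x) as [U1 U2].
  set (N0 := Z.to_nat (up x)).
  assert (EN0 : INR N0 = IZR (up x)).
  { unfold N0. rewrite INR_IZR_INZ, Z2Nat.id. reflexivity. apply le_IZR. lra. }
  assert (HN0 : (1 <= N0)%nat). { assert (0 < N0)%nat. apply INR_lt. rewrite EN0. simpl. lra. lia. }
  assert (HN0x : PI * (INR n - mu t m) <= INR N0 ^ 2) by (rewrite EN0; nra).
  unfold Ebar. rewrite <- regular_bound_Ebar by auto.
  set (T1 := Rpower PI (7 / 4) / Rpower 2 (3 / 4) * Rpower (INR (maxA t)) (INR m / 2) * sqrt (sqrt (mu t m))
    * exp (sqrt 6 * PI * maxM t m / 3 * sqrt (INR n - mu t m))).
  assert (HT1 : 0 <= T1).
  { unfold T1. apply Rmult_le_pos; [|left; apply exp_pos]. apply Rmult_le_pos; [|apply sqrt_pos].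
    apply Rmult_le_pos; [|left; apply exp_pos]. apply Rmult_le_pos. left; apply exp_pos. left; apply Rinv_0_lt_compat; apply exp_pos. }
  assert (Hreg : 0 < regular_bound t m).
  { unfold regular_bound. apply Rmult_lt_0_compat. apply Rmult_lt_0_compat. apply exp_pos. apply exp_pos. apply exp_pos. }
  assert (HB2 : 0 < exp (2 + 8 * PI * mu t m)) by apply exp_pos.
  destruct (Nat.eq_dec t 1) as [->|Ht1].
  - (* Nothing is singular for t = 1: there are no chords, hence no chord errors. *)
    assert (EM : M = RtoC 0).
    { unfold M. replace (mu 1 m) with 0 by (unfold mu; simpl; field). rewrite sqrt_0.
      replace (2 * PI * 0 / INR 1 * / sqrt (INR n - 0)) with 0 by (unfold Rdiv; ring). ring. }
    rewrite EM. replace (RtoC (IZR (c n)) - RtoC 0)%C with (RtoC (IZR (c n))) by ring.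
    pose proof (coefficient_approx 1 m c n N0 Ht Hc Hmu1 HN0 Hnu HN0x) as H.
    assert (Hs : forall h k, singular 1 h k = false).
    { intros h k. unfold singular. simpl Nat.gcd. simpl Nat.ltb. apply Bool.andb_false_r. }
    rewrite csum_all_zero in H.
    2:{ intros k _. apply csum_all_zero. intros h _. unfold cusp_main. rewrite Hs. reflexivity. }
    replace (RtoC (IZR (c n)) - RtoC 0)%C with (RtoC (IZR (c n))) in H by ring.
    assert (HE : rsum (fun k => rsum (fun h => chord_error 1 m N0 h k) k) (S N0) <= INR (S N0) * 0).
    { apply rsum_nonneg_le_const. intros k _. replace 0 with (INR k * 0) by ring. apply rsum_nonneg_le_const.
      intros h _. unfold chord_error. rewrite Hs. lra. }
    replace (INR 1) with 1 by reflexivity. lra.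
  - assert (HtR2 : 2 <= INR t) by (replace 2 with (INR 2) by reflexivity; apply le_INR; lia).
    assert (HB24 : 4 * exp (2 + 8 * PI * mu t m) <= 2 * INR t * exp (2 + 8 * PI * mu t m)) by (apply Rmult_le_compat_r; lra).
    destruct (le_lt_dec t N0) as [HL|HL].
    + (* long dissection: the remaining cusps go into the first error term *)
      pose proof (coefficient_minus_main t m c n N0 ltac:(lia) Hm Hc Hmu1 HL Hnu HN0x) as H. fold M in H.
      pose proof (rest_sum_fine t m n N0 Ht Hm Hmu1 Hnu HN0 ltac:(fold x; lra)) as HF. fold T1 in HF.
      assert (regular_bound t m <= 2 * INR t * regular_bound t m) by nra. lra.
    + (* dissection of order t: the remaining cusps go into the last error term *)
      assert (Htx : PI * (INR n - mu t m) <= INR t ^ 2).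
      { eapply Rle_trans. exact HN0x. apply pow_incr. split. apply pos_INR. apply le_INR; lia. }
      pose proof (coefficient_minus_main t m c n t ltac:(lia) Hm Hc Hmu1 ltac:(lia) Hnu Htx) as H. fold M in H.
      pose proof (rest_sum_coarse t m n ltac:(lia) Hm Hmu1 Hnu Htx) as HF. lra.
Qed.
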